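(* Let $d\geq 2$ be an integer. For Schwartz functions $f,g$ on $\mathbb R$ define $$H_\Gamma(f,g)(x)=\mathrm{p.v.}\int_{\mathbb R} f(x-t)\,g(x-t^d)\,\frac{dt}{t}.$$ Then $H_\Gamma$ extends to a bounded bilinear operator from $L^2(\mathbb R)\times L^2(\mathbb R)$ to $L^1(\mathbb R)$: there is a constant $C$ with $\|H_\Gamma(f,g)\|_{L^1}\le C\|f\|_{L^2}\|g\|_{L^2}$ for all Schwartz $f,g$.
   Context: $H_\Gamma$ is the bilinear Hilbert transform along the curve $\Gamma(t)=(t,t^d)$; p.v. denotes the principal value integral. *)

(* Defs.v *)
From Stdlib Require Import Reals.
Open Scope R_scope.

(* Complex-valued functions on R are represented as pairs of real functions
   (real part, imaginary part). *)

Definition is_RInt (F : R -> R) (a b v : R) : Prop :=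
  exists pr : Riemann_integrable F a b, RiemannInt pr = v.

Definition schwartz_real (f : R -> R) : Prop :=
  exists D : nat -> R -> R,
    D 0%nat = f /\
    (forall n x, derivable_pt_lim (D n) x (D (S n) x)) /\
    (forall k n : nat, exists M : R, forall x, Rabs (x ^ k * D n x) <= M).

Definition schwartz (fr fi : R -> R) : Prop :=
  schwartz_real fr /\ schwartz_real fi.

Definition improper_int (F : R -> R) (l : R) : Prop :=
  forall eps, 0 < eps -> exists N0, forall N, N0 <= N ->
    exists v, is_RInt F (- N) N v /\ Rabs (v - l) < eps.

Definition L2sq (fr fi : R -> R) (nf : R) : Prop :=
  improper_int (fun x => fr x ^ 2 + fi x ^ 2) nf.

Definition pv_int (F : R -> R) (l : R) : Prop :=
  forall eps, 0 < eps -> exists delta, 0 < delta /\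
    forall e, 0 < e < delta ->
      exists v1 v2, is_RInt F (- / e) (- e) v1 /\ is_RInt F e (/ e) v2 /\
                    Rabs (v1 + v2 - l) < eps.

Definition integrand_re (d : nat) (fr fi gr gi : R -> R) (x t : R) : R :=
  (fr (x - t) * gr (x - t ^ d) - fi (x - t) * gi (x - t ^ d)) / t.
Definition integrand_im (d : nat) (fr fi gr gi : R -> R) (x t : R) : R :=
  (fr (x - t) * gi (x - t ^ d) + fi (x - t) * gr (x - t ^ d)) / t.

Definition is_H_Gamma (d : nat) (fr fi gr gi hr hi : R -> R) : Prop :=
  forall x, pv_int (integrand_re d fr fi gr gi x) (hr x) /\
            pv_int (integrand_im d fr fi gr gi x) (hi x).

(* Main.v *)
(* No Fourier transform is used. Truncate the kernel to [2^-J <= |t| <= 2^J], replace [f], [g] by [P]-periodic functions with [P] large,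
   put [t = +- e^v] and cut the [v]-range into dyadic blocks; in block [l] the shifts are [mu_l e^(al v)] and [nu_l e^(be v)] with
   [(al, be) = (1, d)] for small [t] and [(d, 1)] for large [t], so that one of the two shifts is always much larger than the other.
   Around the averages [P_a F], [P_b G] at the scales of the two shifts, a block is the sum of a centred term and of two terms in which
   one of the factors is [P_a F] or [P_b G]. The latter are paraproducts and truncated Hilbert transforms acting on one factor; they are
   controlled by a Carleson embedding, proved with a Bellman functional, and by almost orthogonality. In the centred term, [F] and [G] are
   expanded into Littlewood-Paley pieces, [m] resp. [n] steps finer than the shift. Integrating by parts in [v] gains [2^-m] against a
   loss [2^n], which settles all pieces but those with [m <= 2n]. For these, duality and Cauchy-Schwarz lead to the kernel
   [Gamma (b, z) = g z * g (z - b)] along [b = (s + a)^k - s^k], where [k = d] or [1/d]. Its high-frequency part in [z] is treated by a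
   second Cauchy-Schwarz and an integration by parts along a vector field in [(a, s, s')] that annihilates both [b (a, s)] and
   [b (a, s')]; its low-frequency part by writing [Gamma] as a [b]-derivative. This gains a power [r^n], [r < 1], independent of the
   scale, and the pieces are summed by Cauchy-Schwarz in the scale. *)
From Stdlib Require Import Reals Lra Lia Psatz Compare_dec ClassicalEpsilon FunctionalExtensionality.
From Coquelicot Require Import Coquelicot.
Require Import Defs.
Open Scope R_scope.

(** Periodicity removes every question at infinity: translation invariance is exact, all integrands
    are continuous, and square-function bounds come from a telescoping parallelogram law instead of
    Plancherel. Tents are used because the difference of two consecutive averages is then a quarter
    of the adjoint of [ds d] composed with [ds d], and has an explicit derivative and an explicit
    primitive. The obstacle is the range [m <= 2 n], where integration by parts gains too little.
    There the gain comes from curvature: the field that freezes [b (a, s)] and [b (a, s')] moves the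
    relative position at a speed of at least a multiple of [|s - s'|]. This persists only while the
    ratio of the two shifts is small, whence the gap [N0] between the scales and a middle range of
    [t] that is estimated trivially. All parameters are powers of one small [q]; they balance at the
    exponents 4, 20, 22, 48, and [q^48 = 2^-n] leads to the rate [2^(-1/144)]. Bounds carry
    [En P F + En P G] on the right; applying them to [k f] and [g / k] turns the sum into a product
    at the very end. *)

Module Integrals.

(** * Continuity, integrals of continuous functions, Fubini, periodic functions *)

Ltac pos :=
  first [ assumption | lra | lazymatch goal with
  | |- _ >= 0 => apply Rle_ge; pos
  | |- 0 <= _ ^ 2 => apply pow2_ge_0
  | |- 0 <= Rabs _ => apply Rabs_pos
  | |- 0 <= _ * _ => apply Rmult_le_pos; pos
  | |- 0 < _ * _ => apply Rmult_lt_0_compat; pos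
  | |- 0 <= _ / _ => apply Rdiv_le_0_compat; pos
  | |- 0 < _ / _ => apply Rdiv_lt_0_compat; pos
  | |- 0 < / _ => apply Rinv_0_lt_compat; pos
  | |- 0 <= / _ => apply Rlt_le, Rinv_0_lt_compat; pos
  | |- 0 < _ ^ _ => apply pow_lt; pos
  | |- 0 <= _ ^ _ => apply pow_le; pos
  | |- 0 < exp _ => apply exp_pos
  | |- 0 <= exp _ => left; apply exp_pos
  end | solve [auto] ].
Ltac mul_l := apply Rmult_le_compat_l; [pos|].
Ltac mul_r := apply Rmult_le_compat_r; [pos|].
Ltac letr := eapply Rle_trans.
Tactic Notation "letr_with" constr(b) := apply Rle_trans with b.

(** Stated over an arbitrary uniform space, so that functions of several variables are covered
    through products ([ct2], [ct3], [ct4]) and continuity goals can be solved by following the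
    syntax ([ctac]). *)
Definition ct {U : UniformSpace} (f : U -> R) : Prop := forall u, continuous f u.

Lemma ct_const {U : UniformSpace} (c : R) : ct (fun _ : U => c).
Proof. intro u; apply continuous_const. Qed.
Lemma ct_id : ct (fun x : R => x).
Proof. intro u; apply continuous_id. Qed.
Lemma ct_plus {U : UniformSpace} (f g : U -> R) : ct f -> ct g -> ct (fun u => f u + g u).
Proof. intros Hf Hg u; apply (continuous_plus f g u); auto. Qed.
Lemma ct_opp {U : UniformSpace} (f : U -> R) : ct f -> ct (fun u => - f u).
Proof. intros Hf u; apply (continuous_opp f u); auto. Qed.
Lemma ct_minus {U : UniformSpace} (f g : U -> R) : ct f -> ct g -> ct (fun u => f u - g u).
Proof. intros Hf Hg u; apply (continuous_minus f g u); auto. Qed.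
Lemma ct_mult {U : UniformSpace} (f g : U -> R) : ct f -> ct g -> ct (fun u => f u * g u).
Proof. intros Hf Hg u; apply (continuous_mult f g u); auto. Qed.
Lemma ct_comp {U V : UniformSpace} (f : V -> R) (g : U -> V) :
  ct f -> (forall u, continuous g u) -> ct (fun u => f (g u)).
Proof. intros Hf Hg u; apply (continuous_comp g f); auto. Qed.
Lemma ct_comp1 {U : UniformSpace} (f : R -> R) (g : U -> R) :
  ct f -> ct g -> ct (fun u => f (g u)).
Proof. intros Hf Hg; apply ct_comp; auto. Qed.
Lemma ct_pow {U : UniformSpace} (f : U -> R) n : ct f -> ct (fun u => f u ^ n).
Proof. intro Hf; induction n; simpl; [apply ct_const | apply ct_mult; auto]. Qed.
Lemma ct_abs {U : UniformSpace} (f : U -> R) : ct f -> ct (fun u => Rabs (f u)).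
Proof. intros Hf; apply (ct_comp1 Rabs); auto; intro; apply continuous_Rabs. Qed.
Lemma ct_inv {U : UniformSpace} (f : U -> R) : ct f -> (forall u, f u <> 0) -> ct (fun u => / f u).
Proof. intros Hf H0 u; apply (continuous_comp f Rinv); auto; apply continuous_Rinv; auto. Qed.
Lemma ct_div {U : UniformSpace} (f g : U -> R) :
  ct f -> ct g -> (forall u, g u <> 0) -> ct (fun u => f u / g u).
Proof. intros; apply ct_mult; auto; apply ct_inv; auto. Qed.
Lemma ct_exp {U : UniformSpace} (f : U -> R) : ct f -> ct (fun u => exp (f u)).
Proof. intros Hf; apply (ct_comp1 exp); auto; intro; apply continuous_exp. Qed.
Lemma ct_max {U : UniformSpace} (f : U -> R) c : ct f -> ct (fun u => Rmax (f u) c).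
Proof.
  intros Hf. assert (H : forall u, (f u + c + Rabs (f u - c)) / 2 = Rmax (f u) c).
  { intro u; unfold Rmax; destruct (Rle_dec (f u) c); [rewrite Rabs_left1 by lra | rewrite Rabs_right by lra]; field. }
  intro u; apply (continuous_ext _ _ u H). apply ct_div; [|apply ct_const|intros; lra].
  apply ct_plus; [apply ct_plus|apply ct_abs, ct_minus]; auto; intro; apply continuous_const.
Qed.
Lemma ct_sqrt {U : UniformSpace} (f : U -> R) : ct f -> ct (fun u => sqrt (f u)).
Proof. intros Hf; apply (ct_comp1 sqrt); auto; intro; apply continuous_sqrt. Qed.
Definition ct2 (F : R -> R -> R) : Prop := ct (fun p : R * R => F (fst p) (snd p)).

Lemma ct2_comp {U : UniformSpace} (F : R -> R -> R) (f g : U -> R) :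
  ct2 F -> ct f -> ct g -> ct (fun u => F (f u) (g u)).
Proof. intros HF Hf Hg u. apply (continuous_comp_2 f g F u); auto; apply (HF (f u, g u)). Qed.

Definition ct3 (F : R -> R -> R -> R) : Prop :=
  ct (fun p : R * R * R => F (fst (fst p)) (snd (fst p)) (snd p)).
Definition ct4 (F : R -> R -> R -> R -> R) : Prop :=
  ct (fun p : R * R * R * R => F (fst (fst (fst p))) (snd (fst (fst p))) (snd (fst p)) (snd p)).

Lemma ct_pair {U V W : UniformSpace} (f : U -> V) (g : U -> W) (u : U) :
  continuous f u -> continuous g u -> continuous (fun u => (f u, g u)) u.
Proof.
  intros Hf Hg. apply (continuous_comp_2 f g (fun a b => (a, b)) u Hf Hg).
  apply (continuous_ext (fun p : V * W => p)); [intros [a b]; auto | apply continuous_id].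
Qed.

Lemma ct3_comp {U : UniformSpace} (F : R -> R -> R -> R) (f g h : U -> R) :
  ct3 F -> ct f -> ct g -> ct h -> ct (fun u => F (f u) (g u) (h u)).
Proof.
  intros HF Hf Hg Hh. apply (ct_comp (fun p : R * R * R => F (fst (fst p)) (snd (fst p)) (snd p)) (fun u => (f u, g u, h u)) HF).
  intro u. repeat apply ct_pair; auto.
Qed.
Lemma ct4_comp {U : UniformSpace} (F : R -> R -> R -> R -> R) (f g h i : U -> R) :
  ct4 F -> ct f -> ct g -> ct h -> ct i -> ct (fun u => F (f u) (g u) (h u) (i u)).
Proof.
  intros HF Hf Hg Hh Hi. apply (ct_comp (fun p : R * R * R * R => F (fst (fst (fst p))) (snd (fst (fst p))) (snd (fst p)) (snd p))
    (fun u => (f u, g u, h u, i u)) HF). intro u. repeat apply ct_pair; auto.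
Qed.

Lemma continuous_fst_comp {U V W : UniformSpace} (g : W -> U * V) (w : W) :
  continuous g w -> continuous (fun w => fst (g w)) w.
Proof. intro H; apply (continuous_comp g fst); auto; destruct (g w); apply continuous_fst. Qed.
Lemma continuous_snd_comp {U V W : UniformSpace} (g : W -> U * V) (w : W) :
  continuous g w -> continuous (fun w => snd (g w)) w.
Proof. intro H; apply (continuous_comp g snd); auto; destruct (g w); apply continuous_snd. Qed.
Lemma ct_of {U : UniformSpace} (g : U -> R) : (forall u, continuous g u) -> ct g.
Proof. auto. Qed.

Ltac ctproj :=
  lazymatch goal with
  | |- continuous (fun w => w) _ => apply continuous_id
  | |- continuous (fun w => fst (@?g w)) _ => apply (continuous_fst_comp g); ctproj
  | |- continuous (fun w => snd (@?g w)) _ => apply (continuous_snd_comp g); ctproj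
  | _ => apply continuous_const
  end.

Create HintDb ctdb discriminated.
#[export] Hint Constants Opaque : ctdb.

Ltac ct34_step :=
  match goal with
  | H : ct3 ?F |- ct (fun u => ?F (@?f u) (@?g u) (@?h u)) => simple apply (ct3_comp F f g h H)
  | H : ct4 ?F |- ct (fun u => ?F (@?f u) (@?g u) (@?h u) (@?i u)) => simple apply (ct4_comp F f g h i H)
  | H : ct3 ?F |- ct (?F ?c ?d) => simple apply (ct3_comp F (fun _ => c) (fun _ => d) (fun y => y) H)
  | H : ct4 ?F |- ct (?F ?c ?d ?e) => simple apply (ct4_comp F (fun _ => c) (fun _ => d) (fun _ => e) (fun y => y) H)
  | H : ct ?f |- ct ?f => exact H
  | |- ct (fun u => ?F (@?f u) (@?g u) (@?h u)) => simple apply (ct3_comp F f g h); [solve [eauto 2 with ctdb] | ..]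
  | |- ct (fun u => ?F (@?f u) (@?g u) (@?h u) (@?i u)) =>
      simple apply (ct4_comp F f g h i); [solve [eauto 2 with ctdb] | ..]
  | |- ct (?F ?c ?d) =>
      simple apply (ct3_comp F (fun _ => c) (fun _ => d) (fun y => y)); [solve [eauto 2 with ctdb] | ..]
  end.
Ltac ct_extra := fail.
Ltac ct_step :=
  first [ct34_step | ct_extra | lazymatch goal with
  | |- ct2 ?F => first [match goal with H : ct2 F |- _ => exact H end | unfold ct2; cbv beta]
  | |- ct (fun u => u) => exact ct_id
  | |- ct (fun u => @?f u + @?g u) => simple apply (ct_plus f g)
  | |- ct (fun u => @?f u - @?g u) => simple apply (ct_minus f g)
  | |- ct (fun u => - @?f u) => simple apply (ct_opp f)
  | |- ct (fun u => @?f u * @?g u) => simple apply (ct_mult f g)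
  | |- ct (fun u => @?f u / @?g u) => simple apply (ct_mult f (fun u => / g u))
  | |- ct (fun u => @?f u ^ ?n) => simple apply (ct_pow f n)
  | |- ct (fun u => Rabs (@?f u)) => simple apply (ct_abs f)
  | |- ct (fun u => exp (@?f u)) => simple apply (ct_exp f)
  | |- ct (fun u => Rmax (@?f u) ?c) => simple apply (ct_max f c)
  | |- ct (fun u => fst (@?g u)) => apply ct_of; intro; ctproj
  | |- ct (fun u => snd (@?g u)) => apply ct_of; intro; ctproj
  | |- ct (fun u => ?F (@?f u) (@?g u)) =>
      first [match goal with H : ct2 F |- _ => simple apply (ct2_comp F f g H) end
            | match goal with H : ct (F ?c) |- _ => simple apply (ct_comp1 (F c) g H) end
            | match goal with |- ct (fun u => ?c) => exact (ct_const c) end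
            | lazymatch f with fun _ => ?c => simple apply (ct_comp1 (F c) g); [solve [eauto 6 with ctdb] | ] end
            | simple apply (ct2_comp F f g); [solve [eauto 6 with ctdb] | | ] ]
  | |- ct (fun u => ?f (@?g u)) =>
      first [match goal with H : ct f |- _ => simple apply (ct_comp1 f g H) end
            | match f with ?F ?c => match goal with H : ct2 F |- _ => simple apply (ct2_comp F (fun _ => c) g H) end end
            | match goal with |- ct (fun u => ?c) => exact (ct_const c) end
            | simple apply (ct_comp1 f g); [solve [eauto 6 with ctdb] | ]]
  | |- ct ?f =>
      first [match goal with H : ct f |- _ => exact H end
            | match f with ?F ?c => match goal with H : ct2 F |- _ => simple apply (ct2_comp F (fun _ => c) (fun y => y) H) end end
            | match goal with |- ct (fun u => ?c) => exact (ct_const c) end | solve [eauto 6 with ctdb]]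
  | |- ct3 ?F => unfold ct3; cbv beta
  | |- ct4 ?F => unfold ct4; cbv beta
  end].
Ltac ctac := cbv beta; repeat (ct_step; cbv beta).

(** Fixes the codomain to the reals. Integrands are kept continuous on the whole line, so that
    integrability never appears as a side condition beyond [ct]; functions with singularities are
    clamped later for this purpose. *)
Definition RI (f : R -> R) (a b : R) : R := RInt f a b.

Lemma ct_ex (f : R -> R) a b : ct f -> ex_RInt f a b.
Proof. intro H; apply (ex_RInt_continuous (V := R_CompleteNormedModule)); intros; apply H. Qed.

Lemma RI_plus (f g : R -> R) a b : ct f -> ct g -> RI (fun x => f x + g x) a b = RI f a b + RI g a b.
Proof. intros; unfold RI; apply (RInt_plus (V := R_CompleteNormedModule)); apply ct_ex; auto. Qed.
Lemma RI_minus (f g : R -> R) a b : ct f -> ct g -> RI (fun x => f x - g x) a b = RI f a b - RI g a b.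
Proof. intros; unfold RI; apply (RInt_minus (V := R_CompleteNormedModule)); apply ct_ex; auto. Qed.
Lemma RI_scal (f : R -> R) k a b : ct f -> RI (fun x => k * f x) a b = k * RI f a b.
Proof. intros; unfold RI; apply (RInt_scal (V := R_CompleteNormedModule)); apply ct_ex; auto. Qed.
Lemma RI_opp (f : R -> R) a b : ct f -> RI (fun x => - f x) a b = - RI f a b.
Proof. intros; unfold RI; apply (RInt_opp (V := R_CompleteNormedModule)); apply ct_ex; auto. Qed.
Lemma RI_const (k a b : R) : RI (fun _ => k) a b = (b - a) * k.
Proof. unfold RI; apply (RInt_const (V := R_CompleteNormedModule)). Qed.
Lemma RI_ext (f g : R -> R) a b : (forall x, f x = g x) -> RI f a b = RI g a b.
Proof. intros; unfold RI; apply RInt_ext; auto. Qed.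
Lemma RI_ext_le (f g : R -> R) a b : a <= b -> (forall x, a <= x <= b -> f x = g x) -> RI f a b = RI g a b.
Proof. intros Hab H; unfold RI; apply RInt_ext; intros x; rewrite Rmin_left, Rmax_right by auto. intros; apply H; lra. Qed.
Lemma RI_chasles (f : R -> R) a b c : ct f -> RI f a b + RI f b c = RI f a c.
Proof. intros; unfold RI; apply (RInt_Chasles (V := R_CompleteNormedModule)); apply ct_ex; auto. Qed.
Lemma RI_point (f : R -> R) a : RI f a a = 0.
Proof. unfold RI; apply (RInt_point (V := R_CompleteNormedModule)). Qed.
Lemma RI_swap (f : R -> R) a b : ct f -> RI f b a = - RI f a b.
Proof. intro; unfold RI; symmetry; apply (opp_RInt_swap (V := R_CompleteNormedModule)); apply ct_ex; auto. Qed.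
Lemma RI_le (f g : R -> R) a b : a <= b -> ct f -> ct g -> (forall x, a <= x <= b -> f x <= g x) ->
  RI f a b <= RI g a b.
Proof. intros; unfold RI; apply RInt_le; auto; try (apply ct_ex; auto); intros; apply H2; lra. Qed.
Ltac ri_le := apply RI_le; [pos|ctac|ctac|].
Lemma RI_ge0 (f : R -> R) a b : a <= b -> ct f -> (forall x, a <= x <= b -> 0 <= f x) -> 0 <= RI f a b.
Proof. intros; unfold RI; apply RInt_ge_0; auto; try (apply ct_ex; auto); intros; apply H1; lra. Qed.
Lemma RI_abs (f : R -> R) a b : a <= b -> ct f -> Rabs (RI f a b) <= RI (fun x => Rabs (f x)) a b.
Proof. intros; unfold RI; apply abs_RInt_le; auto; apply ct_ex; auto. Qed.
Lemma RI_bound (f : R -> R) a b M : a <= b -> ct f -> (forall x, a <= x <= b -> Rabs (f x) <= M) ->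
  Rabs (RI f a b) <= (b - a) * M.
Proof. intros Hab Hf HM. letr; [apply RI_abs; auto|]. rewrite <- RI_const. apply RI_le; auto; ctac. Qed.
Lemma RI_mono (f : R -> R) a b c d : a <= b -> b <= c -> c <= d -> ct f -> (forall x, a <= x <= d -> 0 <= f x) ->
  RI f b c <= RI f a d.
Proof.
  intros. rewrite <- (RI_chasles f a b d), <- (RI_chasles f b c d) by auto.
  assert (0 <= RI f a b) by (apply RI_ge0; auto; intros; apply H3; lra).
  assert (0 <= RI f c d) by (apply RI_ge0; auto; intros; apply H3; lra). lra.
Qed.
Lemma RI_shift (f : R -> R) a b y : ct f -> RI (fun x => f (x + y)) a b = RI f (a + y) (b + y).
Proof.
  intro H. replace (a + y) with (1 * a + y) by ring; replace (b + y) with (1 * b + y) by ring.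
  unfold RI; rewrite <- (RInt_comp_lin (V := R_CompleteNormedModule) f 1 y a b) by (apply ct_ex; auto).
  apply RInt_ext; intros; unfold scal; simpl; unfold mult; simpl. rewrite Rmult_1_l; f_equal; ring.
Qed.

(** Compactness of the interval makes [F u] uniformly close to [F u0] on it when [u] is near [u0];
    the parameter space itself may be any uniform space. *)
Lemma ct_RInt {U : UniformSpace} (F : U -> R -> R) a b :
  ct (fun p : U * R => F (fst p) (snd p)) -> ct (fun u => RI (F u) a b).
Proof.
  intro HF. assert (HFu : forall u, ct (F u)).
  { intros u y. apply (continuous_comp_2 (fun _ => u) (fun y => y) F y).
    apply continuous_const. apply continuous_id. apply (HF (u, y)). }
  assert (main : forall a b, a <= b -> ct (fun u => RI (F u) a b)).
  2:{ destruct (Rle_dec a b) as [H|H]; [auto|]. intro u; apply (continuous_ext (fun u => - RI (F u) b a)).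
      - intro; rewrite <- RI_swap; auto.
      - apply ct_opp, main; lra. } clear a b; intros a b Hab u0. apply filterlim_locally; intro eps.
  assert (He : 0 < eps / (2 * (b - a + 1))).
  { apply Rdiv_lt_0_compat; [apply eps | lra]. } set (e := mkposreal _ He).
  assert (Hd : forall y, exists d : posreal, forall u z, ball u0 d u -> Rabs (z - y) < d -> Rabs (F u z - F u0 y) < e).
  { intro y. specialize (HF (u0, y)). apply filterlim_locally with (eps := e) in HF.
    destruct HF as [d Hd]; exists d; intros u z Hu Hz. apply (Hd (u, z)); split; auto. }
  set (delta := fun y => proj1_sig (constructive_indefinite_description _ (Hd y))).
  assert (Hdelta : forall y u z, ball u0 (delta y) u -> Rabs (z - y) < delta y -> Rabs (F u z - F u0 y) < e).
  { intro y; unfold delta; destruct (constructive_indefinite_description _ (Hd y)); auto. }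
  (* One radius [d] for the whole interval: every point lies within the gauge of some [t] whose
     gauge is at least [d]. *)
  destruct (compactness_value_1d a b delta) as [d Hd']. exists d; intros u Hu.
  assert (Hpt : forall x, a <= x <= b -> Rabs (F u x - F u0 x) <= 2 * e).
  { intros x Hx. apply Rnot_lt_le; intro Hlt. apply (Hd' x Hx); intros [t [Ht [Hxt Hdt]]].
    assert (ball u0 (delta t) u) by (apply (ball_le _ d); auto). assert (A1 := Hdelta t u x H Hxt).
    assert (A2 := Hdelta t u0 x (ball_center _ _) Hxt). apply (Rlt_irrefl (2 * e)). eapply Rlt_trans; [apply Hlt|].
    replace (F u x - F u0 x) with ((F u x - F u0 t) - (F u0 x - F u0 t)) by ring.
    eapply Rle_lt_trans; [apply Rabs_triang|]. rewrite Rabs_Ropp. lra. } change (Rabs (RI (F u) a b - RI (F u0) a b) < eps).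
  rewrite <- RI_minus by auto. eapply Rle_lt_trans; [apply (RI_bound _ a b (2 * e)); auto; apply ct_minus; auto|].
  simpl. apply Rle_lt_trans with (eps * ((b - a) / (b - a + 1))).
  { right; field; lra. } rewrite <- (Rmult_1_r eps) at 2. apply Rmult_lt_compat_l; [apply eps|].
  apply Rmult_lt_reg_r with (b - a + 1); [lra|]. field_simplify; lra.
Qed.

Ltac ct_extra ::=
  lazymatch goal with |- ct (fun u => RI (@?F u) ?a ?b) => simple apply (ct_RInt F a b) end.

Lemma RI_prim (f : R -> R) a x : ct f -> is_derive (fun x => RI f a x) x (f x).
Proof.
  intro H. apply (is_derive_RInt f (fun x => RI f a x) a x); unfold RI.
  - apply filter_forall; intro y; apply (RInt_correct (V := R_CompleteNormedModule)), ct_ex; auto.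
  - apply H.
Qed.

Lemma RI_ftc (f df : R -> R) a b : a <= b -> ct df ->
  (forall x, a <= x <= b -> is_derive f x (df x)) -> RI df a b = f b - f a.
Proof.
  intros Hab Hc Hd. unfold RI; apply (is_RInt_unique (V := R_CompleteNormedModule)). apply (is_RInt_derive f df a b).
  - rewrite Rmin_left, Rmax_right by auto; auto.
  - intros; apply Hc.
Qed.

Lemma RI_parts (f g df dg : R -> R) a b : a <= b -> ct f -> ct g -> ct df -> ct dg ->
  (forall x, a <= x <= b -> is_derive f x (df x)) ->
  (forall x, a <= x <= b -> is_derive g x (dg x)) ->
  RI (fun x => f x * dg x) a b = f b * g b - f a * g a - RI (fun x => df x * g x) a b.
Proof.
  intros Hab Cf Cg Cdf Cdg Hf Hg. assert (RI (fun x => df x * g x + f x * dg x) a b = f b * g b - f a * g a).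
  { apply (RI_ftc (fun x => f x * g x) _ a b); auto; [ctac|].
    intros x Hx. apply (is_derive_mult f g x); auto. intros; apply Rmult_comm. } rewrite RI_plus in H by ctac. lra.
Qed.

Lemma RI_comp (f g dg : R -> R) a b : a <= b -> ct f -> ct dg ->
  (forall x, a <= x <= b -> is_derive g x (dg x)) ->
  RI (fun y => dg y * f (g y)) a b = RI f (g a) (g b).
Proof.
  intros Hab Cf Cdg Hg. unfold RI; apply (RInt_comp (V := R_CompleteNormedModule) f g dg a b).
  - intros; apply Cf.
  - rewrite Rmin_left, Rmax_right by auto. intros; split; auto.
Qed.

Lemma ct2_row (F : R -> R -> R) x : ct2 F -> ct (F x).
Proof. intro H; apply (ct2_comp F (fun _ => x) (fun y => y)); auto; ctac. Qed.
Lemma ct2_col (F : R -> R -> R) y : ct2 F -> ct (fun x => F x y).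
Proof. intro H; apply (ct2_comp F (fun x => x) (fun _ => y)); auto; ctac. Qed.

Lemma RI_deriv (F Fx : R -> R -> R) a b x : ct2 F -> ct2 Fx ->
  (forall x y, is_derive (fun x => F x y) x (Fx x y)) ->
  is_derive (fun x => RI (F x) a b) x (RI (Fx x) a b).
Proof.
  intros CF CFx HF. assert (E : forall u v, Derive (fun z => F z v) u = Fx u v) by (intros; apply is_derive_unique; auto).
  rewrite <- (RI_ext (fun t => Derive (fun u => F u t) x) (Fx x)) by auto. unfold RI; apply is_derive_RInt_param.
  - apply filter_forall; intros; eexists; apply HF.
  - intros t _. apply (continuity_2d_pt_ext Fx); [intros; auto|]. apply continuity_2d_pt_filterlim. apply (CFx (x, t)).
  - apply filter_forall; intro; apply ct_ex, ct2_row; auto.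
Qed.

Lemma deriv_lin (a k z : R) : is_derive (fun z => a + z * k) z k.
Proof. auto_derive; auto; ring. Qed.

(** Both sides, as functions of the upper limit [t] in place of [b], vanish at [a] and have the same
    derivative. *)
Lemma fubini (F : R -> R -> R) a b c d : a <= b -> ct2 F ->
  RI (fun x => RI (F x) c d) a b = RI (fun y => RI (fun x => F x y) a b) c d.
Proof.
  intros Hab HF. set (g := fun t => RI (fun x => RI (F x) c d) a t - RI (fun y => RI (fun x => F x y) a t) c d).
  assert (C1 : ct (fun x => RI (F x) c d)) by ctac. assert (Hd : forall t, is_derive g t 0).
  { intro t. replace 0 with (RI (F t) c d - RI (fun y => F t y) c d) by (apply Rminus_diag_eq; auto).
    apply (is_derive_minus (fun t => RI (fun x => RI (F x) c d) a t)).
    - apply (RI_prim (fun x => RI (F x) c d)); auto.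
    - apply (RI_deriv (fun t y => RI (fun x => F x y) a t) F); auto.
      (* Joint continuity of an integral with variable endpoint: rescaling to [[0, 1]] puts the
         endpoint into the integrand, where [ct_RInt] applies. *)
      + intro p. assert (Q : ct (fun q : R * R => RI (fun z => (fst q - a) * F (a + z * (fst q - a)) (snd q)) 0 1)).
        { apply (ct_RInt (fun (q : R * R) z => (fst q - a) * F (a + z * (fst q - a)) (snd q))). ctac. }
        apply (continuous_ext (fun q : R * R => RI (fun z => (fst q - a) * F (a + z * (fst q - a)) (snd q)) 0 1)); [|apply Q].
        intro q. transitivity (RI (fun x => F x (snd q)) (a + 0 * (fst q - a)) (a + 1 * (fst q - a))).
        2:{ rewrite Rmult_0_l, Rmult_1_l, Rplus_0_r, Rplus_minus; reflexivity. }
        apply (RI_comp (fun x => F x (snd q)) (fun z => a + z * (fst q - a)) (fun _ => fst q - a) 0 1);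
          [lra | apply ct2_col; auto | ctac | intros; apply deriv_lin].
      + intros u v. apply (RI_prim (fun x => F x v)). apply ct2_col; auto. } assert (g b = g a).
  { assert (RI (fun _ => 0) a b = g b - g a) by (apply RI_ftc; auto; ctac). rewrite RI_const in H. lra. }
  unfold g in H. rewrite !RI_point in H.
  rewrite (RI_ext (fun y => RI (fun x => F x y) a a) (fun _ => 0)) in H by (intro; apply RI_point). rewrite RI_const in H. lra.
Qed.

Lemma fubini3 (F : R -> R -> R -> R) a b c d e f : a <= b -> c <= d -> ct3 F ->
  RI (fun x => RI (fun y => RI (F x y) e f) c d) a b =
  RI (fun y => RI (fun z => RI (fun x => F x y z) a b) e f) c d.
Proof.
  intros Hab Hcd HF. rewrite (fubini (fun x y => RI (F x y) e f)) by (auto; ctac).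
  apply RI_ext; intro y. apply (fubini (fun x z => F x y z)); auto; ctac.
Qed.

Lemma chain2 (K Kb Kz : R -> R -> R) (b z : R -> R) (s db dz : R) :
  ct2 K -> ct2 Kb -> ct2 Kz ->
  (forall b z, is_derive (fun b => K b z) b (Kb b z)) ->
  (forall b z, is_derive (K b) z (Kz b z)) ->
  is_derive b s db -> is_derive z s dz ->
  is_derive (fun s => K (b s) (z s)) s (Kb (b s) (z s) * db + Kz (b s) (z s) * dz).
Proof.
  intros C Cb Cz Db Dz Hb Hz. apply is_derive_Reals. apply (derivable_pt_lim_comp_2d K b z); try (apply is_derive_Reals; auto).
  apply filterdiff_differentiable_pt_lim. apply (is_derive_filterdiff K (b s) (z s) Kb).
  - apply filter_forall; intros [u v]; apply Db.
  - apply Dz.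
  - apply (Cb (b s, z s)).
Qed.

Lemma RI_cs (f g : R -> R) a b : a <= b -> ct f -> ct g ->
  (RI (fun x => f x * g x) a b) ^ 2 <= RI (fun x => f x ^ 2) a b * RI (fun x => g x ^ 2) a b.
Proof.
  intros Hab Cf Cg. set (A := RI (fun x => f x ^ 2) a b). set (B := RI (fun x => f x * g x) a b).
  set (C := RI (fun x => g x ^ 2) a b). assert (Q : forall t, 0 <= A * t ^ 2 - 2 * B * t + C).
  { intro t. replace (A * t ^ 2 - 2 * B * t + C) with (RI (fun x => (t * f x - g x) ^ 2) a b).
    - apply RI_ge0; auto; [ctac|]. intros; apply pow2_ge_0.
    - unfold A, B, C. rewrite (RI_ext (fun x => (t * f x - g x) ^ 2)
        (fun x => (t ^ 2 * f x ^ 2 - (2 * t) * (f x * g x)) + g x ^ 2)) by (intro; ring).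
      rewrite RI_plus, RI_minus, !RI_scal by ctac. ring. }
  assert (0 <= A) by (apply RI_ge0; auto; [ctac|]; intros; apply pow2_ge_0).
  assert (0 <= C) by (apply RI_ge0; auto; [ctac|]; intros; apply pow2_ge_0). destruct (Req_dec A 0) as [E|E].
  - rewrite E. assert (B = 0).
    (* For [A = 0] and [B <> 0] this value of [t] makes the nonnegative polynomial equal to -1. *)
    { destruct (Req_dec B 0); auto. specialize (Q ((C + 1) / (2 * B))).
      replace (A * ((C + 1) / (2 * B)) ^ 2 - 2 * B * ((C + 1) / (2 * B)) + C) with (-1) in Q; [lra|]. rewrite E; field; auto. }
    rewrite H1. lra.
  - specialize (Q (B / A)). replace (A * (B / A) ^ 2 - 2 * B * (B / A) + C) with ((A * C - B ^ 2) / A) in Q by (field; auto).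
    apply Rmult_le_compat_r with (r := A) in Q; [|lra].
    replace ((A * C - B ^ 2) / A * A) with (A * C - B ^ 2) in Q by (field; auto). lra.
Qed.

Lemma RI_jensen (f : R -> R) a b : a <= b -> ct f ->
  (RI f a b) ^ 2 <= (b - a) * RI (fun x => f x ^ 2) a b.
Proof.
  intros Hab Cf. assert (H := RI_cs (fun _ => 1) f a b Hab (ct_const 1) Cf).
  rewrite (RI_ext (fun x => 1 * f x) f) in H by (intro; ring).
  rewrite (RI_ext (fun x => 1 ^ 2) (fun _ => 1)) in H by (intro; ring). rewrite RI_const in H. lra.
Qed.

Definition per (P : R) (f : R -> R) : Prop := forall x, f (x + P) = f x.
Definition cper (P : R) (f : R -> R) : Prop := ct f /\ per P f.
Definition En (P : R) (f : R -> R) : R := RI (fun x => f x ^ 2) 0 P.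

(** The integral over a window of length [P] has derivative [f (t + P) - f t = 0] in its left
    endpoint. *)
Lemma per_int P (f : R -> R) a : 0 < P -> cper P f -> RI f a (a + P) = RI f 0 P.
Proof.
  intros HP [Cf Hp]. set (g := fun a => RI f 0 (a + P) - RI f 0 a). assert (Hd : forall t, is_derive g t 0).
  { intro t. replace 0 with (1 * f (t + P) - f t) by (rewrite Hp; ring).
    apply (is_derive_minus (fun a => RI f 0 (a + P))); [|apply RI_prim; auto].
    apply (is_derive_comp (fun b => RI f 0 b) (fun a => a + P)); [apply RI_prim; auto|]. auto_derive; auto. }
  assert (Hc : forall u v, u <= v -> g v = g u).
  { intros u v Huv. assert (RI (fun _ => 0) u v = g v - g u) by (apply RI_ftc; auto; ctac). rewrite RI_const in H. lra. }
  assert (g a = g 0) by (destruct (Rle_dec a 0); [symmetry|]; apply Hc; lra).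
  rewrite <- (RI_chasles f a 0), (RI_swap f 0 a) by auto. unfold g in H. rewrite RI_point, Rplus_0_l in H. lra.
Qed.

Lemma per_shift P (f : R -> R) y : 0 < P -> cper P f -> RI (fun x => f (x + y)) 0 P = RI f 0 P.
Proof. intros HP Hf. rewrite RI_shift by apply Hf. rewrite Rplus_0_l, Rplus_comm. apply per_int; auto. Qed.
End Integrals.
Import Integrals.

(** * Moving averages and the pieces between consecutive dyadic scales *)

Module Averages.
Lemma ct_of_cper P f : cper P f -> ct f. Proof. intros [H _]; auto. Qed.
#[export] Hint Resolve ct_of_cper : ctdb.
#[export] Hint Extern 1 (ct2 _) => assumption : ctdb.
#[export] Hint Extern 1 (ct _) => assumption : ctdb.
#[export] Hint Extern 4 (ct (fun _ => _)) => solve [ctac] : ctdb.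

Fixpoint bs (f : nat -> R) (n : nat) : R :=
  match n with O => 0 | S n => bs f n + f n end.

Lemma bs_ext f g n : (forall k, (k < n)%nat -> f k = g k) -> bs f n = bs g n.
Proof. induction n; simpl; intros; auto. rewrite IHn, H; auto. Qed.
Lemma bs_le f g n : (forall k, (k < n)%nat -> f k <= g k) -> bs f n <= bs g n.
Proof. induction n; simpl; intros; [lra|]. assert (f n <= g n) by auto. assert (bs f n <= bs g n) by auto. lra. Qed.
Lemma bs_plus f g n : bs (fun k => f k + g k) n = bs f n + bs g n.
Proof. induction n; simpl; lra. Qed.
Lemma bs_minus f g n : bs (fun k => f k - g k) n = bs f n - bs g n.
Proof. induction n; simpl; lra. Qed.
Lemma bs_scal c f n : bs (fun k => c * f k) n = c * bs f n.
Proof. induction n; simpl; lra. Qed.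
Lemma bs_ge0 f n : (forall k, (k < n)%nat -> 0 <= f k) -> 0 <= bs f n.
Proof. intro H; induction n; simpl; [lra|]. assert (0 <= f n) by auto. assert (0 <= bs f n) by auto. lra. Qed.
Lemma bs_abs f n : Rabs (bs f n) <= bs (fun k => Rabs (f k)) n.
Proof. induction n; simpl; [rewrite Rabs_R0; lra|]. letr; [apply Rabs_triang|]; lra. Qed.
Lemma ct_bs {U : UniformSpace} (f : nat -> U -> R) n :
  (forall k, ct (f k)) -> ct (fun u => bs (fun k => f k u) n).
Proof. intro H; induction n; simpl; [apply ct_const | apply ct_plus; auto]. Qed.
Lemma RI_bs (f : nat -> R -> R) n a b : (forall k, ct (f k)) ->
  RI (fun x => bs (fun k => f k x) n) a b = bs (fun k => RI (f k) a b) n.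
Proof. intro H; induction n; simpl; [rewrite RI_const; ring|]. rewrite RI_plus, IHn; auto. apply ct_bs; auto. Qed.

Implicit Types F G f g u v w h : R -> R.
Implicit Types P d x y c : R.

Lemma cper_plus P f g : cper P f -> cper P g -> cper P (fun x => f x + g x).
Proof. intros [A B] [C D]; split; [ctac | intro x; rewrite B, D; auto]. Qed.
Lemma cper_minus P f g : cper P f -> cper P g -> cper P (fun x => f x - g x).
Proof. intros [A B] [C D]; split; [ctac | intro x; rewrite B, D; auto]. Qed.
Lemma cper_mult P f g : cper P f -> cper P g -> cper P (fun x => f x * g x).
Proof. intros [A B] [C D]; split; [ctac | intro x; rewrite B, D; auto]. Qed.
Lemma cper_scal P c f : cper P f -> cper P (fun x => c * f x).
Proof. intros [A B]; split; [ctac | intro x; rewrite B; auto]. Qed.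
Lemma cper_const P c : cper P (fun _ => c).
Proof. split; [ctac | intro x; auto]. Qed.
Lemma cper_pow P f n : cper P f -> cper P (fun x => f x ^ n).
Proof. intros [A B]; split; [ctac | intro x; rewrite B; auto]. Qed.
Lemma cper_abs P f : cper P f -> cper P (fun x => Rabs (f x)).
Proof. intros [A B]; split; [ctac | intro x; rewrite B; auto]. Qed.
Lemma cper_shift P f y : cper P f -> cper P (fun x => f (x + y)).
Proof. intros [A B]; split; [ctac|]. intro x; rewrite <- (B (x + y)); f_equal; ring. Qed.
Lemma cper_shiftm P f y : cper P f -> cper P (fun x => f (x - y)).
Proof. apply (cper_shift P f (- y)). Qed.
Lemma cper_bs P (f : nat -> R -> R) n :
  (forall k, cper P (f k)) -> cper P (fun x => bs (fun k => f k x) n).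
Proof. intro H; induction n; simpl; [apply cper_const | apply cper_plus; auto]. Qed.

(* [avs] is the adjoint of [av] and [pp = av o avs] averages over a tent; [qq], the part of [F] between the scales [d] and [2 d],
   has the primitive [qp], whose [L^2] norm gains a factor [d]. *)
Definition av (d : R) (F : R -> R) (x : R) : R := / d * RI (fun y => F (x - y)) 0 d.
Definition avs (d : R) (F : R -> R) (x : R) : R := / d * RI (fun y => F (x + y)) 0 d.
Definition ds (d : R) (F : R -> R) (x : R) : R := avs d F x - avs d F (x + d).
Definition pp (d : R) (F : R -> R) : R -> R := av d (avs d F).
Definition qq (d : R) (F : R -> R) (x : R) : R := pp d F x - pp (2 * d) F x.
Definition qp (d : R) (F : R -> R) (x : R) : R := d / 4 * av d (av d (ds d F)) x.

Lemma ct_av d F : ct F -> ct (av d F).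
Proof. intro H; unfold av; ctac. Qed.
Lemma ct_avs d F : ct F -> ct (avs d F).
Proof. intro H; unfold avs; ctac. Qed.
#[export] Hint Resolve ct_av ct_avs : ctdb.
Lemma ct_ds d F : ct F -> ct (ds d F).
Proof. intro H; unfold ds; ctac. Qed.
Lemma ct_pp d F : ct F -> ct (pp d F).
Proof. intro H; unfold pp; ctac. Qed.
#[export] Hint Resolve ct_ds ct_pp : ctdb.
Lemma ct_qq d F : ct F -> ct (qq d F).
Proof. intro H; unfold qq; ctac. Qed.
Lemma ct_qp d F : ct F -> ct (qp d F).
Proof. intro H; unfold qp; ctac. Qed.
#[export] Hint Resolve ct_qq ct_qp : ctdb.

Create HintDb cp.
Lemma cper_av P d F : cper P F -> cper P (av d F).
Proof.
  intros [A B]; split; [ctac|]. intro x; unfold av; f_equal; apply RI_ext; intro y. rewrite <- (B (x - y)); f_equal; ring.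
Qed.
Lemma cper_avs P d F : cper P F -> cper P (avs d F).
Proof.
  intros [A B]; split; [ctac|]. intro x; unfold avs; f_equal; apply RI_ext; intro y. rewrite <- (B (x + y)); f_equal; ring.
Qed.
#[export] Hint Resolve cper_av cper_avs cper_plus cper_minus cper_mult cper_scal cper_const cper_pow
  cper_abs cper_shift cper_shiftm cper_bs : cp.
Lemma cper_ds P d F : cper P F -> cper P (ds d F).
Proof. intro H; unfold ds; apply cper_minus; auto with cp. Qed.
Lemma cper_pp P d F : cper P F -> cper P (pp d F).
Proof. intro H; unfold pp; auto with cp. Qed.
#[export] Hint Resolve cper_ds cper_pp : cp.
Lemma cper_qq P d F : cper P F -> cper P (qq d F).
Proof. intro H; unfold qq; auto with cp. Qed.
Lemma cper_qp P d F : cper P F -> cper P (qp d F).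
Proof. intro H; unfold qp; auto with cp. Qed.
#[export] Hint Resolve cper_qq cper_qp : cp.

Lemma En_ge0 P F : 0 < P -> ct F -> 0 <= En P F.
Proof. intros HP H; apply RI_ge0; [lra | ctac | intros; apply pow2_ge_0]. Qed.
Lemma En_shift P F y : 0 < P -> cper P F -> En P (fun x => F (x + y)) = En P F.
Proof. intros HP H; apply (per_shift P (fun x => F x ^ 2)); auto with cp. Qed.
Lemma En_shiftm P F y : 0 < P -> cper P F -> En P (fun x => F (x - y)) = En P F.
Proof. intros HP H; apply (En_shift P F (- y)); auto. Qed.
Lemma En_scal P c F : ct F -> En P (fun x => c * F x) = c ^ 2 * En P F.
Proof. intro H; unfold En. rewrite <- RI_scal by ctac. apply RI_ext; intro; ring. Qed.
Lemma En_ext P F G : (forall x, F x = G x) -> En P F = En P G.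
Proof. intro H; apply RI_ext; intro; rewrite H; auto. Qed.
Lemma En_le P F G : 0 < P -> ct F -> ct G -> (forall x, Rabs (F x) <= Rabs (G x)) -> En P F <= En P G.
Proof.
  intros HP CF CG H; ri_le; intros x _.
  rewrite <- (pow2_abs (F x)), <- (pow2_abs (G x)). apply pow_incr; split; auto; apply Rabs_pos.
Qed.
Lemma En_plus2 P F G : 0 < P -> ct F -> ct G -> En P (fun x => F x + G x) <= 2 * En P F + 2 * En P G.
Proof.
  intros HP CF CG; unfold En. rewrite <- !RI_scal, <- RI_plus by ctac. ri_le; intros x _; cbv beta.
  assert (0 <= (F x - G x) ^ 2) by pos. nra.
Qed.
Lemma En_minus2 P F G : 0 < P -> ct F -> ct G -> En P (fun x => F x - G x) <= 2 * En P F + 2 * En P G.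
Proof.
  intros HP CF CG; unfold En. rewrite <- !RI_scal, <- RI_plus by ctac. ri_le; intros x _; cbv beta.
  assert (0 <= (F x + G x) ^ 2) by pos. nra.
Qed.

(** Jensen in the inner variable followed by Fubini; together with [En_RI_sup] it plays the part of
    Minkowski's inequality. *)
Lemma En_RI P (u : R -> R -> R) a b : 0 < P -> a <= b -> ct2 u ->
  En P (fun x => RI (u x) a b) <= (b - a) * RI (fun s => En P (fun x => u x s)) a b.
Proof.
  intros HP Hab C. unfold En.
  assert (F : RI (fun s => RI (fun x => u x s ^ 2) 0 P) a b = RI (fun x => RI (fun s => u x s ^ 2) a b) 0 P).
  { symmetry; apply (fubini (fun x s => u x s ^ 2)); [lra|ctac]. } rewrite F, <- RI_scal by ctac.
  ri_le; intros x _. apply RI_jensen; auto; ctac.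
Qed.

Lemma En_RI_sup P (u : R -> R -> R) a b M : 0 < P -> a <= b -> ct2 u ->
  (forall s, a <= s <= b -> En P (fun x => u x s) <= M) ->
  En P (fun x => RI (u x) a b) <= (b - a) ^ 2 * M.
Proof.
  intros HP Hab C HM. letr; [apply En_RI; auto|].
  replace ((b - a) ^ 2 * M) with ((b - a) * RI (fun _ => M) a b) by (rewrite RI_const; ring).
  mul_l. apply RI_le; auto; [unfold En; ctac|ctac].
Qed.

Lemma En_av P d F : 0 < P -> 0 < d -> cper P F -> En P (av d F) <= En P F.
Proof.
  intros HP Hd H. unfold av. rewrite En_scal by (assert (ct F) by apply H; ctac). letr_with ((/ d) ^ 2 * (d - 0) ^ 2 * En P F).
  - rewrite Rmult_assoc. mul_l. apply (En_RI_sup P (fun x s => F (x - s))); [auto|lra|assert (ct F) by apply H; ctac|].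
    intros; rewrite En_shiftm; auto; lra.
  - right; field; lra.
Qed.
Lemma En_avs P d F : 0 < P -> 0 < d -> cper P F -> En P (avs d F) <= En P F.
Proof.
  intros HP Hd H. unfold avs. rewrite En_scal by (assert (ct F) by apply H; ctac). letr_with ((/ d) ^ 2 * (d - 0) ^ 2 * En P F).
  - rewrite Rmult_assoc. mul_l. apply (En_RI_sup P (fun x s => F (x + s))); [auto|lra|assert (ct F) by apply H; ctac|].
    intros; rewrite En_shift; auto; lra.
  - right; field; lra.
Qed.

Lemma avs_RI d F x : ct F -> avs d F x = / d * RI F x (x + d).
Proof.
  intro H; unfold avs; f_equal. rewrite (RI_ext (fun y => F (x + y)) (fun y => F (y + x))).
  - rewrite RI_shift by auto; f_equal; ring.
  - intro; f_equal; ring.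
Qed.
Lemma av_RI d F x : 0 < d -> ct F -> av d F x = / d * RI F (x - d) x.
Proof.
  intros Hd H; unfold av; f_equal. assert (RI (fun y => -1 * F (x - y)) 0 d = RI F (x - 0) (x - d)).
  { apply (RI_comp F (fun y => x - y) (fun _ => -1)); [lra|auto|ctac|]. intros; auto_derive; auto; ring. }
  rewrite RI_scal, (RI_swap F (x - d)) in H0 by ctac. rewrite Rminus_0_r in H0. lra.
Qed.

Lemma avs_double d F x : 0 < d -> ct F -> avs (2 * d) F x = (avs d F x + avs d F (x + d)) / 2.
Proof.
  intros Hd H. rewrite !avs_RI by auto. rewrite <- (RI_chasles F x (x + d) (x + 2 * d)) by auto.
  replace (x + d + d) with (x + 2 * d) by ring. field; lra.
Qed.
Lemma av_double d F x : 0 < d -> ct F -> av (2 * d) F x = (av d F x + av d F (x - d)) / 2.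
Proof.
  intros Hd H. rewrite !av_RI by (auto; lra). rewrite <- (RI_chasles F (x - 2 * d) (x - d) x) by auto.
  replace (x - d - d) with (x - 2 * d) by ring. field; lra.
Qed.

(** An average over length [2 d] is the half sum of two neighbouring averages over length [d], and
    [ds d F] is their difference: this is the parallelogram law, integrated over a period. *)
Lemma ds_parallelogram P d F : 0 < P -> 0 < d -> cper P F ->
  En P (avs (2 * d) F) + / 4 * En P (ds d F) = En P (avs d F).
Proof.
  intros HP Hd H. assert (C : ct F) by apply H.
  assert (S : En P (fun x => avs d F (x + d)) = En P (avs d F)) by (apply En_shift; auto with cp).
  unfold En in *. rewrite <- RI_scal, <- RI_plus by ctac.
  rewrite (RI_ext _ (fun x => / 2 * avs d F x ^ 2 + / 2 * avs d F (x + d) ^ 2)).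
  - rewrite RI_plus, !RI_scal, S by ctac. field.
  - intro x. rewrite avs_double by auto. unfold ds. field.
Qed.

(** The square-function estimate behind all summations over scales: the parallelogram law telescopes
    from [L] downwards. *)
Lemma ds_sum P L F n : 0 < P -> 0 < L -> cper P F ->
  bs (fun k => En P (ds (L / 2 ^ k) F)) n <= 4 * En P F.
Proof.
  intros HP HL H. assert (T : / 4 * bs (fun k => En P (ds (L / 2 ^ k) F)) n =
     En P (avs (2 * L / 2 ^ n) F) - En P (avs (2 * L) F)).
  { induction n; simpl bs.
    - simpl; replace (2 * L / 1) with (2 * L) by field; ring.
    - assert (Hd : 0 < L / 2 ^ n) by pos. assert (Q := ds_parallelogram P _ F HP Hd H).
      replace (2 * (L / 2 ^ n)) with (2 * L / 2 ^ n) in Q by (field; apply pow_nonzero; lra).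
      replace (2 * L / 2 ^ S n) with (L / 2 ^ n) by (simpl; field; apply pow_nonzero; lra). lra. }
  assert (En P (avs (2 * L / 2 ^ n) F) <= En P F).
  { apply En_avs; auto. apply Rdiv_lt_0_compat; [lra|pos]. }
  assert (0 <= En P (avs (2 * L) F)) by (apply En_ge0; auto; ctac). lra.
Qed.

Lemma av_lin d f g a b x : ct f -> ct g ->
  av d (fun x => a * f x + b * g x) x = a * av d f x + b * av d g x.
Proof. intros; unfold av. rewrite RI_plus, !RI_scal by ctac. ring. Qed.
Lemma avs_lin d f g a b x : ct f -> ct g ->
  avs d (fun x => a * f x + b * g x) x = a * avs d f x + b * avs d g x.
Proof. intros; unfold avs. rewrite RI_plus, !RI_scal by ctac. ring. Qed.
Lemma av_ext d f g x : (forall x, f x = g x) -> av d f x = av d g x.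
Proof. intro H; unfold av; f_equal; apply RI_ext; auto. Qed.
Lemma avs_ext d f g x : (forall x, f x = g x) -> avs d f x = avs d g x.
Proof. intro H; unfold avs; f_equal; apply RI_ext; auto. Qed.
Lemma av_shift d f y x : av d (fun x => f (x + y)) x = av d f (x + y).
Proof. unfold av; f_equal; apply RI_ext; intro; f_equal; ring. Qed.

Lemma av_ds d F x : ct F -> av d (ds d F) x = pp d F x - pp d F (x + d).
Proof.
  intro C. unfold ds. rewrite (av_ext _ _ (fun x => 1 * avs d F x + (-1) * avs d F (x + d))) by (intro; ring).
  rewrite (av_lin d (avs d F) (fun x => avs d F (x + d))) by ctac. rewrite (av_shift d (avs d F)). unfold pp. ring.
Qed.

(** Doubling a tent gives [pp (2 d) F x = (2 pp d F x + pp d F (x + d) + pp d F (x - d)) / 4]. Hence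
    [qq] is a difference quotient of averaged [ds], which yields both its primitive and its bound by
    [ds]. *)
Lemma qq_ds d F x : 0 < d -> ct F ->
  qq d F x = / 4 * (av d (ds d F) x - av d (ds d F) (x - d)).
Proof.
  intros Hd C. rewrite !av_ds by auto. replace (x - d + d) with x by ring.
  unfold qq. enough (pp (2 * d) F x = / 4 * (2 * pp d F x + pp d F (x + d) + pp d F (x - d))) by lra.
  unfold pp at 1. rewrite av_double by (auto; ctac).
  assert (K : forall x, av d (avs (2 * d) F) x = / 2 * pp d F x + / 2 * pp d F (x + d)).
  { intro z. rewrite (av_ext d _ (fun x => / 2 * avs d F x + / 2 * avs d F (x + d))).
    - rewrite (av_lin d (avs d F) (fun x => avs d F (x + d))) by ctac. rewrite (av_shift d (avs d F)). reflexivity.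
    - intro w; rewrite avs_double by auto; field. } rewrite !K. replace (x - d + d) with x by ring. field.
Qed.

Lemma av_deriv d v (x : R) : 0 < d -> ct v -> is_derive (av d v) x ((v x - v (x - d)) / d).
Proof.
  intros Hd C. assert (Q : forall t : R, / d * (RI v 0 t - RI v 0 (t - d)) = av d v t).
  { intro t. rewrite av_RI by auto. rewrite <- (RI_chasles v (t - d) 0 t), (RI_swap v 0 (t - d)) by auto. ring. }
  apply (is_derive_ext _ _ x _ Q). replace ((v x - v (x - d)) / d) with (/ d * (v x - 1 * v (x - d))) by (field; lra).
    apply (is_derive_scal (fun x => RI v 0 x - RI v 0 (x - d))).
    apply (is_derive_minus (fun x => RI v 0 x)); [apply RI_prim; auto|].
    apply (is_derive_comp (RI v 0) (fun x => x - d)); [apply RI_prim; auto|]. auto_derive; auto.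
Qed.

Lemma qp_deriv d F (x : R) : 0 < d -> ct F -> is_derive (qp d F) x (qq d F x).
Proof.
  intros Hd C. rewrite qq_ds by auto. replace (/ 4 * (av d (ds d F) x - av d (ds d F) (x - d))) with
    (d / 4 * ((av d (ds d F) x - av d (ds d F) (x - d)) / d)) by (field; lra).
  apply (is_derive_scal (av d (av d (ds d F)))). apply av_deriv; auto; ctac.
Qed.

(** [pp'] and [qq'] are exact derivatives of [pp d F] and [qq d F]. Being combinations of translates
    of [ds d F] divided by [d], they are controlled by the square function and not merely by [F]. *)
Definition pp' (d : R) (F : R -> R) (x : R) : R := - / d * ds d F (x - d).
Definition qq' (d : R) (F : R -> R) (x : R) : R :=
  / (4 * d) * (ds d F x - 2 * ds d F (x - d) + ds d F (x - 2 * d)).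

Lemma ct_pp' d F : ct F -> ct (pp' d F).
Proof. intro H; unfold pp'; ctac. Qed.
Lemma ct_qq' d F : ct F -> ct (qq' d F).
Proof. intro H; unfold qq'; ctac. Qed.
#[export] Hint Resolve ct_pp' ct_qq' : ctdb.

Lemma cper_pp' P d F : cper P F -> cper P (pp' d F).
Proof. intro H; unfold pp'. apply cper_scal, cper_shiftm; auto with cp. Qed.
Lemma cper_qq' P d F : cper P F -> cper P (qq' d F).
Proof. intro H; unfold qq'. apply cper_scal, cper_plus; [apply cper_minus|]; auto with cp. Qed.
#[export] Hint Resolve cper_pp' cper_qq' : cp.

Lemma pp_deriv d F (x : R) : 0 < d -> ct F -> is_derive (pp d F) x (pp' d F x).
Proof.
  intros Hd C. replace (pp' d F x) with ((avs d F x - avs d F (x - d)) / d).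
  - apply av_deriv; auto; ctac.
  - unfold pp', ds. replace (x - d + d) with x by ring. field; lra.
Qed.

Lemma qq_deriv d F (x : R) : 0 < d -> ct F -> is_derive (qq d F) x (qq' d F x).
Proof.
  intros Hd C. apply (is_derive_ext (fun x => / 4 * (av d (ds d F) x - av d (ds d F) (x - d)))).
  { intro t; symmetry; apply qq_ds; auto. } replace (qq' d F x) with (/ 4 * ((ds d F x - ds d F (x - d)) / d -
    1 * ((ds d F (x - d) - ds d F (x - d - d)) / d))).
  2:{ unfold qq'. replace (x - d - d) with (x - 2 * d) by ring. field; lra. }
  apply (is_derive_scal (fun x => av d (ds d F) x - av d (ds d F) (x - d))).
  apply (is_derive_minus (av d (ds d F))); [apply av_deriv; auto; ctac|].
  apply (is_derive_comp (av d (ds d F)) (fun x => x - d)); [apply av_deriv; auto; ctac|]. auto_derive; auto.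
Qed.

Lemma En_qq P d F : 0 < P -> 0 < d -> cper P F -> En P (qq d F) <= / 4 * En P (ds d F).
Proof.
  intros HP Hd H. assert (C : ct F) by apply H. rewrite (En_ext P _ (fun x => / 4 * (av d (ds d F) x - av d (ds d F) (x - d))))
    by (intro; apply qq_ds; auto). rewrite (En_scal P (/ 4) (fun x => av d (ds d F) x - av d (ds d F) (x - d))) by ctac.
  assert (A := En_minus2 P (av d (ds d F)) (fun x => av d (ds d F) (x - d)) HP ltac:(ctac) ltac:(ctac)).
  cbv beta in A. rewrite En_shiftm in A by auto with cp. assert (B := En_av P d (ds d F) HP Hd (cper_ds P d F H)).
  replace ((/ 4) ^ 2) with (/ 16) by field. lra.
Qed.

Lemma En_qp P d F : 0 < P -> 0 < d -> cper P F -> En P (qp d F) <= d ^ 2 / 16 * En P (ds d F).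
Proof.
  intros HP Hd H. unfold qp. rewrite (En_scal P (d / 4) (av d (av d (ds d F)))) by ctac.
  replace (d ^ 2 / 16) with ((d / 4) ^ 2) by field. mul_l. letr; apply En_av; auto with cp.
Qed.

Lemma En_pp' P d F : 0 < P -> 0 < d -> cper P F -> En P (pp' d F) = / d ^ 2 * En P (ds d F).
Proof.
  intros HP Hd H. unfold pp'. rewrite (En_scal P (- / d) (fun x => ds d F (x - d))), En_shiftm by (auto with cp; ctac).
  f_equal; field; lra.
Qed.

Lemma En_qq' P d F : 0 < P -> 0 < d -> cper P F -> En P (qq' d F) <= / d ^ 2 * En P (ds d F).
Proof.
  intros HP Hd H. unfold qq'.
  rewrite (En_scal P (/ (4 * d)) (fun x => ds d F x - 2 * ds d F (x - d) + ds d F (x - 2 * d))) by ctac.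
  replace (/ d ^ 2 * En P (ds d F)) with ((/ (4 * d)) ^ 2 * (16 * En P (ds d F))) by (field; lra). mul_l.
  assert (A1 : En P (fun x => ds d F (x - d)) = En P (ds d F)) by (apply En_shiftm; auto with cp).
  assert (A2 : En P (fun x => ds d F (x - 2 * d)) = En P (ds d F)) by (apply En_shiftm; auto with cp).
  replace (16 * En P (ds d F)) with (4 * En P (ds d F) + 8 * En P (fun x => ds d F (x - d)) +
    4 * En P (fun x => ds d F (x - 2 * d))) by lra. unfold En. rewrite <- !RI_scal, <- !RI_plus by ctac. ri_le. intros x _.
  set (a := ds d F x); set (b := ds d F (x - d)); set (c := ds d F (x - 2 * d)). assert (0 <= (a - c) ^ 2) by pos.
  assert (0 <= (a + 2 * b + c) ^ 2) by pos. nra.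
Qed.

Lemma En_pp P d F : 0 < P -> 0 < d -> cper P F -> En P (pp d F) <= En P F.
Proof. intros; letr; [apply En_av | apply En_avs]; auto with cp. Qed.

(** The increment is [y] times the mean of [F'] over the segment, to which [En_RI_sup] applies. *)
Lemma En_diff P F F' y : 0 < P -> cper P F -> cper P F' -> (forall x, is_derive F x (F' x)) ->
  En P (fun x => F (x + y) - F x) <= y ^ 2 * En P F'.
Proof.
  intros HP HF HF' HD. rewrite (En_ext P _ (fun x => y * RI (fun z => F' (x + z * y)) 0 1)).
  - rewrite (En_scal P y (fun x => RI (fun z => F' (x + z * y)) 0 1)) by ctac. mul_l.
    replace (En P F') with ((1 - 0) ^ 2 * En P F') by ring. apply (En_RI_sup P (fun x z => F' (x + z * y))); [auto|lra|ctac|].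
    intros; rewrite En_shift; auto; lra.
  - intro x. rewrite <- RI_scal by ctac.
    rewrite (RI_ftc (fun z => F (x + z * y)) (fun z => y * F' (x + z * y)) 0 1); [|lra|ctac|].
    + rewrite Rmult_0_l, Rplus_0_r, Rmult_1_l; auto.
    + intros z _. apply (is_derive_comp F (fun z => x + z * y)); [apply HD|apply deriv_lin].
Qed.

Lemma av_adj P d u v : 0 < P -> cper P u -> cper P v ->
  RI (fun x => av d u x * v x) 0 P = RI (fun x => u x * avs d v x) 0 P.
Proof.
  intros HP Hu Hv. rewrite (RI_ext _ (fun x => / d * RI (fun y => u (x - y) * v x) 0 d)).
  2:{ intro x. rewrite (RI_ext (fun y => u (x - y) * v x) (fun y => v x * u (x - y))) by (intro; ring).
      rewrite RI_scal by ctac. unfold av; ring. } rewrite RI_scal by ctac.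
  rewrite (fubini (fun x y => u (x - y) * v x)) by (try lra; ctac).
  rewrite (RI_ext (fun x => u x * avs d v x) (fun x => / d * RI (fun y => u x * v (x + y)) 0 d)).
  2:{ intro x. rewrite RI_scal by ctac. unfold avs; ring. } rewrite RI_scal by ctac. f_equal.
  rewrite (fubini (fun x y => u x * v (x + y))) by (try lra; ctac). apply RI_ext; intro y.
  rewrite <- (per_shift P (fun x => u (x - y) * v x) y) by auto with cp. apply RI_ext; intro x. f_equal; f_equal; ring.
Qed.

(** Exhibits [qq d] as a quarter of the adjoint of [ds d] composed with [ds d], so that one
    difference can be moved to the other factor. *)
Lemma qq_adj P d u v : 0 < P -> 0 < d -> cper P u -> cper P v ->
  RI (fun x => qq d u x * v x) 0 P = / 4 * RI (fun x => ds d u x * ds d v x) 0 P.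
Proof.
  intros HP Hd Hu Hv. assert (Cu : ct u) by apply Hu.
  rewrite (RI_ext _ (fun x => / 4 * (av d (ds d u) x * v x - av d (ds d u) (x - d) * v x)))
    by (intro; rewrite qq_ds by auto; ring). rewrite RI_scal, RI_minus by ctac. f_equal.
  assert (A := av_adj P d (ds d u) v HP ltac:(auto with cp) Hv).
  assert (B : RI (fun x => av d (ds d u) (x - d) * v x) 0 P = RI (fun x => ds d u x * avs d v (x + d)) 0 P).
  { rewrite <- (per_shift P (fun x => av d (ds d u) (x - d) * v x) d) by auto with cp.
    rewrite (RI_ext _ (fun x => av d (ds d u) x * v (x + d))).
    - rewrite (av_adj P d (ds d u) (fun x => v (x + d))) by auto with cp.
      apply RI_ext; intro x. f_equal. unfold avs. f_equal. apply RI_ext; intro; f_equal; ring.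
    - intro; f_equal; f_equal; ring. } rewrite A, B, <- RI_minus by ctac. apply RI_ext; intro; unfold ds; ring.
Qed.

Lemma RI_amgm P u v : 0 < P -> ct u -> ct v ->
  Rabs (RI (fun x => u x * v x) 0 P) <= / 2 * (En P u + En P v).
Proof.
  intros HP Cu Cv. letr; [apply RI_abs; [lra|ctac]|]. unfold En. rewrite <- RI_plus, <- RI_scal by ctac.
  ri_le. intros x _. rewrite Rabs_mult. rewrite <- (pow2_abs (u x)), <- (pow2_abs (v x)).
  assert (0 <= (Rabs (u x) - Rabs (v x)) ^ 2) by pos. nra.
Qed.
End Averages.
Import Averages.

(** * Carleson embedding and the paraproduct estimate *)

Module Paraproduct.
Implicit Types F G f g u v w h : R -> R.
Implicit Types P d x y : R.

Lemma bs_S (f : nat -> R) n : bs f (S n) = f O + bs (fun k => f (S k)) n.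
Proof.
  induction n; [simpl; ring|]. change (bs f (S n) + f (S n) = f O + (bs (fun k => f (S k)) n + f (S n))). rewrite IHn; ring.
Qed.

Lemma bs_mono_n (f : nat -> R) n m : (n <= m)%nat -> (forall k, 0 <= f k) -> bs f n <= bs f m.
Proof. intros H Hf; induction H; simpl; [lra|]. specialize (Hf m); lra. Qed.

Lemma bs_sub (f : nat -> R) (k : nat -> nat) m : (forall j, 0 <= f j) ->
  (forall j, (k j < k (S j))%nat) -> bs (fun j => f (k j)) m <= bs f (k m).
Proof.
  intros Hf Hk; induction m; simpl; [apply bs_ge0; auto|]. letr_with (bs f (S (k m))); [simpl; lra|].
  apply bs_mono_n; auto. apply Hk.
Qed.

(** Scales are indexed downwards from the top scale [L]: a larger index is a finer scale. *)
Definition dl (L : R) (k : nat) : R := L / 2 ^ k.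
Lemma dl_pos L k : 0 < L -> 0 < dl L k.
Proof. intro; apply Rdiv_lt_0_compat; auto; apply pow_lt; lra. Qed.
Lemma dl_S L k : dl L k = 2 * dl L (S k).
Proof. unfold dl; simpl; field; apply pow_nonzero; lra. Qed.
Lemma dl_plus L k m : dl L (k + m) = dl L k * (/ 2) ^ m.
Proof. unfold dl. rewrite pow_add, pow_inv. field. split; apply pow_nonzero; lra. Qed.
Lemma pow_half_le1 m : (/ 2) ^ m <= 1.
Proof. rewrite <- (pow1 m). apply pow_incr; lra. Qed.
Lemma pow_half_pos m : 0 < (/ 2) ^ m.
Proof. apply pow_lt; lra. Qed.

Lemma avs_le d f g x : 0 < d -> ct f -> ct g -> (forall x, f x <= g x) -> avs d f x <= avs d g x.
Proof.
  intros Hd Cf Cg H; unfold avs. apply Rmult_le_compat_l.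
  - left; apply Rinv_0_lt_compat; auto.
  - apply RI_le; [lra|ctac|ctac|auto].
Qed.
Lemma avs_const d (k : R) x : 0 < d -> avs d (fun _ => k) x = k.
Proof. intro; unfold avs; rewrite RI_const; field; lra. Qed.
Lemma avs_plus d f g x : ct f -> ct g -> avs d (fun x => f x + g x) x = avs d f x + avs d g x.
Proof. intros; unfold avs. rewrite RI_plus by ctac. ring. Qed.
Lemma av_jensen d f x : 0 < d -> ct f -> av d f x ^ 2 <= av d (fun x => f x ^ 2) x.
Proof.
  intros Hd C; unfold av. assert (J := RI_jensen (fun y => f (x - y)) 0 d ltac:(lra) ltac:(ctac)). cbv beta in J.
  replace ((/ d * RI (fun y => f (x - y)) 0 d) ^ 2) with ((/ d) ^ 2 * RI (fun y => f (x - y)) 0 d ^ 2) by ring.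
  letr_with ((/ d) ^ 2 * ((d - 0) * RI (fun y => f (x - y) ^ 2) 0 d)).
  - mul_l; auto; apply pow2_ge_0.
  - right; field; lra.
Qed.

(** Shifting a window of length [D] by [d] changes it by two intervals of length [d], where
    [0 <= f <= 1]. *)
Lemma avs_shift_diff d D f x : 0 < d -> 0 < D -> ct f -> (forall x, 0 <= f x <= 1) ->
  avs D f (x + d) - avs D f x <= d / D.
Proof.
  intros Hd HD C Hf. rewrite !avs_RI by auto. assert (A1 := RI_chasles f x (x + D) (x + d + D) C).
  assert (A2 := RI_chasles f x (x + d) (x + d + D) C). assert (B1 : RI f (x + D) (x + d + D) <= d).
  { replace d with (RI (fun _ => 1) (x + D) (x + d + D)) at 2 by (rewrite RI_const; ring).
    apply RI_le; [lra|auto|ctac|intros; apply Hf]. }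
  assert (B2 : 0 <= RI f x (x + d)) by (apply RI_ge0; [lra|auto|intros; apply Hf]). apply Rmult_le_reg_l with D; auto.
  replace (D * (/ D * RI f (x + d) (x + d + D) - / D * RI f x (x + D))) with
    (RI f (x + d) (x + d + D) - RI f x (x + D)) by (field; lra). replace (D * (d / D)) with d by (field; lra). lra.
Qed.

Lemma avs_bound d f x : 0 < d -> ct f -> (forall x, Rabs (f x) <= 1) -> Rabs (avs d f x) <= 1.
Proof.
  intros Hd C H. apply Rabs_le. split.
  - letr_with (avs d (fun _ => -1) x); [rewrite avs_const; lra|]. apply avs_le; auto; [ctac|].
    intro z; specialize (H z); apply Rabs_le_between in H; lra.
  - letr_with (avs d (fun _ => 1) x); [|rewrite avs_const; lra]. apply avs_le; auto; [ctac|].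
    intro z; specialize (H z); apply Rabs_le_between in H; lra.
Qed.

(* [ds d h ^ 2 / 4] is a one-step variance of the averages of [h], so its local sums telescope. *)
Lemma carleson_condition L h c m x : 0 < L -> ct h -> (forall x, Rabs (h x) <= 1) ->
  avs (dl L c) (fun x => bs (fun i => / 4 * ds (dl L (c + 1 + i)) h x ^ 2) m) x <= 2.
Proof.
  intros HL C Hh. set (V := fun k x => avs (dl L k) h x ^ 2). assert (CV : forall k, ct (V k)) by (intro; unfold V; ctac).
  assert (V01 : forall k x, 0 <= V k x <= 1).
  { intros k z; unfold V; split; [pos|]. assert (B := avs_bound (dl L k) h z (dl_pos L k HL) C Hh).
    apply Rabs_le_between in B. nra. } assert (Cs : forall m, ct (fun x => bs (fun i => / 4 * ds (dl L (c + 1 + i)) h x ^ 2) m)).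
  { intro; apply (ct_bs (fun i x => / 4 * ds (dl L (c + 1 + i)) h x ^ 2)); intro; ctac. } assert (HD := dl_pos L c HL).
  (* The telescoped form. The variance identity contains [V] at [z] and at [z + d]; replacing the
     latter by the former under the average at scale [c] costs at most [2^-(m+1) / 2] at step [m],
     and these errors add up to the last term. *)
  enough (T : avs (dl L c) (fun x => bs (fun i => / 4 * ds (dl L (c + 1 + i)) h x ^ 2) m) x <=
    avs (dl L c) (V (c + m)%nat) x - avs (dl L c) (V c) x + / 2 * (1 - (/ 2) ^ m)).
  { assert (avs (dl L c) (V (c + m)%nat) x <= 1).
    { rewrite <- (avs_const (dl L c) 1 x) by auto. apply avs_le; auto; [ctac|intro; apply V01]. }
    assert (0 <= avs (dl L c) (V c) x).
    { rewrite <- (avs_const (dl L c) 0 x) by auto. apply avs_le; auto; [ctac|intro; apply V01]. }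
    assert (Hp := pow_half_pos m). lra. } induction m.
  - simpl bs. rewrite avs_const by auto. replace (c + 0)%nat with c by lia. simpl; lra.
  - simpl bs. set (d := dl L (c + 1 + m)). rewrite (avs_plus (dl L c) _ (fun x => / 4 * ds d h x ^ 2)) by (auto; ctac).
    assert (I : forall z, / 4 * ds d h z ^ 2 = 1 * (1 * V (c + S m)%nat z + (-1) * V (c + m)%nat z) +
      / 2 * (1 * V (c + S m)%nat (z + d) + (-1) * V (c + S m)%nat z)).
    { intro z. unfold V. replace (dl L (c + m)) with (2 * d).
      2:{ unfold d. rewrite (dl_S L (c + m)). f_equal; f_equal; lia. } replace (c + S m)%nat with (c + 1 + m)%nat by lia. fold d.
      rewrite avs_double by (auto; apply dl_pos; auto). unfold ds. field. } rewrite (avs_ext _ _ _ _ I).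
    rewrite (avs_lin _ (fun z => 1 * V (c + S m)%nat z + -1 * V (c + m)%nat z)
      (fun z => 1 * V (c + S m)%nat (z + d) + -1 * V (c + S m)%nat z)) by ctac.
    rewrite (avs_lin _ (V (c + S m)%nat) (V (c + m)%nat)) by ctac.
    rewrite (avs_lin _ (fun z => V (c + S m)%nat (z + d)) (V (c + S m)%nat)) by ctac.
    assert (S1 : avs (dl L c) (fun z => V (c + S m)%nat (z + d)) x = avs (dl L c) (V (c + S m)%nat) (x + d)).
    { unfold avs; f_equal; apply RI_ext; intro; f_equal; ring. } rewrite S1.
    assert (S2 := avs_shift_diff d (dl L c) (V (c + S m)%nat) x (dl_pos _ _ HL) HD (CV _) (V01 _)).
    replace (d / dl L c) with ((/ 2) ^ S m) in S2.
    2:{ unfold d. replace (c + 1 + m)%nat with (c + S m)%nat by lia. rewrite dl_plus. field; lra. } simpl pow in *. lra.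
Qed.

(** Midpoint convexity of [s^2 / (1 + t)]: the deficit is a perfect square over a positive
    denominator. *)
Lemma convex_step (a b m n : R) : 0 <= m -> 0 <= n ->
  ((a + b) / 2) ^ 2 / (1 + (m + n) / 2) <= / 2 * (a ^ 2 / (1 + m)) + / 2 * (b ^ 2 / (1 + n)).
Proof.
  intros Hm Hn. assert (K : / 2 * (a ^ 2 / (1 + m)) + / 2 * (b ^ 2 / (1 + n)) - ((a + b) / 2) ^ 2 / (1 + (m + n) / 2) =
    (a * (1 + n) - b * (1 + m)) ^ 2 / (2 * (1 + m) * (1 + n) * (2 + m + n))) by (field; lra).
  assert (0 <= (a * (1 + n) - b * (1 + m)) ^ 2 / (2 * (1 + m) * (1 + n) * (2 + m + n))).
  { apply Rmult_le_pos; [pos|]. left; apply Rinv_0_lt_compat. repeat apply Rmult_lt_0_compat; lra. } lra.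
Qed.

Lemma avs_ge0 d f x : 0 < d -> ct f -> (forall x, 0 <= f x) -> 0 <= avs d f x.
Proof. intros. rewrite <- (avs_const d 0 x) by auto. apply avs_le; auto; ctac. Qed.

(* Bellman functional of the Carleson embedding: [s^2/(1+t)] is jointly convex, so passing from scale [2 d] to [d] increases it. *)
Definition bell P d F w : R := RI (fun x => avs d F x ^ 2 / (1 + avs d w x)) 0 P.

Lemma ct_bell d F w : 0 < d -> ct F -> ct w -> (forall x, 0 <= w x) ->
  ct (fun x => avs d F x ^ 2 / (1 + avs d w x)).
Proof. intros Hd CF Cw Hw. apply ct_div; [ctac|ctac|]. intro x. assert (0 <= avs d w x) by (apply avs_ge0; auto). lra. Qed.

Lemma bell_double P d F w : 0 < P -> 0 < d -> cper P F -> cper P w -> (forall x, 0 <= w x) ->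
  bell P (2 * d) F w <= bell P d F w.
Proof.
  intros HP Hd HF Hw Hw0. assert (CF : ct F) by apply HF. assert (Cw : ct w) by apply Hw.
  assert (CB := ct_bell d F w Hd CF Cw Hw0). set (b := fun x => avs d F x ^ 2 / (1 + avs d w x)) in *. assert (Hb : cper P b).
  { split; auto. intro x; unfold b. rewrite (proj2 (cper_avs P d F HF)), (proj2 (cper_avs P d w Hw)); auto. }
  replace (bell P d F w) with (RI (fun x => / 2 * b x + / 2 * b (x + d)) 0 P).
  2:{ rewrite RI_plus, !RI_scal, (per_shift P b) by (auto; ctac). unfold bell; fold b; field. }
  unfold bell. apply RI_le; [lra|apply ct_bell; auto; lra|ctac|].
  intros x _. unfold b. rewrite !avs_double by auto. apply convex_step; apply avs_ge0; auto.
Qed.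

Lemma bell_mono P L F w c c' : 0 < P -> 0 < L -> cper P F -> cper P w -> (forall x, 0 <= w x) ->
  (c <= c')%nat -> bell P (dl L c) F w <= bell P (dl L c') F w.
Proof.
  intros HP HL HF Hw Hw0 H; induction H; [lra|]. letr; [apply IHle|]. rewrite dl_S. apply bell_double; auto. apply dl_pos; auto.
Qed.

(** Raising [t] from [m] to [m + a] lowers [u^2 / (1 + t)] by [u^2 a / ((1 + m) (1 + a + m))]; both
    denominators are at most 3 because the averaged weight is at most 2, whence [1 / 9]. *)
Lemma bell_add P d F w v : 0 < P -> 0 < d -> cper P F -> cper P w -> cper P v ->
  (forall x, 0 <= w x) -> (forall x, 0 <= v x) -> (forall x, avs d (fun x => v x + w x) x <= 2) ->
  bell P d F (fun x => v x + w x) + / 9 * RI (fun x => avs d F x ^ 2 * avs d v x) 0 P <= bell P d F w.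
Proof.
  intros HP Hd HF Hw Hv Hw0 Hv0 H2.
  assert (CF : ct F) by apply HF. assert (Cw : ct w) by apply Hw. assert (Cv : ct v) by apply Hv.
  assert (Hvw : forall x, 0 <= v x + w x) by (intro; specialize (Hw0 x); specialize (Hv0 x); lra).
  unfold bell. rewrite <- RI_scal, <- RI_plus.
  2:{ apply (ct_bell d F (fun x => v x + w x)); auto; ctac. } 2,3: ctac. apply RI_le; [lra| | |].
  - apply ct_plus; [apply (ct_bell d F (fun x => v x + w x)); auto; ctac | ctac].
  - apply ct_bell; auto.
  - intros x _. specialize (H2 x). rewrite avs_plus in * by auto.
    assert (0 <= avs d w x) by (apply avs_ge0; auto). assert (0 <= avs d v x) by (apply avs_ge0; auto).
    set (a := avs d v x) in *. set (m := avs d w x) in *. set (u := avs d F x).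
    assert (K : u ^ 2 / (1 + m) - u ^ 2 / (1 + (a + m)) = u ^ 2 * a * / ((1 + m) * (1 + a + m))) by (field; lra).
    assert (/ 9 <= / ((1 + m) * (1 + a + m))) by (apply Rinv_le_contravar; nra). assert (0 <= u ^ 2 * a) by pos. nra.
Qed.

(** Induction splits off the coarsest weight [v 0]. Adding it to the tail at scale [c 0] pays for
    its term ([bell_add]), and the functional of the tail only grows when passing to the finer scale
    [c 1]. The hypothesis on all tails keeps the averaged weights at most 2, as [bell_add]
    demands. *)
Lemma carleson_embedding P L F m : 0 < P -> 0 < L -> cper P F -> forall (c : nat -> nat) (v : nat -> R -> R),
  (forall l, (c l <= c (S l))%nat) -> (forall l, cper P (v l)) -> (forall l x, 0 <= v l x) ->
  (forall j x, (j < m)%nat -> avs (dl L (c j)) (fun x => bs (fun i => v (j + i)%nat x) (m - j)) x <= 2) ->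
  bs (fun j => / 9 * RI (fun x => avs (dl L (c j)) F x ^ 2 * avs (dl L (c j)) (v j) x) 0 P) m
  + bell P (dl L (c O)) F (fun x => bs (fun i => v i x) m) <= En P F.
Proof.
  intros HP HL HF. induction m; intros c v Hc Hv Hv0 H2.
  - simpl. rewrite Rplus_0_l. letr_with (En P (avs (dl L (c O)) F)).
    + right; unfold bell. apply RI_ext; intro x. rewrite avs_const by (apply dl_pos; auto). field.
    + apply En_avs; auto. apply dl_pos; auto.
  - rewrite bs_S. assert (IH := IHm (fun l => c (S l)) (fun l => v (S l)) ltac:(intro; apply Hc) ltac:(intro; apply Hv)
      ltac:(intros; apply Hv0)). cbv beta in IH.
    assert (Hcp : cper P (fun x => bs (fun i => v (S i) x) m)) by (apply cper_bs; intro; apply Hv).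
    assert (Hge : forall x, 0 <= bs (fun i => v (S i) x) m) by (intro; apply bs_ge0; auto).
    assert (B1 := bell_mono P L F _ (c O) (c 1%nat) HP HL HF Hcp Hge (Hc O)).
    assert (B2 := bell_add P (dl L (c O)) F _ (v O) HP (dl_pos L _ HL) HF Hcp (Hv O) Hge (Hv0 O)).
    lapply IH; [clear IH; intro IH|].
    2:{ intros j x Hj. specialize (H2 (S j) x ltac:(lia)). replace (S m - S j)%nat with (m - j)%nat in H2 by lia. exact H2. }
    lapply B2; [clear B2; intro B2|].
    2:{ intro x. specialize (H2 O x ltac:(lia)). simpl Nat.sub in H2. simpl Nat.add in H2.
        rewrite (avs_ext (dl L (c O)) (fun x => v O x + bs (fun i => v (S i) x) m)
          (fun x => bs (fun i => v i x) (S m)) x); [exact H2|]. intro z; rewrite bs_S; auto. } rewrite Rplus_assoc.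
    replace (bell P (dl L (c O)) F (fun x => bs (fun i => v i x) (S m))) with
      (bell P (dl L (c O)) F (fun x => v O x + bs (fun i => v (S i) x) m)).
    + lra.
    + unfold bell; apply RI_ext; intro x. f_equal; f_equal. apply avs_ext; intro z; rewrite (bs_S (fun i => v i z)); auto.
Qed.

Lemma bell_ge0 P d F w : 0 < P -> 0 < d -> ct F -> ct w -> (forall x, 0 <= w x) -> 0 <= bell P d F w.
Proof.
  intros; apply RI_ge0; [lra|apply ct_bell; auto|]. intros x _. apply Rmult_le_pos; [pos|]. left; apply Rinv_0_lt_compat.
  assert (0 <= avs d w x) by (apply avs_ge0; auto). lra.
Qed.

(** Commutator of [ds d] with multiplication by a slowly varying [u]: only increments of [u] over
    distances up to [d] and up to [2 d] enter, and [2 (1 + 4) = 10]. *)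
Lemma ds_mult_comm P d u u' h : 0 < P -> 0 < d -> cper P u -> cper P u' -> cper P h ->
  (forall x, is_derive u x (u' x)) -> (forall x, Rabs (h x) <= 1) ->
  En P (fun x => ds d (fun x => u x * h x) x - u x * ds d h x) <= 10 * d ^ 2 * En P u'.
Proof.
  intros HP Hd Hu Hu' Hh HD H1. assert (Cu' : ct u') by apply Hu'.
  assert (B : forall e, 0 <= e -> En P (fun x => / d * RI (fun y => (u (x + (e + y)) - u x) * h (x + (e + y))) 0 d)
     <= (e + d) ^ 2 * En P u').
  { intros e He. rewrite (En_scal P (/ d) (fun x => RI (fun y => (u (x + (e + y)) - u x) * h (x + (e + y))) 0 d)) by ctac.
    letr_with ((/ d) ^ 2 * ((d - 0) ^ 2 * ((e + d) ^ 2 * En P u'))).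
    2:{ right; field; lra. } mul_l. apply (En_RI_sup P (fun x y => (u (x + (e + y)) - u x) * h (x + (e + y)))); [auto|lra|ctac|].
    intros y Hy. letr_with (En P (fun x => u (x + (e + y)) - u x)).
    - apply En_le; [auto|ctac|ctac|]. intro x. rewrite Rabs_mult.
      rewrite <- (Rmult_1_r (Rabs (u (x + (e + y)) - u x))) at 2. apply Rmult_le_compat_l; auto. apply Rabs_pos.
    - letr; [apply (En_diff P u u'); auto|]. apply Rmult_le_compat_r; [apply En_ge0; auto|]. apply pow_incr; lra. }
  assert (B0 := B 0 (Rle_refl 0)). assert (B1 := B d (Rlt_le _ _ Hd)).
  rewrite (En_ext P _ (fun x => / d * RI (fun y => (u (x + (0 + y)) - u x) * h (x + (0 + y))) 0 d -
    / d * RI (fun y => (u (x + (d + y)) - u x) * h (x + (d + y))) 0 d)).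
  - letr; [apply En_minus2; [auto|ctac|ctac]|]. nra.
  - intro x. unfold ds, avs. rewrite (RI_ext (fun y => (u (x + (0 + y)) - u x) * h (x + (0 + y)))
      (fun y => u (x + y) * h (x + y) - u x * h (x + y))) by (intro y; rewrite Rplus_0_l; ring).
    rewrite (RI_ext (fun y => (u (x + (d + y)) - u x) * h (x + (d + y)))
      (fun y => u (x + d + y) * h (x + d + y) - u x * h (x + d + y))) by (intro y; rewrite <- Rplus_assoc; ring).
    rewrite !RI_minus by ctac. rewrite (RI_scal (fun y => h (x + y))), (RI_scal (fun y => h (x + d + y))) by ctac. ring.
Qed.

Lemma strict_ge (k : nat -> nat) a i : (forall l, (k l < k (S l))%nat) -> (k a + i <= k (a + i))%nat.
Proof.
  intro H; induction i; [rewrite !Nat.add_0_r; auto|].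
  replace (a + S i)%nat with (S (a + i)) by lia. specialize (H (a + i)%nat). lia.
Qed.

(** Jensen bounds [(pp F)^2] by [av] of [(avs F)^2]; moved to the other factor, [av] becomes [avs]
    acting on the weight, which is the shape of the embedding. The constant is [4 * 9], from the
    [/ 4] in the weight and the [/ 9] in the embedding. *)
Lemma paraproduct_carleson P L F h (c k : nat -> nat) n : 0 < P -> 0 < L -> cper P F -> cper P h ->
  (forall x, Rabs (h x) <= 1) -> (forall l, (c l < c (S l))%nat) -> (forall l, (k l < k (S l))%nat) ->
  (forall l, (l < n)%nat -> (c l < k l)%nat) ->
  bs (fun l => En P (fun x => pp (dl L (c l)) F x * ds (dl L (k l)) h x)) n <= 36 * En P F.
Proof.
  intros HP HL HF Hh H1 Hc Hk Hck. assert (CF : ct F) by apply HF. assert (Ch : ct h) by apply Hh.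
  set (v := fun l x => / 4 * ds (dl L (k l)) h x ^ 2). assert (Hv : forall l, cper P (v l)) by (intro; unfold v; auto with cp).
  assert (Hv0 : forall l x, 0 <= v l x).
  { intros; unfold v. apply Rmult_le_pos; [lra|pos]. }
  assert (E := carleson_embedding P L F n HP HL HF c v ltac:(intro; apply Nat.lt_le_incl; auto) Hv Hv0).
  lapply E; [clear E; intro E|].
  (* The scales [k l] with [l >= j] are a subsequence of all scales finer than [c j], so the full
     sum in [carleson_condition] dominates. *)
  2:{ intros j x Hj. set (m := (k (j + (n - j)) - (c j + 1))%nat). letr; [|apply (carleson_condition L h (c j) m x); auto].
      apply avs_le; [apply dl_pos; auto| | |].
      - apply (ct_bs (fun i x => v (j + i)%nat x)); intro; apply (proj1 (Hv _)).
      - apply (ct_bs (fun i x => / 4 * ds (dl L (c j + 1 + i)) h x ^ 2)); intro; ctac.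
      - intro z. assert (Sb := bs_sub (fun i => / 4 * ds (dl L (c j + 1 + i)) h z ^ 2)
           (fun i => (k (j + i) - (c j + 1))%nat) (n - j)). cbv beta in Sb. fold m in Sb. letr; [right|apply Sb].
        + apply bs_ext; intros i _. unfold v.
          assert (Hki := strict_ge k j i Hk). specialize (Hck j Hj). do 4 f_equal. f_equal. lia.
        + intro; apply Rmult_le_pos; [lra|pos].
        + intro i. assert (Hki := strict_ge k j i Hk). specialize (Hck j Hj).
          replace (j + S i)%nat with (S (j + i)) by lia. specialize (Hk (j + i)%nat). lia. }
  assert (B : 0 <= bell P (dl L (c O)) F (fun x => bs (fun i => v i x) n)).
  { apply bell_ge0; auto; [apply dl_pos; auto| |intro; apply bs_ge0; auto]. apply (ct_bs v); intro; apply (proj1 (Hv _)). }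
  letr_with (36 * bs (fun j => / 9 * RI (fun x => avs (dl L (c j)) F x ^ 2 * avs (dl L (c j)) (v j) x) 0 P) n); [|lra].
  rewrite <- bs_scal. apply bs_le; intros l _.
  letr_with (4 * RI (fun x => av (dl L (c l)) (fun x => avs (dl L (c l)) F x ^ 2) x * v l x) 0 P).
  - unfold En. rewrite <- RI_scal by ctac. ri_le.
    intros x _. assert (J := av_jensen (dl L (c l)) (avs (dl L (c l)) F) x (dl_pos L _ HL) ltac:(ctac)).
    cbv beta in J. unfold pp, v. nra.
  - right. rewrite av_adj by auto with cp. field.
Qed.

(** By [qq_adj] the difference also falls on [pp F * h]. A discrete product rule leaves
    [pp F * ds h], a Carleson sum, and a commutator in which the derivative of [pp F] meets the
    ratio of scales [(dl L (k l) / dl L (c l))^2 <= 1 / 4]. *)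
Lemma paraproduct P L F G h (c k : nat -> nat) n : 0 < P -> 0 < L -> cper P F -> cper P G -> cper P h ->
  (forall x, Rabs (h x) <= 1) -> (forall l, (c l < c (S l))%nat) -> (forall l, (k l < k (S l))%nat) ->
  (forall l, (l < n)%nat -> (c l < k l)%nat) ->
  Rabs (bs (fun l => RI (fun x => qq (dl L (k l)) G x * (pp (dl L (c l)) F x * h x)) 0 P) n)
  <= 12 * (En P F + En P G).
Proof.
  intros HP HL HF HG Hh H1 Hc Hk Hck.
  assert (CF : ct F) by apply HF. assert (Ch : ct h) by apply Hh. assert (CG : ct G) by apply HG. letr; [apply bs_abs|].
  letr_with (bs (fun l => / 8 * En P (ds (dl L (k l)) G) +
     (/ 4 * En P (fun x => pp (dl L (c l)) F x * ds (dl L (k l)) h x) + / 4 * 3 * En P (ds (dl L (c l)) F))) n).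
  - apply bs_le; intros l Hl.
    rewrite (qq_adj P (dl L (k l)) G (fun x => pp (dl L (c l)) F x * h x)) by (auto with cp; apply dl_pos; auto).
    rewrite Rabs_mult, (Rabs_right (/ 4)) by lra.
    assert (A := RI_amgm P (ds (dl L (k l)) G) (ds (dl L (k l)) (fun x => pp (dl L (c l)) F x * h x)) HP
      ltac:(ctac) (ct_ds _ _ (ct_mult _ _ (ct_pp _ _ CF) Ch))).
    assert (Hc0 := dl_pos L (c l) HL). assert (Hk0 := dl_pos L (k l) HL).
    assert (B := ds_mult_comm P (dl L (k l)) (pp (dl L (c l)) F) (pp' (dl L (c l)) F) h HP Hk0
      ltac:(auto with cp) ltac:(auto with cp) Hh ltac:(intro; apply pp_deriv; auto) H1). rewrite En_pp' in B by auto.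
    assert (D : En P (ds (dl L (k l)) (fun x => pp (dl L (c l)) F x * h x)) <=
      2 * En P (fun x => pp (dl L (c l)) F x * ds (dl L (k l)) h x) +
      2 * En P (fun x => ds (dl L (k l)) (fun x => pp (dl L (c l)) F x * h x) x - pp (dl L (c l)) F x * ds (dl L (k l)) h x)).
    { letr; [|apply En_plus2; [auto|ctac|ctac]]. right; apply En_ext; intro; ring. }
    assert (Q : dl L (k l) ^ 2 * / dl L (c l) ^ 2 <= / 4).
    { replace (k l) with (c l + 1 + (k l - (c l + 1)))%nat by (specialize (Hck l Hl); lia). rewrite dl_plus, dl_plus.
      assert (A1 := pow_half_le1 (k l - (c l + 1))). assert (A2 := pow_half_pos (k l - (c l + 1))).
      set (z := (/ 2) ^ (k l - (c l + 1))) in *.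
      replace ((dl L (c l) * (/ 2) ^ 1 * z) ^ 2 * / dl L (c l) ^ 2) with (/ 4 * z ^ 2) by (field; lra). nra. }
    assert (0 <= En P (ds (dl L (c l)) F)) by (apply En_ge0; auto; ctac).
    assert (10 * dl L (k l) ^ 2 * (/ dl L (c l) ^ 2 * En P (ds (dl L (c l)) F)) <= 10 * / 4 * En P (ds (dl L (c l)) F)) by nra.
    lra.
  - rewrite !bs_plus, !bs_scal. assert (A1 := paraproduct_carleson P L F h c k n HP HL HF Hh H1 Hc Hk Hck).
    assert (A2 : bs (fun l => En P (ds (dl L (k l)) G)) n <= 4 * En P G).
    { letr; [apply (bs_sub (fun l => En P (ds (dl L l) G))); auto; intro; apply En_ge0; auto; ctac|]. apply ds_sum; auto. }
    assert (A3 : bs (fun l => En P (ds (dl L (c l)) F)) n <= 4 * En P F).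
    { letr; [apply (bs_sub (fun l => En P (ds (dl L l) F))); auto; intro; apply En_ge0; auto; ctac|]. apply ds_sum; auto. }
     assert (0 <= En P G) by (apply En_ge0; auto). lra.
Qed.
End Paraproduct.
Import Paraproduct.

(** * Integrals over one dyadic block of shifts *)

Module Shifts.
Implicit Types F G f g u w h : R -> R.
Implicit Types P d x y : R.

(** Truncated subtraction makes one summand vanish, so this is [|a - k|]. *)
Definition adist (a k : nat) : nat := ((a - k) + (k - a))%nat.
Lemma adist_sym a k : adist a k = adist k a.
Proof. unfold adist; lia. Qed.

Lemma bs_geom r a N : 0 <= r < 1 -> bs (fun k => r ^ adist a k) N <= 2 / (1 - r).
Proof.
  intros Hr. assert (C1 : forall N, (N <= a)%nat -> bs (fun k => r ^ adist a k) N <= r ^ (a - N) * (r / (1 - r))).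
  { intros M; induction M; intros HM; simpl.
    - apply Rmult_le_pos; [pos|]. apply Rdiv_le_0_compat; lra.
    - specialize (IHM ltac:(lia)). replace (adist a M) with (S (a - S M)) by (unfold adist; lia).
      replace (a - M)%nat with (S (a - S M)) in IHM by lia. simpl in *.
      replace (r ^ (a - S M) * (r / (1 - r))) with (r * r ^ (a - S M) * (r / (1 - r)) + r * r ^ (a - S M)) by (field; lra). lra. }
  assert (C2 : forall m, bs (fun k => r ^ adist a k) (a + m) <= r / (1 - r) + (1 - r ^ m) / (1 - r)).
  { induction m.
    - rewrite Nat.add_0_r. specialize (C1 a (le_n a)). rewrite Nat.sub_diag in C1. simpl in *. lra.
    - rewrite Nat.add_succ_r. simpl. replace (adist a (a + m)) with m by (unfold adist; lia).
      replace ((1 - r * r ^ m) / (1 - r)) with ((1 - r ^ m) / (1 - r) + r ^ m) by (field; lra). lra. }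
  letr_with (bs (fun k => r ^ adist a k) (a + N)).
  - apply bs_mono_n; [lia|]. intro; apply pow_le; lra.
  - letr; [apply C2|]. assert (0 <= r ^ N) by pos. apply Rmult_le_reg_r with (1 - r); [lra|]. field_simplify; lra.
Qed.

Lemma bs_geom_sub r k (a : nat -> nat) n : 0 <= r < 1 -> (forall l, (a l < a (S l))%nat) ->
  bs (fun l => r ^ adist (a l) k) n <= 2 / (1 - r).
Proof.
  intros Hr Ha. letr; [|apply (bs_geom r k (a n)); auto].
  rewrite (bs_ext _ (fun l => (fun i => r ^ adist k i) (a l))) by (intros; rewrite adist_sym; auto).
  apply (bs_sub (fun i => r ^ adist k i)); auto. intro; apply pow_le; lra.
Qed.

Lemma bs_cs (u w : nat -> R) n : (forall k, 0 < w k) ->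
  bs u n ^ 2 <= bs w n * bs (fun k => u k ^ 2 / w k) n.
Proof.
  intro Hw. induction n; [simpl; lra|]. destruct n.
  - simpl. right; field. specialize (Hw O); lra.
  - change ((bs u (S n) + u (S n)) ^ 2 <= (bs w (S n) + w (S n)) * (bs (fun k => u k ^ 2 / w k) (S n) + u (S n) ^ 2 / w (S n))).
    assert (W : 0 < bs w (S n)).
    { simpl. assert (0 <= bs w n) by (apply bs_ge0; intros; left; auto). specialize (Hw n); lra. }
    set (A := bs u (S n)) in *. set (B := bs w (S n)) in *. set (C := bs (fun k => u k ^ 2 / w k) (S n)) in *.
    specialize (Hw (S n)). set (a := u (S n)). set (b := w (S n)) in *. assert (A ^ 2 / B <= C).
    { apply Rmult_le_reg_r with B; auto. replace (A ^ 2 / B * B) with (A ^ 2) by (field; lra). lra. }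
    letr_with ((B + b) * (A ^ 2 / B + a ^ 2 / b)).
    + assert ((B + b) * (A ^ 2 / B + a ^ 2 / b) - (A + a) ^ 2 = (A * b - a * B) ^ 2 / (B * b)) by (field; lra).
      assert (0 <= (A * b - a * B) ^ 2 / (B * b)).
      { apply Rmult_le_pos; [pos|]. left; apply Rinv_0_lt_compat, Rmult_lt_0_compat; auto. } lra.
    + mul_l; lra.
Qed.

Lemma En_bs P (u : nat -> R -> R) (w : nat -> R) n : 0 < P -> (forall k, ct (u k)) -> (forall k, 0 < w k) ->
  En P (fun x => bs (fun k => u k x) n) <= bs w n * bs (fun k => En P (u k) / w k) n.
Proof.
  intros HP Cu Hw. unfold En.
  rewrite (bs_ext (fun k => RI (fun x => u k x ^ 2) 0 P / w k) (fun k => RI (fun x => u k x ^ 2 / w k) 0 P)).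
  - rewrite <- (RI_bs (fun k x => u k x ^ 2 / w k)), <- RI_scal.
    2:{ apply (ct_bs (fun k x => u k x ^ 2 / w k)); intro k; assert (K := Cu k); ctac. }
    2:{ intro k; assert (K := Cu k); ctac. } apply RI_le; [lra| | |].
    + apply (ct_pow (fun x => bs (fun k => u k x) n)), (ct_bs u); auto.
    + apply ct_mult; [ctac|]. apply (ct_bs (fun k x => u k x ^ 2 / w k)); intro k; assert (K := Cu k); ctac.
    + intros x _. apply (bs_cs (fun k => u k x)); auto.
  - intros k _. unfold Rdiv. rewrite (Rmult_comm (RI _ _ _)), <- RI_scal by ctac. apply RI_ext; intro; ring.
Qed.

Definition mexp (mu al v : R) : R := mu * exp (al * v).
Lemma ct_mexp mu al : ct (mexp mu al).
Proof. unfold mexp; ctac. Qed.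
#[export] Hint Resolve ct_mexp : ctdb.

(** One block of a truncated Hilbert transform: for [m = mexp mu al] and [t = m v], the measure [dv]
    is [dt / (al t)], and the two signs of [t] give the difference. *)
Definition sm (m : R -> R) (V : R) u x : R := RI (fun v => u (x - m v) - u (x + m v)) 0 V.

Lemma ct_sm m V u : ct m -> ct u -> ct (sm m V u).
Proof. intros; unfold sm; ctac. Qed.
#[export] Hint Resolve ct_sm : ctdb.
Lemma cper_sm P m V u : ct m -> cper P u -> cper P (sm m V u).
Proof.
  intros Cm [A B]; split; [ctac|]. intro x; unfold sm; apply RI_ext; intro y.
  rewrite <- (B (x - m y)), <- (B (x + m y)); f_equal; f_equal; ring.
Qed.
#[export] Hint Resolve cper_sm ct_mexp : cp.

Lemma sm_ext m V u w x : (forall x, u x = w x) -> sm m V u x = sm m V w x.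
Proof. intro H; unfold sm; apply RI_ext; intro; rewrite !H; auto. Qed.
Lemma sm_bs m V (u : nat -> R -> R) n x : ct m -> (forall k, ct (u k)) ->
  sm m V (fun x => bs (fun k => u k x) n) x = bs (fun k => sm m V (u k) x) n.
Proof.
  intros Cm Cu. unfold sm. rewrite <- (RI_bs (fun k v => u k (x - m v) - u k (x + m v))).
  - apply RI_ext; intro v; rewrite bs_minus; auto.
  - intro k; assert (K := Cu k); ctac.
Qed.

Lemma sm_deriv m V u u' (x : R) : ct m -> ct u -> ct u' -> (forall x, is_derive u x (u' x)) ->
  is_derive (sm m V u) x (sm m V u' x).
Proof.
  intros Cm Cu Cu' D. unfold sm. apply (RI_deriv (fun x v => u (x - m v) - u (x + m v)) (fun x v => u' (x - m v) - u' (x + m v)));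
    [ctac|ctac|]. intros z v. apply (is_derive_minus (fun z => u (z - m v)) (fun z => u (z + m v))).
  - replace (u' (z - m v)) with (1 * u' (z - m v)) by ring.
    apply (is_derive_comp u (fun z => z - m v)); [apply D|]. auto_derive; auto.
  - replace (u' (z + m v)) with (1 * u' (z + m v)) by ring.
    apply (is_derive_comp u (fun z => z + m v)); [apply D|]. auto_derive; auto.
Qed.

Lemma sm_comm m m' V V' u x : 0 <= V -> 0 <= V' -> ct m -> ct m' -> ct u ->
  sm m V (sm m' V' u) x = sm m' V' (sm m V u) x.
Proof.
  intros HV HV' Cm Cm' Cu. unfold sm. rewrite (RI_ext _ (fun v => RI (fun v' => u (x - m v - m' v') - u (x - m v + m' v') -
     (u (x + m v - m' v') - u (x + m v + m' v'))) 0 V')).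
  2:{ intro v. rewrite <- RI_minus by ctac. auto. } rewrite (fubini (fun v v' => u (x - m v - m' v') - u (x - m v + m' v') -
     (u (x + m v - m' v') - u (x + m v + m' v')))) by (try lra; ctac).
  apply RI_ext; intro v'. rewrite <- RI_minus by ctac. apply RI_ext; intro v.
  replace (x - m' v' - m v) with (x - m v - m' v') by ring. replace (x - m' v' + m v) with (x + m v - m' v') by ring.
  replace (x + m' v' - m v) with (x - m v + m' v') by ring. replace (x + m' v' + m v) with (x + m v + m' v') by ring. ring.
Qed.

Lemma sm_av m V d u x : 0 <= V -> ct m -> ct u -> av d (sm m V u) x = sm m V (av d u) x.
Proof.
  intros HV Cm Cu. unfold av, sm. rewrite <- (fubini (fun v y => u (x - y - m v) - u (x - y + m v))) by (auto; ctac).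
  rewrite <- RI_scal by ctac. apply RI_ext; intro v. rewrite RI_minus by ctac.
  rewrite (RI_ext (fun y => u (x - m v - y)) (fun y => u (x - y - m v))) by (intro; f_equal; ring).
  rewrite (RI_ext (fun y => u (x + m v - y)) (fun y => u (x - y + m v))) by (intro; f_equal; ring). ring.
Qed.
Lemma sm_avs m V d u x : 0 <= V -> ct m -> ct u -> avs d (sm m V u) x = sm m V (avs d u) x.
Proof.
  intros HV Cm Cu. unfold avs, sm. rewrite <- (fubini (fun v y => u (x + y - m v) - u (x + y + m v))) by (auto; ctac).
  rewrite <- RI_scal by ctac. apply RI_ext; intro v. rewrite RI_minus by ctac.
  rewrite (RI_ext (fun y => u (x - m v + y)) (fun y => u (x + y - m v))) by (intro; f_equal; ring).
  rewrite (RI_ext (fun y => u (x + m v + y)) (fun y => u (x + y + m v))) by (intro; f_equal; ring). ring.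
Qed.
Lemma sm_pp m V d u x : 0 <= V -> ct m -> ct u -> pp d (sm m V u) x = sm m V (pp d u) x.
Proof.
  intros HV Cm Cu. unfold pp. rewrite (av_ext d _ (sm m V (avs d u))) by (intro; apply sm_avs; auto). apply sm_av; auto; ctac.
Qed.

Lemma sm_adj P m V u w : 0 < P -> 0 <= V -> ct m -> cper P u -> cper P w ->
  RI (fun x => sm m V u x * w x) 0 P = - RI (fun x => u x * sm m V w x) 0 P.
Proof.
  intros HP HV Cm Hu Hw. unfold sm. rewrite <- RI_opp by ctac.
  rewrite (RI_ext _ (fun x => RI (fun v => w x * (u (x - m v) - u (x + m v))) 0 V)).
  2:{ intro x. rewrite RI_scal by ctac. ring. }
  rewrite (fubini (fun x v => w x * (u (x - m v) - u (x + m v)))) by (try lra; ctac).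
  rewrite (RI_ext (fun x => - _) (fun x => RI (fun v => u x * (w (x + m v) - w (x - m v))) 0 V)).
  2:{ intro x. rewrite RI_scal, !RI_minus by ctac. ring. }
  rewrite (fubini (fun x v => u x * (w (x + m v) - w (x - m v)))) by (try lra; ctac). apply RI_ext; intro v.
  rewrite (RI_ext (fun x => w x * (u (x - m v) - u (x + m v))) (fun x => w x * u (x - m v) - w x * u (x + m v))) by (intro; ring).
  rewrite (RI_ext (fun x => u x * (w (x + m v) - w (x - m v))) (fun x => u x * w (x + m v) - u x * w (x - m v))) by (intro; ring).
  rewrite !RI_minus by ctac. f_equal.
  - rewrite <- (per_shift P (fun x => w x * u (x - m v)) (m v)) by auto with cp.
    apply RI_ext; intro x. replace (x + m v - m v) with x by ring; ring.
  - rewrite <- (per_shift P (fun x => w x * u (x + m v)) (- m v)) by auto with cp.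
    apply RI_ext; intro x. replace (x + - m v + m v) with x by ring. replace (x + - m v) with (x - m v) by ring; ring.
Qed.

Lemma sq_mul_le (V M : R) : 0 <= V <= 1 -> 0 <= M -> (V - 0) ^ 2 * M <= M.
Proof. intros HV HM. rewrite <- (Rmult_1_l M) at 2. mul_r; auto. nra. Qed.

Lemma sm_bd P m V u : 0 < P -> 0 <= V <= 1 -> ct m -> cper P u -> En P (sm m V u) <= 4 * En P u.
Proof.
  intros HP HV Cm Hu. assert (Cu : ct u) by apply Hu. unfold sm. assert (0 <= En P u) by (apply En_ge0; auto).
  letr; [apply (En_RI_sup P (fun x v => u (x - m v) - u (x + m v)) 0 V (4 * En P u)); try lra; [ctac|]|].
  - intros s _. letr; [apply En_minus2; [auto|ctac|ctac]|]. rewrite En_shift, En_shiftm by auto. lra.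
  - apply sq_mul_le; lra.
Qed.

(** For slowly varying data the two signs of the shift nearly cancel: the arguments differ by
    [2 m v]. *)
Lemma sm_low P m V u u' M : 0 < P -> 0 <= V <= 1 -> ct m -> cper P u -> cper P u' ->
  (forall x, is_derive u x (u' x)) -> (forall v, 0 <= v <= V -> Rabs (m v) <= M) ->
  En P (sm m V u) <= 4 * M ^ 2 * En P u'.
Proof.
  intros HP HV Cm Hu Hu' D HM. assert (Cu' : ct u') by apply Hu'. unfold sm. assert (0 <= En P u') by (apply En_ge0; auto).
  letr; [apply (En_RI_sup P (fun x v => u (x - m v) - u (x + m v)) 0 V (4 * M ^ 2 * En P u')); try lra; [ctac|]|].
  - intros s Hs. replace (En P (fun x => u (x - m s) - u (x + m s))) with (En P (fun x => u (x + - (2 * m s)) - u x)).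
    2:{ rewrite <- (En_shift P (fun x => u (x + - (2 * m s)) - u x) (m s)) by (auto; apply cper_minus; auto with cp).
        apply En_ext; intro. f_equal; f_equal; ring. } letr; [apply (En_diff P u u'); auto|]. mul_r; auto. specialize (HM s Hs).
    replace ((- (2 * m s)) ^ 2) with (4 * Rabs (m s) ^ 2) by (rewrite pow2_abs; ring).
    assert (0 <= Rabs (m s)) by pos. mul_l. apply pow_incr; lra.
  - apply sq_mul_le; auto. apply Rmult_le_pos; auto. apply Rmult_le_pos; [lra|pos].
Qed.

(* Integration by parts in [v], using that [W'(x - s mu e^(al v))] is, up to a factor, a [v]-derivative. *)
Lemma shift_parts W W' (mu al s V x : R) (c c' : R -> R) : 0 < mu -> 0 < al -> s ^ 2 = 1 -> 0 <= V -> ct W -> ct W' ->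
  ct c -> ct c' ->
  (forall x, is_derive W x (W' x)) -> (forall v, 0 <= v <= V -> is_derive c v (c' v)) ->
  RI (fun v => c v * W' (x - s * mexp mu al v)) 0 V =
  - (s / (al * mu)) * (c V * exp (- al * V) * W (x - s * mexp mu al V) - c 0 * W (x - s * mexp mu al 0)
    - RI (fun v => (c' v - al * c v) * exp (- al * v) * W (x - s * mexp mu al v)) 0 V).
Proof.
  intros Hmu Hal Hs HV CW CW' Cc Cc' D Dc. assert (Dm : forall v, is_derive (fun v => W (x - s * mexp mu al v)) v
     (- (s * al * mu) * exp (al * v) * W' (x - s * mexp mu al v))).
  { intro v. apply (is_derive_comp W (fun v => x - s * mexp mu al v)); [apply D|]. unfold mexp. auto_derive; auto. ring. }
  assert (De : forall v, 0 <= v <= V -> is_derive (fun v => c v * exp (- al * v)) v ((c' v - al * c v) * exp (- al * v))).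
  { intros v Hv.
    replace ((c' v - al * c v) * exp (- al * v)) with (c' v * exp (- al * v) + c v * (- al * exp (- al * v))) by ring.
    apply (is_derive_mult c (fun v => exp (- al * v)) v); auto.
    - auto_derive; auto; ring.
    - intros; apply Rmult_comm. } assert (Q := RI_parts (fun v => c v * exp (- al * v)) (fun v => W (x - s * mexp mu al v))
    (fun v => (c' v - al * c v) * exp (- al * v)) (fun v => - (s * al * mu) * exp (al * v) * W' (x - s * mexp mu al v)) 0 V HV
    ltac:(ctac) ltac:(ctac) ltac:(ctac) ltac:(ctac) De (fun v _ => Dm v)). cbv beta in Q.
  rewrite (RI_ext _ (fun v => - (s * al * mu) * (c v * W' (x - s * mexp mu al v)))) in Q.
  2:{ intro v. assert (exp (- al * v) * exp (al * v) = 1).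
      { rewrite <- exp_plus. replace (- al * v + al * v) with 0 by ring. apply exp_0. }
      replace (c v * exp (- al * v) * (- (s * al * mu) * exp (al * v) * W' (x - s * mexp mu al v)))
        with (- (s * al * mu) * (c v * W' (x - s * mexp mu al v)) * (exp (- al * v) * exp (al * v))) by ring. rewrite H; ring. }
  rewrite RI_scal in Q by ctac. replace (exp (- al * 0)) with 1 in Q by (rewrite Rmult_0_r, exp_0; auto).
  set (X := RI (fun v => c v * W' (x - s * mexp mu al v)) 0 V) in *.
  set (Y := RI (fun v => (c' v - al * c v) * exp (- al * v) * W (x - s * mexp mu al v)) 0 V) in *.
  replace X with (- (s / (al * mu)) * (- (s * al * mu) * X)).
  - rewrite Q. ring.
  - replace (- (s / (al * mu)) * (- (s * al * mu) * X)) with (s ^ 2 * X) by (field; lra). rewrite Hs; ring.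
Qed.

Lemma exp_neg_le1 a v : 0 <= a -> 0 <= v -> 0 < exp (- a * v) <= 1.
Proof.
  intros Ha Hv. split; [pos|]. rewrite <- exp_0. destruct (Req_dec (- a * v) 0) as [->|]; [lra|]. left; apply exp_increasing. nra.
Qed.

(** For oscillating data the gain comes from a small primitive, via [shift_parts] with constant
    coefficient. The three resulting terms give the factor 9 for each sign, and the two signs give
    36. *)
Lemma sm_parts P mu al V W W' : 0 < P -> 0 < mu -> 1 <= al -> 0 <= V <= 1 -> cper P W -> cper P W' ->
  (forall x, is_derive W x (W' x)) -> En P (sm (mexp mu al) V W') <= 36 * / mu ^ 2 * En P W.
Proof.
  intros HP Hmu Hal HV HW HW' D. assert (CW : ct W) by apply HW. assert (HE : 0 <= En P W) by (apply En_ge0; auto).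
  assert (One : forall s, s ^ 2 = 1 -> En P (fun x => RI (fun v => W' (x - s * mexp mu al v)) 0 V) <= 9 * / mu ^ 2 * En P W).
  { intros s Hs. set (A := fun x => exp (- al * V) * W (x - s * mexp mu al V)). set (B := fun x => W (x - s * mexp mu al 0)).
    set (I := fun x => RI (fun v => exp (- al * v) * W (x - s * mexp mu al v)) 0 V).
    assert (CA : ct A) by (unfold A; ctac). assert (CB : ct B) by (unfold B; ctac). assert (CI : ct I) by (unfold I; ctac).
    assert (EA : En P A <= En P W).
    { unfold A. rewrite (En_scal P _ (fun x => W (x - s * mexp mu al V))), En_shiftm by (auto; ctac).
      assert (Q := exp_neg_le1 al V ltac:(lra) ltac:(lra)). rewrite <- (Rminus_0_r (exp (- al * V))). apply sq_mul_le; lra. }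
    assert (EB : En P B <= En P W) by (unfold B; rewrite En_shiftm; auto; lra). assert (EI : En P I <= En P W).
    { unfold I. letr; [apply (En_RI_sup P (fun x v => exp (- al * v) * W (x - s * mexp mu al v)) 0 V (En P W)); try lra; [ctac|]|apply sq_mul_le; auto].
      intros v Hv. rewrite (En_scal P _ (fun x => W (x - s * mexp mu al v))), En_shiftm by (auto; ctac).
      assert (Q := exp_neg_le1 al v ltac:(lra) ltac:(lra)). rewrite <- (Rminus_0_r (exp (- al * v))). apply sq_mul_le; lra. }
    rewrite (En_ext P _ (fun x => (s / mu) * (/ al * (B x - A x) + (-1) * I x))).
    - rewrite (En_scal P _ (fun x => / al * (B x - A x) + (-1) * I x)) by ctac.
      replace ((s / mu) ^ 2) with (s ^ 2 * / mu ^ 2) by (field; lra). rewrite Hs, Rmult_1_l.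
      replace (9 * / mu ^ 2 * En P W) with (/ mu ^ 2 * (9 * En P W)) by ring. mul_l.
      letr_with (3 * En P B + 3 * En P A + 3 * En P I); [|lra]. unfold En. rewrite <- !RI_scal, <- !RI_plus by ctac.
      ri_le. intros x _. assert (Hi : 0 < / al <= 1).
      { split; [pos|]. rewrite <- Rinv_1. apply Rinv_le_contravar; lra. }
      set (i := / al) in *. generalize (A x) (B x) (I x); intros a b z. letr_with (3 * (i * b) ^ 2 + 3 * (i * a) ^ 2 + 3 * z ^ 2).
      + assert (0 <= (i * b + i * a) ^ 2) by pos. assert (0 <= (i * b + z) ^ 2) by pos. nra.
      + assert (i ^ 2 <= 1) by nra. nra.
    - intro x. rewrite (RI_ext _ (fun v => 1 * W' (x - s * mexp mu al v))) by (intro; ring).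
      rewrite (shift_parts W W' mu al s V x (fun _ => 1) (fun _ => 0)); auto; try lra; try ctac.
      2:{ intros; auto_derive; auto. } unfold A, B, I.
      rewrite (RI_ext (fun v => (0 - al * 1) * exp (- al * v) * W (x - s * mexp mu al v))
        (fun v => (- al) * (exp (- al * v) * W (x - s * mexp mu al v)))) by (intro; ring). rewrite RI_scal by ctac. field. lra. }
  assert (O1 := One 1 ltac:(ring)). assert (O2 := One (-1) ltac:(ring)).
  rewrite (En_ext P _ (fun x => RI (fun v => W' (x - 1 * mexp mu al v)) 0 V - RI (fun v => W' (x - -1 * mexp mu al v)) 0 V)).
  - letr; [apply En_minus2; [auto|ctac|ctac]|]. lra.
  - intro x. unfold sm. rewrite RI_minus by ctac. f_equal; apply RI_ext; intro; f_equal; ring.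
Qed.
End Shifts.
Import Shifts.

(** * Almost orthogonality for sums of Hilbert-transform blocks *)

Module HilbertBound.
Implicit Types F G f g u w h : R -> R.
Implicit Types P d x y : R.

Lemma bs_swap (f : nat -> nat -> R) n m : bs (fun i => bs (f i) m) n = bs (fun j => bs (fun i => f i j) n) m.
Proof.
  induction n; simpl.
  - induction m; simpl; lra.
  - rewrite IHn, <- bs_plus. auto.
Qed.

Lemma RI_bs_mul (f : nat -> R -> R) (g : R -> R) n a b : (forall k, ct (f k)) -> ct g ->
  RI (fun x => bs (fun k => f k x) n * g x) a b = bs (fun k => RI (fun x => f k x * g x) a b) n.
Proof.
  intros Cf Cg. rewrite <- (RI_bs (fun k x => f k x * g x)).
  - apply RI_ext; intro x. rewrite Rmult_comm, <- bs_scal. apply bs_ext; intros; ring.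
  - intro k; assert (K := Cf k); ctac.
Qed.

Lemma avs_av_comm d e F x : 0 < d -> ct F -> avs d (av e F) x = av e (avs d F) x.
Proof.
  intros Hd C. unfold avs, av.
  rewrite (RI_scal (fun y => RI (fun z => F (x + y - z)) 0 e)), (RI_scal (fun z => RI (fun y => F (x - z + y)) 0 d)) by ctac.
  rewrite (fubini (fun y z => F (x + y - z))) by (try lra; ctac).
  rewrite (RI_ext (fun z => RI (fun y => F (x - z + y)) 0 d) (fun z => RI (fun y => F (x + y - z)) 0 d)); [ring|].
  intro; apply RI_ext; intro; f_equal; ring.
Qed.
Lemma avs_avs_comm d e F x : 0 < d -> ct F -> avs d (avs e F) x = avs e (avs d F) x.
Proof.
  intros Hd C. unfold avs.
  rewrite (RI_scal (fun y => RI (fun z => F (x + y + z)) 0 e)), (RI_scal (fun z => RI (fun y => F (x + z + y)) 0 d)) by ctac.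
  rewrite (fubini (fun y z => F (x + y + z))) by (try lra; ctac).
  rewrite (RI_ext (fun z => RI (fun y => F (x + z + y)) 0 d) (fun z => RI (fun y => F (x + y + z)) 0 d)); [ring|].
  intro; apply RI_ext; intro; f_equal; ring.
Qed.
Lemma avs_shift d f y x : avs d (fun x => f (x + y)) x = avs d f (x + y).
Proof. unfold avs; f_equal; apply RI_ext; intro; f_equal; ring. Qed.

Lemma ds_pp_comm d e F x : 0 < d -> ct F -> ds d (pp e F) x = pp e (ds d F) x.
Proof.
  intros Hd C. unfold ds at 1, pp. rewrite !avs_av_comm by (auto; ctac). rewrite <- (av_shift e (avs d (avs e F)) d).
  rewrite (av_ext e (avs e (ds d F)) (fun x => 1 * avs d (avs e F) x + (-1) * avs d (avs e F) (x + d))).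
  - rewrite (av_lin e (avs d (avs e F)) (fun x => avs d (avs e F) (x + d))) by ctac. ring.
  - intro z. rewrite (avs_avs_comm d e F z), (avs_avs_comm d e F (z + d)) by auto. unfold ds.
    rewrite (avs_ext e _ (fun x => 1 * avs d F x + (-1) * avs d F (x + d))) by (intro; ring).
    rewrite (avs_lin e (avs d F) (fun x => avs d F (x + d))) by ctac. rewrite (avs_shift e (avs d F)). reflexivity.
Qed.

(** Littlewood-Paley pieces below the scale [L]; index 0 keeps the whole coarse part, so that
    finitely many pieces add up to [pp (dl L K) F]. *)
Definition Bk (L : R) F (k : nat) : R -> R :=
  match k with O => pp (dl L 0) F | S _ => qq (dl L k) F end.
Definition Bk' (L : R) F (k : nat) : R -> R :=
  match k with O => pp' (dl L 0) F | S _ => qq' (dl L k) F end.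
Lemma cper_Bk P L F k : cper P F -> cper P (Bk L F k).
Proof. intro; destruct k; simpl; auto with cp. Qed.
Lemma cper_Bk' P L F k : cper P F -> cper P (Bk' L F k).
Proof. intro; destruct k; simpl; auto with cp. Qed.
Lemma ct_Bk L F k : ct F -> ct (Bk L F k).
Proof. intro; destruct k; simpl; ctac. Qed.
Lemma ct_Bk' L F k : ct F -> ct (Bk' L F k).
Proof. intro; destruct k; simpl; ctac. Qed.
#[export] Hint Resolve ct_Bk ct_Bk' : ctdb.
#[export] Hint Resolve cper_Bk cper_Bk' : cp.

Lemma pp_Bk L F K x : 0 < L -> pp (dl L K) F x = bs (fun k => Bk L F k x) (S K).
Proof.
  intro HL. induction K; [simpl; ring|]. change (pp (dl L (S K)) F x = bs (fun k => Bk L F k x) (S K) + Bk L F (S K) x).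
  rewrite <- IHK. simpl. unfold qq. rewrite <- dl_S. ring.
Qed.

Lemma Bk_deriv L F k (x : R) : 0 < L -> ct F -> is_derive (Bk L F k) x (Bk' L F k x).
Proof. intros HL C; destruct k; simpl; [apply pp_deriv | apply qq_deriv]; auto; apply dl_pos; auto. Qed.
Lemma En_Bk' P L F k : 0 < P -> 0 < L -> cper P F -> En P (Bk' L F k) <= / dl L k ^ 2 * En P (ds (dl L k) F).
Proof. intros HP HL HF; destruct k; simpl Bk'; [right; apply En_pp' | apply En_qq']; auto; apply dl_pos; auto. Qed.
Lemma En_Bk P L F k : 0 < P -> 0 < L -> cper P F -> (1 <= k)%nat -> En P (Bk L F k) <= En P (ds (dl L k) F).
Proof.
  intros HP HL HF Hk; destruct k; [lia|]. simpl Bk. assert (A := En_qq P (dl L (S k)) F HP (dl_pos _ _ HL) HF).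
  assert (0 <= En P (ds (dl L (S k)) F)) by (apply En_ge0; auto; assert (ct F) by apply HF; ctac). lra.
Qed.

Definition Ph (L al V : R) (a : nat) u : R -> R := sm (mexp (dl L a) al) V u.
Lemma ct_Ph L al V a u : ct u -> ct (Ph L al V a u).
Proof. intro; unfold Ph; ctac. Qed.
Lemma cper_Ph P L al V a u : cper P u -> cper P (Ph L al V a u).
Proof. intro; unfold Ph; auto with cp. Qed.
#[export] Hint Resolve ct_Ph : ctdb.
#[export] Hint Resolve cper_Ph : cp.

Definition CU (al : R) : R := 36 + 4 * exp al ^ 2.
Lemma CU_pos al : 36 <= CU al.
Proof. unfold CU. assert (0 <= exp al ^ 2) by pos. lra. Qed.

Lemma mexp_bound mu al V v : 0 < mu -> 0 <= al -> V <= 1 -> 0 <= v <= V -> Rabs (mexp mu al v) <= mu * exp al.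
Proof.
  intros. unfold mexp. rewrite Rabs_right by (apply Rle_ge, Rmult_le_pos; [lra|pos]).
  mul_l. destruct (Req_dec (al * v) al) as [->|]; [lra|]. left; apply exp_increasing. nra.
Qed.

Lemma dl_ratio L a k : 0 < L -> (k <= a)%nat -> dl L a ^ 2 * / dl L k ^ 2 = (/ 4) ^ adist a k.
Proof.
  intros HL H. replace (adist a k) with (a - k)%nat by (unfold adist; lia).
  replace a with (k + (a - k))%nat at 1 by lia. rewrite dl_plus.
  assert (Q := dl_pos L k HL). replace (/ 4) with (/ 2 * / 2) by field. rewrite (Rpow_mult_distr (/ 2) (/ 2)). field. lra.
Qed.

Lemma Ph_low P L al V a u u' : 0 < P -> 0 < L -> 1 <= al -> 0 <= V <= 1 -> cper P u -> cper P u' ->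
  (forall x, is_derive u x (u' x)) -> En P (Ph L al V a u) <= 4 * exp al ^ 2 * (dl L a ^ 2 * En P u').
Proof.
  intros. unfold Ph. letr; [apply (sm_low P (mexp (dl L a) al) V u u' (dl L a * exp al)); auto; [ctac|]|].
  - intros; apply (mexp_bound _ al V); try lra; auto. apply dl_pos; auto.
  - right; ring.
Qed.

(** A piece coarser than the shift ([k <= a]) nearly cancels between the two signs; a finer one is
    integrated by parts against [qp]. Either way the gain is the squared ratio of the scales. *)
Lemma En_PhB P L al V F a k : 0 < P -> 0 < L -> 1 <= al -> 0 <= V <= 1 -> cper P F ->
  En P (Ph L al V a (Bk L F k)) <= CU al * (/ 4) ^ adist a k * En P (ds (dl L k) F).
Proof.
  intros HP HL Hal HV HF. assert (CF : ct F) by apply HF. assert (Hd : 0 <= En P (ds (dl L k) F)) by (apply En_ge0; auto; ctac).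
  assert (Hw : 0 <= (/ 4) ^ adist a k) by pos. assert (Ha := dl_pos L a HL). assert (Hk := dl_pos L k HL).
  assert (He : 0 <= exp al ^ 2) by pos. assert (Hwd : 0 <= (/ 4) ^ adist a k * En P (ds (dl L k) F)) by pos.
  rewrite Rmult_assoc. unfold CU. destruct (le_lt_dec k a) as [H|H].
  - letr; [apply (Ph_low P L al V a (Bk L F k) (Bk' L F k)); auto with cp; intro; apply Bk_deriv; auto|].
    letr_with (4 * exp al ^ 2 * ((/ 4) ^ adist a k * En P (ds (dl L k) F))).
    2:{ mul_r; auto. lra. } rewrite <- (dl_ratio L a k) by auto. mul_l. rewrite Rmult_assoc. mul_l. apply En_Bk'; auto.
  - destruct k; [lia|]. simpl Bk.
    letr; [apply (sm_parts P (dl L a) al V (qp (dl L (S k)) F) (qq (dl L (S k)) F)); auto with cp; intro; apply qp_deriv; auto|].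
    assert (Q := En_qp P (dl L (S k)) F HP Hk HF).
    letr_with (36 * / dl L a ^ 2 * (dl L (S k) ^ 2 / 16 * En P (ds (dl L (S k)) F))).
    + apply Rmult_le_compat_l; auto. apply Rmult_le_pos; [lra|]. left; apply Rinv_0_lt_compat, pow_lt; auto.
    + rewrite adist_sym, <- (dl_ratio L (S k) a) by (auto; lia). set (z := dl L (S k) ^ 2 * / dl L a ^ 2).
      replace (36 * / dl L a ^ 2 * (dl L (S k) ^ 2 / 16 * En P (ds (dl L (S k)) F))) with
        (36 / 16 * (z * En P (ds (dl L (S k)) F))) by (unfold z; field; lra).
      apply Rmult_le_compat_r; [|lra]. unfold z. rewrite adist_sym, <- (dl_ratio L (S k) a) in Hwd by (auto; lia). auto.
Qed.

Definition hsum (L al V : R) (a : nat -> nat) (n : nat) u x : R := bs (fun l => Ph L al V (a l) u x) n.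

Lemma ct_hsum L al V a n u : ct u -> ct (hsum L al V a n u).
Proof. intro; unfold hsum. apply (ct_bs (fun l => Ph L al V (a l) u)); intro; ctac. Qed.
Lemma cper_hsum P L al V a n u : cper P u -> cper P (hsum L al V a n u).
Proof. intro; unfold hsum. apply (cper_bs P (fun l => Ph L al V (a l) u)); auto with cp. Qed.
#[export] Hint Resolve ct_hsum : ctdb.
#[export] Hint Resolve cper_hsum : cp.

Lemma RI_amgm_t P u v (t : R) : 0 < P -> 0 < t -> ct u -> ct v ->
  Rabs (RI (fun x => u x * v x) 0 P) <= / 2 * (t * En P u + / t * En P v).
Proof.
  intros HP Ht Cu Cv. assert (St : 0 < sqrt t) by (apply sqrt_lt_R0; auto).
  assert (A := RI_amgm P (fun x => sqrt t * u x) (fun x => / sqrt t * v x) HP ltac:(ctac) ltac:(ctac)).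
  rewrite !En_scal in A by ctac.
  rewrite (RI_ext (fun x => sqrt t * u x * (/ sqrt t * v x)) (fun x => u x * v x)) in A by (intro; field; lra).
  rewrite pow_inv, pow2_sqrt in A by lra. lra.
Qed.

Lemma Ph_Ph_swap P L al V a a' u w : 0 < P -> 0 <= V -> cper P u -> cper P w ->
  RI (fun x => Ph L al V a u x * Ph L al V a' w x) 0 P = RI (fun x => Ph L al V a' u x * Ph L al V a w x) 0 P.
Proof.
  intros HP HV Hu Hw. unfold Ph. rewrite (sm_adj P (mexp (dl L a) al) V u (sm (mexp (dl L a') al) V w)) by (auto with cp).
  rewrite (sm_adj P (mexp (dl L a') al) V u (sm (mexp (dl L a) al) V w)) by (auto with cp).
  apply (f_equal Ropp), RI_ext; intro x; apply (f_equal (Rmult (u x))). apply sm_comm; auto; ctac.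
Qed.

(** Blocks commute and are antisymmetric, so the two block indices may be exchanged, and
    Cauchy-Schwarz gives decay in either pair of distances. Taking the better pair and using
    [1 / 2 <= (3 / 4)^2] gives decay in all four distances at once, which the fourfold sum needs. *)
Lemma En_PhB_pair P L al V F a a' k k' : 0 < P -> 0 < L -> 1 <= al -> 0 <= V <= 1 -> cper P F ->
  Rabs (RI (fun x => Ph L al V a (Bk L F k) x * Ph L al V a' (Bk L F k') x) 0 P) <=
  CU al * ((3 / 4) ^ adist a k * (3 / 4) ^ adist a' k' * (3 / 4) ^ adist a' k * (3 / 4) ^ adist a k') *
    (En P (ds (dl L k) F) + En P (ds (dl L k') F)).
Proof.
  intros HP HL Hal HV HF.
  assert (M : forall a a', Rabs (RI (fun x => Ph L al V a (Bk L F k) x * Ph L al V a' (Bk L F k') x) 0 P) <=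
    CU al * (/ 2) ^ (adist a k + adist a' k') * (En P (ds (dl L k) F) + En P (ds (dl L k') F))).
  { clear a a'; intros a a'. set (p := adist a k). set (q := adist a' k').
    (* The weight balances the squared norms [4^-p] and [4^-q] into the common factor [2^-(p+q)]. *)
    assert (A := RI_amgm_t P (Ph L al V a (Bk L F k)) (Ph L al V a' (Bk L F k')) (2 ^ p * (/ 2) ^ q) HP
      ltac:(pos) ltac:(ctac) ltac:(ctac)).
    assert (B1 := En_PhB P L al V F a k HP HL Hal HV HF). assert (B2 := En_PhB P L al V F a' k' HP HL Hal HV HF).
    fold p in B1. fold q in B2. assert (P1 : 0 < 2 ^ p) by pos. assert (P2 : 0 < 2 ^ q) by pos.
    set (D := En P (ds (dl L k) F)) in *. set (D' := En P (ds (dl L k') F)) in *.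
    assert (0 <= D) by (apply En_ge0; auto; ctac). assert (0 <= D') by (apply En_ge0; auto; ctac). assert (HC := CU_pos al).
    replace (/ 4) with (/ 2 * / 2) in B1, B2 by field. rewrite Rpow_mult_distr, !pow_inv in B1, B2.
    rewrite !pow_inv in A. rewrite pow_inv, pow_add. letr; [apply A|].
    letr_with (/ 2 * (2 ^ p * / 2 ^ q * (CU al * (/ 2 ^ p * / 2 ^ p) * D) + / (2 ^ p * / 2 ^ q) * (CU al * (/ 2 ^ q * / 2 ^ q) * D'))).
    - mul_l. apply Rplus_le_compat; apply Rmult_le_compat_l; auto.
      + left; apply Rmult_lt_0_compat; auto. apply Rinv_0_lt_compat; auto.
      + left; apply Rinv_0_lt_compat, Rmult_lt_0_compat; auto. apply Rinv_0_lt_compat; auto.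
    - letr_with (/ 2 * (CU al * / (2 ^ p * 2 ^ q) * (D + D'))); [right; field; lra|].
      assert (0 <= CU al * / (2 ^ p * 2 ^ q) * (D + D')).
      { apply Rmult_le_pos; [|lra]. apply Rmult_le_pos; [lra|]. left; apply Rinv_0_lt_compat, Rmult_lt_0_compat; auto. } lra. }
  assert (M1 := M a a'). assert (M2 := M a' a). rewrite (Ph_Ph_swap P L al V a' a) in M2 by (auto with cp; lra).
  set (X := Rabs _) in *. clearbody X. rewrite <- !pow_add.
  assert (0 <= En P (ds (dl L k) F)) by (apply En_ge0; auto; ctac). assert (0 <= En P (ds (dl L k') F)) by (apply En_ge0; auto; ctac).
  assert (HC := CU_pos al). set (S := En P (ds (dl L k) F) + En P (ds (dl L k') F)) in *. assert (0 <= S) by (unfold S; lra).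
  assert (G : forall p q, (/ 2) ^ p <= (3 / 4) ^ q -> X <= CU al * (/ 2) ^ p * S -> X <= CU al * (3 / 4) ^ q * S).
  { intros p q Hpq HX. letr; [apply HX|]. mul_r; auto. mul_l; lra. }
  set (p := (adist a k + adist a' k')%nat) in *. set (q := (adist a' k + adist a k')%nat) in *.
  replace (p + adist a' k + adist a k')%nat with (p + q)%nat by (unfold q; lia).
  assert (H34 : forall s t, (t <= s)%nat -> (/ 2) ^ s <= (3 / 4) ^ (s + t)).
  { intros s t Hst. letr_with ((3 / 4) ^ (s + s)).
    - rewrite pow_add, <- Rpow_mult_distr. apply pow_incr; lra.
    - replace (s + s)%nat with ((s + t) + (s - t))%nat by lia. rewrite pow_add.
      rewrite <- (Rmult_1_r ((3 / 4) ^ (s + t))) at 2. mul_l. rewrite <- (pow1 (s - t)). apply pow_incr; lra. }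
  destruct (le_lt_dec q p).
  - apply (G p); auto.
  - apply (G q); auto. rewrite Nat.add_comm; apply H34; lia.
Qed.

(** By symmetry only [d k] has to be kept, at the price of the factor 2. One of the four weights is
    bounded by 1, and the other three are summed geometrically over [k'], [l'] and [l]. *)
Lemma quad_sum (r M : R) (a : nat -> nat) (d : nat -> R) n N : 0 <= r < 1 -> M = 2 / (1 - r) ->
  (forall l, (a l < a (S l))%nat) -> (forall k, 0 <= d k) ->
  bs (fun l => bs (fun k => bs (fun l' => bs (fun k' =>
    (r ^ adist (a l) k * r ^ adist (a l') k' * r ^ adist (a l') k * r ^ adist (a l) k') * (d k + d k')) N) n) N) n
  <= 2 * M ^ 3 * bs d N.
Proof.
  intros Hr HM Ha Hd. assert (HM0 : 0 <= M) by (rewrite HM; apply Rdiv_le_0_compat; lra). set (w := fun l k => r ^ adist (a l) k).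
  assert (Hw : forall l k, 0 <= w l k) by (intros; apply pow_le; lra).
  assert (Hw1 : forall l k, w l k <= 1) by (intros; unfold w; rewrite <- (pow1 (adist (a l) k)); apply pow_incr; lra).
  set (f := fun l k l' k' => w l k * w l' k' * w l' k * w l k' * d k).
  set (Q := fun f : nat -> nat -> nat -> nat -> R => bs (fun l => bs (fun k => bs (fun l' => bs (fun k' => f l k l' k') N) n) N) n).
  assert (Qp : forall f g : nat -> nat -> nat -> nat -> R, Q (fun l k l' k' => f l k l' k' + g l k l' k') = Q f + Q g).
  { intros f0 g0; unfold Q. rewrite <- bs_plus; apply bs_ext; intros. rewrite <- bs_plus; apply bs_ext; intros.
    rewrite <- bs_plus; apply bs_ext; intros. rewrite <- bs_plus; auto. }
  assert (Qs : forall f : nat -> nat -> nat -> nat -> R, Q f = Q (fun l k l' k' => f l' k' l k)).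
  { intro f0; unfold Q.
    rewrite (bs_ext _ (fun l => bs (fun l' => bs (fun k => bs (fun k' => f0 l k l' k') N) N) n)) by (intros; rewrite bs_swap; auto).
    rewrite bs_swap. rewrite (bs_ext (fun l => bs (fun k => bs (fun l' => bs (fun k' => f0 l' k' l k) N) n) N)
      (fun l => bs (fun l' => bs (fun k => bs (fun k' => f0 l' k' l k) N) N) n)) by (intros; rewrite bs_swap; auto).
    apply bs_ext; intros l _; apply bs_ext; intros l' _. rewrite bs_swap. auto. }
  letr_with (Q (fun l k l' k' => f l k l' k' + f l' k' l k)).
  { right; unfold Q; apply bs_ext; intros l _; apply bs_ext; intros k _; apply bs_ext; intros l' _; apply bs_ext; intros k' _.
    unfold f, w; ring. } rewrite Qp, <- (Qs f). assert (B : Q f <= M ^ 3 * bs d N); [|lra]. unfold Q.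
  assert (G1 : forall l, bs (w l) N <= M) by (intro l; rewrite HM; apply (bs_geom r (a l) N); auto).
  assert (G2 : forall k, bs (fun l => w l k) n <= M) by (intro k; rewrite HM; apply (bs_geom_sub r k a n); auto).
  letr_with (bs (fun l => bs (fun k => M ^ 2 * d k * w l k) N) n).
  - apply bs_le; intros l _; apply bs_le; intros k _. letr_with (bs (fun l' => (w l k * d k * M) * w l' k) n).
    + apply bs_le; intros l' _. letr_with (bs (fun k' => (w l k * d k * w l' k) * w l k') N).
      * apply bs_le; intros k' _. unfold f.
        replace (w l k * w l' k' * w l' k * w l k' * d k) with (w l' k' * (w l k * d k * w l' k * w l k')) by ring.
        rewrite <- (Rmult_1_l (w l k * d k * w l' k * w l k')) at 2. mul_r; auto. repeat apply Rmult_le_pos; auto.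
      * rewrite bs_scal. replace (w l k * d k * M * w l' k) with (w l k * d k * w l' k * M) by ring.
        mul_l; auto. repeat apply Rmult_le_pos; auto.
    + rewrite bs_scal. replace (M ^ 2 * d k * w l k) with (w l k * d k * M * M) by ring.
      mul_l; auto. repeat apply Rmult_le_pos; auto.
  - rewrite bs_swap. rewrite <- bs_scal. apply bs_le; intros k _.
    rewrite (bs_scal (M ^ 2 * d k) (fun l => w l k)). replace (M ^ 3 * d k) with (M ^ 2 * d k * M) by ring.
    apply Rmult_le_compat_l; auto. apply Rmult_le_pos; auto. apply pow2_ge_0.
Qed.

Lemma Ph_bs L al V a (u : nat -> R -> R) n x : (forall k, ct (u k)) ->
  Ph L al V a (fun x => bs (fun k => u k x) n) x = bs (fun k => Ph L al V a (u k) x) n.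
Proof. intro; apply sm_bs; auto; ctac. Qed.

Lemma Ph_pp_Bk L al V a F K x : 0 < L -> ct F ->
  Ph L al V a (pp (dl L K) F) x = bs (fun k => Ph L al V a (Bk L F k) x) (S K).
Proof. intros HL C. rewrite <- (Ph_bs L al V a (Bk L F)) by (intro; ctac). apply sm_ext. intro; apply pp_Bk; auto. Qed.

(** The square is expanded over pairs of blocks and pairs of pieces. The constant is [2 * 8^3 * 4]:
    8 is the two-sided geometric sum of ratio [3 / 4], and the last 4 comes from [ds_sum]. *)
Lemma hilbert_bound P L al V F (a : nat -> nat) K n : 0 < P -> 0 < L -> 1 <= al -> 0 <= V <= 1 -> cper P F ->
  (forall l, (a l < a (S l))%nat) ->
  En P (hsum L al V a n (pp (dl L K) F)) <= 4096 * CU al * En P F.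
Proof.
  intros HP HL Hal HV HF Ha. assert (CF := proj1 HF). assert (HC := CU_pos al). set (U := fun l k => Ph L al V (a l) (Bk L F k)).
  assert (CUk : forall l k, ct (U l k)) by (intros; unfold U; ctac).
  set (X := fun x => bs (fun l => bs (fun k => U l k x) (S K)) n). assert (CX : ct X).
  { unfold X. apply (ct_bs (fun l x => bs (fun k => U l k x) (S K))). intro l. apply (ct_bs (U l)); auto. }
  assert (EX : forall x, hsum L al V a n (pp (dl L K) F) x = X x).
  { intro x; unfold hsum, X. apply bs_ext; intros l _. apply Ph_pp_Bk; auto. } rewrite (En_ext P _ X) by auto.
  assert (T : En P X = bs (fun l => bs (fun k => bs (fun l' => bs (fun k' =>
     RI (fun x => U l k x * U l' k' x) 0 P) (S K)) n) (S K)) n).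
  { unfold En. rewrite (RI_ext _ (fun x => X x * X x)) by (intro; ring).
    assert (G : forall g, ct g -> RI (fun x => X x * g x) 0 P = bs (fun l => bs (fun k => RI (fun x => U l k x * g x) 0 P) (S K)) n).
    { intros g Cg. unfold X. rewrite (RI_bs_mul (fun l x => bs (fun k => U l k x) (S K))); auto.
      - apply bs_ext; intros l _. apply RI_bs_mul; auto.
      - intro l. apply (ct_bs (U l)); auto. } rewrite G by auto. apply bs_ext; intros l _; apply bs_ext; intros k _.
    rewrite (RI_ext _ (fun x => X x * U l k x)) by (intro; ring). rewrite G by auto.
    apply bs_ext; intros l' _; apply bs_ext; intros k' _. apply RI_ext; intro; ring. } rewrite T. letr; [apply Rle_abs|].
  assert (Q := quad_sum (3 / 4) 8 a (fun k => En P (ds (dl L k) F)) n (S K) ltac:(lra) ltac:(field) Ha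
    ltac:(intro; apply En_ge0; auto; ctac)). cbv beta in Q. assert (D := ds_sum P L F (S K) HP HL HF). fold (dl L) in D.
  letr_with (CU al * (2 * 8 ^ 3 * (4 * En P F))); [|right; ring].
  letr; [|apply Rmult_le_compat_l; [lra|letr; [apply Q|apply Rmult_le_compat_l; [lra|apply D]]]].
  rewrite <- bs_scal. letr; [apply bs_abs|]. apply bs_le; intros l _.
  rewrite <- bs_scal. letr; [apply bs_abs|]. apply bs_le; intros k _.
  rewrite <- bs_scal. letr; [apply bs_abs|]. apply bs_le; intros l' _.
  rewrite <- bs_scal. letr; [apply bs_abs|]. apply bs_le; intros k' _.
  unfold U. letr; [apply (En_PhB_pair P L al V F (a l) (a l') k k'); auto|]. right; ring.
Qed.
End HilbertBound.
Import HilbertBound.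

(** * A Cotlar-type comparison of partial sums with averages of the full sum *)

Module HilbertRemainder.
Implicit Types F G u w h : R -> R.
Implicit Types P d x y : R.

Lemma av_bs d (u : nat -> R -> R) n x : (forall k, ct (u k)) ->
  av d (fun x => bs (fun k => u k x) n) x = bs (fun k => av d (u k) x) n.
Proof. intro C; unfold av. rewrite (RI_bs (fun k y => u k (x - y))), bs_scal; auto. intro k; assert (K := C k); ctac. Qed.
Lemma avs_bs d (u : nat -> R -> R) n x : (forall k, ct (u k)) ->
  avs d (fun x => bs (fun k => u k x) n) x = bs (fun k => avs d (u k) x) n.
Proof. intro C; unfold avs. rewrite (RI_bs (fun k y => u k (x + y))), bs_scal; auto. intro k; assert (K := C k); ctac. Qed.
Lemma pp_bs d (u : nat -> R -> R) n x : (forall k, ct (u k)) ->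
  pp d (fun x => bs (fun k => u k x) n) x = bs (fun k => pp d (u k) x) n.
Proof.
  intro C; unfold pp. rewrite (av_ext d _ (fun x => bs (fun k => avs d (u k) x) n)) by (intro; apply avs_bs; auto).
  apply (av_bs d (fun k => avs d (u k))). intro k; assert (K := C k); ctac.
Qed.
Lemma pp_ext d u w x : (forall x, u x = w x) -> pp d u x = pp d w x.
Proof. intro H; unfold pp; apply av_ext; intro; apply avs_ext; auto. Qed.

Lemma En_sub_pp P d w : 0 < P -> 0 < d -> cper P w -> En P (fun x => w x - pp d w x) <= 4 * En P w.
Proof. intros HP Hd Hw. letr; [apply En_minus2; [auto|ctac|ctac]|]. assert (A := En_pp P d w HP Hd Hw). lra. Qed.

Lemma En_sub_pp' P d w w' : 0 < P -> 0 < d -> cper P w -> cper P w' -> (forall x, is_derive w x (w' x)) ->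
  En P (fun x => w x - pp d w x) <= 4 * d ^ 2 * En P w'.
Proof.
  intros HP Hd Hw Hw' D. assert (C' := proj1 Hw'). assert (H0 : 0 <= En P w') by (apply En_ge0; auto).
  assert (A : En P (fun x => w x - avs d w x) <= d ^ 2 * En P w').
  { rewrite (En_ext P _ (fun x => / d * RI (fun y => w x - w (x + y)) 0 d)).
    - rewrite (En_scal P (/ d) (fun x => RI (fun y => w x - w (x + y)) 0 d)) by ctac.
      letr_with ((/ d) ^ 2 * ((d - 0) ^ 2 * (d ^ 2 * En P w'))); [|right; field; lra]. mul_l.
      apply (En_RI_sup P (fun x y => w x - w (x + y))); [auto|lra|ctac|].
      intros y Hy. rewrite (En_ext P _ (fun x => -1 * (w (x + y) - w x))) by (intro; ring).
      rewrite (En_scal P (-1) (fun x => w (x + y) - w x)) by ctac. replace ((-1) ^ 2) with 1 by ring. rewrite Rmult_1_l.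
      letr; [apply (En_diff P w w'); auto|]. mul_r; auto. apply pow_incr; lra.
    - intro x. unfold avs. rewrite (RI_minus (fun _ => w x) (fun y => w (x + y))), RI_const by ctac. field; lra. }
  assert (B : En P (fun x => avs d w x - pp d w x) <= d ^ 2 * En P w').
  { rewrite (En_ext P _ (fun x => / d * RI (fun y => avs d w x - avs d w (x - y)) 0 d)).
    - rewrite (En_scal P (/ d) (fun x => RI (fun y => avs d w x - avs d w (x - y)) 0 d)) by ctac.
      letr_with ((/ d) ^ 2 * ((d - 0) ^ 2 * (d ^ 2 * En P w'))); [|right; field; lra]. mul_l.
      apply (En_RI_sup P (fun x y => avs d w x - avs d w (x - y))); [auto|lra|ctac|]. intros y Hy.
      rewrite (En_ext P _ (avs d (fun x => -1 * (w (x + - y) - w x)))).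
      + letr; [apply En_avs; [auto|auto|]|].
        { apply cper_scal, cper_minus; auto with cp. } rewrite (En_scal P (-1) (fun x => w (x + - y) - w x)) by ctac.
        replace ((-1) ^ 2) with 1 by ring. rewrite Rmult_1_l. letr; [apply (En_diff P w w'); auto|]. mul_r; auto.
        replace ((- y) ^ 2) with (y ^ 2) by ring. apply pow_incr; lra.
      + intro x. rewrite (avs_ext d (fun x => -1 * (w (x + - y) - w x)) (fun x => 1 * w x + (-1) * w (x + - y))) by (intro; ring).
        rewrite (avs_lin d w (fun x => w (x + - y))) by ctac. rewrite (avs_shift d w). unfold Rminus. ring.
    - intro x. unfold pp. unfold av. rewrite (RI_minus (fun _ => avs d w x) (fun y => avs d w (x - y))), RI_const by ctac. field; lra. }
  rewrite (En_ext P _ (fun x => (w x - avs d w x) + (avs d w x - pp d w x))) by (intro; ring).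
  letr; [apply En_plus2; [auto|ctac|ctac]|]. lra.
Qed.

Lemma pow_quarter_half p q : (q <= 2 * p)%nat -> (/ 4) ^ p <= (/ 2) ^ q.
Proof.
  intro H. replace (/ 4) with (/ 2 * / 2) by field. rewrite Rpow_mult_distr, <- pow_add.
  replace (p + p)%nat with (q + (2 * p - q))%nat by lia. rewrite pow_add.
  rewrite <- (Rmult_1_r ((/ 2) ^ q)) at 2. mul_l. apply pow_half_le1.
Qed.

Lemma Ph_deriv L al V a u u' (x : R) : ct u -> ct u' -> (forall x, is_derive u x (u' x)) ->
  is_derive (Ph L al V a u) x (Ph L al V a u' x).
Proof. intros; apply sm_deriv; auto; ctac. Qed.

(** Three positions of the piece: coarser than both scales (differentiate the piece), between them
    (differentiate, then integrate by parts over the block), finer than [a] (the block itself is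
    small). Each case controls the larger of the two distances, hence their sum at half the rate:
    [/ 2] instead of [/ 4]. *)
Lemma PhB_high P L al V F a a' k : 0 < P -> 0 < L -> 1 <= al -> 0 <= V <= 1 -> cper P F -> (a' <= a)%nat ->
  En P (fun x => Ph L al V a' (Bk L F k) x - pp (dl L a) (Ph L al V a' (Bk L F k)) x) <=
  4 * CU al * (/ 2) ^ (adist a a' + adist a k) * En P (ds (dl L k) F).
Proof.
  intros HP HL Hal HV HF Haa. assert (CF := proj1 HF). assert (HC := CU_pos al).
  set (D := En P (ds (dl L k) F)). assert (HD : 0 <= D) by (apply En_ge0; auto; ctac).
  assert (Hda := dl_pos L a HL). assert (Hda' := dl_pos L a' HL).
  assert (G : forall p, (adist a a' + adist a k <= 2 * p)%nat -> forall c, 0 <= c <= 4 * CU al ->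
     c * (/ 4) ^ p * D <= 4 * CU al * (/ 2) ^ (adist a a' + adist a k) * D).
  { intros p Hp c Hc. mul_r; auto. apply Rmult_le_compat; [lra|pos|lra|]. apply pow_quarter_half; auto. }
  destruct (le_lt_dec k a) as [H|H].
  - letr; [apply (En_sub_pp' P (dl L a) _ (Ph L al V a' (Bk' L F k))); auto with cp|].
    { intro; apply Ph_deriv; [ctac|ctac|]. intro; apply Bk_deriv; auto. } destruct (le_lt_dec k a') as [H'|H'].
    + letr_with (16 * (/ 4) ^ adist a k * D); [|apply G; [unfold adist; lia|lra]].
      assert (A := sm_bd P (mexp (dl L a') al) V (Bk' L F k) HP HV ltac:(ctac) ltac:(auto with cp)).
      assert (B := En_Bk' P L F k HP HL HF). fold D in B. rewrite <- (dl_ratio L a k) by auto. unfold Ph.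
      replace (16 * (dl L a ^ 2 * / dl L k ^ 2) * D) with (4 * dl L a ^ 2 * (4 * (/ dl L k ^ 2 * D))) by ring. mul_l. lra.
    + letr_with (144 * (/ 4) ^ adist a a' * D); [|apply G; [unfold adist; lia|lra]].
      assert (A := sm_parts P (dl L a') al V (Bk L F k) (Bk' L F k) HP Hda' Hal HV ltac:(auto with cp) ltac:(auto with cp)
         ltac:(intro; apply Bk_deriv; auto)). assert (B := En_Bk P L F k HP HL HF ltac:(lia)). fold D in B.
      rewrite <- (dl_ratio L a a') by auto. unfold Ph.
      replace (144 * (dl L a ^ 2 * / dl L a' ^ 2) * D) with (4 * dl L a ^ 2 * (36 * / dl L a' ^ 2 * D)) by ring. mul_l.
      letr; [apply A|]. apply Rmult_le_compat_l; auto. apply Rmult_le_pos; [lra|]. left; apply Rinv_0_lt_compat, pow_lt; auto.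
  - letr; [apply En_sub_pp; auto with cp|]. assert (A := En_PhB P L al V F a' k HP HL Hal HV HF). fold D in A.
    letr_with (4 * CU al * (/ 4) ^ adist a' k * D); [lra|]. apply G; [unfold adist; lia|lra].
Qed.

Lemma Ph_high P L al V F a a' K : 0 < P -> 0 < L -> 1 <= al -> 0 <= V <= 1 -> cper P F -> (a' <= a)%nat ->
  En P (fun x => Ph L al V a' (pp (dl L K) F) x - pp (dl L a) (Ph L al V a' (pp (dl L K) F)) x) <=
  32 * CU al * (/ 2) ^ adist a a' * bs (fun k => (2 / 3) ^ adist a k * En P (ds (dl L k) F)) (S K).
Proof.
  intros HP HL Hal HV HF Haa. assert (CF := proj1 HF).
  set (Z := fun k x => Ph L al V a' (Bk L F k) x - pp (dl L a) (Ph L al V a' (Bk L F k)) x).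
  assert (CZ : forall k, ct (Z k)) by (intro; unfold Z; ctac). rewrite (En_ext P _ (fun x => bs (fun k => Z k x) (S K))).
  - letr; [apply (En_bs P Z (fun k => (3 / 4) ^ adist a k)); auto|].
    { intro; apply pow_lt; lra. } assert (B := bs_geom (3 / 4) a (S K) ltac:(lra)).
    assert (G : forall k, En P (Z k) / (3 / 4) ^ adist a k <= 4 * CU al * (/ 2) ^ adist a a' * ((2 / 3) ^ adist a k * En P (ds (dl L k) F))).
    { intro k. assert (Q := PhB_high P L al V F a a' k HP HL Hal HV HF Haa). fold (Z k) in Q.
      assert (H34 : 0 < (3 / 4) ^ adist a k) by pos. apply Rmult_le_reg_r with ((3 / 4) ^ adist a k); auto.
      replace (En P (Z k) / (3 / 4) ^ adist a k * (3 / 4) ^ adist a k) with (En P (Z k)) by (field; lra).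
      letr; [apply Q|]. right. rewrite pow_add.
      (* The factor [3 / 4] is spent on the Cauchy-Schwarz weights; [2 / 3] remains for the sum over
         [k]. *)
      replace (/ 2) with (2 / 3 * (3 / 4)) at 2 by field. rewrite Rpow_mult_distr. ring. }
    assert (H0 : 0 <= bs (fun k => (2 / 3) ^ adist a k * En P (ds (dl L k) F)) (S K)).
    { apply bs_ge0; intros. apply Rmult_le_pos; [pos|apply En_ge0; auto; ctac]. }
    letr_with (8 * (4 * CU al * (/ 2) ^ adist a a' * bs (fun k => (2 / 3) ^ adist a k * En P (ds (dl L k) F)) (S K))); [|right; ring].
    apply Rmult_le_compat.
    + apply bs_ge0; intros; apply pow_le; lra.
    + apply bs_ge0; intros. apply Rmult_le_pos; [apply En_ge0; auto|]. left; apply Rinv_0_lt_compat, pow_lt; lra.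
    + letr; [apply B|]. right; field.
    + rewrite <- bs_scal. apply bs_le; auto.
  - intro x. unfold Z. rewrite bs_minus. f_equal; [apply Ph_pp_Bk; auto|].
    rewrite (pp_ext _ _ (fun x => bs (fun k => Ph L al V a' (Bk L F k) x) (S K))) by (intro; apply Ph_pp_Bk; auto).
    apply (pp_bs (dl L a) (fun k => Ph L al V a' (Bk L F k))). intro; ctac.
Qed.

(** The average commutes with the block, and the averaged function varies slowly at the length of
    the shift, so the two signs nearly cancel. *)
Lemma Ph_fine P L al V F a a' K : 0 < P -> 0 < L -> 1 <= al -> 0 <= V <= 1 -> cper P F -> (a <= a')%nat ->
  En P (pp (dl L a) (Ph L al V a' (pp (dl L K) F))) <= CU al * (/ 2) ^ adist a a' * En P (ds (dl L a) F).
Proof.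
  intros HP HL Hal HV HF Haa. assert (CF := proj1 HF). assert (Hda := dl_pos L a HL).
  set (u := pp (dl L K) F). assert (Hu : cper P u) by (unfold u; auto with cp).
  rewrite (En_ext P _ (Ph L al V a' (pp (dl L a) u))) by (intro; unfold Ph; apply sm_pp; [lra|ctac|apply Hu]).
  letr; [apply (Ph_low P L al V a' _ (pp' (dl L a) u)); auto with cp|].
  { intro; apply pp_deriv; auto; apply Hu. } rewrite En_pp' by auto. assert (B : En P (ds (dl L a) u) <= En P (ds (dl L a) F)).
  { unfold u. rewrite (En_ext P _ (pp (dl L K) (ds (dl L a) F))) by (intro; apply ds_pp_comm; auto).
    apply En_pp; auto with cp. apply dl_pos; auto. } assert (0 <= En P (ds (dl L a) F)) by (apply En_ge0; auto; ctac).
  rewrite <- (Rmult_assoc (dl L a' ^ 2)), (dl_ratio L a' a), adist_sym by auto.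
  assert (Q := pow_quarter_half (adist a a') (adist a a') ltac:(lia)). assert (0 <= (/ 4) ^ adist a a') by pos.
  rewrite !Rmult_assoc. letr_with (4 * exp al ^ 2 * ((/ 2) ^ adist a a' * En P (ds (dl L a) F))).
  - rewrite !Rmult_assoc. mul_l. mul_l. apply Rmult_le_compat; auto. apply En_ge0; auto. ctac.
  - apply Rmult_le_compat_r; [|unfold CU; lra]. apply Rmult_le_pos; auto. apply pow_le; lra.
Qed.

Lemma bs_indic (f : nat -> R) l n : (l <= n)%nat ->
  bs (fun j => if lt_dec j l then f j else 0) n = bs f l.
Proof.
  intro H. induction n.
  - replace l with O by lia. auto.
  - destruct (Nat.eq_dec l (S n)) as [->|E].
    + apply bs_ext; intros k Hk. destruct (lt_dec k (S n)); [auto|lia].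
    + simpl. rewrite IHn by lia. destruct (lt_dec n l); [lia|ring].
Qed.

(** A square-summed Cotlar inequality. Blocks before [l] have longer shifts and nearly coincide with
    their averages at scale [a l]; blocks from [l] on are nearly annihilated by that average. The
    errors decay in [|a l' - a l|] and are therefore summable in [l]. *)
Lemma hilbert_remainder P L al V F (a : nat -> nat) K n : 0 < P -> 0 < L -> 1 <= al -> 0 <= V <= 1 -> cper P F ->
  (forall l, (a l < a (S l))%nat) ->
  bs (fun l => En P (fun x => hsum L al V a l (pp (dl L K) F) x -
    pp (dl L (a l)) (hsum L al V a n (pp (dl L K) F)) x)) n <= 40000 * CU al * En P F.
Proof.
  intros HP HL Hal HV HF Ha. assert (CF := proj1 HF). assert (HC := CU_pos al). set (u := pp (dl L K) F).
  set (d := fun k => En P (ds (dl L k) F)). assert (Hd : forall k, 0 <= d k) by (intro; apply En_ge0; auto; ctac).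
  set (T := fun l => bs (fun k => (2 / 3) ^ adist (a l) k * d k) (S K)).
  assert (HT : forall l, 0 <= T l) by (intro; apply bs_ge0; intros; apply Rmult_le_pos; auto; apply pow_le; lra).
  assert (Hl : forall l, (l < n)%nat -> En P (fun x => hsum L al V a l u x - pp (dl L (a l)) (hsum L al V a n u) x) <=
    48 * CU al * (32 * T l + d (a l))).
  { intros l Hln. set (Z := fun l' => if lt_dec l' l then (fun x => Ph L al V (a l') u x - pp (dl L (a l)) (Ph L al V (a l') u) x)
       else (fun x => -1 * pp (dl L (a l)) (Ph L al V (a l') u) x)).
    assert (CZ : forall k, ct (Z k)) by (intro k; unfold Z; destruct (lt_dec k l); ctac).
    rewrite (En_ext P _ (fun x => bs (fun l' => Z l' x) n)).
    - letr; [apply (En_bs P Z (fun l' => (3 / 4) ^ adist (a l') (a l))); auto|].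
      { intro; apply pow_lt; lra. } assert (HX : 0 <= 32 * T l + d (a l)) by (specialize (HT l); specialize (Hd (a l)); lra).
      assert (G : forall l', En P (Z l') / (3 / 4) ^ adist (a l') (a l) <= CU al * (32 * T l + d (a l)) * (2 / 3) ^ adist (a l') (a l)).
      { intro l'. assert (H34 : 0 < (3 / 4) ^ adist (a l') (a l)) by pos.
        apply Rmult_le_reg_r with ((3 / 4) ^ adist (a l') (a l)); auto.
        replace (En P (Z l') / (3 / 4) ^ adist (a l') (a l) * (3 / 4) ^ adist (a l') (a l)) with (En P (Z l')) by (field; lra).
        rewrite Rmult_assoc, <- Rpow_mult_distr. replace (2 / 3 * (3 / 4)) with (/ 2) by field.
        rewrite adist_sym. assert (Hp : 0 <= (/ 2) ^ adist (a l) (a l')) by pos.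
        assert (Mono : forall i j, (i <= j)%nat -> (a i <= a j)%nat).
        { intros i j Hij; induction Hij; auto. specialize (Ha m); lia. } unfold Z; destruct (lt_dec l' l).
        - letr; [apply (Ph_high P L al V F (a l) (a l') K); auto; apply Mono; lia|]. fold (T l). fold d.
          replace (32 * CU al * (/ 2) ^ adist (a l) (a l') * bs (fun k => (2 / 3) ^ adist (a l) k * En P (ds (dl L k) F)) (S K))
            with (CU al * (32 * T l) * (/ 2) ^ adist (a l) (a l')) by (unfold T, d; ring).
          mul_r; auto. mul_l. specialize (Hd (a l)); lra.
        - rewrite (En_scal P (-1) (pp (dl L (a l)) (Ph L al V (a l') u))) by ctac.
          replace ((-1) ^ 2) with 1 by ring. rewrite Rmult_1_l.
          letr; [apply (Ph_fine P L al V F (a l) (a l') K); auto; apply Mono; lia|].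
          replace (CU al * (/ 2) ^ adist (a l) (a l') * En P (ds (dl L (a l)) F)) with (CU al * d (a l) * (/ 2) ^ adist (a l) (a l'))
            by (unfold d; ring). mul_r; auto. mul_l. specialize (HT l); lra. }
      assert (B1 := bs_geom_sub (3 / 4) (a l) a n ltac:(lra) Ha). assert (B2 := bs_geom_sub (2 / 3) (a l) a n ltac:(lra) Ha).
      letr_with (8 * (CU al * (32 * T l + d (a l)) * 6)); [|right; ring]. apply Rmult_le_compat.
      + apply bs_ge0; intros; apply pow_le; lra.
      + apply bs_ge0; intros. apply Rmult_le_pos; [apply En_ge0; auto|]. left; apply Rinv_0_lt_compat, pow_lt; lra.
      + letr; [apply B1|]. right; field.
      + letr_with (bs (fun l' => CU al * (32 * T l + d (a l)) * (2 / 3) ^ adist (a l') (a l)) n); [apply bs_le; auto|].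
        rewrite bs_scal. mul_l. letr; [apply B2|]. right; field.
    - intro x. rewrite (pp_ext _ _ (fun x => bs (fun l' => Ph L al V (a l') u x) n)) by (intro; reflexivity).
      rewrite (pp_bs (dl L (a l)) (fun l' => Ph L al V (a l') u)) by (intro; ctac).
      unfold hsum. rewrite <- (bs_indic _ l n) by lia. rewrite <- bs_minus. apply bs_ext; intros l' _.
      unfold Z; destruct (lt_dec l' l); ring. }
  letr_with (bs (fun l => 48 * CU al * (32 * T l + d (a l))) n); [apply bs_le; auto|]. rewrite bs_scal, bs_plus, bs_scal.
  assert (D := ds_sum P L F (S K) HP HL HF). fold (dl L) in D. assert (D1 : bs (fun l => d (a l)) n <= 4 * En P F).
  { letr; [apply (bs_sub d a n); auto|]. apply (ds_sum P L F (a n)); auto. } assert (D2 : bs T n <= 6 * (4 * En P F)).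
  { unfold T. rewrite bs_swap. letr_with (6 * bs d (S K)).
    - rewrite <- bs_scal. apply bs_le; intros k _. rewrite (bs_ext _ (fun l => d k * (2 / 3) ^ adist (a l) k)) by (intros; ring).
      rewrite bs_scal, Rmult_comm. mul_r; auto. letr; [apply (bs_geom_sub (2 / 3) k a n); auto; lra|]. right; field.
    - mul_l. apply D. } assert (0 <= En P F) by (apply En_ge0; auto).
  letr_with (48 * CU al * (32 * (6 * (4 * En P F)) + 4 * En P F)).
  - mul_l; lra.
  - replace (48 * CU al * (32 * (6 * (4 * En P F)) + 4 * En P F)) with (37056 * (CU al * En P F)) by ring.
    assert (0 <= CU al * En P F) by pos. lra.
Qed.
End HilbertRemainder.
Import HilbertRemainder.

(** * Paraproducts in which one factor is a Hilbert-transform block *)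

Module Paraproducts.
Implicit Types F G u w h : R -> R.
Implicit Types P d x y : R.

Lemma abel (S p : nat -> R) m :
  bs (fun l => (S (1 + l)%nat - S l) * p l) (1 + m) =
  S (1 + m)%nat * p m - S O * p O - bs (fun j => S (1 + j)%nat * (p (1 + j)%nat - p j)) m.
Proof.
  induction m; [simpl; ring|].
  change (bs (fun l => (S (1 + l)%nat - S l) * p l) (1 + m) + (S (1 + (1 + m))%nat - S (1 + m)%nat) * p (1 + m)%nat =
    S (1 + (1 + m))%nat * p (1 + m)%nat - S O * p O -
    (bs (fun j => S (1 + j)%nat * (p (1 + j)%nat - p j)) m + S (1 + m)%nat * (p (1 + m)%nat - p m))). rewrite IHm. ring.
Qed.

Lemma abel2 (w u : nat -> R) m :
  bs (fun j => w (1 + j)%nat * (u (1 + j)%nat - u j)) m =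
  w m * u m - w O * u O - bs (fun j => (w (1 + j)%nat - w j) * u j) m.
Proof.
  induction m; [simpl; ring|].
  change (bs (fun j => w (1 + j)%nat * (u (1 + j)%nat - u j)) m + w (1 + m)%nat * (u (1 + m)%nat - u m) =
    w (1 + m)%nat * u (1 + m)%nat - w O * u O - (bs (fun j => (w (1 + j)%nat - w j) * u j) m + (w (1 + m)%nat - w m) * u m)).
  rewrite IHm. ring.
Qed.

Lemma pp_diff L G k B x : pp (dl L (k + B)) G x - pp (dl L k) G x =
  bs (fun i => qq (dl L (k + 1 + i)) G x) B.
Proof.
  induction B; [rewrite Nat.add_0_r; simpl; ring|].
  simpl. rewrite <- IHB. unfold qq. replace (k + 1 + B)%nat with (S (k + B)) by lia. replace (k + S B)%nat with (S (k + B)) by lia.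
  rewrite <- dl_S. ring.
Qed.

(** Each difference consists of [B] pieces [qq]; one factor [INR B] is Cauchy-Schwarz, the other
    counts the progressions of step [B], each covered by [ds_sum]. *)
Lemma En_pp_diff_sum P L G (b : nat -> nat) B n : 0 < P -> 0 < L -> cper P G -> (1 <= B)%nat ->
  (forall l, b (S l) = (b l + B)%nat) ->
  bs (fun l => En P (fun x => pp (dl L (b l + B)) G x - pp (dl L (b l)) G x)) n <= INR B ^ 2 * En P G.
Proof.
  intros HP HL HG HB Hb. assert (B0 : forall l, En P (fun x => pp (dl L (b l + B)) G x - pp (dl L (b l)) G x) <=
    INR B * bs (fun i => / 4 * En P (ds (dl L (b l + 1 + i)) G)) B).
  { intro l. rewrite (En_ext P _ (fun x => bs (fun i => qq (dl L (b l + 1 + i)) G x) B)) by (intro; apply pp_diff).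
    letr; [apply (En_bs P (fun i => qq (dl L (b l + 1 + i)) G) (fun _ => 1)); auto; [intro; ctac|intro; lra]|].
    assert (E1 : bs (fun _ => 1) B = INR B) by (clear; induction B; [auto|rewrite S_INR; simpl; rewrite IHB; auto]).
    rewrite E1. apply Rmult_le_compat_l; [apply pos_INR|]. apply bs_le; intros i _.
    unfold Rdiv; rewrite Rinv_1, Rmult_1_r. apply En_qq; auto. apply dl_pos; auto. } letr; [apply bs_le; intros l _; apply B0|].
  rewrite bs_scal, bs_swap. replace (INR B ^ 2) with (INR B * INR B) by ring. rewrite Rmult_assoc.
  apply Rmult_le_compat_l; [apply pos_INR|]. letr_with (bs (fun _ => En P G) B).
  - apply bs_le; intros i _. rewrite bs_scal. assert (Q : bs (fun l => En P (ds (dl L (b l + 1 + i)) G)) n <= 4 * En P G); [|lra].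
    letr; [apply (bs_sub (fun k => En P (ds (dl L k) G)) (fun l => (b l + 1 + i)%nat))|apply (ds_sum P L G)]; auto.
    + intro; apply En_ge0; auto; ctac.
    + intro j; rewrite Hb; lia.
  - right. clear; induction B; [simpl; ring|]. rewrite S_INR. simpl. rewrite IHB. ring.
Qed.

Lemma paraproduct_diff P L F G h (c b : nat -> nat) B n : 0 < P -> 0 < L -> cper P F -> cper P G -> cper P h ->
  (forall x, Rabs (h x) <= 1) -> (forall l, (c l < c (S l))%nat) -> (forall l, b (S l) = (b l + B)%nat) ->
  (1 <= B)%nat -> (forall l, (l < n)%nat -> (c l <= b l)%nat) ->
  Rabs (RI (fun x => bs (fun l => (pp (dl L (b l + B)) G x - pp (dl L (b l)) G x) * pp (dl L (c l)) F x) n * h x) 0 P)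
  <= 12 * INR B * (En P F + En P G).
Proof.
  intros HP HL HF HG Hh H1 Hc Hb HB Hcb.
  rewrite (RI_ext _ (fun x => bs (fun i => bs (fun l => qq (dl L (b l + 1 + i)) G x * (pp (dl L (c l)) F x * h x)) n) B)).
  2:{ intro x. rewrite <- bs_swap. rewrite Rmult_comm, <- bs_scal. apply bs_ext; intros l _.
      rewrite pp_diff. replace (h x * (bs (fun i => qq (dl L (b l + 1 + i)) G x) B * pp (dl L (c l)) F x)) with
        ((pp (dl L (c l)) F x * h x) * bs (fun i => qq (dl L (b l + 1 + i)) G x) B) by ring.
      rewrite <- bs_scal. apply bs_ext; intros; ring. }
  assert (C0 : forall i l, ct (fun x => qq (dl L (b l + 1 + i)) G x * (pp (dl L (c l)) F x * h x))) by (intros; ctac).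
  rewrite (RI_bs (fun i x => bs (fun l => qq (dl L (b l + 1 + i)) G x * (pp (dl L (c l)) F x * h x)) n)).
  2:{ intro i. apply (ct_bs (fun l x => qq (dl L (b l + 1 + i)) G x * (pp (dl L (c l)) F x * h x))). auto. }
  letr; [apply bs_abs|]. letr_with (bs (fun _ => 12 * (En P F + En P G)) B).
  - apply bs_le; intros i _. rewrite (RI_bs (fun l x => qq (dl L (b l + 1 + i)) G x * (pp (dl L (c l)) F x * h x))) by auto.
    apply (paraproduct P L F G h c (fun l => (b l + 1 + i)%nat)); auto.
    + intro l; rewrite Hb; lia.
    + intros l Hl; specialize (Hcb l Hl); lia.
  - right. clear; induction B; [simpl; ring|]. rewrite S_INR. simpl. rewrite IHB. ring.
Qed.

Lemma RI_amgm_h P u w h : 0 < P -> ct u -> ct w -> ct h -> (forall x, Rabs (h x) <= 1) ->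
  Rabs (RI (fun x => u x * w x * h x) 0 P) <= / 2 * (En P u + En P w).
Proof.
  intros HP Cu Cw Ch H1. rewrite (RI_ext _ (fun x => u x * (w x * h x))) by (intro; ring).
  letr; [apply (RI_amgm P u (fun x => w x * h x)); auto; ctac|]. assert (En P (fun x => w x * h x) <= En P w); [|lra].
  apply En_le; auto; [ctac|]. intro x. rewrite Rabs_mult.
  rewrite <- (Rmult_1_r (Rabs (w x))) at 2. apply Rmult_le_compat_l; auto. apply Rabs_pos.
Qed.

Lemma RI_bs_h P (u w : nat -> R -> R) h n : 0 < P -> (forall k, ct (u k)) -> (forall k, ct (w k)) -> ct h ->
  (forall x, Rabs (h x) <= 1) ->
  Rabs (RI (fun x => bs (fun k => u k x * w k x) n * h x) 0 P) <=
  / 2 * (bs (fun k => En P (u k)) n + bs (fun k => En P (w k)) n).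
Proof.
  intros HP Cu Cw Ch H1. rewrite (RI_bs_mul (fun k x => u k x * w k x)); auto.
  2:{ intro k; assert (A := Cu k); assert (B := Cw k); ctac. }
  letr; [apply bs_abs|]. rewrite <- bs_plus, <- bs_scal. apply bs_le; intros k _. apply (RI_amgm_h P (u k) (w k) h); auto.
Qed.

Lemma step_mono (a : nat -> nat) A : (1 <= A)%nat -> (forall l, a (S l) = (a l + A)%nat) ->
  forall l, (a l < a (S l))%nat.
Proof. intros HA H l; rewrite H; lia. Qed.

Lemma Rabs_le3 (a b c A B C : R) : Rabs a <= A -> Rabs b <= B -> Rabs c <= C -> Rabs (a - b - c) <= A + B + C.
Proof.
  intros. unfold Rminus. letr; [apply Rabs_triang|]. rewrite Rabs_Ropp.
  assert (Rabs (a + - b) <= A + B); [|lra]. letr; [apply Rabs_triang|]. rewrite Rabs_Ropp. lra.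
Qed.

(** A block is a difference of partial sums, so summation by parts puts the difference on the
    averages of [G]. Replacing the partial sums by averages of the full sum [X] leaves a
    square-summable error and a true paraproduct of [X] and [G]; the condition [a (S l) <= b l]
    ensures that the differenced factor is the finer one. *)
Lemma para1 P L al V F G h (a b : nat -> nat) A B K n : 0 < P -> 0 < L -> 1 <= al -> 0 <= V <= 1 ->
  cper P F -> cper P G -> cper P h -> (forall x, Rabs (h x) <= 1) ->
  (1 <= A)%nat -> (1 <= B)%nat -> (forall l, a (S l) = (a l + A)%nat) -> (forall l, b (S l) = (b l + B)%nat) ->
  (forall l, (l < n)%nat -> (a (S l) <= b l)%nat) ->
  Rabs (RI (fun x => bs (fun l => Ph L al V (a l) (pp (dl L K) F) x * pp (dl L (b l)) G x) n * h x) 0 P)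
  <= 100000 * CU al * INR B ^ 2 * (En P F + En P G).
Proof.
  intros HP HL Hal HV HF HG Hh H1 HA HB Ha Hb Hab.
  assert (CF := proj1 HF). assert (CG := proj1 HG). assert (Ch := proj1 Hh). assert (HC := CU_pos al).
  assert (EF : 0 <= En P F) by (apply En_ge0; auto). assert (EG : 0 <= En P G) by (apply En_ge0; auto).
  assert (HIB : 1 <= INR B) by (apply (le_INR 1); auto). destruct n as [|m].
  { simpl. rewrite (RI_ext _ (fun _ => 0)) by (intro; ring). rewrite RI_const, Rmult_0_r, Rabs_R0.
    repeat apply Rmult_le_pos; lra. } set (u := pp (dl L K) F). assert (Hu : cper P u) by (unfold u; auto with cp).
  set (X := hsum L al V a (S m) u). assert (HX : cper P X) by (unfold X; auto with cp). assert (CX := proj1 HX).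
  assert (Ha' := step_mono a A HA Ha). assert (EX : En P X <= 4096 * CU al * En P F) by (apply hilbert_bound; auto).
  set (R0 := fun l x => hsum L al V a l u x - pp (dl L (a l)) X x). assert (CR : forall l, ct (R0 l)) by (intro; unfold R0; ctac).
  assert (ER := hilbert_remainder P L al V F a K (S m) HP HL Hal HV HF Ha'). fold u in ER. fold X in ER.
  rewrite bs_S in ER. fold (R0 O) in ER. assert (ER0 : 0 <= En P (R0 O)) by (apply En_ge0; auto).
  set (q := fun j x => pp (dl L (b j + B)) G x - pp (dl L (b j)) G x).
  assert (Cq : forall j, ct (q j)) by (intro; unfold q; ctac). assert (Eq := En_pp_diff_sum P L G b B m HP HL HG HB Hb).
  assert (PD := paraproduct_diff P L X G h (fun j => a (S j)) b B m HP HL HX HG Hh H1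
    ltac:(intro; apply Ha') Hb HB ltac:(intros; apply Hab; lia)). set (S1 := fun x => bs (fun j => R0 (S j) x * q j x) m).
  set (S2 := fun x => bs (fun l => (pp (dl L (b l + B)) G x - pp (dl L (b l)) G x) * pp (dl L (a (S l))) X x) m).
  assert (CR' : forall l, ct (R0 (S l))) by (intro; apply CR). assert (C1 : ct S1).
  { apply (ct_bs (fun j x => R0 (S j) x * q j x)). intro j; assert (A1 := CR' j); assert (A2 := Cq j); ctac. }
  assert (C2 : ct S2).
  { apply (ct_bs (fun l x => (pp (dl L (b l + B)) G x - pp (dl L (b l)) G x) * pp (dl L (a (S l))) X x)). intro; ctac. }
  rewrite (RI_ext _ (fun x => X x * pp (dl L (b m)) G x * h x - S1 x * h x - S2 x * h x)).
  - rewrite RI_minus, RI_minus by ctac. letr; [apply Rabs_le3|].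
    + apply (RI_amgm_h P X (pp (dl L (b m)) G) h); auto; ctac.
    + apply (RI_bs_h P (fun j => R0 (S j)) q h); auto.
    + apply PD.
    + assert (Epp := En_pp P (dl L (b m)) G HP (dl_pos _ _ HL) HG).
      change (bs (fun k => En P (R0 (S k))) m) with (bs (fun k => En P (fun x => hsum L al V a (S k) u x - pp (dl L (a (S k))) X x)) m).
      set (e1 := bs (fun k => En P (fun x => hsum L al V a (S k) u x - pp (dl L (a (S k))) X x)) m) in *.
      change (bs (fun k => En P (q k)) m) with (bs (fun l => En P (fun x => pp (dl L (b l + B)) G x - pp (dl L (b l)) G x)) m).
      set (e2 := bs (fun l => En P (fun x => pp (dl L (b l + B)) G x - pp (dl L (b l)) G x)) m) in *. set (z := INR B) in *.
      assert (Z2 : z <= z ^ 2) by nra. assert (K1 : 12 * z * (En P X + En P G) <= 12 * z ^ 2 * (4096 * CU al * En P F + En P G)).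
      { apply Rmult_le_compat; try lra. assert (0 <= En P X) by (apply En_ge0; auto). lra. } assert (Z1 : 1 <= z ^ 2) by lra.
      assert (K2 : CU al * En P F <= CU al * z ^ 2 * En P F).
      { replace (CU al * z ^ 2 * En P F) with (z ^ 2 * (CU al * En P F)) by ring.
        rewrite <- (Rmult_1_l (CU al * En P F)) at 1. apply Rmult_le_compat_r; auto. apply Rmult_le_pos; lra. }
      assert (K3 : z ^ 2 * En P G <= CU al * z ^ 2 * En P G).
      { rewrite Rmult_assoc. rewrite <- (Rmult_1_l (z ^ 2 * En P G)) at 1. apply Rmult_le_compat_r; [|lra].
        apply Rmult_le_pos; lra. } assert (K4 : En P G <= z ^ 2 * En P G).
      { rewrite <- (Rmult_1_l (En P G)) at 1. mul_r; lra. } assert (K0 : 0 <= CU al * z ^ 2 * En P F) by pos.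
      letr_with (/ 2 * (4096 * CU al * En P F + En P G) + / 2 * (40000 * CU al * En P F + z ^ 2 * En P G) +
        12 * z ^ 2 * (4096 * CU al * En P F + En P G)); [lra|].
      replace (12 * z ^ 2 * (4096 * CU al * En P F + En P G)) with (49152 * (CU al * z ^ 2 * En P F) + 12 * (z ^ 2 * En P G)) by ring.
      replace (100000 * CU al * z ^ 2 * (En P F + En P G)) with (100000 * (CU al * z ^ 2 * En P F) + 100000 * (CU al * z ^ 2 * En P G)) by ring.
      lra.
  - intro x. rewrite <- !Rmult_minus_distr_r. f_equal.
    rewrite (bs_ext (fun l => Ph L al V (a l) (pp (dl L K) F) x * pp (dl L (b l)) G x)
       (fun l => (hsum L al V a (1 + l) u x - hsum L al V a l u x) * pp (dl L (b l)) G x)).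
    2:{ intros l _. f_equal. unfold hsum; simpl. unfold u. ring. } change (S m) with (1 + m)%nat.
    rewrite (abel (fun l => hsum L al V a l u x) (fun l => pp (dl L (b l)) G x) m).
    change (hsum L al V a 0 u x) with 0. change (hsum L al V a (1 + m) u x) with (X x).
    assert (AR : bs (fun j => hsum L al V a (1 + j) u x * (pp (dl L (b (1 + j)%nat)) G x - pp (dl L (b j)) G x)) m = S1 x + S2 x).
    { unfold S1, S2. rewrite <- bs_plus. apply bs_ext; intros j _. unfold R0, q. simpl. rewrite Hb. ring. } rewrite AR. ring.
Qed.

(** Summation by parts here puts the difference on the averages of [F], which is the coarser factor.
    Once the partial sums are replaced by averages of the full sum [Y], a second summation by parts
    ([abel2]) moves the difference back to the finer factor, at the cost of the boundary terms [T2]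
    and [T3]. *)
Lemma para2 P L be V F G h (a b : nat -> nat) A B K n : 0 < P -> 0 < L -> 1 <= be -> 0 <= V <= 1 ->
  cper P F -> cper P G -> cper P h -> (forall x, Rabs (h x) <= 1) ->
  (1 <= A)%nat -> (1 <= B)%nat -> (forall l, a (S l) = (a l + A)%nat) -> (forall l, b (S l) = (b l + B)%nat) ->
  (forall l, (l < n)%nat -> (a l <= b l)%nat) ->
  Rabs (RI (fun x => bs (fun l => pp (dl L (a l)) F x * Ph L be V (b l) (pp (dl L K) G) x) n * h x) 0 P)
  <= 100000 * CU be * (INR A ^ 2 + INR B) * (En P F + En P G).
Proof.
  intros HP HL Hbe HV HF HG Hh H1 HA HB Ha Hb Hab.
  assert (CF := proj1 HF). assert (CG := proj1 HG). assert (Ch := proj1 Hh). assert (HC := CU_pos be).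
  assert (EF : 0 <= En P F) by (apply En_ge0; auto). assert (EG : 0 <= En P G) by (apply En_ge0; auto).
  assert (HIB : 1 <= INR B) by (apply (le_INR 1); auto). assert (HIA : 1 <= INR A) by (apply (le_INR 1); auto).
  destruct n as [|m].
  { simpl. rewrite (RI_ext _ (fun _ => 0)) by (intro; ring). rewrite RI_const, Rmult_0_r, Rabs_R0.
    assert (0 <= INR A ^ 2) by pos. repeat apply Rmult_le_pos; lra. }
  set (v := pp (dl L K) G). assert (Hv : cper P v) by (unfold v; auto with cp).
  set (Y := hsum L be V b (S m) v). assert (HY : cper P Y) by (unfold Y; auto with cp).
  assert (Ha' := step_mono a A HA Ha). assert (Hb' := step_mono b B HB Hb).
  assert (EY : En P Y <= 4096 * CU be * En P G) by (apply hilbert_bound; auto).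
  set (R0 := fun l x => hsum L be V b l v x - pp (dl L (b l)) Y x). assert (CR : forall l, ct (R0 l)) by (intro; unfold R0; ctac).
  assert (ER := hilbert_remainder P L be V G b K (S m) HP HL Hbe HV HG Hb'). fold v in ER. fold Y in ER.
  rewrite bs_S in ER. fold (R0 O) in ER. assert (ER0 : 0 <= En P (R0 O)) by (apply En_ge0; auto).
  set (q := fun j x => pp (dl L (a j + A)) F x - pp (dl L (a j)) F x).
  assert (Cq : forall j, ct (q j)) by (intro; unfold q; ctac). assert (Eq := En_pp_diff_sum P L F a A m HP HL HF HA Ha).
  assert (PD := paraproduct_diff P L F Y h a b B m HP HL HF HY Hh H1 Ha' Hb HB ltac:(intros; apply Hab; lia)).
  set (S1 := fun x => bs (fun j => R0 (S j) x * q j x) m).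
  set (S2 := fun x => bs (fun l => (pp (dl L (b l + B)) Y x - pp (dl L (b l)) Y x) * pp (dl L (a l)) F x) m).
  set (T1 := fun x => pp (dl L (a m)) F x * Y x * h x). set (T2 := fun x => pp (dl L (a m)) F x * pp (dl L (b m)) Y x * h x).
  set (T3 := fun x => pp (dl L (a O)) F x * pp (dl L (b O)) Y x * h x).
  assert (CR' : forall l, ct (R0 (S l))) by (intro; apply CR). assert (C1 : ct S1).
  { apply (ct_bs (fun j x => R0 (S j) x * q j x)). intro j; assert (A1 := CR' j); assert (A2 := Cq j); ctac. }
  assert (C2 : ct S2).
  { apply (ct_bs (fun l x => (pp (dl L (b l + B)) Y x - pp (dl L (b l)) Y x) * pp (dl L (a l)) F x)). intro; ctac. }
  assert (D1 : ct T1) by (unfold T1; ctac). assert (D2 : ct T2) by (unfold T2; ctac). assert (D3 : ct T3) by (unfold T3; ctac).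
  rewrite (RI_ext _ (fun x => (T1 x - S1 x * h x - T2 x) + (T3 x + S2 x * h x))).
  - rewrite RI_plus, RI_plus, RI_minus, RI_minus by ctac. letr; [apply Rabs_triang|].
    assert (I1 : Rabs (RI T1 0 P) <= / 2 * (En P (pp (dl L (a m)) F) + En P Y)) by (apply (RI_amgm_h P (pp (dl L (a m)) F) Y h); auto; ctac).
    assert (I2 : Rabs (RI T2 0 P) <= / 2 * (En P (pp (dl L (a m)) F) + En P (pp (dl L (b m)) Y))) by (apply (RI_amgm_h P (pp (dl L (a m)) F) (pp (dl L (b m)) Y) h); auto; ctac).
    assert (I3 : Rabs (RI T3 0 P) <= / 2 * (En P (pp (dl L (a O)) F) + En P (pp (dl L (b O)) Y))) by (apply (RI_amgm_h P (pp (dl L (a O)) F) (pp (dl L (b O)) Y) h); auto; ctac).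
    assert (I4 := RI_bs_h P (fun j => R0 (S j)) q h m HP CR' Cq Ch H1). cbv beta in I4. fold S1 in I4.
    change (bs (fun k => En P (R0 (S k))) m) with (bs (fun k => En P (fun x => hsum L be V b (S k) v x - pp (dl L (b (S k))) Y x)) m) in I4.
    change (bs (fun k => En P (q k)) m) with (bs (fun l => En P (fun x => pp (dl L (a l + A)) F x - pp (dl L (a l)) F x)) m) in I4.
    assert (E1 := En_pp P (dl L (a m)) F HP (dl_pos _ _ HL) HF). assert (E2 := En_pp P (dl L (b m)) Y HP (dl_pos _ _ HL) HY).
    assert (E3 := En_pp P (dl L (a O)) F HP (dl_pos _ _ HL) HF). assert (E4 := En_pp P (dl L (b O)) Y HP (dl_pos _ _ HL) HY).
    assert (J1 := Rabs_le3 _ _ _ _ _ _ I1 I4 I2).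
    assert (J2 : Rabs (RI T3 0 P + RI (fun x => S2 x * h x) 0 P) <= / 2 * (En P (pp (dl L (a O)) F) + En P (pp (dl L (b O)) Y)) + 12 * INR B * (En P F + En P Y)).
    { letr; [apply Rabs_triang|]. apply Rplus_le_compat; auto. }
    set (e1 := bs (fun k => En P (fun x => hsum L be V b (S k) v x - pp (dl L (b (S k))) Y x)) m) in *.
    set (e2 := bs (fun l => En P (fun x => pp (dl L (a l + A)) F x - pp (dl L (a l)) F x)) m) in *.
    set (z := INR B) in *. set (y := INR A ^ 2) in *. assert (Hy : 1 <= y) by (unfold y; nra).
    set (f := En P F) in *. set (g := En P G) in *. set (c := CU be) in *.
    assert (K1 : 12 * z * (f + En P Y) <= 12 * z * (f + 4096 * c * g)).
    { mul_l; lra. } letr_with (/ 2 * (f + 4096 * c * g) + / 2 * (40000 * c * g + y * f) + / 2 * (f + 4096 * c * g) +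
       (/ 2 * (f + 4096 * c * g) + 12 * z * (f + 4096 * c * g))); [letr; [apply Rplus_le_compat; [apply J1 | apply J2] | lra] |].
    assert (P1 : 0 <= c * g) by pos. assert (P2 : c * g <= c * g * z) by (rewrite <- (Rmult_1_r (c * g)) at 1; mul_l; lra).
    assert (P3 : f * 36 <= f * c) by (mul_l; lra).
    assert (P4 : f * c <= f * c * y) by (rewrite <- (Rmult_1_r (f * c)) at 1; mul_l; lra).
    assert (P5 : f * c <= f * c * z) by (rewrite <- (Rmult_1_r (f * c)) at 1; mul_l; lra).
    assert (P6 : y * f * 36 <= y * f * c) by (mul_l; lra). assert (P7 : z * f * 36 <= z * f * c) by (mul_l; lra).
    assert (P8 : 0 <= c * g * y) by pos. lra.
  - intro x. unfold T1, T2, T3.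
    replace (pp (dl L (a m)) F x * Y x * h x - S1 x * h x - pp (dl L (a m)) F x * pp (dl L (b m)) Y x * h x +
      (pp (dl L (a O)) F x * pp (dl L (b O)) Y x * h x + S2 x * h x)) with
      ((pp (dl L (a m)) F x * Y x - S1 x - pp (dl L (a m)) F x * pp (dl L (b m)) Y x +
      (pp (dl L (a O)) F x * pp (dl L (b O)) Y x + S2 x)) * h x) by ring. f_equal.
    rewrite (bs_ext (fun l => pp (dl L (a l)) F x * Ph L be V (b l) (pp (dl L K) G) x)
       (fun l => (hsum L be V b (1 + l) v x - hsum L be V b l v x) * pp (dl L (a l)) F x)).
    2:{ intros l _. unfold hsum; simpl. unfold v. ring. } change (S m) with (1 + m)%nat.
    rewrite (abel (fun l => hsum L be V b l v x) (fun l => pp (dl L (a l)) F x) m).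
    change (hsum L be V b 0 v x) with 0. change (hsum L be V b (1 + m) v x) with (Y x).
    assert (AB : bs (fun j => pp (dl L (b (1 + j)%nat)) Y x * (pp (dl L (a (1 + j)%nat)) F x - pp (dl L (a j)) F x)) m =
      pp (dl L (b m)) Y x * pp (dl L (a m)) F x - pp (dl L (b O)) Y x * pp (dl L (a O)) F x - S2 x).
    { rewrite (abel2 (fun l => pp (dl L (b l)) Y x) (fun l => pp (dl L (a l)) F x)). f_equal.
      unfold S2. apply bs_ext; intros j _. simpl. rewrite Hb. ring. }
    assert (AR : bs (fun j => hsum L be V b (1 + j) v x * (pp (dl L (a (1 + j)%nat)) F x - pp (dl L (a j)) F x)) m =
      S1 x + bs (fun j => pp (dl L (b (1 + j)%nat)) Y x * (pp (dl L (a (1 + j)%nat)) F x - pp (dl L (a j)) F x)) m).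
    { unfold S1. rewrite <- bs_plus. apply bs_ext; intros j _. unfold R0, q. simpl. rewrite Ha. ring. } rewrite AR, AB. ring.
Qed.
End Paraproducts.
Import Paraproducts.

(** * The core estimate for an abstract curve *)

Module CoreEstimate.
Implicit Types f g : R -> R.

Lemma D_eq (f : R -> R) (x l l' : R) : is_derive f x l -> l = l' -> is_derive f x l'.
Proof. intros H <-; auto. Qed.
Lemma D_mult (f g : R -> R) (x l l' : R) : is_derive f x l -> is_derive g x l' ->
  is_derive (fun x => f x * g x) x (l * g x + f x * l').
Proof. intros Hf Hg; apply (is_derive_mult f g x l l' Hf Hg); intros; apply Rmult_comm. Qed.
Lemma D_plus (f g : R -> R) (x l l' : R) : is_derive f x l -> is_derive g x l' ->
  is_derive (fun x => f x + g x) x (l + l').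
Proof. intros Hf Hg; apply (is_derive_plus f g x l l' Hf Hg). Qed.
Lemma D_minus (f g : R -> R) (x l l' : R) : is_derive f x l -> is_derive g x l' ->
  is_derive (fun x => f x - g x) x (l - l').
Proof. intros Hf Hg; apply (is_derive_minus f g x l l' Hf Hg). Qed.
Lemma D_comp (f g : R -> R) (x l l' : R) : is_derive f (g x) l -> is_derive g x l' ->
  is_derive (fun x => f (g x)) x (l' * l).
Proof. intros Hf Hg; apply (is_derive_comp f g x l l' Hf Hg). Qed.
Lemma D_const (c x : R) : is_derive (fun _ => c) x 0.
Proof. apply (is_derive_const c x). Qed.
Lemma D_id (x : R) : is_derive (fun x => x) x 1.
Proof. apply (is_derive_id x). Qed.
Lemma D_scal (f : R -> R) (k x l : R) : is_derive f x l -> is_derive (fun x => k * f x) x (k * l).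
Proof. intros Hf; apply (is_derive_scal f x k l Hf). Qed.

Lemma D_opp (f : R -> R) (x l : R) : is_derive f x l -> is_derive (fun x => - f x) x (- l).
Proof. intros Hf; apply (is_derive_opp f x l Hf). Qed.

(** Compact support lets integrals over [[-D, D]] be translated as if they were over the line. *)
Definition csup (R0 : R) f : Prop := forall x, R0 < Rabs x -> f x = 0.

Lemma RI_zero f a b : a <= b -> (forall x, a < x < b -> f x = 0) -> RI f a b = 0.
Proof.
  intros Hab H. transitivity (RI (fun _ => 0) a b); [|rewrite RI_const; ring].
  unfold RI; apply RInt_ext. rewrite Rmin_left, Rmax_right by auto. auto.
Qed.

Lemma RI_refl f z u v : u <= v -> ct f -> RI (fun d => f (z - d)) u v = RI f (z - v) (z - u).
Proof.
  intros H C. transitivity (- RI (fun d => -1 * f (z - d)) u v).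
  - rewrite <- RI_opp by ctac. apply RI_ext; intro; ring.
  - rewrite (RI_comp f (fun d => z - d) (fun _ => -1)); [symmetry; apply RI_swap; auto|auto|auto|ctac|].
    intros; auto_derive; auto; ring.
Qed.

Lemma csup_enlarge f R0 a b A B : ct f -> csup R0 f -> A <= a -> b <= B -> a <= - R0 -> R0 <= b -> a <= b ->
  RI f A B = RI f a b.
Proof.
  intros C H HA HB Ha Hb Hab. rewrite <- (RI_chasles f A a B), <- (RI_chasles f a b B) by auto.
  rewrite (RI_zero f A a), (RI_zero f b B); auto; [lra| |].
  - intros x Hx; apply H. unfold Rabs; destruct (Rcase_abs x); lra.
  - intros x Hx; apply H. unfold Rabs; destruct (Rcase_abs x); lra.
Qed.

Lemma J_shift f R0 D y : 0 <= R0 -> ct f -> csup R0 f -> R0 + Rabs y <= D ->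
  RI (fun x => f (x + y)) (- D) D = RI f (- D) D.
Proof.
  intros HR C H Hy. rewrite RI_shift by auto. assert (Hy2 := Rle_abs y). assert (Hy3 := Rle_abs (- y)). rewrite Rabs_Ropp in Hy3.
  rewrite (csup_enlarge f R0 (- R0) R0 (- D + y) (D + y)) by (auto; lra).
  rewrite (csup_enlarge f R0 (- R0) R0 (- D) D) by (auto; lra). auto.
Qed.

Lemma RI_RI_sq (u : R -> R -> R) a b A B : a <= b -> A <= B -> ct2 u ->
  RI (fun x => RI (u x) a b ^ 2) A B <= (b - a) * RI (fun s => RI (fun x => u x s ^ 2) A B) a b.
Proof.
  intros Hab HAB C. rewrite <- (fubini (fun x s => u x s ^ 2)) by (auto; ctac). rewrite <- RI_scal by ctac.
  ri_le; intros x _. apply RI_jensen; auto; ctac.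
Qed.

(** An explicit primitive of [g - av sig g]: convolution with a decreasing ramp on [[0, sig]]. It
    keeps compact support and gains a factor [sig] in norm. *)
Definition Kg (sig : R) g (z : R) : R := RI (fun d => (1 - d / sig) * g (z - d)) 0 sig.

Lemma Kg_deriv sig g (z : R) : 0 < sig -> ct g -> is_derive (Kg sig g) z (g z - av sig g z).
Proof.
  intros Hs C. set (G := fun z => RI g 0 z). assert (DG : forall z, is_derive G z (g z)) by (intro; apply RI_prim; auto).
  assert (CG : ct G) by (intro u; apply (ex_derive_continuous G u); eexists; apply DG).
  assert (Q : forall t : R, G t - av sig G t = Kg sig g t).
  { intro t. unfold Kg.
    rewrite (RI_parts (fun d => 1 - d / sig) (fun d => - G (t - d)) (fun _ => - / sig) (fun d => g (t - d)) 0 sig);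
      [|lra|ctac|ctac|ctac|ctac| |].
    - unfold av. rewrite (RI_ext (fun d => - / sig * - G (t - d)) (fun d => / sig * G (t - d))) by (intro; ring).
      rewrite RI_scal by ctac. rewrite Rminus_0_r. field. lra.
    - intros x _. auto_derive; auto. field; lra.
    - intros x _. eapply D_eq.
      + apply (D_opp (fun d => G (t - d))). apply (D_comp G (fun d => t - d)); [apply DG|].
        apply D_minus; [apply D_const|apply D_id].
      + ring. } apply (is_derive_ext _ _ z _ Q). apply (D_minus G (av sig G)); auto. eapply D_eq; [apply av_deriv; auto|].
  unfold G. rewrite av_RI by auto. rewrite <- (RI_chasles g (z - sig) 0 z), (RI_swap g 0 (z - sig)) by auto. field; lra.
Qed.

Lemma Kg_norm sig g R0 D : 0 < sig -> 0 <= R0 -> ct g -> csup R0 g -> R0 + sig <= D ->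
  RI (fun z => Kg sig g z ^ 2) (- D) D <= sig ^ 2 * RI (fun z => g z ^ 2) (- D) D.
Proof.
  intros Hs HR C H HD. unfold Kg. letr; [apply (RI_RI_sq (fun z d => (1 - d / sig) * g (z - d))); [lra|lra|ctac]|].
  letr_with ((sig - 0) * RI (fun _ => RI (fun z => g z ^ 2) (- D) D) 0 sig).
  2:{ rewrite RI_const. right; ring. } mul_l. ri_le. intros d Hd. letr_with (RI (fun z => g (z + - d) ^ 2) (- D) D).
  - ri_le. intros z _. unfold Rminus at 2. rewrite Rpow_mult_distr. rewrite <- (Rmult_1_l (g (z + - d) ^ 2)) at 2. mul_r.
    assert (0 <= d / sig <= 1).
    { split; [pos|]. apply Rmult_le_reg_r with sig; auto. field_simplify; lra. } nra.
  - right. apply (J_shift (fun z => g z ^ 2) R0); auto; [ctac| |].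
    + intros x Hx; rewrite H; auto; ring.
    + rewrite Rabs_Ropp, Rabs_right; lra.
Qed.

Lemma av_norm sig g R0 D : 0 < sig -> 0 <= R0 -> ct g -> csup R0 g -> R0 + sig <= D ->
  RI (fun z => av sig g z ^ 2) (- D) D <= RI (fun z => g z ^ 2) (- D) D.
Proof.
  intros Hs HR C H HD. rewrite (RI_ext _ (fun z => (/ sig) ^ 2 * RI (fun d => g (z - d)) 0 sig ^ 2)) by (intro; unfold av; ring).
  rewrite RI_scal by ctac. letr_with ((/ sig) ^ 2 * ((sig - 0) * RI (fun _ => RI (fun z => g z ^ 2) (- D) D) 0 sig)).
  2:{ rewrite RI_const. right; field; lra. } mul_l. letr; [apply (RI_RI_sq (fun z d => g (z - d))); [lra|lra|ctac]|].
  mul_l. ri_le. intros d Hd. right. apply (J_shift (fun z => g z ^ 2) R0 D (- d)); auto; [ctac| |].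
  + intros x Hx; rewrite H; auto; ring.
  + rewrite Rabs_Ropp, Rabs_right; lra.
Qed.

Lemma csup_av sig g R0 : 0 < sig -> csup R0 g -> csup (R0 + sig) (av sig g).
Proof.
  intros Hs H x Hx. unfold av. rewrite (RI_zero (fun y => g (x - y))); [ring|lra|].
  intros y Hy. apply H. assert (Rabs x <= Rabs (x - y) + Rabs y).
  { replace x with ((x - y) + y) at 1 by ring. apply Rabs_triang. } rewrite (Rabs_right y) in H0; lra.
Qed.
Lemma csup_Kg sig g R0 : 0 < sig -> csup R0 g -> csup (R0 + sig) (Kg sig g).
Proof.
  intros Hs H x Hx. unfold Kg. apply RI_zero; [lra|]. intros y Hy. rewrite H; [ring|]. assert (Rabs x <= Rabs (x - y) + Rabs y).
  { replace x with ((x - y) + y) at 1 by ring. apply Rabs_triang. } rewrite (Rabs_right y) in H0; lra.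
Qed.

Lemma amgm_t (a b t : R) : 0 < t -> Rabs (a * b) <= / 2 * (t * a ^ 2 + / t * b ^ 2).
Proof.
  intro Ht. assert (Hi : 0 < / t) by pos. assert (K : t * / t = 1) by (field; lra). assert (0 <= / t * (t * a - b) ^ 2) by pos.
  assert (0 <= / t * (t * a + b) ^ 2) by pos.
  replace (/ t * (t * a - b) ^ 2) with (t * (t * / t) * a ^ 2 - 2 * (t * / t) * (a * b) + / t * b ^ 2) in H by ring.
  replace (/ t * (t * a + b) ^ 2) with (t * (t * / t) * a ^ 2 + 2 * (t * / t) * (a * b) + / t * b ^ 2) in H0 by ring.
  rewrite K in *. apply Rabs_le. lra.
Qed.

(** The form [XX] comes from squaring an integral in [s]: [a] is the difference of two values of
    [s], [be a s] the displacement between the two copies of [g], [th s] the position where they are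
    read. The function [ta] makes [- a d_a + ta d_s] annihilate [be], and [psi] inverts [bes] up to
    the factor [a]. The parameter [r] is the width of the cut-off [chi], [sig] the scale of the
    splitting in [z], [rho] the threshold for a small speed [vd], [al1 <= al0] are thresholds for
    [a], and [eta] is the size of the [b]-primitive [Gam1]. *)
Section Core.
Context (s0 s1 C1 cb c0 bm R0 D sig r rho al0 al1 eta Mphi : R).
Context (th th' th'' chi chi' f : R -> R).
Context (be bea bes ta taa tas psi psis Gam Gamb Gam1 : R -> R -> R).
Notation c := (s1 - s0).
Context (Hs : s0 < s1) (HC1 : 1 <= C1) (Hcb : 0 < cb) (Hc0 : 0 < c0) (HR0 : 0 <= R0)
  (Hsig : 0 < sig <= 1) (Hr : 0 < r <= 1) (Hrho : 0 < rho <= 1) (Hal : 0 < al1 <= al0) (Hal0 : al0 <= c)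
  (Heta : 0 < eta) (HD : R0 + 1 + 2 * C1 + c <= D).
Context (Cth : ct th) (Cth' : ct th') (Cth'' : ct th'') (Cchi : ct chi) (Cchi' : ct chi') (Cf : ct f)
  (Cbe : ct2 be) (Cbea : ct2 bea) (Cbes : ct2 bes) (Cta : ct2 ta) (Ctaa : ct2 taa) (Ctas : ct2 tas)
  (Cpsi : ct2 psi) (Cpsis : ct2 psis) (CG : ct2 Gam) (CGb : ct2 Gamb) (CG1 : ct2 Gam1).
Definition dom (a s : R) : Prop := al1 <= a <= c /\ s0 <= s <= s1.
Context (Dbea : forall a s, dom a s -> is_derive (fun a => be a s) a (bea a s))
  (Dbes : forall a s, dom a s -> is_derive (fun s => be a s) s (bes a s))
  (Dtaa : forall a s, dom a s -> is_derive (fun a => ta a s) a (taa a s))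
  (Dtas : forall a s, dom a s -> is_derive (fun s => ta a s) s (tas a s))
  (Dpsis : forall a s, dom a s -> is_derive (fun s => psi a s) s (psis a s))
  (Dth : forall s, s0 <= s <= s1 -> is_derive th s (th' s))
  (Dth' : forall s, s0 <= s <= s1 -> is_derive th' s (th'' s))
  (Dchi : forall s, is_derive chi s (chi' s)).
Context (Hta : forall a s, dom a s -> a * bea a s = ta a s * bes a s)
  (Hpsi : forall a s, dom a s -> psi a s * bes a s = a)
  (Bbe : forall a s, dom a s -> 0 <= be a s <= bm)
  (Bbea : forall a s, dom a s -> cb <= bea a s)
  (Bta : forall a s, dom a s -> Rabs (ta a s) <= C1) (Btas : forall a s, dom a s -> Rabs (tas a s) <= C1)
  (Btaa : forall a s, dom a s -> Rabs (a * taa a s) <= C1)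
  (Bpsi : forall a s, dom a s -> Rabs (psi a s) <= C1) (Bpsis : forall a s, dom a s -> Rabs (psis a s) <= C1)
  (Bth : forall s, s0 <= s <= s1 -> Rabs (th s) <= C1)
  (Bth' : forall s, s0 <= s <= s1 -> Rabs (th' s) <= C1)
  (Bth'' : forall s, s0 <= s <= s1 -> Rabs (th'' s) <= C1)
  (Hmono : forall a s s', dom a s -> dom a s' -> c0 * Rabs (s - s') <= Rabs (th' s' * ta a s' - th' s * ta a s)).
Context (chi01 : forall s, 0 <= chi s <= 1) (Bchi' : forall s, Rabs (chi' s) <= C1 / r)
  (chi_l : forall s, s <= s0 -> chi s = 0) (chi_r : forall s, s1 <= s -> chi s = 0).
Context (DGb : forall b z, is_derive (fun b => Gam b z) b (Gamb b z))
  (DG1 : forall b z, is_derive (fun b => Gam1 b z) b (Gam b z))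
  (SG : forall b, csup R0 (Gam b)) (SG1 : forall b, csup R0 (Gam1 b)) (Sf : csup R0 f).
Notation J F := (RI F (- D) D).
Definition phi (b : R) : R := J (fun z => Gam b z ^ 2).
Definition phi1 (b : R) : R := J (fun z => Gam1 b z ^ 2).
Context (NG : RI phi 0 bm <= 1) (NG1 : RI phi1 0 bm <= eta ^ 2)
  (NGL : forall b, 0 <= b <= bm -> J (fun z => Rabs (Gam b z)) <= 1)
  (Hphi : forall b, 0 <= b <= bm -> phi b <= Mphi)
  (Nf : J (fun y => f y ^ 2) <= 1).

Let Hc : 0 < c. Proof. lra. Qed.
Let HDp : - D <= D. Proof. lra. Qed.

Lemma ct_phi : ct phi. Proof. unfold phi; ctac. Qed.
Lemma ct_phi1 : ct phi1. Proof. unfold phi1; ctac. Qed.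
#[local] Hint Resolve ct_phi ct_phi1 : ctdb.
Lemma phi_ge0 b : 0 <= phi b.
Proof. apply RI_ge0; [auto|ctac|intros; apply pow2_ge_0]. Qed.
Lemma phi1_ge0 b : 0 <= phi1 b.
Proof. apply RI_ge0; [auto|ctac|intros; apply pow2_ge_0]. Qed.

(* Substitution [b = be a s] at fixed [s]; the Jacobian is at least [cb], so no weight [1/a] is lost. *)
Lemma subst_a (ph : R -> R) s : ct ph -> (forall b, 0 <= ph b) -> s0 <= s <= s1 ->
  RI (fun a => ph (be a s)) al1 c <= / cb * RI ph 0 bm.
Proof.
  intros Cp Hp Hss. assert (D1 : dom al1 s) by (split; lra). assert (D2 : dom c s) by (split; lra).
  assert (Q : RI (fun a => bea a s * ph (be a s)) al1 c = RI ph (be al1 s) (be c s)).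
  { apply (RI_comp ph (fun a => be a s) (fun a => bea a s)); [lra|auto|apply (ct2_col bea); auto|].
    intros a Ha; apply Dbea; split; lra. } assert (B1 := Bbe al1 s D1). assert (B2 := Bbe c s D2).
  assert (Hle : be al1 s <= be c s).
  { assert (RI (fun a => bea a s) al1 c = be c s - be al1 s).
    { apply (RI_ftc (fun a => be a s)); [lra|apply (ct2_col bea); auto|]. intros a Ha; apply Dbea; split; lra. }
    assert (0 <= RI (fun a => bea a s) al1 c); [|lra].
    apply RI_ge0; [lra|apply (ct2_col bea); auto|]. intros a Ha. assert (cb <= bea a s) by (apply Bbea; split; lra). lra. }
  assert (M : RI ph (be al1 s) (be c s) <= RI ph 0 bm) by (apply RI_mono; auto; lra). apply Rmult_le_reg_l with cb; auto.
  replace (cb * (/ cb * RI ph 0 bm)) with (RI ph 0 bm) by (field; lra).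
  rewrite <- RI_scal by ctac. letr; [|apply M]. rewrite <- Q. ri_le. intros a Ha. mul_r; auto. apply Bbea; split; lra.
Qed.

(** [kf] is the part of [Gam] of high frequency in [z], [Kf] its [z]-primitive; [kb] and [Kb] are
    the [b]-derivatives of the two. *)
Definition kf (b z : R) : R := Gam b z - av sig (Gam b) z.
Definition Kf (b z : R) : R := Kg sig (Gam b) z.
Definition kb (b z : R) : R := Gamb b z - av sig (Gamb b) z.
Definition Kb (b z : R) : R := Kg sig (Gamb b) z.
Lemma ct_kf : ct2 kf. Proof. unfold kf, av; ctac. Qed.
Lemma ct_Kf : ct2 Kf. Proof. unfold Kf, Kg; ctac. Qed.
Lemma ct_kb : ct2 kb. Proof. unfold kb, av; ctac. Qed.
Lemma ct_Kb : ct2 Kb. Proof. unfold Kb, Kg; ctac. Qed.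
#[local] Hint Resolve ct_kf ct_Kf ct_kb ct_Kb : ctdb.

Lemma kf_b b z : is_derive (fun b => kf b z) b (kb b z).
Proof.
  unfold kf, kb. apply (D_minus (fun b => Gam b z) (fun b => av sig (Gam b) z)); auto.
  unfold av. apply (D_scal (fun b => RI (fun y => Gam b (z - y)) 0 sig)).
  apply (RI_deriv (fun b y => Gam b (z - y)) (fun b y => Gamb b (z - y))); [ctac|ctac|auto].
Qed.
Lemma Kf_b b z : is_derive (fun b => Kf b z) b (Kb b z).
Proof.
  unfold Kf, Kb, Kg.
  apply (RI_deriv (fun b d => (1 - d / sig) * Gam b (z - d)) (fun b d => (1 - d / sig) * Gamb b (z - d))); [ctac|ctac|].
  intros u d. apply (D_scal (fun b => Gam b (z - d))); auto.
Qed.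
Lemma Kf_z b z : is_derive (Kf b) z (kf b z).
Proof. apply Kg_deriv; [lra|]. apply ct2_row; auto. Qed.
Lemma csup_kf b : csup (R0 + 1) (kf b).
Proof. intros x Hx. unfold kf. rewrite SG by lra. rewrite (csup_av sig (Gam b) R0); [ring|lra|auto|lra]. Qed.
Lemma csup_Kf b : csup (R0 + 1) (Kf b).
Proof. intros x Hx. apply (csup_Kg sig (Gam b) R0); [lra|auto|lra]. Qed.

Lemma kf_norm b : J (fun z => kf b z ^ 2) <= 4 * phi b.
Proof.
  assert (A := av_norm sig (Gam b) R0 D ltac:(lra) HR0 (ct2_row _ b CG) (SG b) ltac:(lra)). fold (phi b) in A. unfold kf.
  letr_with (J (fun z => 2 * Gam b z ^ 2 + 2 * av sig (Gam b) z ^ 2)).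
  - assert (Cr := ct2_row _ b CG). ri_le. intros z _. assert (0 <= (Gam b z + av sig (Gam b) z) ^ 2) by pos. lra.
  - assert (Cr := ct2_row _ b CG). rewrite RI_plus, !RI_scal by ctac. fold (phi b). lra.
Qed.
Lemma Kf_norm b : J (fun z => Kf b z ^ 2) <= sig ^ 2 * phi b.
Proof. apply (Kg_norm sig (Gam b) R0 D); auto; [lra|apply ct2_row; auto|lra]. Qed.

Lemma J_shift_sq (h : R -> R) y : ct h -> csup (R0 + 1) h -> Rabs y <= 2 * C1 ->
  J (fun z => h (z + y) ^ 2) = J (fun z => h z ^ 2).
Proof. intros Ch Hh Hy. apply (J_shift (fun z => h z ^ 2) (R0 + 1)); [lra|ctac| |lra]. intros x Hx; rewrite Hh; auto; ring. Qed.

Lemma th_diff s s' : s0 <= s <= s1 -> s0 <= s' <= s1 -> Rabs (th s' - th s) <= 2 * C1.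
Proof.
  intros H H'. unfold Rminus. letr; [apply Rabs_triang|]. rewrite Rabs_Ropp. assert (A := Bth s H). assert (B := Bth s' H'). lra.
Qed.

(* The field [- a d_a + ta a s d_s + ta a s' d_s'] kills [be a s] and [be a s'], and sends [th s' - th s] to [vd s s' a]. *)
Definition vd (s s' a : R) : R := th' s' * ta a s' - th' s * ta a s.
(** The kernel that appears when the [s]-integral of [kf] is squared. In [ee] one factor is replaced
    by its primitive; the vector field is applied to [ee] to recover the integrand of [Lk]. *)
Definition Lk (s s' a : R) : R := J (fun y => kf (be a s) y * kf (be a s') (y + (th s' - th s))).
Definition ee (s s' a y : R) : R := kf (be a s) y * Kf (be a s') (y + (th s' - th s)).
Lemma ct_vd : ct3 vd. Proof. unfold vd; ctac. Qed.
Lemma ct_Lk : ct3 Lk. Proof. unfold Lk; ctac. Qed.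
Lemma ct_ee : ct4 ee. Proof. unfold ee; ctac. Qed.
#[local] Hint Resolve ct_vd ct_Lk ct_ee : ctdb.

Lemma Lk_bound a s s' : dom a s -> dom a s' -> Rabs (Lk s s' a) <= 2 * phi (be a s) + 2 * phi (be a s').
Proof.
  intros Hd Hd'. unfold Lk. assert (A := ct_kf). assert (Ck : forall b, ct (kf b)) by (intro; apply ct2_row; auto).
  letr; [apply RI_abs; [auto|ctac]|].
  letr_with (J (fun y => / 2 * kf (be a s) y ^ 2 + / 2 * kf (be a s') (y + (th s' - th s)) ^ 2)).
  - ri_le. intros y _. letr; [apply (amgm_t _ _ 1); lra|]. rewrite Rinv_1. lra.
  - rewrite RI_plus, !RI_scal by ctac.
    rewrite (J_shift_sq (kf (be a s'))); [|apply Ck|apply csup_kf|apply th_diff; [apply Hd|apply Hd']].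
    assert (B1 := kf_norm (be a s)). assert (B2 := kf_norm (be a s')). lra.
Qed.

(** The weight [sig] balances [kf] against its primitive [Kf], which is smaller by that factor. *)
Lemma ee_bound a s s' : dom a s -> dom a s' ->
  J (fun y => Rabs (ee s s' a y)) <= 2 * sig * (phi (be a s) + phi (be a s')).
Proof.
  intros Hd Hd'. unfold ee. assert (B := ct_Kf). assert (CK : forall b, ct (Kf b)) by (intro; apply ct2_row; auto).
  letr_with (J (fun y => / 2 * sig * kf (be a s) y ^ 2 + / 2 * / sig * Kf (be a s') (y + (th s' - th s)) ^ 2)).
  - ri_le. intros y _. letr; [apply (amgm_t _ _ sig); lra|]. lra.
  - rewrite RI_plus, (RI_scal (fun y => kf (be a s) y ^ 2)), (RI_scal (fun y => Kf (be a s') (y + (th s' - th s)) ^ 2)) by ctac.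
    rewrite (J_shift_sq (Kf (be a s'))); [|apply CK|apply csup_Kf|apply th_diff; [apply Hd|apply Hd']].
    assert (B1 := kf_norm (be a s)). assert (B2 := Kf_norm (be a s')). assert (P1 := phi_ge0 (be a s')).
    assert (/ 2 * / sig * J (fun z => Kf (be a s') z ^ 2) <= / 2 * sig * phi (be a s')).
    { letr_with (/ 2 * / sig * (sig ^ 2 * phi (be a s'))); [|right; field; lra].
      apply Rmult_le_compat_l; auto. apply Rmult_le_pos; [lra|]. left; apply Rinv_0_lt_compat; lra. }
    assert (/ 2 * sig * J (fun z => kf (be a s) z ^ 2) <= / 2 * sig * (4 * phi (be a s))).
    { apply Rmult_le_compat_l; auto. lra. } assert (0 <= sig * phi (be a s')) by pos. lra.
Qed.

Definition w4 (s s' a : R) : R := chi s * chi (s + a) * (chi s' * chi (s' + a)).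
(** A regularised [1 / v]: the identity [1 = rho^2 / (v^2 + rho^2) + v * gq v] separates the pairs
    with small speed from those where the speed can be factored out. *)
Definition gq (v : R) : R := v / (v ^ 2 + rho ^ 2).
Definition gq' (v : R) : R := (rho ^ 2 - v ^ 2) / (v ^ 2 + rho ^ 2) ^ 2.
Lemma den_pos v : 0 < v ^ 2 + rho ^ 2.
Proof. assert (0 <= v ^ 2) by pos. assert (0 < rho ^ 2) by pos. lra. Qed.
Lemma ct_gq : ct gq.
Proof. unfold gq. apply ct_div; [ctac|ctac|]. intro v; assert (H := den_pos v); lra. Qed.
Lemma ct_gq' : ct gq'.
Proof. unfold gq'. apply ct_div; [ctac|ctac|]. intro v; assert (H := den_pos v). apply pow_nonzero; lra. Qed.
#[local] Hint Resolve ct_gq ct_gq' : ctdb.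
Lemma gq_deriv v : is_derive gq v (gq' v).
Proof. assert (H := den_pos v). unfold gq, gq'. auto_derive; [lra|]. field; lra. Qed.
Lemma gq_bound v : Rabs (gq v) <= / rho.
Proof.
  assert (H := den_pos v). unfold gq. unfold Rdiv. rewrite Rabs_mult, (Rabs_right (/ _)) by pos.
  apply Rmult_le_reg_r with (v ^ 2 + rho ^ 2); auto. rewrite Rmult_assoc, Rinv_l, Rmult_1_r by lra.
  apply Rmult_le_reg_l with rho; [lra|]. rewrite <- Rmult_assoc, Rinv_r, Rmult_1_l by lra. rewrite <- (pow2_abs v). nra.
Qed.
Lemma gq'_bound v : Rabs (gq' v) <= / rho ^ 2.
Proof.
  assert (H := den_pos v). assert (Hr2 : 0 < rho ^ 2) by pos.
  unfold gq'. unfold Rdiv. rewrite Rabs_mult, (Rabs_right (/ _)) by pos. assert (0 <= v ^ 2) by pos.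
  apply Rmult_le_reg_r with ((v ^ 2 + rho ^ 2) ^ 2); [pos|]. rewrite Rmult_assoc, Rinv_l, Rmult_1_r by (apply pow_nonzero; lra).
  apply Rmult_le_reg_l with (rho ^ 2); auto. rewrite <- Rmult_assoc, Rinv_r, Rmult_1_l by lra.
  assert (Rabs (rho ^ 2 - v ^ 2) <= rho ^ 2 + v ^ 2) by (apply Rabs_le; lra). nra.
Qed.

Definition uu (s s' a : R) : R := w4 s s' a * gq (vd s s' a).
(** [ca] and [cs] are the derivatives, in [a] and in [s], of the coefficients [a * uu] and
    [uu * ta]; they remain after the vector field has been integrated by parts. *)
Definition ca (s s' a : R) : R :=
  uu s s' a + (chi s * chi s' * (chi' (s + a) * chi (s' + a) + chi (s + a) * chi' (s' + a)) * a * gq (vd s s' a)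
    + w4 s s' a * gq' (vd s s' a) * (th' s' * (a * taa a s') - th' s * (a * taa a s))).
Definition cs (s s' a : R) : R :=
  ((chi' s * chi (s + a) + chi s * chi' (s + a)) * (chi s' * chi (s' + a)) * gq (vd s s' a)
    - w4 s s' a * gq' (vd s s' a) * (th'' s * ta a s + th' s * tas a s)) * ta a s + uu s s' a * tas a s.
Lemma ct_w4 : ct3 w4. Proof. unfold w4; ctac. Qed.
#[local] Hint Resolve ct_w4 : ctdb.
Lemma ct_uu : ct3 uu. Proof. unfold uu; ctac. Qed.
#[local] Hint Resolve ct_uu : ctdb.
Lemma ct_ca : ct3 ca.
Proof. unfold ca; ctac. Qed.
Lemma ct_cs : ct3 cs.
Proof. unfold cs; ctac. Qed.
#[local] Hint Resolve ct_ca ct_cs : ctdb.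

Lemma chi_shift (a s : R) : is_derive (fun a => chi (s + a)) a (chi' (s + a)).
Proof. eapply D_eq; [apply (D_comp chi (fun a => s + a)); [apply Dchi|apply D_plus; [apply D_const|apply D_id]]|]. ring. Qed.
Lemma chi_shift' (a s : R) : is_derive (fun s => chi (s + a)) s (chi' (s + a)).
Proof. eapply D_eq; [apply (D_comp chi (fun s => s + a)); [apply Dchi|apply D_plus; [apply D_id|apply D_const]]|]. ring. Qed.

Lemma ca_deriv a s s' : dom a s -> dom a s' -> is_derive (fun a => a * uu s s' a) a (ca s s' a).
Proof.
  intros Hd Hd'. unfold uu, w4. assert (Dv : is_derive (fun a => vd s s' a) a (th' s' * taa a s' - th' s * taa a s)).
  { unfold vd. apply (D_minus (fun a => th' s' * ta a s') (fun a => th' s * ta a s)).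
    - apply (D_scal (fun a => ta a s')); auto.
    - apply (D_scal (fun a => ta a s)); auto. } eapply D_eq.
  - apply (D_mult (fun a => a)); [apply D_id|].
    apply (D_mult (fun a => chi s * chi (s + a) * (chi s' * chi (s' + a))) (fun a => gq (vd s s' a))).
    + apply (D_mult (fun a => chi s * chi (s + a)) (fun a => chi s' * chi (s' + a))).
      * apply (D_scal (fun a => chi (s + a))), chi_shift.
      * apply (D_scal (fun a => chi (s' + a))), chi_shift.
    + apply (D_comp gq (fun a => vd s s' a)); [apply gq_deriv|apply Dv].
  - unfold ca, uu, w4. ring.
Qed.

Lemma cs_deriv a s s' : dom a s -> is_derive (fun s => uu s s' a * ta a s) s (cs s s' a).
Proof.
  intros Hd. unfold uu, w4. assert (Dv : is_derive (fun s => vd s s' a) s (0 - (th'' s * ta a s + th' s * tas a s))).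
  { unfold vd. apply (D_minus (fun s => th' s' * ta a s') (fun s => th' s * ta a s)); [apply D_const|].
    apply (D_mult th' (fun s => ta a s)); [apply Dth'; apply Hd|auto]. } eapply D_eq.
  - apply (D_mult (fun s => chi s * chi (s + a) * (chi s' * chi (s' + a)) * gq (vd s s' a)) (fun s => ta a s)); [|apply Dtas; auto].
    apply (D_mult (fun s => chi s * chi (s + a) * (chi s' * chi (s' + a))) (fun s => gq (vd s s' a))).
    + apply (D_mult (fun s => chi s * chi (s + a)) (fun _ => chi s' * chi (s' + a))); [|apply D_const].
      apply (D_mult chi (fun s => chi (s + a))); [apply Dchi|apply chi_shift'].
    + apply (D_comp gq (fun s => vd s s' a)); [apply gq_deriv|apply Dv].
  - unfold cs, uu, w4. ring.
Qed.

Lemma uu_antisym s s' a : uu s' s a = - uu s s' a.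
Proof.
  unfold uu, w4. assert (V : vd s' s a = - vd s s' a) by (unfold vd; ring). rewrite V.
  unfold gq. replace ((- vd s s' a) ^ 2) with (vd s s' a ^ 2) by ring. unfold Rdiv. ring.
Qed.

(** Common bound for [ca] and [cs]: differentiating the cut-off costs [1 / r], differentiating [gq]
    costs [1 / rho^2]. *)
Definition QQ : R := 6 * (1 + c) * C1 ^ 3 / (r * rho ^ 2).

Lemma chi_abs s : Rabs (chi s) <= 1.
Proof. assert (H := chi01 s). rewrite Rabs_right; lra. Qed.

Lemma Rabs_mult_le (a b A B : R) : Rabs a <= A -> Rabs b <= B -> Rabs (a * b) <= A * B.
Proof. intros. rewrite Rabs_mult. apply Rmult_le_compat; auto; apply Rabs_pos. Qed.
Lemma Rabs_plus_le (a b A B : R) : Rabs a <= A -> Rabs b <= B -> Rabs (a + b) <= A + B.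
Proof. intros. letr; [apply Rabs_triang|]. lra. Qed.
Lemma Rabs_minus_le (a b A B : R) : Rabs a <= A -> Rabs b <= B -> Rabs (a - b) <= A + B.
Proof. intros. unfold Rminus. apply Rabs_plus_le; auto. rewrite Rabs_Ropp; auto. Qed.

Lemma w4_bound s s' a : Rabs (w4 s s' a) <= 1.
Proof. unfold w4. replace 1 with (1 * 1 * (1 * 1)) by ring. repeat apply Rabs_mult_le; apply chi_abs. Qed.
Lemma uu_bound s s' a : Rabs (uu s s' a) <= / rho.
Proof. unfold uu. rewrite <- (Rmult_1_l (/ rho)). apply Rabs_mult_le; [apply w4_bound|apply gq_bound]. Qed.

Lemma rr_facts : 1 <= / r /\ 1 <= / rho /\ / rho <= / rho ^ 2.
Proof.
  assert (1 <= / r) by (rewrite <- Rinv_1; apply Rinv_le_contravar; lra).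
  assert (1 <= / rho) by (rewrite <- Rinv_1; apply Rinv_le_contravar; lra). split; [auto|split; auto]. rewrite <- pow_inv. nra.
Qed.

Lemma ca_bound a s s' : dom a s -> dom a s' -> Rabs (ca s s' a) <= QQ.
Proof.
  intros Hd Hd'. destruct rr_facts as [H1 [H2 H3]]. assert (Ha : Rabs a <= c) by (destruct Hd; rewrite Rabs_right; lra).
  assert (B1 : Rabs (chi s * chi s' * (chi' (s + a) * chi (s' + a) + chi (s + a) * chi' (s' + a)) * a * gq (vd s s' a)) <=
    1 * 1 * (C1 / r * 1 + 1 * (C1 / r)) * c * / rho).
  { repeat (apply Rabs_mult_le || apply Rabs_plus_le || apply chi_abs || apply gq_bound || apply Bchi' || auto). }
  assert (B2 : Rabs (w4 s s' a * gq' (vd s s' a) * (th' s' * (a * taa a s') - th' s * (a * taa a s))) <=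
    1 * / rho ^ 2 * (C1 * C1 + C1 * C1)).
  { apply Rabs_mult_le; [apply Rabs_mult_le; [apply w4_bound|apply gq'_bound]|].
    apply Rabs_minus_le; apply Rabs_mult_le; auto; apply Bth'; [apply Hd'|apply Hd]. }
  unfold ca. letr; [apply Rabs_plus_le; [apply uu_bound|apply Rabs_plus_le; [apply B1|apply B2]]|].
  unfold QQ. replace (6 * (1 + c) * C1 ^ 3 / (r * rho ^ 2)) with (6 * (1 + c) * C1 ^ 3 * (/ r * / rho ^ 2)) by (field; lra).
  set (X := / r * / rho ^ 2). assert (X1 : / rho ^ 2 <= X) by (unfold X; rewrite <- (Rmult_1_l (/ rho ^ 2)) at 1; mul_r; lra).
  assert (X2 : / r * / rho <= X) by (unfold X; mul_l; lra).
  assert (Q1 : 1 <= C1 ^ 2) by nra. assert (Q2 : C1 ^ 2 <= C1 ^ 3) by (simpl in *; nra). assert (Q3 : C1 <= C1 ^ 3) by (simpl in *; nra).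
  letr_with (C1 ^ 3 * X + (2 * (C1 ^ 3 * c) * X + 2 * C1 ^ 3 * X)).
  - apply Rplus_le_compat; [|apply Rplus_le_compat].
    + letr_with X; [lra|]. rewrite <- (Rmult_1_l X) at 1. mul_r; lra.
    + replace (1 * 1 * (C1 / r * 1 + 1 * (C1 / r)) * c * / rho) with (2 * (C1 * c) * (/ r * / rho)) by (field; lra).
      apply Rmult_le_compat; try lra.
      * assert (0 <= C1 * c) by pos. lra.
      * left; apply Rmult_lt_0_compat; lra.
      * mul_l. mul_r; lra.
    + replace (1 * / rho ^ 2 * (C1 * C1 + C1 * C1)) with (2 * C1 ^ 2 * / rho ^ 2) by ring. apply Rmult_le_compat; try lra.
  - assert (0 <= C1 ^ 3 * X) by pos. assert (0 <= C1 ^ 3 * c * X) by pos. lra.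
Qed.

Lemma cs_bound a s s' : dom a s -> dom a s' -> Rabs (cs s s' a) <= QQ.
Proof.
  intros Hd Hd'. destruct rr_facts as [H1 [H2 H3]].
  assert (B1 : Rabs ((chi' s * chi (s + a) + chi s * chi' (s + a)) * (chi s' * chi (s' + a)) * gq (vd s s' a)) <=
    (C1 / r * 1 + 1 * (C1 / r)) * (1 * 1) * / rho).
  { repeat (apply Rabs_mult_le || apply Rabs_plus_le || apply chi_abs || apply gq_bound || apply Bchi' || auto). }
  assert (B2 : Rabs (w4 s s' a * gq' (vd s s' a) * (th'' s * ta a s + th' s * tas a s)) <= 1 * / rho ^ 2 * (C1 * C1 + C1 * C1)).
  { apply Rabs_mult_le; [apply Rabs_mult_le; [apply w4_bound|apply gq'_bound]|].
    apply Rabs_plus_le; apply Rabs_mult_le; auto; [apply Bth''|apply Bth']; apply Hd. }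
  unfold cs. letr; [apply Rabs_plus_le; [apply Rabs_mult_le; [apply Rabs_minus_le; [apply B1|apply B2]|apply Bta; auto]
    |apply Rabs_mult_le; [apply uu_bound|apply Btas; auto]]|].
  unfold QQ. replace (6 * (1 + c) * C1 ^ 3 / (r * rho ^ 2)) with (6 * (1 + c) * C1 ^ 3 * (/ r * / rho ^ 2)) by (field; lra).
  set (X := / r * / rho ^ 2). assert (X1 : / rho ^ 2 <= X) by (unfold X; rewrite <- (Rmult_1_l (/ rho ^ 2)) at 1; mul_r; lra).
  assert (X2 : / r * / rho <= X) by (unfold X; mul_l; lra).
  assert (Q1 : 1 <= C1 ^ 2) by nra. assert (Q2 : C1 ^ 2 <= C1 ^ 3) by (simpl in *; nra). assert (Q3 : C1 <= C1 ^ 3) by (simpl in *; nra).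
  letr_with (2 * C1 ^ 3 * X + 2 * C1 ^ 3 * X + C1 ^ 3 * X).
  - apply Rplus_le_compat.
    + replace (((C1 / r * 1 + 1 * (C1 / r)) * (1 * 1) * / rho + 1 * / rho ^ 2 * (C1 * C1 + C1 * C1)) * C1) with
        (2 * C1 ^ 2 * (/ r * / rho) + 2 * C1 ^ 3 * / rho ^ 2) by (field; lra).
      apply Rplus_le_compat; apply Rmult_le_compat; try lra. left; apply Rmult_lt_0_compat; lra.
    + rewrite Rmult_comm. apply Rmult_le_compat; lra.
  - assert (0 <= C1 ^ 3 * X) by pos. assert (0 <= C1 ^ 3 * c * X) by pos. lra.
Qed.

Definition I3 (F : R -> R -> R -> R) : R := RI (fun s => RI (fun s' => RI (fun a => F s s' a) al1 c) s0 s1) s0 s1.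

Lemma I3_le F G : ct3 F -> ct3 G -> (forall s s' a, dom a s -> dom a s' -> F s s' a <= G s s' a) -> I3 F <= I3 G.
Proof. intros CF CG' H. unfold I3. ri_le. intros s Hs1. ri_le. intros s' Hs2. ri_le. intros a Ha. apply H; split; lra. Qed.
Lemma I3_ext F G : (forall s s' a, dom a s -> dom a s' -> F s s' a = G s s' a) -> I3 F = I3 G.
Proof.
  intros H. unfold I3. apply RI_ext_le; [lra|]. intros s Hs1.
  apply RI_ext_le; [lra|]. intros s' Hs2. apply RI_ext_le; [lra|]. intros a Ha. apply H; split; lra.
Qed.
Lemma I3_plus F G : ct3 F -> ct3 G -> I3 (fun s s' a => F s s' a + G s s' a) = I3 F + I3 G.
Proof.
  intros CF CG'. unfold I3. rewrite <- RI_plus by ctac. apply RI_ext; intro s.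
  rewrite <- RI_plus by ctac. apply RI_ext; intro s'. apply RI_plus; ctac.
Qed.
Lemma I3_scal F k : ct3 F -> I3 (fun s s' a => k * F s s' a) = k * I3 F.
Proof.
  intros CF. unfold I3. rewrite <- RI_scal by ctac. apply RI_ext; intro s.
  rewrite <- RI_scal by ctac. apply RI_ext; intro s'. apply RI_scal; ctac.
Qed.
Lemma I3_abs F G : ct3 F -> ct3 G -> (forall s s' a, dom a s -> dom a s' -> Rabs (F s s' a) <= G s s' a) ->
  Rabs (I3 F) <= I3 G.
Proof.
  intros CF CG' H. apply Rabs_le. split.
  - replace (- I3 G) with (-1 * I3 G) by ring. rewrite <- I3_scal by auto. apply I3_le; [unfold ct3; ctac|auto|].
    intros s s' a Hd Hd'. specialize (H s s' a Hd Hd'). apply Rabs_le_between in H. lra.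
  - apply I3_le; auto. intros s s' a Hd Hd'. specialize (H s s' a Hd Hd'). apply Rabs_le_between in H. lra.
Qed.

Lemma RI_phi s : s0 <= s <= s1 -> RI (fun a => phi (be a s)) al1 c <= / cb.
Proof.
  intro H. letr; [apply subst_a; [apply ct_phi|apply phi_ge0|auto]|].
  rewrite <- (Rmult_1_r (/ cb)) at 2. apply Rmult_le_compat_l; auto. left; apply Rinv_0_lt_compat; auto.
Qed.

(** For fixed [s] the substitution [b = be a s] bounds the [a]-integral of [phi] by [/ cb]; the
    weight then only contributes its integral in [s']. *)
Lemma I3_phi (wt : R -> R -> R) m : ct2 wt -> (forall s s', 0 <= wt s s') ->
  (forall s, s0 <= s <= s1 -> RI (fun s' => wt s s') s0 s1 <= m) ->
  I3 (fun s s' a => wt s s' * phi (be a s)) <= c * m * / cb.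
Proof.
  intros Cw Hw Hm. unfold I3. rewrite Rmult_assoc. rewrite <- RI_const. ri_le. intros s H. assert (P := RI_phi s H).
  letr_with (RI (fun s' => / cb * wt s s') s0 s1).
  - ri_le. intros s' H'. rewrite RI_scal by ctac. rewrite Rmult_comm. mul_r; auto.
  - rewrite RI_scal by ctac. rewrite Rmult_comm. apply Rmult_le_compat_r; auto. left; apply Rinv_0_lt_compat; auto.
Qed.

Lemma I3_sym F : ct3 F -> I3 (fun s s' a => F s' s a) = I3 F.
Proof. intro CF. unfold I3. apply (fubini (fun s s' => RI (fun a => F s' s a) al1 c)); [lra|ctac]. Qed.

Lemma I3_phi' (wt : R -> R -> R) m : ct2 wt -> (forall s s', 0 <= wt s s') ->
  (forall s', s0 <= s' <= s1 -> RI (fun s => wt s s') s0 s1 <= m) ->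
  I3 (fun s s' a => wt s s' * phi (be a s')) <= c * m * / cb.
Proof.
  intros Cw Hw Hm. rewrite <- (I3_sym (fun s s' a => wt s s' * phi (be a s'))) by (unfold ct3; ctac).
  apply (I3_phi (fun s s' => wt s' s)); auto. ctac.
Qed.

Lemma parts_J (A dA : R -> R) (e de : R -> R -> R) x1 x2 : x1 <= x2 -> ct A -> ct dA -> ct2 e -> ct2 de ->
  (forall x, x1 <= x <= x2 -> is_derive A x (dA x)) ->
  (forall x y, x1 <= x <= x2 -> is_derive (fun x => e x y) x (de x y)) ->
  RI (fun x => A x * J (de x)) x1 x2 = A x2 * J (e x2) - A x1 * J (e x1) - RI (fun x => dA x * J (e x)) x1 x2.
Proof.
  intros Hx CA CdA Ce Cde HA He. transitivity (J (fun y => RI (fun x => A x * de x y) x1 x2)).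
  { rewrite <- (fubini (fun x y => A x * de x y)) by (auto; ctac). apply RI_ext; intro x. rewrite RI_scal by ctac. auto. }
  transitivity (J (fun y => A x2 * e x2 y - A x1 * e x1 y - RI (fun x => dA x * e x y) x1 x2)).
  { apply RI_ext; intro y. apply (RI_parts A (fun x => e x y) dA (fun x => de x y)); auto; ctac. }
  rewrite !RI_minus, !RI_scal by ctac. f_equal.
  rewrite <- (fubini (fun x y => dA x * e x y)) by (auto; ctac). apply RI_ext; intro x. rewrite RI_scal by ctac. auto.
Qed.

Definition e_a (s s' a y : R) : R := kb (be a s) y * bea a s * Kf (be a s') (y + (th s' - th s))
  + kf (be a s) y * (Kb (be a s') (y + (th s' - th s)) * bea a s').
Definition e_s (s s' a y : R) : R := kb (be a s) y * bes a s * Kf (be a s') (y + (th s' - th s))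
  - kf (be a s) y * (kf (be a s') (y + (th s' - th s)) * th' s).
Definition e_s' (s s' a y : R) : R := kf (be a s) y *
  (Kb (be a s') (y + (th s' - th s)) * bes a s' + kf (be a s') (y + (th s' - th s)) * th' s').
Lemma ct_ea : ct4 e_a.
Proof. unfold e_a; ctac. Qed.
Lemma ct_es : ct4 e_s.
Proof. unfold e_s; ctac. Qed.
Lemma ct_es' : ct4 e_s'.
Proof. unfold e_s'; ctac. Qed.
#[local] Hint Resolve ct_ea ct_es ct_es' : ctdb.

Lemma ea_deriv s s' a y : dom a s -> dom a s' -> is_derive (fun a => ee s s' a y) a (e_a s s' a y).
Proof.
  intros Hd Hd'. unfold ee. eapply D_eq.
  - apply (D_mult (fun a => kf (be a s) y) (fun a => Kf (be a s') (y + (th s' - th s)))).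
    + apply (D_comp (fun b => kf b y) (fun a => be a s)); [apply kf_b|apply Dbea; auto].
    + apply (D_comp (fun b => Kf b (y + (th s' - th s))) (fun a => be a s')); [apply Kf_b|apply Dbea; auto].
  - unfold e_a. ring.
Qed.
Lemma es_deriv s s' a y : dom a s -> is_derive (fun s => ee s s' a y) s (e_s s s' a y).
Proof.
  intros Hd. unfold ee. eapply D_eq.
  - apply (D_mult (fun s => kf (be a s) y) (fun s => Kf (be a s') (y + (th s' - th s)))).
    + apply (D_comp (fun b => kf b y) (fun s => be a s)); [apply kf_b|apply Dbes; auto].
    + apply (D_comp (fun z => Kf (be a s') z) (fun s => y + (th s' - th s))); [apply Kf_z|].
      apply D_plus; [apply D_const|]. apply D_minus; [apply D_const|apply Dth; apply Hd].
  - unfold e_s. ring.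
Qed.
Lemma es'_deriv s s' a y : dom a s' -> is_derive (fun s' => ee s s' a y) s' (e_s' s s' a y).
Proof.
  intros Hd. unfold ee. eapply D_eq.
  - apply (D_scal (fun s' => Kf (be a s') (y + (th s' - th s)))).
    apply (chain2 Kf Kb kf (fun s' => be a s') (fun s' => y + (th s' - th s))); [apply ct_Kf|apply ct_Kb|apply ct_kf|
      apply Kf_b|apply Kf_z|apply Dbes; auto|].
    apply D_plus; [apply D_const|]. apply D_minus; [apply Dth; apply Hd|apply D_const].
  - unfold e_s'. ring.
Qed.

(** In the field applied to [ee] all [b]-derivatives cancel by [Hta]; what survives is the
    [z]-derivative [kf] of [Kf] times the speed [vd]. *)
Lemma vd_Lk s s' a : dom a s -> dom a s' ->
  vd s s' a * Lk s s' a = - a * J (e_a s s' a) + ta a s * J (e_s s s' a) + ta a s' * J (e_s' s s' a).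
Proof.
  intros Hd Hd'. assert (B := ct_ea). assert (B' := ct_es). assert (B'' := ct_es'). unfold Lk.
  rewrite <- !RI_scal, <- !RI_plus by ctac. apply RI_ext; intro y.
  unfold e_a, e_s, e_s', vd. assert (H1 := Hta a s Hd). assert (H2 := Hta a s' Hd').
  set (K' := Kf (be a s') (y + (th s' - th s))). set (KB := Kb (be a s') (y + (th s' - th s))).
  set (k' := kf (be a s') (y + (th s' - th s))). set (k := kf (be a s) y). set (kB := kb (be a s) y).
  transitivity (- kB * K' * (a * bea a s) - k * KB * (a * bea a s') + kB * K' * (ta a s * bes a s) + k * KB * (ta a s' * bes a s')
    + (th' s' * ta a s' - th' s * ta a s) * (k * k')); [rewrite H1, H2; ring|ring].
Qed.

Definition EE (s s' a : R) : R := J (ee s s' a).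
Lemma ct_EE : ct3 EE.
Proof. unfold EE; ctac. Qed.
#[local] Hint Resolve ct_EE : ctdb.
Lemma EE_bound a s s' : dom a s -> dom a s' -> Rabs (EE s s' a) <= 2 * sig * (phi (be a s) + phi (be a s')).
Proof. intros Hd Hd'. assert (A := ct_ee). letr; [apply RI_abs; [auto|ctac]|]. apply ee_bound; auto. Qed.

Lemma w4_s0 s s' a : s <= s0 \/ s1 <= s -> w4 s s' a = 0.
Proof. intros [H|H]; unfold w4; [rewrite (chi_l s)|rewrite (chi_r s)]; auto; ring. Qed.
Lemma w4_s' s s' a : s' <= s0 \/ s1 <= s' -> w4 s s' a = 0.
Proof. intros [H|H]; unfold w4; [rewrite (chi_l s')|rewrite (chi_r s')]; auto; ring. Qed.
Lemma w4_c s s' : s0 <= s -> w4 s s' c = 0.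
Proof. intros H; unfold w4; rewrite (chi_r (s + c)) by lra; ring. Qed.

(** Integration by parts in [a]. The boundary term at [a = c] vanishes because [chi (s + c) = 0];
    the one at [al1] stays, and will be harmless once [al1] is taken small. *)
Lemma T_a : I3 (fun s s' a => uu s s' a * (- a * J (e_a s s' a))) =
  I3 (fun s s' a => ca s s' a * EE s s' a) + RI (fun s => RI (fun s' => al1 * uu s s' al1 * EE s s' al1) s0 s1) s0 s1.
Proof.
  unfold I3. rewrite <- RI_plus by ctac. apply RI_ext_le; [lra|]; intros s H.
  rewrite <- RI_plus by ctac. apply RI_ext_le; [lra|]; intros s' H'.
  rewrite (RI_ext _ (fun a => -1 * (a * uu s s' a * J (e_a s s' a)))) by (intro; ring). rewrite RI_scal by ctac.
  rewrite (parts_J (fun a => a * uu s s' a) (fun a => ca s s' a) (ee s s') (e_a s s')); [|lra|ctac|ctac|ctac|ctac| |].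
  - unfold uu at 1. rewrite w4_c by lra. unfold EE. ring.
  - intros a Ha. apply ca_deriv; split; lra.
  - intros a y Ha. apply ea_deriv; split; lra.
Qed.

Lemma T_s : I3 (fun s s' a => uu s s' a * (ta a s * J (e_s s s' a))) = - I3 (fun s s' a => cs s s' a * EE s s' a).
Proof.
  unfold I3. rewrite (fubini3 (fun s s' a => uu s s' a * (ta a s * J (e_s s s' a)))) by (try lra; unfold ct3; ctac).
  rewrite (fubini3 (fun s s' a => cs s s' a * EE s s' a)) by (try lra; unfold ct3; ctac).
  rewrite <- RI_opp by ctac. apply RI_ext_le; [lra|]; intros s' H'.
  rewrite <- RI_opp by ctac. apply RI_ext_le; [lra|]; intros a H.
  rewrite (RI_ext _ (fun s => (uu s s' a * ta a s) * J (e_s s s' a))) by (intro; ring).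
  rewrite (parts_J (fun s => uu s s' a * ta a s) (fun s => cs s s' a) (fun s => ee s s' a) (fun s => e_s s s' a));
    [|lra|ctac|ctac|ctac|ctac| |].
  - unfold uu at 1 2. rewrite (w4_s0 s0), (w4_s0 s1) by ((left; lra) || (right; lra)). unfold EE. ring.
  - intros s Hss. apply cs_deriv; split; lra.
  - intros s y Ha. apply es_deriv; split; lra.
Qed.

(** Antisymmetry of [uu] reduces the derivative in [s'] to the one already computed, with [s] and
    [s'] exchanged and the opposite sign. *)
Lemma T_s' : I3 (fun s s' a => uu s s' a * (ta a s' * J (e_s' s s' a))) = I3 (fun s s' a => cs s' s a * EE s s' a).
Proof.
  unfold I3. apply RI_ext_le; [lra|]; intros s H.
  rewrite (fubini (fun s' a => uu s s' a * (ta a s' * J (e_s' s s' a)))) by (try lra; ctac).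
  rewrite (fubini (fun s' a => cs s' s a * EE s s' a)) by (try lra; ctac). apply RI_ext_le; [lra|]; intros a Ha.
  rewrite (RI_ext _ (fun s' => (uu s s' a * ta a s') * J (e_s' s s' a))) by (intro; ring).
  rewrite (parts_J (fun s' => uu s s' a * ta a s') (fun s' => - cs s' s a) (fun s' => ee s s' a) (fun s' => e_s' s s' a));
    [|lra|ctac|ctac|ctac|ctac| |].
  - unfold uu at 1 2. rewrite (w4_s' s s0), (w4_s' s s1) by ((left; lra) || (right; lra)).
    rewrite (RI_ext (fun s' => - cs s' s a * J (ee s s' a)) (fun s' => -1 * (cs s' s a * EE s s' a))) by (intro; unfold EE; ring). rewrite RI_scal by ctac. cbv beta. ring.
  - intros s' Hss. apply (is_derive_ext (fun s' => - (uu s' s a * ta a s'))).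
    + intro t. rewrite (uu_antisym s t a). change (- (- uu s t a * ta a t) = uu s t a * ta a t :> R). ring.
    + apply (D_opp (fun s' => uu s' s a * ta a s')). apply cs_deriv; split; lra.
  - intros s' y Hss. apply es'_deriv; split; lra.
Qed.

Lemma QQ_pos : 0 < QQ.
Proof. unfold QQ. apply Rdiv_lt_0_compat; [|apply Rmult_lt_0_compat; [lra|pos]]. apply Rmult_lt_0_compat; [lra|pos]. Qed.

Lemma far_bound (k : R -> R -> R -> R) : ct3 k -> (forall s s' a, dom a s -> dom a s' -> Rabs (k s s' a) <= QQ) ->
  Rabs (I3 (fun s s' a => k s s' a * EE s s' a)) <= 4 * QQ * sig * c ^ 2 / cb.
Proof.
  intros Ck Hk. assert (HQ := QQ_pos).
  letr; [apply (I3_abs _ (fun s s' a => (2 * sig * QQ) * (1 * phi (be a s)) + (2 * sig * QQ) * (1 * phi (be a s'))))|].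
  - unfold ct3; ctac.
  - unfold ct3; ctac.
  - intros s s' a Hd Hd'. letr; [apply Rabs_mult_le; [apply Hk; auto|apply EE_bound; auto]|]. lra.
  - rewrite I3_plus, !I3_scal by (unfold ct3; ctac).
    assert (P1 := I3_phi (fun _ _ => 1) c ltac:(ctac) ltac:(intros; lra) ltac:(intros; cbv beta; rewrite RI_const; lra)).
    assert (P2 := I3_phi' (fun _ _ => 1) c ltac:(ctac) ltac:(intros; lra) ltac:(intros; cbv beta; rewrite RI_const; lra)).
    cbv beta in P1, P2. rewrite I3_scal in P1, P2 by (unfold ct3; ctac). apply (Rmult_le_compat_l (2 * sig * QQ)) in P1; [|pos].
    apply (Rmult_le_compat_l (2 * sig * QQ)) in P2; [|pos].
    letr; [apply Rplus_le_compat; [apply P1|apply P2]|]. right. field; lra.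
Qed.

(** Each of the three directions of the field contributes [4 QQ sig c^2 / cb]; the last term is the
    boundary at [al1]. *)
Lemma T_far : Rabs (I3 (fun s s' a => uu s s' a * (vd s s' a * Lk s s' a))) <=
  12 * QQ * sig * c ^ 2 / cb + 4 * al1 * c ^ 2 * Mphi * sig / rho.
Proof.
  rewrite (I3_ext _ (fun s s' a => uu s s' a * (- a * J (e_a s s' a)) + (uu s s' a * (ta a s * J (e_s s s' a)) +
    uu s s' a * (ta a s' * J (e_s' s s' a))))).
  2:{ intros s s' a Hd Hd'. rewrite vd_Lk by auto. ring. } rewrite !I3_plus by (unfold ct3; ctac). rewrite T_a, T_s, T_s'.
  assert (F1 := far_bound ca ct_ca (fun s s' a H H' => ca_bound a s s' H H')).
  assert (F2 := far_bound cs ct_cs (fun s s' a H H' => cs_bound a s s' H H')).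
  assert (F3 := far_bound (fun s s' a => cs s' s a) ltac:(unfold ct3; ctac) (fun s s' a H H' => cs_bound a s' s H' H)).
  cbv beta in F3.
  assert (F4 : Rabs (RI (fun s => RI (fun s' => al1 * uu s s' al1 * EE s s' al1) s0 s1) s0 s1) <= 4 * al1 * c ^ 2 * Mphi * sig / rho).
  { letr; [apply (RI_bound _ _ _ (c * (al1 * / rho * (2 * sig * (Mphi + Mphi))))); [lra|ctac|]|].
    - intros s H. apply RI_bound; [lra|ctac|]. intros s' H'.
      assert (Hd : dom al1 s) by (split; lra). assert (Hd' : dom al1 s') by (split; lra).
      apply Rabs_mult_le; [apply Rabs_mult_le; [rewrite Rabs_right; lra|apply uu_bound]|]. letr; [apply EE_bound; auto|]. mul_l.
      apply Rplus_le_compat; apply Hphi; apply Bbe; auto.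
    - right; field; lra. } apply Rabs_le_between in F1, F2, F3, F4. apply Rabs_le. lra.
Qed.

(** Majorant of the small-speed factor obtained from [Hmono], with integral of order [rho / c0]. *)
Definition wt (s s' : R) : R := rho ^ 2 / (c0 ^ 2 * (s - s') ^ 2 + rho ^ 2).
Lemma wden s s' : 0 < c0 ^ 2 * (s - s') ^ 2 + rho ^ 2.
Proof. assert (0 < rho ^ 2) by pos. assert (0 <= c0 ^ 2 * (s - s') ^ 2); [|lra]. apply Rmult_le_pos; apply pow2_ge_0. Qed.
Lemma ct_wt : ct2 wt.
Proof. unfold wt, ct2. apply ct_div; [ctac|ctac|]. intros [s s']. assert (H := wden s s'). simpl in *; lra. Qed.
#[local] Hint Resolve ct_wt : ctdb.
Lemma wt_ge0 s s' : 0 <= wt s s'.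
Proof. unfold wt. apply Rdiv_le_0_compat; [pos|apply wden]. Qed.
Lemma wt_sym s s' : wt s s' = wt s' s.
Proof. unfold wt. replace ((s - s') ^ 2) with ((s' - s) ^ 2) by ring. auto. Qed.
Lemma wt_int s : RI (fun s' => wt s s') s0 s1 <= 4 * rho / c0.
Proof.
  (* The arctangent varies by at most [PI], and [PI <= 4] explains the constant. *)
  rewrite (RI_ftc (fun s' => rho / c0 * atan (c0 / rho * (s' - s)))); [|lra|ctac|].
  - assert (H1 := atan_bound (c0 / rho * (s1 - s))). assert (H2 := atan_bound (c0 / rho * (s0 - s))). assert (P := PI_4).
    assert (0 < rho / c0) by pos. replace (4 * rho / c0) with (rho / c0 * 4) by (field; lra). rewrite <- Rmult_minus_distr_l.
    mul_l; lra.
  - intros x _. assert (H := wden s x). unfold wt. auto_derive; [auto|]. assert (H2 : 1 + (c0 / rho * (x - s)) ^ 2 <> 0).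
    { assert (0 <= (c0 / rho * (x - s)) ^ 2) by pos. lra. } field. repeat split; lra.
Qed.

Lemma T_near : Rabs (I3 (fun s s' a => w4 s s' a * (rho ^ 2 / (vd s s' a ^ 2 + rho ^ 2)) * Lk s s' a)) <= 16 * rho * c / (c0 * cb).
Proof.
  assert (W := ct_wt). assert (Cq : ct3 (fun s s' a => rho ^ 2 / (vd s s' a ^ 2 + rho ^ 2))).
  { unfold ct3. apply ct_div; [ctac|ctac|]. intros [[s s'] a]; simpl. assert (H := den_pos (vd s s' a)). simpl in H; lra. }
  letr; [apply (I3_abs _ (fun s s' a => 2 * (wt s s' * phi (be a s)) + 2 * (wt s s' * phi (be a s'))))|].
  - set (q := fun s s' a => rho ^ 2 / (vd s s' a ^ 2 + rho ^ 2)) in *.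
    assert (Hq : ct3 (fun s s' a => w4 s s' a * q s s' a * Lk s s' a)); [|exact Hq]. unfold ct3; ctac.
  - unfold ct3; ctac.
  - intros s s' a Hd Hd'. replace (2 * (wt s s' * phi (be a s)) + 2 * (wt s s' * phi (be a s'))) with
      (1 * wt s s' * (2 * phi (be a s) + 2 * phi (be a s'))) by ring.
    apply Rabs_mult_le; [apply Rabs_mult_le; [apply w4_bound|]|apply Lk_bound; auto].
    assert (H := den_pos (vd s s' a)). assert (H' := wden s s').
    rewrite Rabs_right by (apply Rle_ge, Rdiv_le_0_compat; [pos|auto]). unfold wt. mul_l. apply Rinv_le_contravar; auto.
    apply Rplus_le_compat_r. assert (Hm := Hmono a s s' Hd Hd').
    rewrite <- (pow2_abs (vd s s' a)), <- (pow2_abs (s - s')), <- Rpow_mult_distr. apply pow_incr. split; auto.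
    apply Rmult_le_pos; [lra|pos].
  - rewrite I3_plus, !I3_scal by (unfold ct3; ctac). assert (P1 := I3_phi wt (4 * rho / c0) W wt_ge0 (fun s _ => wt_int s)).
    assert (P2 := I3_phi' wt (4 * rho / c0) W wt_ge0).
    assert (P3 : forall s', s0 <= s' <= s1 -> RI (fun s => wt s s') s0 s1 <= 4 * rho / c0).
    { intros s' _. rewrite (RI_ext _ (fun s => wt s' s)) by (intro; apply wt_sym). apply wt_int. }
    specialize (P2 P3). replace (16 * rho * c / (c0 * cb)) with (2 * (c * (4 * rho / c0) * / cb) + 2 * (c * (4 * rho / c0) * / cb)) by (field; lra).
    lra.
Qed.

Definition TT : R := 16 * rho * c / (c0 * cb) + 12 * QQ * sig * c ^ 2 / cb + 4 * al1 * c ^ 2 * Mphi * sig / rho.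

Lemma T_bound : I3 (fun s s' a => w4 s s' a * Lk s s' a) <= TT.
Proof.
  assert (Cq : ct3 (fun s s' a => rho ^ 2 / (vd s s' a ^ 2 + rho ^ 2))).
  { unfold ct3. apply ct_div; [ctac|ctac|]. intros [[s s'] a]; simpl. assert (H := den_pos (vd s s' a)). simpl in H; lra. }
  rewrite (I3_ext _ (fun s s' a => w4 s s' a * (rho ^ 2 / (vd s s' a ^ 2 + rho ^ 2)) * Lk s s' a + uu s s' a * (vd s s' a * Lk s s' a))).
  2:{ intros s s' a _ _. assert (H := den_pos (vd s s' a)). unfold uu, gq. field. lra. }
  set (q := fun s s' a => rho ^ 2 / (vd s s' a ^ 2 + rho ^ 2)) in *.
  rewrite (I3_plus (fun s s' a => w4 s s' a * q s s' a * Lk s s' a)) by (unfold ct3; ctac).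
  assert (H1 := T_near). assert (H2 := T_far). fold q in H1. apply Rabs_le_between in H1, H2. unfold TT.
  fold (q) in H1. unfold q in *. lra.
Qed.

Lemma C1_sq : C1 <= C1 ^ 2.
Proof. nra. Qed.

Lemma RI_refl_le F R1 z u v : 0 <= R1 <= D -> u <= v -> ct F -> csup R1 F -> (forall x, 0 <= F x) ->
  RI (fun d => F (z - d)) u v <= J F.
Proof.
  intros HR Huv CF HF Hp. rewrite RI_refl by auto.
  rewrite <- (csup_enlarge F R1 (- D) D (- (D + Rabs z + Rabs u + Rabs v)) (D + Rabs z + Rabs u + Rabs v));
    assert (A := Rle_abs z); assert (A' := Rle_abs (- z)); assert (B := Rle_abs u); assert (B' := Rle_abs (- u));
    assert (E := Rle_abs v); assert (E' := Rle_abs (- v)); rewrite !Rabs_Ropp in *; auto; try lra. apply RI_mono; auto; lra.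
Qed.

Lemma J_sq_ge0 (h : R -> R) : ct h -> 0 <= J (fun y => h y ^ 2).
Proof. intro. apply RI_ge0; [auto|ctac|intros; apply pow2_ge_0]. Qed.

Lemma f_corr : RI (fun a => J (fun y => (f y * f (y - a)) ^ 2)) al1 c <= 1.
Proof.
  rewrite (fubini (fun a y => (f y * f (y - a)) ^ 2)) by (try lra; ctac). letr_with (J (fun y => f y ^ 2)); [|auto].
  ri_le. intros y _. rewrite (RI_ext _ (fun a => f y ^ 2 * f (y - a) ^ 2)) by (intro; ring). rewrite RI_scal by ctac.
  rewrite <- (Rmult_1_r (f y ^ 2)) at 2. mul_l.
  letr; [apply (RI_refl_le (fun y => f y ^ 2) R0); try lra; [ctac| |intro; apply pow2_ge_0]|auto].
  intros x Hx; rewrite Sf; auto; ring.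
Qed.

Lemma csup_sq R1 (h : R -> R) : csup R1 h -> csup R1 (fun x => h x ^ 2).
Proof. intros H x Hx. rewrite H; auto; ring. Qed.

Definition XX (x1 x2 : R) (h : R -> R -> R) : R :=
  RI (fun a => RI (fun s => chi s * chi (s + a) * J (fun y => f y * f (y - a) * h (be a s) (y + th s))) s0 s1) x1 x2.

Lemma XX_swap x1 x2 h : ct2 h -> XX x1 x2 h = RI (fun a => J (fun y => f y * f (y - a) *
  RI (fun s => chi s * chi (s + a) * h (be a s) (y + th s)) s0 s1)) x1 x2.
Proof.
  intro Ch. unfold XX. apply RI_ext; intro a.
  transitivity (RI (fun s => J (fun y => chi s * chi (s + a) * (f y * f (y - a) * h (be a s) (y + th s)))) s0 s1).
  - apply RI_ext; intro s. rewrite RI_scal by ctac. auto.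
  - rewrite (fubini (fun s y => chi s * chi (s + a) * (f y * f (y - a) * h (be a s) (y + th s)))) by (try lra; ctac).
    apply RI_ext; intro y. rewrite <- RI_scal by ctac. apply RI_ext; intro s. ring.
Qed.

(** The square is a double integral in [s] and [s']; translating [y] by [th s] produces [Lk]. *)
Lemma S_sq : RI (fun a => J (fun y => RI (fun s => chi s * chi (s + a) * kf (be a s) (y + th s)) s0 s1 ^ 2)) al1 c =
  I3 (fun s s' a => w4 s s' a * Lk s s' a).
Proof.
  unfold I3. rewrite <- (fubini3 (fun a s s' => w4 s s' a * Lk s s' a)) by (try lra; unfold ct3; ctac).
  apply RI_ext_le; [lra|]. intros a Ha.
  transitivity (J (fun y => RI (fun s => RI (fun s' => w4 s s' a * (kf (be a s) (y + th s) * kf (be a s') (y + th s'))) s0 s1) s0 s1)).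
  - apply RI_ext; intro y. simpl pow. rewrite Rmult_1_r. rewrite <- RI_scal by ctac. apply RI_ext; intro s.
    rewrite Rmult_comm, <- RI_scal by ctac. apply RI_ext; intro s'. unfold w4. ring.
  - rewrite (fubini3 (fun y s s' => w4 s s' a * (kf (be a s) (y + th s) * kf (be a s') (y + th s')))) by (try lra; unfold ct3; ctac).
    apply RI_ext_le; [lra|]. intros s H. apply RI_ext_le; [lra|]. intros s' H'.
    rewrite RI_scal by ctac. apply (f_equal (Rmult (w4 s s' a))). unfold Lk.
    rewrite <- (J_shift (fun y => kf (be a s) y * kf (be a s') (y + (th s' - th s))) (R0 + 1) D (th s)); [|lra|ctac| |].
    + apply RI_ext; intro y. replace (y + th s + (th s' - th s)) with (y + th s') by ring. auto.
    + intros x Hx. rewrite csup_kf by auto. ring.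
    + assert (E := Bth s H). lra.
Qed.

(** The factor [f y * f (y - a)] has norm at most 1 in [(a, y)]; Cauchy-Schwarz with weight [t]
    removes [f] altogether and leaves the square of the [s]-integral, bounded by [TT]. *)
Lemma X_high t : 0 < t -> TT <= t ^ 2 -> Rabs (XX al1 c kf) <= t.
Proof.
  intros Ht HT. assert (A := ct_kf). rewrite XX_swap by auto.
  set (S := fun a y => RI (fun s => chi s * chi (s + a) * kf (be a s) (y + th s)) s0 s1). assert (CS : ct2 S) by (unfold S; ctac).
  letr_with (RI (fun a => J (fun y => / 2 * t * (f y * f (y - a)) ^ 2 + / 2 * / t * S a y ^ 2)) al1 c).
  - letr; [apply RI_abs; [lra|fold (S); ctac]|]. apply RI_le; [lra|fold S; ctac|ctac|]. intros a _.
    letr; [apply RI_abs; [lra|fold (S a); ctac]|]. apply RI_le; [lra| |ctac|].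
    + assert (ct (fun y => Rabs (f y * f (y - a) * S a y))) by ctac. auto.
    + intros y _. fold (S a y). letr; [apply (amgm_t _ _ t); auto|]. lra.
  - transitivity (/ 2 * t * RI (fun a => J (fun y => (f y * f (y - a)) ^ 2)) al1 c + / 2 * / t * RI (fun a => J (fun y => S a y ^ 2)) al1 c).
    { rewrite <- !RI_scal, <- RI_plus by ctac. right; apply RI_ext; intro a. rewrite RI_plus, !RI_scal by ctac. auto. }
    unfold S. rewrite S_sq. assert (B := f_corr). assert (E := T_bound). assert (Hi : 0 < / t) by pos.
    assert (K : / t * I3 (fun s s' a => w4 s s' a * Lk s s' a) <= t).
    { letr_with (/ t * t ^ 2); [mul_l; lra|right; field; lra]. }
    assert (t * RI (fun a => J (fun y => (f y * f (y - a)) ^ 2)) al1 c <= t * 1) by (mul_l; lra). lra.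
Qed.

(** [pf] is the low-frequency part, [p1] its primitive in [b], and [q1] the [z]-derivative of [p1],
    which costs [1 / sig]. *)
Definition pf (b z : R) : R := av sig (Gam b) z.
Definition p1 (b z : R) : R := av sig (Gam1 b) z.
Definition q1 (b z : R) : R := / sig * (Gam1 b z - Gam1 b (z - sig)).
Lemma ct_pf : ct2 pf. Proof. unfold pf, av; ctac. Qed.
Lemma ct_p1 : ct2 p1. Proof. unfold p1, av; ctac. Qed.
Lemma ct_q1 : ct2 q1. Proof. unfold q1; ctac. Qed.
#[local] Hint Resolve ct_pf ct_p1 ct_q1 : ctdb.
Lemma p1_b b z : is_derive (fun b => p1 b z) b (pf b z).
Proof.
  unfold p1, pf, av. apply (D_scal (fun b => RI (fun y => Gam1 b (z - y)) 0 sig)).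
  apply (RI_deriv (fun b y => Gam1 b (z - y)) (fun b y => Gam b (z - y))); [ctac|ctac|auto].
Qed.
Lemma p1_z b z : is_derive (p1 b) z (q1 b z).
Proof. unfold p1, q1. eapply D_eq; [apply av_deriv; [lra|apply ct2_row; auto]|]. field. lra. Qed.

Lemma pf_sup b z : 0 <= b <= bm -> Rabs (pf b z) <= / sig.
Proof.
  intro Hb. unfold pf, av. rewrite Rabs_mult, Rabs_right by pos. rewrite <- (Rmult_1_r (/ sig)) at 2. mul_l.
  letr; [apply RI_abs; [lra|ctac]|].
  letr; [apply (RI_refl_le (fun z => Rabs (Gam b z)) R0); try lra; [ctac| |intro; apply Rabs_pos]|auto].
  intros x Hx; rewrite SG, Rabs_R0; auto.
Qed.

Lemma ff_bound a : Rabs a <= 2 * C1 + c -> J (fun y => Rabs (f y * f (y - a))) <= 1.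
Proof.
  intro Ha. letr_with (J (fun y => / 2 * f y ^ 2 + / 2 * f (y - a) ^ 2)).
  - ri_le. intros y _. letr; [apply (amgm_t _ _ 1); lra|]. rewrite Rinv_1. lra.
  - rewrite RI_plus, !RI_scal by ctac. change (fun y => f (y - a) ^ 2) with (fun y => (fun y => f y ^ 2) (y + - a)).
    rewrite J_shift with (R0 := R0); [lra|auto|ctac|apply csup_sq; auto|rewrite Rabs_Ropp; lra].
Qed.

(** For [a <= al0] dividing by [a] would be too expensive; the bound [1 / sig] for [pf] and the
    short range of [a] suffice. *)
Lemma X_low_small : Rabs (XX al1 al0 pf) <= c * al0 / sig.
Proof.
  unfold XX. letr; [apply (RI_bound _ _ _ (c * / sig)); [lra|ctac|]|].
  - intros a Ha. apply RI_bound; [lra|ctac|]. intros s H.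
    rewrite <- (Rmult_1_l (/ sig)). apply Rabs_mult_le; [replace 1 with (1 * 1) by ring; apply Rabs_mult_le; apply chi_abs|].
    letr; [apply RI_abs; [auto|ctac]|]. letr_with (J (fun y => / sig * Rabs (f y * f (y - a)))).
    + ri_le. intros y _. rewrite Rabs_mult, Rmult_comm. mul_r. apply pf_sup. apply Bbe; split; lra.
    + rewrite RI_scal by ctac. assert (B := ff_bound a ltac:(rewrite Rabs_right; lra)).
      rewrite <- (Rmult_1_r (/ sig)) at 2. apply Rmult_le_compat_l; auto. left; apply Rinv_0_lt_compat; lra.
  - assert (0 < / sig) by pos. replace (c * al0 / sig) with (al0 * (c * / sig)) by (field; lra). mul_r; lra.
Qed.

Lemma Y_bound (h : R -> R -> R) k : 0 < k -> ct2 h -> (forall b, csup (R0 + 1) (h b)) ->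
  (forall b, J (fun z => h b z ^ 2) <= k ^ 2 * phi1 b) ->
  RI (fun a => RI (fun s => J (fun y => Rabs (f y * f (y - a) * h (be a s) (y + th s)))) s0 s1) al0 c <=
  k * eta * c * (1 + / cb).
Proof.
  intros Hk Ch Sh Hh. set (t := k * eta). assert (Ht : 0 < t) by (apply Rmult_lt_0_compat; auto). assert (Hi : 0 < / t) by pos.
  assert (Ck : forall b, ct (h b)) by (intro; apply ct2_row; auto).
  letr_with (RI (fun a => RI (fun s => / 2 * t * J (fun y => (f y * f (y - a)) ^ 2) + / 2 * / t * k ^ 2 * phi1 (be a s)) s0 s1) al1 c).
  - letr; [|apply (RI_mono _ al1 al0 c c); try lra; [ctac|]].
    2:{ intros a Ha. apply RI_ge0; [lra|ctac|]. intros s H. assert (Q1 := J_sq_ge0 (fun y => f y * f (y - a)) ltac:(ctac)).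
        cbv beta in Q1. assert (Q2 := phi1_ge0 (be a s)). assert (0 <= / 2 * t * J (fun y => (f y * f (y - a)) ^ 2)) by pos.
        assert (0 <= / 2 * / t * k ^ 2 * phi1 (be a s)).
        { apply Rmult_le_pos; auto. apply Rmult_le_pos; [lra|pos]. } lra. } ri_le. intros a Ha. ri_le. intros s H.
    letr_with (J (fun y => / 2 * t * (f y * f (y - a)) ^ 2 + / 2 * / t * h (be a s) (y + th s) ^ 2)).
    + ri_le. intros y _. letr; [apply (amgm_t _ _ t); auto|]. lra.
    + rewrite RI_plus, (RI_scal (fun y => (f y * f (y - a)) ^ 2)), (RI_scal (fun y => h (be a s) (y + th s) ^ 2)) by ctac.
      apply Rplus_le_compat_l. rewrite J_shift_sq; [|auto|auto|assert (E := Bth s H); assert (E' := Rabs_pos (th s)); lra].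
      rewrite (Rmult_assoc (/ 2 * / t)). apply Rmult_le_compat_l; [lra|auto].
  - transitivity (RI (fun a => (c * / 2 * t) * J (fun y => (f y * f (y - a)) ^ 2)) al1 c +
      / 2 * / t * k ^ 2 * RI (fun a => RI (fun s => phi1 (be a s)) s0 s1) al1 c).
    { right. rewrite <- RI_scal, <- RI_plus by ctac. apply RI_ext; intro a.
      rewrite RI_plus, RI_const, (RI_scal (fun s => phi1 (be a s))) by ctac. ring. }
    rewrite RI_scal by ctac. assert (B := f_corr).
    assert (E : RI (fun a => RI (fun s => phi1 (be a s)) s0 s1) al1 c <= c * (/ cb * eta ^ 2)).
    { rewrite (fubini (fun a s => phi1 (be a s))) by (try lra; ctac). rewrite <- RI_const. ri_le.
      intros s H. letr; [apply subst_a; [apply ct_phi1|apply phi1_ge0|auto]|].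
      apply Rmult_le_compat_l; auto. left; apply Rinv_0_lt_compat; auto. } assert (Hb : 0 < / cb) by pos.
    letr_with (c * / 2 * t * 1 + / 2 * / t * k ^ 2 * (c * (/ cb * eta ^ 2))).
    + apply Rplus_le_compat; apply Rmult_le_compat_l; auto.
      * repeat apply Rmult_le_pos; lra.
      * apply Rmult_le_pos; [lra|pos].
    + replace (/ 2 * / t * k ^ 2 * (c * (/ cb * eta ^ 2))) with (/ 2 * (t * c * / cb)) by (unfold t; field; lra).
      fold t. assert (0 <= t * c * / cb) by pos. assert (0 <= t * c) by pos. lra.
Qed.

Definition ms (a s : R) : R := (chi' s * chi (s + a) + chi s * chi' (s + a)) * psi a s + chi s * chi (s + a) * psis a s.

(** Since [psi * bes = a], the function [pf] is [psi / a] times the [s]-derivative of [p1] along the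
    curve, up to the term with [q1 * th']. Integration by parts has no boundary terms because of the
    cut-offs. *)
Lemma X_low_parts a y : al0 <= a <= c ->
  RI (fun s => chi s * chi (s + a) * pf (be a s) (y + th s)) s0 s1 =
  - / a * RI (fun s => ms a s * p1 (be a s) (y + th s) + chi s * chi (s + a) * psi a s * th' s * q1 (be a s) (y + th s)) s0 s1.
Proof.
  intro Ha. assert (A := ct_pf). assert (B := ct_p1). assert (B' := ct_q1). unfold ms.
  set (m := fun s => chi s * chi (s + a) * psi a s).
  set (m' := fun s => (chi' s * chi (s + a) + chi s * chi' (s + a)) * psi a s + chi s * chi (s + a) * psis a s).
  set (dp := fun s => pf (be a s) (y + th s) * bes a s + q1 (be a s) (y + th s) * th' s).
  assert (Cm : ct m) by (unfold m; ctac). assert (Cm' : ct m') by (unfold m'; ctac). assert (Cdp : ct dp) by (unfold dp; ctac).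
  assert (Pt : RI (fun s => m s * dp s) s0 s1 = - RI (fun s => m' s * p1 (be a s) (y + th s)) s0 s1).
  { rewrite (RI_parts m (fun s => p1 (be a s) (y + th s)) m' dp); try lra; auto; [|ctac| |].
    - unfold m. rewrite (chi_l s0), (chi_r s1) by lra. ring.
    - intros s H. unfold m, m'. apply (D_mult (fun s => chi s * chi (s + a)) (fun s => psi a s)).
      + apply (D_mult chi (fun s => chi (s + a))); [apply Dchi|apply chi_shift'].
      + apply Dpsis; split; lra.
    - intros s H. unfold dp. apply (chain2 p1 pf q1 (fun s => be a s) (fun s => y + th s)); auto; [apply p1_b|apply p1_z| |].
      + apply Dbes; split; lra.
      + eapply D_eq; [apply D_plus; [apply D_const|apply Dth; auto]|]. ring. }
  transitivity (/ a * RI (fun s => m s * dp s - m s * th' s * q1 (be a s) (y + th s)) s0 s1).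
  - rewrite <- RI_scal by ctac. apply RI_ext_le; [lra|]. intros s H. unfold dp, m. assert (P := Hpsi a s ltac:(split; lra)).
    replace (chi s * chi (s + a) * psi a s * (pf (be a s) (y + th s) * bes a s + q1 (be a s) (y + th s) * th' s) -
      chi s * chi (s + a) * psi a s * th' s * q1 (be a s) (y + th s)) with
      (chi s * chi (s + a) * (psi a s * bes a s) * pf (be a s) (y + th s)) by ring. rewrite P. field. lra.
  - rewrite RI_minus, Pt, RI_plus by ctac. unfold m, m'. ring.
Qed.

(** The primitive gains [eta]; the losses are [1 / al0] from dividing by [a], [1 / sig] from the
    [z]-derivative and [1 / r] from the cut-off. *)
Lemma X_low_large : Rabs (XX al0 c pf) <= 5 * C1 ^ 2 * c * (1 + / cb) * eta / (al0 * sig * r).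
Proof.
  assert (A := ct_pf). assert (B := ct_p1). assert (B' := ct_q1). assert (Hb : 0 < / cb) by pos.
  assert (Hi : 0 < / al0) by pos. destruct rr_facts as [H1 [H2 H3]].
  assert (Hsi : 1 <= / sig) by (rewrite <- Rinv_1; apply Rinv_le_contravar; lra). assert (Cms : ct2 ms) by (unfold ms; ctac).
  rewrite XX_swap by auto. set (Ya := fun h a => RI (fun s => J (fun y => Rabs (f y * f (y - a) * h (be a s) (y + th s)))) s0 s1).
  assert (Yb1 : RI (Ya p1) al0 c <= 1 * eta * c * (1 + / cb)).
  { apply (Y_bound p1 1); [lra|auto| |].
    - intros b x Hx. apply (csup_av sig (Gam1 b) R0); [lra|auto|lra].
    - intro b. rewrite pow1, Rmult_1_l. apply (av_norm sig (Gam1 b) R0 D); auto; [lra|apply ct2_row; auto|lra]. }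
  assert (Yb2 : RI (Ya q1) al0 c <= 2 / sig * eta * c * (1 + / cb)).
  { apply (Y_bound q1 (2 / sig)); [pos|auto| |].
    - intros b x Hx. unfold q1. rewrite !SG1; [ring| |lra].
      assert (T := Rabs_triang (x - sig) sig). replace (x - sig + sig) with x in T by ring. rewrite (Rabs_right sig) in T; lra.
    - intro b. letr_with (J (fun z => (/ sig) ^ 2 * (2 * Gam1 b z ^ 2 + 2 * Gam1 b (z + - sig) ^ 2))).
      + apply RI_le; [auto|unfold q1; ctac|ctac|]. intros z _. unfold q1. rewrite Rpow_mult_distr.
        mul_l. assert (0 <= (Gam1 b z + Gam1 b (z - sig)) ^ 2) by pos. unfold Rminus in *. lra.
      + rewrite RI_scal, RI_plus, !RI_scal by ctac.
        rewrite (J_shift (fun z => Gam1 b z ^ 2) R0 D (- sig)); [|auto|ctac|apply csup_sq; auto|rewrite Rabs_Ropp, Rabs_right; lra].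
        fold (phi1 b). right. field. lra. }
  assert (CY1 : ct (Ya p1)) by (unfold Ya; ctac). assert (CY2 : ct (Ya q1)) by (unfold Ya; ctac).
  letr_with (RI (fun a => / al0 * (3 * C1 ^ 2 / r * Ya p1 a + C1 ^ 2 * Ya q1 a)) al0 c).
  - letr; [apply RI_abs; [lra|ctac]|]. ri_le. intros a Ha.
    transitivity (Rabs (- / a * RI (fun s => ms a s * J (fun y => f y * f (y - a) * p1 (be a s) (y + th s)) +
      chi s * chi (s + a) * psi a s * th' s * J (fun y => f y * f (y - a) * q1 (be a s) (y + th s))) s0 s1)).
    { right. apply (f_equal Rabs).
      transitivity (J (fun y => - / a * RI (fun s => ms a s * (f y * f (y - a) * p1 (be a s) (y + th s)) +
        chi s * chi (s + a) * psi a s * th' s * (f y * f (y - a) * q1 (be a s) (y + th s))) s0 s1)).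
      - apply RI_ext; intro y. rewrite X_low_parts by auto.
        replace (f y * f (y - a) * (- / a * RI (fun s => ms a s * p1 (be a s) (y + th s) + chi s * chi (s + a) * psi a s * th' s * q1 (be a s) (y + th s)) s0 s1))
          with (- / a * (f y * f (y - a) * RI (fun s => ms a s * p1 (be a s) (y + th s) + chi s * chi (s + a) * psi a s * th' s * q1 (be a s) (y + th s)) s0 s1)) by ring.
        apply (f_equal (Rmult (- / a))). rewrite <- RI_scal by ctac. apply RI_ext; intro s. ring.
      - rewrite RI_scal by ctac. apply (f_equal (Rmult (- / a))).
        rewrite <- (fubini (fun s y => ms a s * (f y * f (y - a) * p1 (be a s) (y + th s)) +
        chi s * chi (s + a) * psi a s * th' s * (f y * f (y - a) * q1 (be a s) (y + th s)))) by (try lra; ctac).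
        apply RI_ext; intro s. rewrite RI_plus, !RI_scal by ctac. auto. } apply Rabs_mult_le.
    { rewrite Rabs_Ropp, Rabs_right by pos. apply Rinv_le_contravar; lra. } unfold Ya. rewrite <- !RI_scal, <- RI_plus by ctac.
    letr; [apply RI_abs; [lra|ctac]|]. ri_le. intros s H. assert (Hd : dom a s) by (split; lra). assert (Q := C1_sq).
    apply Rabs_plus_le; (apply Rabs_mult_le; [|apply RI_abs; [auto|ctac]]).
    + unfold ms. letr_with ((C1 / r * 1 + 1 * (C1 / r)) * C1 + 1 * 1 * C1).
      * repeat (apply Rabs_mult_le || apply Rabs_plus_le || apply chi_abs || apply Bchi' || auto).
      * replace (3 * C1 ^ 2 / r) with (2 * C1 ^ 2 * / r + C1 ^ 2 * / r) by (field; lra).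
        replace ((C1 / r * 1 + 1 * (C1 / r)) * C1 + 1 * 1 * C1) with (2 * C1 ^ 2 * / r + C1) by (field; lra).
        apply Rplus_le_compat_l. rewrite <- (Rmult_1_r C1) at 1. apply Rmult_le_compat; lra.
    + letr_with (1 * 1 * C1 * C1); [|right; ring]. repeat (apply Rabs_mult_le || apply chi_abs || auto).
  - rewrite RI_scal, RI_plus, !RI_scal by ctac. assert (Q := C1_sq).
    set (Z := eta * c * (1 + / cb)). assert (HZ : 0 <= Z) by (unfold Z; repeat apply Rmult_le_pos; lra).
    replace (1 * eta * c * (1 + / cb)) with Z in Yb1 by (unfold Z; ring).
    replace (2 / sig * eta * c * (1 + / cb)) with (2 * / sig * Z) in Yb2 by (unfold Z; field; lra).
    replace (5 * C1 ^ 2 * c * (1 + / cb) * eta / (al0 * sig * r)) with (/ al0 * (5 * C1 ^ 2 * Z * (/ r * / sig))) by (unfold Z; field; lra).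
    mul_l. letr_with (3 * C1 ^ 2 * / r * Z + C1 ^ 2 * (2 * / sig * Z)).
    + apply Rplus_le_compat; apply Rmult_le_compat_l; auto; [|lra]. apply Rmult_le_pos; lra.
    + assert (0 <= C1 ^ 2 * Z) by pos. assert (/ r <= / r * / sig) by (rewrite <- (Rmult_1_r (/ r)) at 1; mul_l; lra).
      assert (/ sig <= / r * / sig) by (rewrite <- (Rmult_1_l (/ sig)) at 1; mul_r; lra).
      apply (Rmult_le_compat_l (C1 ^ 2 * Z)) in H0; auto. apply (Rmult_le_compat_l (C1 ^ 2 * Z)) in H4; auto. lra.
Qed.

Theorem core t : 0 < t -> TT <= t ^ 2 ->
  Rabs (XX al1 c Gam) <= t + c * al0 / sig + 5 * C1 ^ 2 * c * (1 + / cb) * eta / (al0 * sig * r).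
Proof.
  intros Ht HT. assert (E : XX al1 c Gam = XX al1 c kf + (XX al1 al0 pf + XX al0 c pf)).
  { unfold XX. rewrite (RI_chasles (fun a => RI (fun s => chi s * chi (s + a) * J (fun y => f y * f (y - a) * pf (be a s) (y + th s))) s0 s1)) by ctac.
    rewrite <- RI_plus by ctac. apply RI_ext; intro a. rewrite <- RI_plus by ctac. apply RI_ext; intro s.
    rewrite <- Rmult_plus_distr_l. apply (f_equal (Rmult (chi s * chi (s + a)))).
    rewrite <- RI_plus by ctac. apply RI_ext; intro y. unfold kf, pf. ring. }
  rewrite E. assert (H1 := X_high t Ht HT). assert (H2 := X_low_small). assert (H3 := X_low_large).
  apply Rabs_le_between in H1, H2, H3. apply Rabs_le. lra.
Qed.
End Core.
End CoreEstimate.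
Import CoreEstimate.

(** * Real powers, cut-offs, and the ratios attached to a power curve *)

Module Powers.
Implicit Types f g : R -> R.

Ltac rring := cbv beta; lazymatch goal with |- @eq _ ?a ?b => change (@eq R a b) end; ring.

Lemma exp_le x y : x <= y -> exp x <= exp y.
Proof. intros [H| ->]; [left; apply exp_increasing; auto|lra]. Qed.

(** Clamping at [1 / 2] makes the powers [pw] continuous on the whole line; the estimates use them
    for [s >= 1]. *)
Definition lnc (s : R) : R := ln (Rmax s (/ 2)).
Definition pw (k s : R) : R := exp (k * lnc s).

Lemma rmax_half s : 0 < Rmax s (/ 2).
Proof. apply Rlt_le_trans with (/ 2); [lra|apply Rmax_r]. Qed.
Lemma ct_ln {U : UniformSpace} (h : U -> R) : ct h -> (forall u, 0 < h u) -> ct (fun u => ln (h u)).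
Proof.
  intros Ch Hp u. apply (continuous_comp h ln); [apply Ch|].
  apply (ex_derive_continuous ln). exists (/ h u). apply is_derive_Reals, derivable_pt_lim_ln; auto.
Qed.
Lemma ct_lnc : ct lnc.
Proof. unfold lnc. apply ct_ln; [ctac|intro; apply rmax_half]. Qed.
#[local] Hint Resolve ct_lnc : ctdb.
Lemma ct_pw k : ct (pw k).
Proof. unfold pw. ctac. Qed.
#[export] Hint Resolve ct_pw : ctdb.
Lemma pw_pos k s : 0 < pw k s.
Proof. apply exp_pos. Qed.
Lemma pw_plus k l s : pw (k + l) s = pw k s * pw l s.
Proof. unfold pw. rewrite <- exp_plus. f_equal; ring. Qed.
Lemma pw_1 s : / 2 <= s -> pw 1 s = s.
Proof. intro H. unfold pw, lnc. rewrite Rmult_1_l, Rmax_left by auto. apply exp_ln; lra. Qed.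
Lemma pw_0 s : pw 0 s = 1.
Proof. unfold pw. rewrite Rmult_0_l. apply exp_0. Qed.
Lemma pw_at1 k : pw k 1 = 1.
Proof. unfold pw, lnc. rewrite Rmax_left, ln_1, Rmult_0_r by lra. apply exp_0. Qed.
Lemma pw_step k s : / 2 <= s -> pw (k - 1) s * s = pw k s.
Proof. intro H. rewrite <- (pw_1 s H) at 2. rewrite <- pw_plus. f_equal; ring. Qed.

Lemma loc_gt (P : R -> Prop) (x0 x : R) : x0 < x -> (forall y, x0 < y -> P y) -> locally x P.
Proof.
  intros H HP. assert (Hd : 0 < x - x0) by lra. exists (mkposreal _ Hd). intros y Hy.
  apply HP. unfold ball in Hy; simpl in Hy; unfold AbsRing_ball, abs, minus, plus, opp in Hy; simpl in Hy.
  apply Rabs_lt_between in Hy. lra.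
Qed.
Lemma loc_lt (P : R -> Prop) (x0 x : R) : x < x0 -> (forall y, y < x0 -> P y) -> locally x P.
Proof.
  intros H HP. assert (Hd : 0 < x0 - x) by lra. exists (mkposreal _ Hd). intros y Hy.
  apply HP. unfold ball in Hy; simpl in Hy; unfold AbsRing_ball, abs, minus, plus, opp in Hy; simpl in Hy.
  apply Rabs_lt_between in Hy. lra.
Qed.

Lemma pw_deriv k (s : R) : / 2 < s -> is_derive (pw k) s (k * pw (k - 1) s).
Proof.
  intro H. apply (is_derive_ext_loc (fun s => exp (k * ln s))).
  - apply (loc_gt _ (/ 2)); auto. intros y Hy. unfold pw, lnc. rewrite Rmax_left by lra. auto.
  - auto_derive; [lra|]. assert (E : exp (k * ln s) = pw k s) by (unfold pw, lnc; rewrite Rmax_left by lra; auto).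
    rewrite E, <- (pw_step k s) by lra. field; lra.
Qed.

Lemma lnc_bound s L : 1 <= s <= L -> 0 <= lnc s <= ln L.
Proof.
  intro H. unfold lnc. rewrite Rmax_left by lra. split.
  - rewrite <- ln_1. apply ln_le; lra.
  - apply ln_le; lra.
Qed.
Lemma pw_bound k s L : 1 <= s <= L -> exp (- (Rabs k * ln L)) <= pw k s <= exp (Rabs k * ln L).
Proof.
  intro H. assert (B := lnc_bound s L H). unfold pw. assert (Rabs (k * lnc s) <= Rabs k * ln L).
  { rewrite Rabs_mult, (Rabs_right (lnc s)) by lra. mul_l; lra. } apply Rabs_le_between in H0. split; apply exp_le; lra.
Qed.
Lemma pw_mono k s s' : 0 <= k -> 1 <= s <= s' -> pw k s <= pw k s'.
Proof. intros Hk H. unfold pw. apply exp_le. mul_l; auto. unfold lnc. rewrite !Rmax_left by lra. apply ln_le; lra. Qed.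

Definition sq_pos (x : R) : R := Rmax x 0 ^ 2.
Lemma sq_pos_deriv (x : R) : is_derive sq_pos x (2 * Rmax x 0).
Proof.
  destruct (Rtotal_order x 0) as [H|[H|H]].
  - rewrite Rmax_right by lra. apply (is_derive_ext_loc (fun _ => 0)).
    + apply (loc_lt _ 0); auto. intros y Hy. unfold sq_pos. rewrite Rmax_right by lra. rring.
    + eapply D_eq; [apply D_const|ring].
  - subst x. rewrite Rmax_right by lra. rewrite Rmult_0_r. apply is_derive_Reals. intros eps He.
    exists (mkposreal eps He). intros h Hh0 Hh. simpl in Hh. unfold sq_pos. rewrite Rplus_0_l, (Rmax_right 0 0) by lra.
    unfold Rmax; destruct (Rle_dec h 0).
    + replace ((0 ^ 2 - 0 ^ 2) / h - 0) with 0 by (field; auto). rewrite Rabs_R0; auto.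
    + replace ((h ^ 2 - 0 ^ 2) / h - 0) with h by (field; auto). auto.
  - rewrite Rmax_left by lra. apply (is_derive_ext_loc (fun x => x ^ 2)).
    + apply (loc_gt _ 0); auto. intros y Hy. unfold sq_pos. rewrite Rmax_left by lra. auto.
    + auto_derive; auto. ring.
Qed.

(** A continuously differentiable step from 0 to 1 on [[0, r]]. The denominator is positive because
    the positive parts of [x] and [r - x] add up to at least [r]. *)
Definition step (r x : R) : R := sq_pos x / (sq_pos x + sq_pos (r - x)).
Definition step' (r x : R) : R := 2 * Rmax x 0 * Rmax (r - x) 0 * (Rmax x 0 + Rmax (r - x) 0) / (sq_pos x + sq_pos (r - x)) ^ 2.
Lemma step_den r x : 0 < r -> (Rmax x 0 + Rmax (r - x) 0) ^ 2 <= 2 * (sq_pos x + sq_pos (r - x)) /\ r <= Rmax x 0 + Rmax (r - x) 0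
  /\ 0 < sq_pos x + sq_pos (r - x).
Proof.
  intro Hr. unfold sq_pos. assert (A := Rmax_l x 0). assert (B := Rmax_l (r - x) 0).
  set (u := Rmax x 0) in *. set (v := Rmax (r - x) 0) in *.
  assert (0 <= (u - v) ^ 2) by pos. assert (r ^ 2 <= (u + v) ^ 2) by (apply pow_incr; lra).
  assert (0 < r ^ 2) by pos. repeat split; lra.
Qed.
Lemma step_deriv r (x : R) : 0 < r -> is_derive (step r) x (step' r x).
Proof.
  intro Hr. destruct (step_den r x Hr) as [_ [_ H]]. unfold step, step'. eapply D_eq.
  - apply (is_derive_div sq_pos (fun x => sq_pos x + sq_pos (r - x)) x (2 * Rmax x 0) (2 * Rmax x 0 + -1 * (2 * Rmax (r - x) 0))).
    + apply sq_pos_deriv.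
    + apply (D_plus sq_pos (fun x => sq_pos (r - x))); [apply sq_pos_deriv|].
      apply (D_comp sq_pos (fun x => r - x)); [apply sq_pos_deriv|]. auto_derive; auto; ring.
    + lra.
  - assert (H' := H). unfold sq_pos in H' |- *. field. lra.
Qed.
Lemma ct_step r : 0 < r -> ct (step r).
Proof. intros Hr u. apply (ex_derive_continuous (step r)). eexists; apply step_deriv; auto. Qed.
Lemma ct_step' r : 0 < r -> ct (step' r).
Proof.
  intro Hr. unfold step'. apply ct_div; [ctac|unfold sq_pos; ctac|]. intro u. destruct (step_den r u Hr) as [_ [_ H]].
  apply pow_nonzero; lra.
Qed.
Lemma step_01 r x : 0 < r -> 0 <= step r x <= 1.
Proof.
  intro Hr. destruct (step_den r x Hr) as [_ [_ H]]. assert (A : 0 <= sq_pos x) by apply pow2_ge_0.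
  assert (B : 0 <= sq_pos (r - x)) by apply pow2_ge_0. unfold step. split; [pos|].
  apply Rmult_le_reg_r with (sq_pos x + sq_pos (r - x)); auto. unfold Rdiv. rewrite Rmult_assoc, Rinv_l by lra. lra.
Qed.
Lemma step_l r x : x <= 0 -> step r x = 0.
Proof. intro H. unfold step, sq_pos. rewrite (Rmax_right x 0) by auto. unfold Rdiv; ring. Qed.
Lemma step'_l r x : x <= 0 -> step' r x = 0.
Proof. intro H. unfold step'. rewrite (Rmax_right x 0) by auto. unfold Rdiv; ring. Qed.
Lemma step_r r x : 0 < r -> r <= x -> step r x = 1.
Proof. intros Hr H. unfold step, sq_pos. rewrite (Rmax_right (r - x) 0), Rmax_left by lra. field. lra. Qed.
Lemma step'_bound r x : 0 < r -> Rabs (step' r x) <= 2 / r.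
Proof.
  intro Hr. destruct (step_den r x Hr) as [H1 [H2 H3]]. unfold step'. assert (A := Rmax_r x 0). assert (B := Rmax_r (r - x) 0).
  set (u := Rmax x 0) in *. set (v := Rmax (r - x) 0) in *. set (w := sq_pos x + sq_pos (r - x)) in *.
  assert (E : w = u ^ 2 + v ^ 2) by reflexivity. rewrite Rabs_right by (apply Rle_ge, Rdiv_le_0_compat; [pos|pos]).
  apply Rmult_le_reg_r with (w ^ 2); [pos|]. unfold Rdiv. rewrite Rmult_assoc, Rinv_l, Rmult_1_r by (apply pow_nonzero; lra).
  apply Rmult_le_reg_l with r; auto. replace (r * (2 * / r * w ^ 2)) with (2 * w * w) by (field; lra).
  assert (0 <= 2 * u * v) by pos. letr_with ((2 * u * v) * (r * (u + v))); [right; ring|]. assert (r * (u + v) <= 2 * w).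
  { letr_with ((u + v) * (u + v)); [mul_r; lra|lra]. }
  letr_with (w * (2 * w)); [|right; ring]. apply Rmult_le_compat; try lra. apply Rmult_le_pos; lra.
Qed.

(** A cut-off to [[1, L]] with transitions of length [r], times [1 / s], the density produced by the
    substitution [s = exp (al * v)]. *)
Definition ramp (L r s : R) : R := step r (s - 1) * step r (L - s) * pw (-1) s.
Definition ramp' (L r s : R) : R := (step' r (s - 1) * step r (L - s) - step r (s - 1) * step' r (L - s)) * pw (-1) s
  - step r (s - 1) * step r (L - s) * pw (-2) s.
Lemma ct_ramp L r : 0 < r -> ct (ramp L r).
Proof. intro Hr. assert (A := ct_step r Hr). unfold ramp. ctac. Qed.
Lemma ct_ramp' L r : 0 < r -> ct (ramp' L r).
Proof. intro Hr. assert (A := ct_step r Hr). assert (A' := ct_step' r Hr). unfold ramp'. ctac. Qed.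
Lemma ramp_deriv L r (s : R) : 0 < r -> is_derive (ramp L r) s (ramp' L r s).
Proof.
  intro Hr. destruct (Rlt_dec s 1) as [H|H].
  - unfold ramp'. rewrite (step_l r (s - 1)), (step'_l r (s - 1)) by lra. apply (is_derive_ext_loc (fun _ => 0)).
    + apply (loc_lt _ 1); auto. intros y Hy. unfold ramp. rewrite (step_l r (y - 1)) by lra. rring.
    + eapply D_eq; [apply D_const|ring].
  - unfold ramp, ramp'. eapply D_eq.
    + apply (D_mult (fun s => step r (s - 1) * step r (L - s)) (pw (-1))); [|apply pw_deriv; lra].
      apply (D_mult (fun s => step r (s - 1)) (fun s => step r (L - s))).
      * apply (D_comp (step r) (fun s => s - 1)); [apply step_deriv; auto|]. apply D_minus; [apply D_id|apply D_const].
      * apply (D_comp (step r) (fun s => L - s)); [apply step_deriv; auto|]. apply D_minus; [apply D_const|apply D_id].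
    + replace (-1 - 1) with (-2) by ring. ring.
Qed.
Lemma pw_neg k s : k <= 0 -> 1 <= s -> pw k s <= 1.
Proof.
  intros Hk H. assert (B := lnc_bound s s ltac:(lra)). unfold pw. rewrite <- exp_0. apply exp_le.
  assert (0 <= - k * lnc s) by pos. lra.
Qed.
Lemma ramp_01 L r s : 0 < r -> 0 <= ramp L r s <= 1.
Proof.
  intro Hr. unfold ramp. destruct (Rlt_dec s 1) as [H|H].
  - rewrite (step_l r (s - 1)) by lra. lra.
  - assert (A := step_01 r (s - 1) Hr). assert (B := step_01 r (L - s) Hr). assert (C := pw_pos (-1) s). assert (D := pw_neg (-1) s ltac:(lra) ltac:(lra)).
    split; [apply Rmult_le_pos; [pos|]; lra|]. letr_with (1 * 1 * 1); [|lra].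
    apply Rmult_le_compat; [pos|lra|apply Rmult_le_compat; lra|lra].
Qed.
Lemma ramp'_bound L r s : 0 < r <= 1 -> Rabs (ramp' L r s) <= 5 / r.
Proof.
  intro Hr. unfold ramp'. destruct (Rlt_dec s 1) as [H|H].
  - rewrite (step_l r (s - 1)), (step'_l r (s - 1)) by lra. replace ((0 * step r (L - s) - 0 * step' r (L - s)) * pw (-1) s - 0 * step r (L - s) * pw (-2) s) with 0 by ring.
    rewrite Rabs_R0. apply Rdiv_le_0_compat; lra.
  - assert (St : forall x, Rabs (step r x) <= 1) by (intro x; assert (A := step_01 r x ltac:(lra)); rewrite Rabs_right; lra).
    assert (Pw : forall k, k <= 0 -> Rabs (pw k s) <= 1) by (intros k Hk; assert (C := pw_pos k s); rewrite Rabs_right by lra; apply pw_neg; lra).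
    assert (B : forall x, Rabs (step' r x) <= 2 / r) by (intro; apply step'_bound; lra).
    assert (1 <= / r) by (rewrite <- Rinv_1; apply Rinv_le_contravar; lra).
    letr_with ((2 / r * 1 + 1 * (2 / r)) * 1 + 1 * 1 * 1); [|unfold Rdiv; lra].
    repeat (apply St || apply B || (apply Pw; lra) || apply Rabs_mult_le || apply Rabs_minus_le || apply Rabs_plus_le).
Qed.
Lemma ramp_l L r s : s <= 1 -> ramp L r s = 0.
Proof. intro H. unfold ramp. rewrite (step_l r (s - 1)) by lra. ring. Qed.
Lemma ramp_r L r s : L <= s -> ramp L r s = 0.
Proof. intro H. unfold ramp. rewrite (step_l r (L - s)) by lra. ring. Qed.

(** For the curve [be a s = (s + a)^kap - s^kap], put [k = kap - 1] and [x = a / s]. By homogeneity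
    [bes = kap s^k Ex k x], the relation [a bea = ta bes] gives [ta = a + s rr k x], and the
    [s]-derivative of [ta] is [r1 k x]. *)
Definition Ex (k x : R) : R := pw k (1 + x) - 1.
Definition rr (k x : R) : R := x / Ex k x.
Definition r1 (k x : R) : R := x ^ 2 * (k * pw (k - 1) (1 + x)) / Ex k x ^ 2.

Section Ratios.
Context (k L : R) (Hk : k <> 0) (HL : 1 < L).
Definition em : R := Rabs k * exp (- (Rabs (k - 1) * ln L)).
Definition eM : R := Rabs k * exp (Rabs (k - 1) * ln L).
Lemma em_pos : 0 < em <= eM.
Proof.
  assert (0 < Rabs k) by (apply Rabs_pos_lt; auto). assert (0 < ln L) by (rewrite <- ln_1; apply ln_increasing; lra).
  assert (0 <= Rabs (k - 1) * ln L) by pos.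
  unfold em, eM. split; [apply Rmult_lt_0_compat; auto; apply exp_pos|]. mul_l. apply exp_le; lra.
Qed.
Lemma Ex_mvt x : 0 < x <= L - 1 -> exists xi, 0 <= xi <= x /\ Ex k x = x * (k * pw (k - 1) (1 + xi)).
Proof.
  intro Hx. destruct (MVT_gen (fun x => Ex k x) 0 x (fun x => k * pw (k - 1) (1 + x))) as [xi [H1 H2]].
  - intros y Hy. rewrite Rmin_left, Rmax_right in Hy by lra. unfold Ex. eapply D_eq.
    + apply D_minus; [|apply D_const]. apply (D_comp (pw k) (fun x => 1 + x)); [apply pw_deriv; lra|]. apply D_plus; [apply D_const|apply D_id].
    + ring.
  - intros y Hy. apply continuity_pt_filterlim. assert (ct (Ex k)) by (unfold Ex; ctac). apply H.
  - rewrite Rmin_left, Rmax_right in H1 by lra. exists xi. split; auto.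
    assert (Ex k 0 = 0) by (unfold Ex; rewrite Rplus_0_r, pw_at1; ring). rewrite H in H2. lra.
Qed.
Lemma ek_bound x : 0 <= x <= L - 1 -> em <= Rabs (k * pw (k - 1) (1 + x)) <= eM.
Proof.
  intro H. rewrite Rabs_mult, (Rabs_right (pw _ _)) by (left; apply pw_pos).
  assert (B := pw_bound (k - 1) (1 + x) L ltac:(lra)). unfold em, eM. split; apply Rmult_le_compat_l; try apply Rabs_pos; lra.
Qed.
Lemma Ex_bound x : 0 < x <= L - 1 -> x * em <= Rabs (Ex k x) <= x * eM.
Proof.
  intro H. destruct (Ex_mvt x H) as [xi [H1 H2]]. rewrite H2, Rabs_mult, (Rabs_right x) by lra.
  assert (B := ek_bound xi ltac:(lra)). split; mul_l; lra.
Qed.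
Lemma rr_bound x : 0 < x <= L - 1 -> Rabs (rr k x) <= / em.
Proof.
  intro H. assert (B := Ex_bound x H). assert (E := em_pos). assert (0 < x * em) by pos.
  unfold rr, Rdiv. rewrite Rabs_mult, Rabs_inv, (Rabs_right x) by lra.
  apply Rmult_le_reg_r with (Rabs (Ex k x)); [lra|]. rewrite Rmult_assoc, Rinv_l by lra.
  apply Rmult_le_reg_l with em; [lra|]. field_simplify; lra.
Qed.
(** The lower bound is where curvature enters: [r1] is the [s]-derivative of [ta], so [ta] depends
    on [s] without degeneracy, down to [a = 0]. *)
Lemma r1_bound x : 0 < x <= L - 1 -> em / eM ^ 2 <= Rabs (r1 k x) <= eM / em ^ 2.
Proof.
  intro H. assert (B := Ex_bound x H). assert (E := em_pos). assert (0 < x * em) by pos.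
  assert (K := ek_bound x ltac:(lra)). set (d := k * pw (k - 1) (1 + x)) in *. unfold r1. fold d. set (y := Rabs (Ex k x)) in *.
  unfold Rdiv. rewrite Rabs_mult, Rabs_inv, Rabs_mult, <- !RPow_abs. fold y. rewrite (Rabs_right x) by lra.
  assert (0 < x ^ 2) by pos. assert (0 < y ^ 2) by pos. assert (0 < em ^ 2) by pos. assert (0 < eM ^ 2) by pos.
  assert (U1 : x ^ 2 * em ^ 2 <= y ^ 2) by (rewrite <- Rpow_mult_distr; apply pow_incr; lra).
  assert (U2 : y ^ 2 <= x ^ 2 * eM ^ 2) by (rewrite <- Rpow_mult_distr; apply pow_incr; lra). split.
  - apply Rmult_le_reg_r with (y ^ 2 * eM ^ 2); [pos|].
    replace (em * / eM ^ 2 * (y ^ 2 * eM ^ 2)) with (em * y ^ 2) by (field; lra).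
    replace (x ^ 2 * Rabs d * / y ^ 2 * (y ^ 2 * eM ^ 2)) with (Rabs d * (x ^ 2 * eM ^ 2)) by (field; lra).
    apply Rmult_le_compat; lra.
  - apply Rmult_le_reg_r with (y ^ 2 * em ^ 2); [pos|].
    replace (eM * / em ^ 2 * (y ^ 2 * em ^ 2)) with (eM * y ^ 2) by (field; lra).
    replace (x ^ 2 * Rabs d * / y ^ 2 * (y ^ 2 * em ^ 2)) with (Rabs d * (x ^ 2 * em ^ 2)) by (field; lra).
    apply Rmult_le_compat; try lra. apply Rmult_le_pos; lra.
Qed.
Lemma Ex_nz x : 0 < x -> Ex k x <> 0.
Proof.
  intro Hx. unfold Ex. intro H. assert (E : pw k (1 + x) = 1) by lra. unfold pw, lnc in E. rewrite Rmax_left in E by lra.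
  assert (E' : exp (k * ln (1 + x)) = exp 0) by (rewrite exp_0; auto). clear E; rename E' into E. apply exp_inv in E. apply Rmult_integral in E. destruct E; [auto|].
  assert (0 < ln (1 + x)) by (rewrite <- ln_1; apply ln_increasing; lra). lra.
Qed.
Lemma rr_deriv (x : R) : 0 < x -> is_derive (rr k) x ((rr k x - r1 k x) / x).
Proof.
  intro H. assert (N := Ex_nz x H). unfold rr. eapply D_eq.
  - apply (is_derive_div (fun x => x) (fun x => Ex k x) x 1 (k * pw (k - 1) (1 + x))); auto; [apply D_id|].
    unfold Ex. eapply D_eq.
    + apply D_minus; [|apply D_const]. apply (D_comp (pw k) (fun x => 1 + x)); [apply pw_deriv; lra|]. apply D_plus; [apply D_const|apply D_id].
    + ring.
  - unfold r1. field. lra.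
Qed.
End Ratios.
End Powers.
Import Powers.

(** * The core estimate for power curves *)

Module CorePower.
Implicit Types f g : R -> R.

Lemma pw_mult k s t : 1 <= s -> 1 <= t -> pw k (s * t) = pw k s * pw k t.
Proof.
  intros Hs Ht. assert (1 <= s * t) by (rewrite <- (Rmult_1_l 1); apply Rmult_le_compat; lra).
  unfold pw, lnc. rewrite !Rmax_left, ln_mult, <- exp_plus by lra. f_equal; ring.
Qed.

Lemma ct_bounded (F : R -> R) a b : a <= b -> ct F -> exists M, 0 <= M /\ forall x, a <= x <= b -> Rabs (F x) <= M.
Proof.
  intros H C. destruct (continuity_ab_maj (fun x => Rabs (F x)) a b H) as [x0 [Hm _]].
  - intros x _. apply continuity_pt_filterlim. assert (E : ct (fun x => Rabs (F x))) by ctac. apply E.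
  - exists (Rabs (F x0)). split; [pos|auto].
Qed.

Lemma pow_le1 q n : 0 < q <= 1 -> 0 < q ^ n <= 1.
Proof. intro H. split; [pos|]. rewrite <- (pow1 n). apply pow_incr; lra. Qed.

Section Pow.
Context (kap L : R) (Hkap : 0 < kap) (Hkap1 : kap <> 1) (HL : 2 <= L).
Notation k := (kap - 1).
Notation c := (L - 1).
(** Bound for [pw j] on [[1, 2 L]], an interval containing both [s] and [s + a]. *)
Definition Bd (j : R) : R := exp (Rabs j * ln (2 * L)).
Definition im : R := / em k L.
Definition Mm : R := eM k L / em k L ^ 2.
Definition mr : R := em k L / eM k L ^ 2.
(** The sum of all the bounds that the core estimate wants below [C1]; the 5 is for the derivative
    of the cut-off ([ramp'_bound]). *)
Definition C1p : R := 5 + (c + L * im) + Mm + (c + L * (im + Mm)) + / kap * Bd (2 - kap) * im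
  + / kap * Bd (1 - kap) * (Rabs (1 - kap) * im + Mm) + (L + Bd kap) + (1 + kap * Bd k) + kap * (Rabs k * Bd (k - 1)).
(** So small that the term with [nu] in [thp] leaves [|thp'| >= 1 / 2] and changes the derivative of
    [thp' * tap] by at most [mr / 4]. *)
Definition nu0 : R := / (1 + 2 * (kap * Bd k) + 4 * (kap * (Rabs k * Bd (k - 1))) * C1p / mr).
Definition cbp : R := kap * exp (- (Rabs k * ln (2 * L))).

Let Hk : k <> 0. Proof. lra. Qed.
Lemma pow_pos : 0 < im /\ 0 < Mm /\ 0 < mr /\ (forall j, 1 <= Bd j) /\ 0 < / kap.
Proof.
  assert (E := em_pos k L Hk ltac:(lra)). assert (0 < em k L ^ 2) by pos. assert (0 < eM k L ^ 2) by pos.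
  unfold im, Mm, mr. repeat split; try (apply Rdiv_lt_0_compat; lra); try (apply Rinv_0_lt_compat; lra).
  intro j. unfold Bd. rewrite <- exp_0. apply exp_le. apply Rmult_le_pos; [pos|]. rewrite <- ln_1. apply ln_le; lra.
Qed.
Lemma C1p_terms : 5 <= C1p /\ c + L * im <= C1p /\ Mm <= C1p /\ c + L * (im + Mm) <= C1p /\ / kap * Bd (2 - kap) * im <= C1p
  /\ / kap * Bd (1 - kap) * (Rabs (1 - kap) * im + Mm) <= C1p /\ L + Bd kap <= C1p /\ 1 + kap * Bd k <= C1p
  /\ kap * (Rabs k * Bd (k - 1)) <= C1p /\ 0 < 1 + 2 * (kap * Bd k) + 4 * (kap * (Rabs k * Bd (k - 1))) * C1p / mr.
Proof.
  destruct pow_pos as [H1 [H2 [H3 [H4 H5]]]]. assert (P := fun j => Rlt_le_trans 0 1 (Bd j) Rlt_0_1 (H4 j)).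
  assert (T2 : 0 <= L * im) by pos. assert (T3 : 0 <= L * (im + Mm)) by pos.
  assert (T4 : 0 <= / kap * Bd (2 - kap) * im) by (assert (X := P (2 - kap)); apply Rmult_le_pos; [pos|]; lra).
  assert (T5 : 0 <= / kap * Bd (1 - kap) * (Rabs (1 - kap) * im + Mm)).
  { assert (X := P (1 - kap)). assert (0 <= Rabs (1 - kap) * im) by pos. apply Rmult_le_pos; [pos|]; lra. }
  assert (T6 := P kap). assert (T7 : 0 <= kap * Bd k) by (assert (X := P k); apply Rmult_le_pos; lra).
  assert (T8 : 0 <= kap * (Rabs k * Bd (k - 1))).
  { assert (X := P (k - 1)). apply Rmult_le_pos; [lra|]. apply Rmult_le_pos; [pos|lra]. }
  assert (T9 : 5 <= C1p) by (unfold C1p; lra). assert (T10 : 0 <= 4 * (kap * (Rabs k * Bd (k - 1))) * C1p / mr).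
  { apply Rdiv_le_0_compat; auto. apply Rmult_le_pos; lra. } repeat split; try (unfold C1p; lra). lra.
Qed.
Lemma nu0_pos : 0 < nu0 <= 1.
Proof.
  destruct C1p_terms as [_ [_ [_ [_ [_ [_ [_ [_ [_ H]]]]]]]]]. destruct pow_pos as [H1 [H2 [H3 [H4 H5]]]].
  assert (P := fun j => Rlt_le_trans 0 1 (Bd j) Rlt_0_1 (H4 j)). destruct C1p_terms as [T _].
  assert (0 <= 2 * (kap * Bd k)) by (assert (X := P k); apply Rmult_le_pos; [lra|]; apply Rmult_le_pos; lra).
  assert (0 <= 4 * (kap * (Rabs k * Bd (k - 1))) * C1p / mr).
  { apply Rdiv_le_0_compat; auto. apply Rmult_le_pos; [|lra]. apply Rmult_le_pos; [lra|]. assert (X := P (k - 1)).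
    apply Rmult_le_pos; [lra|]. apply Rmult_le_pos; [pos|lra]. }
  unfold nu0. split; [pos|]. letr_with (/ 1); [apply Rinv_le_contravar; lra|rewrite Rinv_1; lra].
Qed.
Lemma pw_Bd j s : 1 <= s <= 2 * L -> pw j s <= Bd j.
Proof. intro H. apply pw_bound; auto. Qed.

Context (h nu e2 : R) (Hh : 0 < h) (Hnu : 0 <= nu <= nu0) (He2 : e2 ^ 2 = 1).
(** The ratio [a / s], clamped so as to be positive and continuous everywhere; the clamps lie
    strictly outside [domp], so derivatives there are unaffected. *)
Definition xh (a s : R) : R := Rmax a (h / 2) / Rmax s (/ 2).
Definition bep (a s : R) : R := pw kap (s + a) - pw kap s.
Definition beap (a s : R) : R := kap * pw k (s + a).
Definition besp (a s : R) : R := kap * (pw k (s + a) - pw k s).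
Definition tap (a s : R) : R := a + s * rr k (xh a s).
Definition taap (a s : R) : R := 1 + (rr k (xh a s) - r1 k (xh a s)) / xh a s.
Definition tasp (a s : R) : R := r1 k (xh a s).
Definition psip (a s : R) : R := / kap * pw (2 - kap) s * rr k (xh a s).
Definition psisp (a s : R) : R := / kap * pw (1 - kap) s * ((1 - kap) * rr k (xh a s) + r1 k (xh a s)).
(** Position of [g] relative to [f]: for [y = x - s] one has [x - e2 * nu * s^kap = y + thp s]. *)
Definition thp (s : R) : R := s - e2 * nu * pw kap s.
Definition thp' (s : R) : R := 1 - e2 * nu * (kap * pw k s).
Definition thp'' (s : R) : R := - (e2 * nu * (kap * (k * pw (k - 1) s))).
Definition domp (a s : R) : Prop := h <= a <= c /\ 1 <= s <= L.

Lemma xh_pos a s : 0 < xh a s.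
Proof. unfold xh. assert (A := Rmax_r a (h / 2)). apply Rdiv_lt_0_compat; [lra|apply rmax_half]. Qed.
Lemma ct_xh : ct2 xh.
Proof. unfold xh, ct2. apply ct_div; [ctac|ctac|]. intro u. apply Rgt_not_eq, (rmax_half (snd u)). Qed.
Lemma ct2_Exh : ct2 (fun a s => Ex k (xh a s)).
Proof. assert (A := ct_xh). unfold Ex. ctac. Qed.
#[local] Hint Resolve ct_xh ct2_Exh : ctdb.
Lemma ct2_rr : ct2 (fun a s => rr k (xh a s)).
Proof. assert (B := ct2_Exh). unfold rr, ct2. apply ct_div; [ctac|exact B|]. intro u. apply Ex_nz; [lra|apply xh_pos]. Qed.
#[local] Hint Resolve ct2_rr : ctdb.
Lemma ct2_r1 : ct2 (fun a s => r1 k (xh a s)).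
Proof.
  assert (B := ct2_Exh). unfold r1, ct2. apply ct_div; [ctac|apply ct_pow; exact B|].
  intro u. apply pow_nonzero. apply Ex_nz; [lra|apply xh_pos].
Qed.
Lemma ct_pows : (forall j, ct (pw j)) /\ ct2 bep /\ ct2 beap /\ ct2 besp /\ ct2 tap /\ ct2 taap /\ ct2 tasp /\ ct2 psip /\ ct2 psisp
  /\ ct thp /\ ct thp' /\ ct thp''.
Proof.
  assert (P := ct_pw). set (rx := fun a s => rr k (xh a s)). set (r1x := fun a s => r1 k (xh a s)).
  assert (B : ct2 rx) by apply ct2_rr. assert (C : ct2 r1x) by apply ct2_r1.
  unfold bep, beap, besp, tap, tasp, psip, psisp, thp, thp', thp''.
  repeat split; auto; try solve [ctac]; try (fold (rx); fold (r1x)).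
  - change (ct2 (fun a s => a + s * rx a s)). ctac.
  - change (ct2 (fun a s => 1 + (rx a s - r1x a s) / xh a s)). unfold ct2. apply ct_plus; [ctac|]. apply ct_div; [ctac|ctac|].
    intro u. apply Rgt_not_eq, (xh_pos (fst u) (snd u)).
  - change (ct2 (fun a s => / kap * pw (2 - kap) s * rx a s)). ctac.
  - change (ct2 (fun a s => / kap * pw (1 - kap) s * ((1 - kap) * rx a s + r1x a s))). ctac.
Qed.

Lemma xh_dom a s : domp a s -> xh a s = a / s /\ 0 < a / s <= c.
Proof.
  intros [Ha Hs]. unfold xh. rewrite !Rmax_left by lra. split; auto. split; [pos|].
  apply Rmult_le_reg_r with s; [lra|]. unfold Rdiv. rewrite Rmult_assoc, Rinv_l by lra. letr_with (c * 1); [lra|]. mul_l; lra.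
Qed.
Lemma loc_a a s (F : R -> R -> R) (l : R) : domp a s -> is_derive (fun a => F a (a / s)) a l -> is_derive (fun a => F a (xh a s)) a l.
Proof.
  intros [Ha Hs] H. apply (is_derive_ext_loc (fun a => F a (a / s))); auto.
  apply (loc_gt _ (h / 2)); [lra|]. intros y Hy. unfold xh. rewrite !Rmax_left by lra. auto.
Qed.
Lemma loc_s a s (F : R -> R -> R) (l : R) : domp a s -> is_derive (fun s => F s (a / s)) s l -> is_derive (fun s => F s (xh a s)) s l.
Proof.
  intros [Ha Hs] H. apply (is_derive_ext_loc (fun s => F s (a / s))); auto.
  apply (loc_gt _ (/ 2)); [lra|]. intros y Hy. unfold xh. rewrite !Rmax_left by lra. auto.
Qed.

Lemma bep_a a s : domp a s -> is_derive (fun a => bep a s) a (beap a s).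
Proof.
  intros [Ha Hs]. unfold bep, beap. eapply D_eq.
  - apply D_minus; [|apply D_const]. apply (D_comp (pw kap) (fun a => s + a)); [apply pw_deriv; lra|]. apply D_plus; [apply D_const|apply D_id].
  - ring.
Qed.
Lemma bep_s a s : domp a s -> is_derive (fun s => bep a s) s (besp a s).
Proof.
  intros [Ha Hs]. unfold bep, besp. eapply D_eq.
  - apply D_minus; [|apply pw_deriv; lra]. apply (D_comp (pw kap) (fun s => s + a)); [apply pw_deriv; lra|]. apply D_plus; [apply D_id|apply D_const].
  - ring.
Qed.
Lemma div_a (a s : R) : s <> 0 -> is_derive (fun a => a / s) a (/ s).
Proof. intro H. auto_derive; auto. field; auto. Qed.
Lemma div_s (a s : R) : s <> 0 -> is_derive (fun s => a / s) s (- a / s ^ 2).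
Proof. intro H. auto_derive; auto. field; auto. Qed.
Lemma tap_a a s : domp a s -> is_derive (fun a => tap a s) a (taap a s).
Proof.
  intro Hd. destruct (xh_dom a s Hd) as [E P]. unfold tap, taap. rewrite E. destruct Hd as [Ha Hs].
  apply (loc_a a s (fun a x => a + s * rr k x)); [split; auto|]. eapply D_eq.
  - apply D_plus; [apply D_id|]. apply (D_scal (fun a => rr k (a / s))).
    apply (D_comp (rr k) (fun a => a / s)); [apply rr_deriv; [lra|apply P]|apply div_a; lra].
  - field. lra.
Qed.
Lemma tap_s a s : domp a s -> is_derive (fun s => tap a s) s (tasp a s).
Proof.
  intro Hd. destruct (xh_dom a s Hd) as [E P]. unfold tap, tasp. rewrite E. destruct Hd as [Ha Hs].
  apply (loc_s a s (fun s x => a + s * rr k x)); [split; auto|]. eapply D_eq.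
  - apply D_plus; [apply D_const|]. apply (D_mult (fun s => s) (fun s => rr k (a / s))); [apply D_id|].
    apply (D_comp (rr k) (fun s => a / s)); [apply rr_deriv; [lra|apply P]|apply div_s; lra].
  - field. lra.
Qed.
Lemma psip_s a s : domp a s -> is_derive (fun s => psip a s) s (psisp a s).
Proof.
  intro Hd. destruct (xh_dom a s Hd) as [E P]. unfold psip, psisp. rewrite E. destruct Hd as [Ha Hs].
  apply (loc_s a s (fun s x => / kap * pw (2 - kap) s * rr k x)); [split; auto|]. eapply D_eq.
  - apply (D_mult (fun s => / kap * pw (2 - kap) s) (fun s => rr k (a / s))).
    + apply (D_scal (pw (2 - kap))). apply pw_deriv; lra.
    + apply (D_comp (rr k) (fun s => a / s)); [apply rr_deriv; [lra|apply P]|apply div_s; lra].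
  - replace (2 - kap - 1) with (1 - kap) by ring. assert (Q : pw (2 - kap) s = pw (1 - kap) s * s).
    { rewrite <- (pw_step (2 - kap) s) by lra. f_equal. f_equal. ring. } rewrite Q. field. lra.
Qed.
Lemma thp_s s : 1 <= s <= L -> is_derive thp s (thp' s).
Proof. intro H. unfold thp, thp'. apply D_minus; [apply D_id|]. apply (D_scal (pw kap)). apply pw_deriv; lra. Qed.
Lemma thp'_s s : 1 <= s <= L -> is_derive thp' s (thp'' s).
Proof.
  intro H. unfold thp', thp''. eapply D_eq.
  - apply D_minus; [apply D_const|]. apply (D_scal (fun s => kap * pw k s)). apply (D_scal (pw k)). apply pw_deriv; lra.
  - ring.
Qed.

Lemma pw_shift a s : domp a s -> pw k (s + a) = pw k s * pw k (1 + a / s).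
Proof. intro Hd. destruct (xh_dom a s Hd) as [E P]. destruct Hd as [Ha Hs]. rewrite <- pw_mult by lra. f_equal. field. lra. Qed.
Lemma tap_id a s : domp a s -> a * beap a s = tap a s * besp a s.
Proof.
  intro Hd. unfold beap, tap, besp. rewrite (pw_shift a s Hd). destruct (xh_dom a s Hd) as [E P]. rewrite E. destruct Hd as [Ha Hs].
  assert (N := Ex_nz k Hk (a / s) ltac:(lra)). unfold rr. unfold Ex in *. field. split; lra.
Qed.
Lemma psip_id a s : domp a s -> psip a s * besp a s = a.
Proof.
  intro Hd. unfold psip, besp. rewrite (pw_shift a s Hd). destruct (xh_dom a s Hd) as [E P]. rewrite E. destruct Hd as [Ha Hs].
  assert (N := Ex_nz k Hk (a / s) ltac:(lra)). unfold rr. unfold Ex in *.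
  assert (Q : pw (2 - kap) s * pw k s = s) by (rewrite <- pw_plus; replace (2 - kap + k) with 1 by ring; apply pw_1; lra).
  transitivity (pw (2 - kap) s * pw k s * (a / s)); [field; repeat split; lra|]. rewrite Q. field. lra.
Qed.

Lemma rr_d a s : domp a s -> Rabs (rr k (xh a s)) <= im /\ Rabs (r1 k (xh a s)) <= Mm /\ mr <= Rabs (r1 k (xh a s)).
Proof.
  intro Hd. destruct (xh_dom a s Hd) as [E P]. rewrite E. assert (B := rr_bound k L Hk ltac:(lra) (a / s) P).
  assert (B' := r1_bound k L Hk ltac:(lra) (a / s) P). unfold im, Mm, mr. lra.
Qed.
Lemma B_be a s : domp a s -> 0 <= bep a s <= Bd kap.
Proof.
  intros [Ha Hs]. unfold bep. assert (A := pw_mono kap s (s + a) ltac:(lra) ltac:(lra)). assert (B := pw_Bd kap (s + a) ltac:(lra)).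
  assert (C := pw_pos kap s). lra.
Qed.
Lemma B_bea a s : domp a s -> cbp <= beap a s.
Proof. intros [Ha Hs]. unfold beap, cbp. mul_l. apply (pw_bound k (s + a) (2 * L)); lra. Qed.
Lemma B_ta a s : domp a s -> Rabs (tap a s) <= C1p.
Proof.
  intro Hd. destruct (rr_d a s Hd) as [B _]. destruct Hd as [Ha Hs]. destruct C1p_terms as [_ [T _]]. letr; [|apply T].
  unfold tap. apply Rabs_plus_le; [rewrite Rabs_right; lra|]. apply Rabs_mult_le; auto. rewrite Rabs_right; lra.
Qed.
Lemma B_tas a s : domp a s -> Rabs (tasp a s) <= C1p.
Proof. intro Hd. destruct (rr_d a s Hd) as [_ [B _]]. destruct C1p_terms as [_ [_ [T _]]]. unfold tasp. lra. Qed.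
Lemma B_taa a s : domp a s -> Rabs (a * taap a s) <= C1p.
Proof.
  intro Hd. destruct (rr_d a s Hd) as [B [B' _]]. destruct C1p_terms as [_ [_ [_ [T _]]]]. letr; [|apply T].
  unfold taap. destruct (xh_dom a s Hd) as [E P]. rewrite E in *. destruct Hd as [Ha Hs].
  replace (a * (1 + (rr k (a / s) - r1 k (a / s)) / (a / s))) with (a + s * (rr k (a / s) - r1 k (a / s))) by (field; lra).
  apply Rabs_plus_le; [rewrite Rabs_right; lra|]. apply Rabs_mult_le; [rewrite Rabs_right; lra|]. apply Rabs_minus_le; auto.
Qed.
Lemma Rabs_pw j s : 1 <= s <= 2 * L -> Rabs (pw j s) <= Bd j.
Proof. intro H. rewrite Rabs_right by (left; apply pw_pos). apply pw_Bd; auto. Qed.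
Lemma B_psi a s : domp a s -> Rabs (psip a s) <= C1p.
Proof.
  intro Hd. destruct (rr_d a s Hd) as [B _]. destruct Hd as [Ha Hs]. destruct C1p_terms as [_ [_ [_ [_ [T _]]]]]. letr; [|apply T].
  destruct pow_pos as [_ [_ [_ [_ P]]]].
  unfold psip. repeat apply Rabs_mult_le; auto; [rewrite Rabs_right; lra|apply Rabs_pw; lra].
Qed.
Lemma B_psis a s : domp a s -> Rabs (psisp a s) <= C1p.
Proof.
  intro Hd. destruct (rr_d a s Hd) as [B [B' _]]. destruct Hd as [Ha Hs]. destruct C1p_terms as [_ [_ [_ [_ [_ [T _]]]]]]. letr; [|apply T].
  destruct pow_pos as [_ [_ [_ [_ P]]]].
  unfold psisp. apply Rabs_mult_le; [apply Rabs_mult_le; [rewrite Rabs_right; lra|apply Rabs_pw; lra]|].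
  apply Rabs_plus_le; auto. apply Rabs_mult_le; auto. lra.
Qed.
Lemma e2_abs : Rabs e2 = 1.
Proof. rewrite <- (sqrt_pow2 (Rabs e2)) by pos. rewrite pow2_abs, He2. apply sqrt_1. Qed.
Lemma e2nu : Rabs (e2 * nu) = nu.
Proof. rewrite Rabs_mult, e2_abs, Rabs_right; lra. Qed.
Lemma B_th s : 1 <= s <= L -> Rabs (thp s) <= C1p.
Proof.
  intro H. assert (N := nu0_pos). destruct C1p_terms as [_ [_ [_ [_ [_ [_ [T _]]]]]]]. letr; [|apply T].
  unfold thp. apply Rabs_minus_le; [rewrite Rabs_right; lra|]. rewrite <- (Rmult_1_l (Bd kap)). apply Rabs_mult_le; [rewrite e2nu; lra|apply Rabs_pw; lra].
Qed.
Lemma th'_pert s : 1 <= s <= L -> Rabs (e2 * nu * (kap * pw k s)) <= nu * (kap * Bd k).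
Proof. intro H. apply Rabs_mult_le; [rewrite e2nu; lra|]. apply Rabs_mult_le; [rewrite Rabs_right; lra|apply Rabs_pw; lra]. Qed.
Lemma B_th'' s : 1 <= s <= L -> Rabs (thp'' s) <= nu * (kap * (Rabs k * Bd (k - 1))).
Proof.
  intro H. unfold thp''. rewrite Rabs_Ropp. apply Rabs_mult_le; [rewrite e2nu; lra|]. apply Rabs_mult_le; [rewrite Rabs_right; lra|].
  apply Rabs_mult_le; [lra|apply Rabs_pw; lra].
Qed.
Lemma nu_small : nu * (2 * (kap * Bd k)) <= 1 /\ nu * (4 * (kap * (Rabs k * Bd (k - 1))) * C1p) <= mr.
Proof.
  destruct C1p_terms as [T1 [_ [_ [_ [_ [_ [_ [_ [_ T]]]]]]]]]. destruct pow_pos as [_ [_ [H3 [H4 H5]]]].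
  assert (P := fun j => Rlt_le_trans 0 1 (Bd j) Rlt_0_1 (H4 j)).
  set (A := kap * Bd k) in *. set (B := kap * (Rabs k * Bd (k - 1))) in *.
  assert (HA : 0 <= A) by (unfold A; assert (X := P k); apply Rmult_le_pos; lra).
  assert (HB : 0 <= B). { unfold B. assert (X := P (k - 1)). apply Rmult_le_pos; [lra|]. apply Rmult_le_pos; [pos|lra]. }
  set (Z := 1 + 2 * A + 4 * B * C1p / mr) in *. assert (Q : nu * Z <= 1).
  { letr_with (nu0 * Z); [mul_r; lra|]. unfold nu0. fold A. fold B. fold Z. rewrite Rinv_l; lra. }
  assert (0 <= 4 * B * C1p / mr) by pos. split.
  - letr_with (nu * Z); auto. mul_l. unfold Z. lra.
  - letr_with (mr * (nu * Z)).
    + replace (nu * (4 * B * C1p)) with (mr * (nu * (4 * B * C1p / mr))) by (field; lra). mul_l. mul_l. unfold Z. lra.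
    + rewrite <- (Rmult_1_r mr) at 2. mul_l; lra.
Qed.
Lemma B_th' s : 1 <= s <= L -> Rabs (thp' s) <= C1p /\ / 2 <= Rabs (thp' s).
Proof.
  intro H. assert (N := nu0_pos). destruct C1p_terms as [_ [_ [_ [_ [_ [_ [_ [T _]]]]]]]]. assert (P := th'_pert s H). destruct nu_small as [Q _].
  destruct pow_pos as [_ [_ [_ [H4 _]]]]. assert (X := H4 k). assert (0 <= kap * Bd k) by pos.
  assert (nu * (kap * Bd k) <= 1 * (kap * Bd k)) by (mul_r; lra). unfold thp'. apply Rabs_le_between in P. split.
  - apply Rabs_le. lra.
  - rewrite Rabs_right; lra.
Qed.
(** Mean value theorem in [s]: in the derivative of [thp' * tap] the term [thp' * tasp] has modulus
    at least [mr / 2], and [thp'' * tap], which carries the factor [nu], at most [mr / 4]. *)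
Lemma mono_p a s s' : domp a s -> domp a s' -> mr / 4 * Rabs (s - s') <= Rabs (thp' s' * tap a s' - thp' s * tap a s).
Proof.
  intros Hd Hd'. destruct ct_pows as [_ [_ [_ [_ [C1 [_ [C2 [_ [_ [_ [C3 C4]]]]]]]]]]].
  destruct (MVT_gen (fun s => thp' s * tap a s) s s' (fun s => thp'' s * tap a s + thp' s * tasp a s)) as [xi [H1 H2]].
  - intros x Hx. assert (domp a x).
    { destruct Hd as [Ha Hs]. destruct Hd' as [_ Hs']. split; auto. unfold Rmin, Rmax in Hx. destruct (Rle_dec s s'); lra. }
    apply (D_mult thp' (fun s => tap a s)); [apply thp'_s; apply H|apply tap_s; auto].
  - intros x _. apply continuity_pt_filterlim. assert (E : ct (fun s => thp' s * tap a s)) by ctac. apply E.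
  - cbv beta in H2. rewrite H2. rewrite Rabs_mult, (Rabs_minus_sym s s'). mul_r. assert (Hx : domp a xi).
    { destruct Hd as [Ha Hs]. destruct Hd' as [_ Hs']. split; auto. unfold Rmin, Rmax in H1. destruct (Rle_dec s s'); lra. }
    destruct (rr_d a xi Hx) as [_ [_ B]]. fold (tasp a xi) in B. destruct (B_th' xi ltac:(apply Hx)) as [_ B'].
    assert (Bt := B_ta a xi Hx). assert (Bt'' := B_th'' xi ltac:(apply Hx)). destruct nu_small as [_ Q]. destruct pow_pos as [_ [_ [Hm _]]].
    assert (U : Rabs (thp'' xi * tap a xi) <= mr / 4).
    { letr; [apply Rabs_mult_le; [apply Bt''|apply Bt]|]. lra. }
    assert (W : / 2 * mr <= Rabs (thp' xi * tasp a xi)) by (rewrite Rabs_mult; apply Rmult_le_compat; lra).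
    assert (T := Rabs_triang (thp'' xi * tap a xi + thp' xi * tasp a xi) (- (thp'' xi * tap a xi))).
    replace (thp'' xi * tap a xi + thp' xi * tasp a xi + - (thp'' xi * tap a xi)) with (thp' xi * tasp a xi) in T by ring.
    rewrite Rabs_Ropp in T. lra.
Qed.

Definition T0 : R := 16 * c / (mr / 4 * cbp) + 72 * (1 + c) * C1p ^ 3 * c ^ 2 / cbp + 1.
Definition Kq : R := T0 + c + 5 * C1p ^ 2 * c * (1 + / cbp).

Lemma cbp_pos : 0 < cbp.
Proof. unfold cbp. apply Rmult_lt_0_compat; [lra|pos]. Qed.
Lemma T0_ge1 : 1 <= T0.
Proof.
  destruct pow_pos as [_ [_ [Hm _]]]. assert (B := cbp_pos). destruct C1p_terms as [T _].
  assert (0 < 16 * c / (mr / 4 * cbp)) by pos. assert (0 < 72 * (1 + c) * C1p ^ 3 * c ^ 2 / cbp).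
  { apply Rdiv_lt_0_compat; auto. apply Rmult_lt_0_compat; [apply Rmult_lt_0_compat; [lra|pos]|pos]. } unfold T0; lra.
Qed.

(** The choice is [r = rho = q^4], [sig = q^20], [al0 = q^22]. Then [rho] is [q^4] and [QQ * sig] is
    of order [q^8], so [TT <= T0 * q^4] up to a constant; [al0 / sig = q^2]; and
    [eta / (al0 sig r) <= q^48 / q^46]. All three contributions are of order [q^2]. *)
Lemma core_q q R0 D eta Mphi f Gam Gamb Gam1 : 0 < q <= 1 -> 0 <= R0 -> 0 < eta <= q ^ 48 -> h <= q ^ 22 ->
  R0 + 1 + 2 * C1p + c <= D -> ct f -> ct2 Gam -> ct2 Gamb -> ct2 Gam1 ->
  (forall b z, is_derive (fun b => Gam b z) b (Gamb b z)) ->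
  (forall b z, is_derive (fun b => Gam1 b z) b (Gam b z)) ->
  (forall b, csup R0 (Gam b)) -> (forall b, csup R0 (Gam1 b)) -> csup R0 f ->
  RI (phi D Gam) 0 (Bd kap) <= 1 -> RI (phi1 D Gam1) 0 (Bd kap) <= eta ^ 2 ->
  (forall b, 0 <= b <= Bd kap -> RI (fun z => Rabs (Gam b z)) (- D) D <= 1) ->
  (forall b, 0 <= b <= Bd kap -> phi D Gam b <= Mphi) ->
  RI (fun y => f y ^ 2) (- D) D <= 1 -> h * (4 * c ^ 2 * Mphi) <= 1 ->
  Rabs (XX 1 L D thp (ramp L (q ^ 4)) f bep h c Gam) <= Kq * q ^ 2.
Proof.
  intros Hq HR He Hhq HD Cf CG CGb CG1 DGb DG1 SG SG1 Sf NG NG1 NGL NGM Nf HM.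
  destruct ct_pows as [P0 [P1 [P2 [P3 [P4 [P5 [P6 [P7 [P8 [P9 [P10 P11]]]]]]]]]]].
  destruct pow_pos as [_ [_ [Hm [_ _]]]]. assert (B := cbp_pos). destruct C1p_terms as [T [_ [_ [_ [_ [_ [_ [_ [T8 _]]]]]]]]].
  assert (Q4 := pow_le1 q 4 Hq). assert (Q20 := pow_le1 q 20 Hq). assert (Q22 := pow_le1 q 22 Hq). assert (Q2 := pow_le1 q 2 Hq).
  assert (Q12 := pow_le1 q 12 Hq). assert (N := nu0_pos).
  assert (QS : 0 < T0 * q ^ 2) by (assert (X := T0_ge1); apply Rmult_lt_0_compat; lra).
  assert (HTT : TT 1 L C1p cbp (mr / 4) (q ^ 20) (q ^ 4) (q ^ 4) h Mphi <= (T0 * q ^ 2) ^ 2).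
  { letr_with (q ^ 4 * T0).
    - unfold TT, QQ.
      replace (16 * q ^ 4 * c / (mr / 4 * cbp) + 12 * (6 * (1 + c) * C1p ^ 3 / (q ^ 4 * (q ^ 4) ^ 2)) * q ^ 20 * c ^ 2 / cbp +
        4 * h * c ^ 2 * Mphi * q ^ 20 / q ^ 4) with
        (q ^ 4 * (16 * c / (mr / 4 * cbp) + q ^ 4 * (72 * (1 + c) * C1p ^ 3 * c ^ 2 / cbp) + q ^ 12 * (h * (4 * c ^ 2 * Mphi)))) by (field; lra).
      mul_l. unfold T0. apply Rplus_le_compat; [apply Rplus_le_compat_l|].
      + rewrite <- (Rmult_1_l (72 * _ * _ * _ / _)) at 2. apply Rmult_le_compat_r; [|lra].
        apply Rdiv_le_0_compat; auto. apply Rmult_le_pos; [apply Rmult_le_pos; [lra|pos]|pos].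
      + letr_with (q ^ 12 * 1); [mul_l; lra|lra].
    - replace ((T0 * q ^ 2) ^ 2) with (q ^ 4 * (T0 * T0)) by ring. mul_l. assert (X := T0_ge1).
      rewrite <- (Rmult_1_l T0) at 1. mul_r; lra. }
  assert (C := core 1 L C1p cbp (mr / 4) (Bd kap) R0 D (q ^ 20) (q ^ 4) (q ^ 4) (q ^ 22) h eta Mphi thp thp' thp''
    (ramp L (q ^ 4)) (ramp' L (q ^ 4)) f bep beap besp tap taap tasp psip psisp Gam Gamb Gam1).
  assert (R1 := ct_ramp L (q ^ 4) ltac:(lra)). assert (R2 := ct_ramp' L (q ^ 4) ltac:(lra)).
  do 11 (specialize (C ltac:(lra))). specialize (C ltac:(lra)).
  specialize (C P9 P10 P11 R1 R2 Cf P1 P2 P3 P4 P5 P6 P7 P8 CG CGb CG1 bep_a bep_s tap_a tap_s psip_s thp_s thp'_s).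
  specialize (C (fun s => ramp_deriv L (q ^ 4) s ltac:(lra)) tap_id psip_id B_be B_bea B_ta B_tas B_taa B_psi B_psis B_th
    (fun s H => proj1 (B_th' s H))). assert (Bth2 : forall s, 1 <= s <= L -> Rabs (thp'' s) <= C1p).
  { intros s H. letr; [apply B_th''; auto|]. letr; [|apply T8]. assert (0 <= kap * (Rabs k * Bd (k - 1))).
    { apply Rmult_le_pos; [lra|]. apply Rmult_le_pos; [pos|left; apply exp_pos]. }
    rewrite <- (Rmult_1_l (kap * _)) at 2. mul_r; lra. } specialize (C Bth2 mono_p (fun s => ramp_01 L (q ^ 4) s ltac:(lra))).
  assert (BR : forall s, Rabs (ramp' L (q ^ 4) s) <= C1p / q ^ 4).
  { intro s. letr; [apply ramp'_bound; lra|]. apply Rmult_le_compat_r; [|lra]. left; apply Rinv_0_lt_compat; lra. }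
  specialize (C BR (ramp_l L (q ^ 4)) (ramp_r L (q ^ 4)) DGb DG1 SG SG1 Sf NG NG1 NGL NGM Nf (T0 * q ^ 2) QS HTT).
  letr; [apply C|]. unfold Kq. rewrite !Rmult_plus_distr_r. apply Rplus_le_compat; [apply Rplus_le_compat_l|].
  - right; field. lra.
  - set (Z := 5 * C1p ^ 2 * c * (1 + / cbp)).
    assert (HZ : 0 <= Z). { assert (0 < / cbp) by pos. unfold Z. repeat apply Rmult_le_pos; lra. }
    replace (Z * eta / (q ^ 22 * q ^ 20 * q ^ 4)) with (Z * (eta * / q ^ 46)) by (field; lra).
    mul_l; auto. assert (Q46 := pow_le1 q 46 Hq).
    apply Rmult_le_reg_r with (q ^ 46); [lra|]. rewrite Rmult_assoc, Rinv_l, Rmult_1_r by lra.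
    rewrite <- pow_add. simpl (2 + 46)%nat. lra.
Qed.
End Pow.

(** Removes the truncation [a >= h]. For given data [h] is chosen in terms of bounds for [phi] and
    for the integrand in [a], so that the boundary term and the range [a <= h] are both negligible;
    [K] does not depend on these bounds. *)
Lemma core_pow kap L : 0 < kap -> kap <> 1 -> 2 <= L -> exists K nu0, 1 <= K /\ 0 < nu0 <= 1 /\
  forall nu e2 q R0 D eta f Gam Gamb Gam1, 0 <= nu <= nu0 -> e2 ^ 2 = 1 -> 0 < q <= 1 -> 0 <= R0 -> 0 < eta <= q ^ 48 ->
  R0 + K <= D -> ct f -> ct2 Gam -> ct2 Gamb -> ct2 Gam1 ->
  (forall b z, is_derive (fun b => Gam b z) b (Gamb b z)) ->
  (forall b z, is_derive (fun b => Gam1 b z) b (Gam b z)) ->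
  (forall b, csup R0 (Gam b)) -> (forall b, csup R0 (Gam1 b)) -> csup R0 f ->
  RI (phi D Gam) 0 (Bd L kap) <= 1 -> RI (phi D Gam1) 0 (Bd L kap) <= eta ^ 2 ->
  (forall b, 0 <= b <= Bd L kap -> RI (fun z => Rabs (Gam b z)) (- D) D <= 1) ->
  RI (fun y => f y ^ 2) (- D) D <= 1 ->
  Rabs (XX 1 L D (thp kap nu e2) (ramp L (q ^ 4)) f (bep kap) 0 (L - 1) Gam) <= K * q ^ 2.
Proof.
  intros Hkap Hkap1 HL. assert (KT : 0 < T0 kap L) by (assert (X := T0_ge1 kap L Hkap Hkap1 HL); lra).
  destruct (C1p_terms kap L Hkap Hkap1 HL) as [T _]. assert (HKq : 1 <= Kq kap L).
  { unfold Kq. assert (0 < / cbp kap L) by (apply Rinv_0_lt_compat, cbp_pos; auto).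
    assert (0 <= 5 * C1p kap L ^ 2 * (L - 1) * (1 + / cbp kap L)); [|lra].
    apply Rmult_le_pos; [apply Rmult_le_pos; [|lra]|lra]. apply Rmult_le_pos; [lra|pos]. }
  exists (Kq kap L + 1 + (1 + 2 * C1p kap L + (L - 1))), (nu0 kap L). split; [lra|]. split; [apply nu0_pos; auto|].
  intros nu e2 q R0 D eta f Gam Gamb Gam1 Hnu He2 Hq HR He HD Cf CG CGb CG1 DGb DG1 SG SG1 Sf NG NG1 NGL Nf.
  assert (Cphi : ct (phi D Gam)) by (unfold phi; ctac).
  destruct (ct_bounded (phi D Gam) 0 (Bd L kap)) as [Mp [HMp BMp]]; [left; apply exp_pos|auto|].
  set (F := fun a => RI (fun s => ramp L (q ^ 4) s * ramp L (q ^ 4) (s + a) *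
    RI (fun y => f y * f (y - a) * Gam (bep kap a s) (y + thp kap nu e2 s)) (- D) D) 1 L). assert (CF : ct F).
  { assert (Q4 : 0 < q ^ 4) by pos. assert (P2 : ct (ramp L (q ^ 4))) by (apply ct_ramp; auto). unfold F, bep, thp. ctac. }
  destruct (ct_bounded F 0 (L - 1)) as [MF [HMF BMF]]; [lra|auto|].
  set (c := L - 1) in *. set (h := q ^ 22 / ((1 + MF) * (1 + 4 * c ^ 2 * Mp))).
  assert (Q22 := pow_le1 q 22 Hq). assert (Q2 := pow_le1 q 2 Hq). assert (Z1 : 0 <= 4 * c ^ 2 * Mp) by pos.
  assert (Z2 : 1 <= (1 + MF) * (1 + 4 * c ^ 2 * Mp)) by (rewrite <- (Rmult_1_l 1); apply Rmult_le_compat; lra).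
  assert (Hh : 0 < h) by (apply Rdiv_lt_0_compat; lra).
  assert (E : h * ((1 + MF) * (1 + 4 * c ^ 2 * Mp)) = q ^ 22) by (unfold h; field; lra).
  assert (E1 : h * 1 <= q ^ 22) by (rewrite <- E; mul_l; lra). assert (E2 : h * MF <= q ^ 22).
  { rewrite <- E. mul_l. rewrite <- (Rmult_1_r MF) at 1. apply Rmult_le_compat; lra. }
  assert (E3 : h * (4 * c ^ 2 * Mp) <= q ^ 22).
  { rewrite <- E. mul_l. rewrite <- (Rmult_1_l (4 * c ^ 2 * Mp)) at 1. apply Rmult_le_compat; lra. }
  assert (Main := core_q kap L Hkap Hkap1 HL h nu e2 Hh Hnu He2 q R0 D eta Mp f Gam Gamb Gam1 Hq HR He ltac:(lra) ltac:(unfold c in *; lra)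
    Cf CG CGb CG1 DGb DG1 SG SG1 Sf NG NG1 NGL (fun b Hb => Rle_trans _ _ _ (Rle_abs _) (BMp b Hb)) Nf ltac:(unfold c in *; lra)).
  unfold XX in *. fold F in Main |- *. fold c in Main. rewrite <- (RI_chasles F 0 h c) by auto.
  assert (Hhc : h <= c) by (unfold c in *; lra).
  assert (Tiny : Rabs (RI F 0 h) <= (h - 0) * MF) by (apply RI_bound; [lra|auto|intros; apply BMF; lra]).
  assert (q ^ 22 <= q ^ 2).
  { replace (q ^ 22) with (q ^ 2 * q ^ 20) by ring. assert (X := pow_le1 q 20 Hq). rewrite <- (Rmult_1_r (q ^ 2)) at 2. mul_l; lra. }
  assert (0 <= (1 + 2 * C1p kap L + c) * q ^ 2) by pos. letr; [apply Rabs_triang|]. lra.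
Qed.
End CorePower.
Import CorePower.

(** * Localisation to windows of the length of the smaller shift *)

Module Localisation.
Implicit Types f g F u W w : R -> R.

Lemma RI_sub_le F R1 D x y : 0 <= R1 <= D -> x <= y -> ct F -> csup R1 F -> (forall x, 0 <= F x) -> RI F x y <= RI F (- D) D.
Proof.
  intros HR Hxy CF HF Hp.
  assert (B := Rle_abs x); assert (B' := Rle_abs (- x)); assert (E := Rle_abs y); assert (E' := Rle_abs (- y)); rewrite !Rabs_Ropp in *.
  rewrite <- (csup_enlarge F R1 (- D) D (- (D + Rabs x + Rabs y)) (D + Rabs x + Rabs y)); auto; try lra. apply RI_mono; auto; lra.
Qed.

(** The square of an integral is twice the integral of the correlations at lags [a > 0]. With [H]
    the primitive of [h] vanishing at [c2], [h * H] integrates to minus half the square; the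
    vanishing of [h] beyond [c2] allows a fixed range of lags. *)
Lemma RI_square h (c1 c2 : R) : c1 <= c2 -> ct h -> (forall s, c2 <= s -> h s = 0) ->
  RI h c1 c2 ^ 2 = 2 * RI (fun a => RI (fun s => h s * h (s + a)) c1 c2) 0 (c2 - c1).
Proof.
  intros Hc Ch Hz. set (H := fun s => RI h c2 s). assert (DH : forall s : R, is_derive H s (h s)) by (intro; apply RI_prim; auto).
  assert (CH : ct H) by (intro s; apply (ex_derive_continuous H s); eexists; apply DH).
  assert (Q : RI (fun s => h s * H s) c1 c2 = - RI h c1 c2 ^ 2 / 2).
  { assert (E : RI (fun s => H s * h s) c1 c2 = H c2 * H c2 - H c1 * H c1 - RI (fun s => h s * H s) c1 c2)
      by (apply RI_parts; auto). rewrite (RI_ext (fun s => H s * h s) (fun s => h s * H s)) in E by (intro; ring).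
    assert (E2 : H c2 = 0) by apply RI_point. assert (E1 : H c1 = - RI h c1 c2) by (apply RI_swap; auto).
    rewrite E1, E2 in E. lra. } rewrite (fubini (fun a s => h s * h (s + a))) by (try lra; ctac).
  rewrite (RI_ext_le (fun s => RI (fun a => h s * h (s + a)) 0 (c2 - c1)) (fun s => - 1 * (h s * H s))); auto.
  - rewrite RI_scal by ctac. rewrite Q. field.
  - intros s Hs. rewrite RI_scal by ctac.
    rewrite (RI_ext (fun a => h (s + a)) (fun a => h (a + s))) by (intro; f_equal; ring). rewrite RI_shift by auto.
    rewrite <- (RI_chasles h (0 + s) c2 (c2 - c1 + s)) by auto. rewrite (RI_zero h c2) by (try lra; intros; apply Hz; lra).
    rewrite Rplus_0_l. unfold H. rewrite (RI_swap h s c2) by auto. ring.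
Qed.

Definition ind (B t : R) : R := if Rle_dec (Rabs t) B then 1 else 0.
Lemma ind_01 B t : 0 <= ind B t <= 1.
Proof. unfold ind. destruct Rle_dec; lra. Qed.
Lemma count_near B t n : 0 <= B -> bs (fun i => ind B (t - INR i)) n <= 2 * B + 1.
Proof.
  intro HB. assert (H : bs (fun i => ind B (t - INR i)) n <= Rmax 0 (INR n - t + B) /\ bs (fun i => ind B (t - INR i)) n <= 2 * B + 1); [|apply H].
  induction n as [|n [I1 I2]].
  - simpl. split; [apply Rmax_l|lra].
  - change (bs (fun i => ind B (t - INR i)) (S n)) with (bs (fun i => ind B (t - INR i)) n + ind B (t - INR n)).
    rewrite S_INR. unfold ind at 2 4. destruct (Rle_dec (Rabs (t - INR n)) B) as [H|H].
    + apply Rabs_le_between in H. rewrite Rmax_right in I1 by lra. rewrite Rmax_right by lra. lra.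
    + split; [|lra]. rewrite Rplus_0_r. letr; [apply I1|]. apply Rle_max_compat_l. lra.
Qed.

(** Cauchy-Schwarz in which only the at most [2 B + 1] indices near [t] count, so the constant does
    not grow with [n]. *)
Lemma bs_cs_ind (u : nat -> R) B t n : 0 <= B -> (forall i, ind B (t - INR i) = 0 -> u i = 0) ->
  bs u n ^ 2 <= (2 * B + 1) * bs (fun i => u i ^ 2) n.
Proof.
  intros HB Hu. assert (Hc := count_near B t n HB).
  assert (Hs : 0 <= bs (fun i => u i ^ 2) n) by (apply bs_ge0; intros; apply pow2_ge_0).
  enough (G : bs u n ^ 2 <= bs (fun i => ind B (t - INR i)) n * bs (fun i => u i ^ 2) n).
  { letr; [apply G|]. mul_r; auto. }
  clear Hc. assert (Hi : forall m, 0 <= bs (fun i => ind B (t - INR i)) m) by (intro; apply bs_ge0; intros; apply ind_01).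
  clear Hs. induction n; [simpl; lra|].
  change (bs u (S n)) with (bs u n + u n). change (bs (fun i => u i ^ 2) (S n)) with (bs (fun i => u i ^ 2) n + u n ^ 2).
  change (bs (fun i => ind B (t - INR i)) (S n)) with (bs (fun i => ind B (t - INR i)) n + ind B (t - INR n)).
  set (S1 := bs (fun i => ind B (t - INR i)) n) in *. set (S2 := bs (fun i => u i ^ 2) n) in *.
  assert (H2 : 0 <= S2) by (apply bs_ge0; intros; apply pow2_ge_0).
  assert (H1 : 0 <= S1) by apply Hi. assert (X := Hu n). unfold ind in X |- *. destruct (Rle_dec (Rabs (t - INR n)) B) as [H|H].
  - destruct (Req_dec S1 0) as [Z|Z].
    + rewrite Z in *. assert (bs u n ^ 2 = 0) by (assert (0 <= bs u n ^ 2) by pos; lra).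
      assert (bs u n = 0) by (apply Rsqr_0_uniq; unfold Rsqr; lra). rewrite H3. lra.
    + assert (T := amgm_t (bs u n) (u n) (/ S1) ltac:(pos)). rewrite Rinv_inv in T.
      assert (T2 := Rle_abs (bs u n * u n)). assert (/ S1 * bs u n ^ 2 <= S2).
      { apply Rmult_le_reg_l with S1; [lra|]. rewrite <- Rmult_assoc, Rinv_r, Rmult_1_l by lra. auto. } lra.
  - rewrite X by auto. lra.
Qed.

Definition tz (A x : R) : R := 1 - Rmax (1 - Rmax (A + 1 - Rabs x) 0) 0.
Lemma tz_01 A x : 0 <= tz A x <= 1.
Proof. unfold tz, Rmax; repeat destruct Rle_dec; lra. Qed.
Lemma tz_in A x : Rabs x <= A -> tz A x = 1.
Proof. intro; unfold tz, Rmax; repeat destruct Rle_dec; lra. Qed.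
Lemma tz_out A x : A + 1 <= Rabs x -> tz A x = 0.
Proof. intro; unfold tz, Rmax; repeat destruct Rle_dec; lra. Qed.
Lemma ct_tz A : ct (tz A).
Proof. unfold tz; ctac. Qed.
#[local] Hint Resolve ct_tz : ctdb.

(** Averaging the trapezoid [tz] twice gives a cut-off [k1] with two explicit continuous
    derivatives, still equal to 1 on [[2 - A, A]]. *)
Definition k0 (A : R) : R -> R := av 1 (tz A).
Definition k1 (A : R) : R -> R := av 1 (k0 A).
Definition k1' (A x : R) : R := k0 A x - k0 A (x - 1).
Definition k1'' (A x : R) : R := tz A x - 2 * tz A (x - 1) + tz A (x - 2).
Lemma ct_k0 A : ct (k0 A). Proof. unfold k0. ctac. Qed.
#[local] Hint Resolve ct_k0 : ctdb.
Lemma ct_k1 A : ct (k1 A). Proof. unfold k1. ctac. Qed.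
Lemma ct_k1' A : ct (k1' A). Proof. unfold k1'. ctac. Qed.
Lemma ct_k1'' A : ct (k1'' A). Proof. unfold k1''. ctac. Qed.
#[local] Hint Resolve ct_k1 ct_k1' ct_k1'' : ctdb.
Lemma k0_d A (x : R) : is_derive (k0 A) x (tz A x - tz A (x - 1)).
Proof. eapply D_eq; [apply av_deriv; [lra|apply ct_tz]|]. field. Qed.
Lemma k1_d A (x : R) : is_derive (k1 A) x (k1' A x).
Proof. eapply D_eq; [apply av_deriv; [lra|apply ct_k0]|]. unfold k1'. field. Qed.
Lemma k1'_d A (x : R) : is_derive (k1' A) x (k1'' A x).
Proof.
  unfold k1', k1''. eapply D_eq.
  - apply D_minus; [apply k0_d|]. apply (D_comp (k0 A) (fun x => x - 1)); [apply k0_d|]. apply D_minus; [apply D_id|apply D_const].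
  - replace (x - 1 - 1) with (x - 2) by ring. ring.
Qed.
Lemma av1_const F x v : ct F -> (forall y, x - 1 <= y <= x -> F y = v) -> av 1 F x = v.
Proof. intros C H. unfold av. rewrite (RI_ext_le _ (fun _ => v)); [|lra|intros; apply H; lra]. rewrite RI_const. field. Qed.
Lemma av1_01 F x : ct F -> (forall y, 0 <= F y <= 1) -> 0 <= av 1 F x <= 1.
Proof.
  intros C H. unfold av. rewrite Rinv_1, Rmult_1_l. split; [apply RI_ge0; [lra|ctac|intros; apply H]|].
  letr_with (RI (fun _ => 1) 0 1); [apply RI_le; [lra|ctac|ctac|intros; apply H]|rewrite RI_const; lra].
Qed.
Lemma k0_01 A x : 0 <= k0 A x <= 1. Proof. apply av1_01; [apply ct_tz|apply tz_01]. Qed.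
Lemma k1_01 A x : 0 <= k1 A x <= 1. Proof. apply av1_01; [apply ct_k0|apply k0_01]. Qed.
Lemma k1'_1 A x : Rabs (k1' A x) <= 1.
Proof. unfold k1'. assert (H := k0_01 A x). assert (H' := k0_01 A (x - 1)). apply Rabs_le. lra. Qed.
Lemma k0_in A x : - A + 1 <= x <= A -> k0 A x = 1.
Proof. intro H. apply av1_const; [apply ct_tz|]. intros; apply tz_in, Rabs_le; lra. Qed.
Lemma k0_out A x : x <= - A - 1 \/ A + 2 <= x -> k0 A x = 0.
Proof.
  intro H. apply av1_const; [apply ct_tz|]. intros y Hy; apply tz_out. destruct H.
  - assert (T := Rle_abs (- y)). rewrite Rabs_Ropp in T. lra.
  - assert (T := Rle_abs y). lra.
Qed.
Lemma k1_in A x : - A + 2 <= x <= A -> k1 A x = 1 /\ k1' A x = 0.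
Proof.
  intro H. split; [apply av1_const; [apply ct_k0|]; intros; apply k0_in; lra|]. unfold k1'. rewrite !k0_in by lra. ring.
Qed.
Lemma k1_out A x : A + 3 < Rabs x -> k1 A x = 0 /\ k1' A x = 0.
Proof.
  intro H. assert (H' : x < - A - 3 \/ A + 3 < x) by (unfold Rabs in H; destruct (Rcase_abs x); lra).
  split; [apply av1_const; [apply ct_k0|]; intros; apply k0_out; lra|]. unfold k1'. rewrite !k0_out by lra. ring.
Qed.

Section Loc.
Context (kap L K : R) (n : nat) (e2 q M c ep : R) (u w w' W : R -> R).
Context (HL : 2 <= L) (HK : 1 <= K) (Hn : (1 <= n)%nat) (He2 : e2 ^ 2 = 1) (Hq : 0 < q <= 1)
  (HM : 1 <= M) (HMq : / M <= q ^ 48) (Hep : 0 < ep) (Cu : ct u) (Cw : ct w) (Cw' : ct w') (CW : ct W)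
  (DW : forall x : R, is_derive W x (w x)) (Dw : forall x : R, is_derive w x (w' x)).
Notation N := (INR n).
Definition Aw : R := Bd L kap + 2.
Definition Ov : R := 2 * (Aw + 3) + 1.
Definition R0w : R := Aw + 4 + L + 1.
Definition Dw0 : R := R0w + K + L.
Notation D := Dw0.
Context (Hcore : forall R0 D eta f Gam Gamb Gam1, 0 <= R0 -> 0 < eta <= q ^ 48 ->
  R0 + K <= D -> ct f -> ct2 Gam -> ct2 Gamb -> ct2 Gam1 ->
  (forall b z, is_derive (fun b => Gam b z) b (Gamb b z)) ->
  (forall b z, is_derive (fun b => Gam1 b z) b (Gam b z)) ->
  (forall b, csup R0 (Gam b)) -> (forall b, csup R0 (Gam1 b)) -> csup R0 f ->
  RI (phi D Gam) 0 (Bd L kap) <= 1 -> RI (phi D Gam1) 0 (Bd L kap) <= eta ^ 2 ->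
  (forall b, 0 <= b <= Bd L kap -> RI (fun z => Rabs (Gam b z)) (- D) D <= 1) ->
  RI (fun y => f y ^ 2) (- D) D <= 1 ->
  Rabs (XX 1 L D (thp kap (/ INR n) e2) (ramp L (q ^ 4)) f (bep kap) 0 (L - 1) Gam) <= K * q ^ 2).

Lemma N_pos : 1 <= N.
Proof. rewrite <- INR_1. apply le_INR; auto. Qed.
Lemma Bd_ge1 : 1 <= Bd L kap.
Proof. unfold Bd. rewrite <- exp_0 at 1. apply exp_le. apply Rmult_le_pos; [pos|]. rewrite <- ln_1. apply ln_le; lra. Qed.
Lemma Aw_pos : 3 <= Aw. Proof. unfold Aw. assert (X := Bd_ge1). lra. Qed.
Lemma DR : 0 <= R0w <= D /\ R0w + K <= D /\ R0w + L <= D /\ L + 1 <= R0w.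
Proof. assert (X := Aw_pos). unfold Dw0, R0w. repeat split; lra. Qed.
Lemma Ov_ge1 : 1 <= Ov. Proof. assert (X := Aw_pos). unfold Ov. lra. Qed.

(** The cut-off is applied to the primitive [W] and the product is differentiated, so that the
    localised function [gi] keeps a compactly supported primitive. The derivative of the cut-off
    costs [N], which the weight [(M * N)^2] on [W] pays for. *)
Definition Gi (i : nat) (z : R) : R := W (c + z) * k1 Aw (N * z - INR i).
Definition gi (i : nat) (z : R) : R := w (c + z) * k1 Aw (N * z - INR i) + N * (W (c + z) * k1' Aw (N * z - INR i)).
Definition gi' (i : nat) (z : R) : R := w' (c + z) * k1 Aw (N * z - INR i) + 2 * N * (w (c + z) * k1' Aw (N * z - INR i))
  + N ^ 2 * (W (c + z) * k1'' Aw (N * z - INR i)).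
Definition fu (y : R) : R := u (c + y) * tz L y.
Lemma ct_Gi i : ct (Gi i). Proof. unfold Gi. ctac. Qed.
Lemma ct_gi i : ct (gi i). Proof. unfold gi. ctac. Qed.
Lemma ct_gi' i : ct (gi' i). Proof. unfold gi'. ctac. Qed.
Lemma ct_fu : ct fu. Proof. unfold fu. ctac. Qed.
#[local] Hint Resolve ct_Gi ct_gi ct_gi' ct_fu : ctdb.
Lemma lin_d (x : R) i : is_derive (fun z => N * z - INR i) x N.
Proof. auto_derive; auto; ring. Qed.
Lemma add_d (x : R) : is_derive (fun z => c + z) x 1.
Proof. auto_derive; auto; ring. Qed.
Lemma Gi_d i (z : R) : is_derive (Gi i) z (gi i z).
Proof.
  unfold Gi, gi. eapply D_eq.
  - apply (D_mult (fun z => W (c + z)) (fun z => k1 Aw (N * z - INR i))).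
    + apply (D_comp W (fun z => c + z)); [apply DW|apply add_d].
    + apply (D_comp (k1 Aw) (fun z => N * z - INR i)); [apply k1_d|apply lin_d].
  - ring.
Qed.
Lemma gi_d i (z : R) : is_derive (gi i) z (gi' i z).
Proof.
  unfold gi, gi'. eapply D_eq.
  - apply (D_plus (fun z => w (c + z) * k1 Aw (N * z - INR i)) (fun z => N * (W (c + z) * k1' Aw (N * z - INR i)))).
    + apply (D_mult (fun z => w (c + z)) (fun z => k1 Aw (N * z - INR i))).
      * apply (D_comp w (fun z => c + z)); [apply Dw|apply add_d].
      * apply (D_comp (k1 Aw) (fun z => N * z - INR i)); [apply k1_d|apply lin_d].
    + apply (D_scal (fun z => W (c + z) * k1' Aw (N * z - INR i))).
      apply (D_mult (fun z => W (c + z)) (fun z => k1' Aw (N * z - INR i))).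
      * apply (D_comp W (fun z => c + z)); [apply DW|apply add_d].
      * apply (D_comp (k1' Aw) (fun z => N * z - INR i)); [apply k1'_d|apply lin_d].
  - ring.
Qed.
Lemma g_out i z : ind (Aw + 3) (N * z - INR i) = 0 -> gi i z = 0 /\ Gi i z = 0.
Proof.
  unfold ind. destruct (Rle_dec (Rabs (N * z - INR i)) (Aw + 3)) as [H|H]; [lra|]. intros _.
  destruct (k1_out Aw (N * z - INR i)) as [E E']; [lra|]. unfold gi, Gi. rewrite E, E'. split; ring.
Qed.
Lemma csup_g i : (i < n)%nat -> csup R0w (gi i) /\ csup R0w (Gi i).
Proof.
  intro Hi. assert (X := N_pos). assert (Y := Aw_pos). apply lt_INR in Hi. assert (Z := pos_INR i).
  assert (H : forall z, R0w < Rabs z -> ind (Aw + 3) (N * z - INR i) = 0).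
  { intros z Hz. unfold ind. destruct (Rle_dec (Rabs (N * z - INR i)) (Aw + 3)) as [H|H]; auto. exfalso.
    assert (T := Rabs_triang (N * z - INR i) (INR i)). replace (N * z - INR i + INR i) with (N * z) in T by ring.
    rewrite Rabs_mult, (Rabs_right N), (Rabs_right (INR i)) in T by lra. unfold R0w in Hz.
    assert (N * (Aw + 4) < N * Rabs z) by (apply Rmult_lt_compat_l; lra).
    assert (1 * (Aw + 3) <= N * (Aw + 3)) by (mul_r; lra). lra. } split; intros z Hz; apply g_out; auto.
Qed.
Lemma csup_fu : csup R0w fu.
Proof. intros y Hy. unfold fu. rewrite tz_out; [ring|]. assert (X := DR). lra. Qed.

Notation J F := (RI F (- D) D).
Definition Ji (i : nat) : R := J (fun z => gi i z ^ 2).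
Definition Jw (i : nat) : R := J (fun z => Gi i z ^ 2).
(** Energy of a window, used through [ci] to normalise the kernel [GG] so that the core estimate
    applies with [eta = / M]. The term [ep / N] prevents division by zero and adds up to [ep] over
    the [n] windows. *)
Definition qi (i : nat) : R := Ji i + (M * N) ^ 2 * Jw i + ep / N.
Lemma HDD : - D <= D. Proof. assert (X := DR). lra. Qed.
Lemma Ji_ge0 i : 0 <= Ji i. Proof. apply RI_ge0; [apply HDD|ctac|intros; apply pow2_ge_0]. Qed.
Lemma Jw_ge0 i : 0 <= Jw i. Proof. apply RI_ge0; [apply HDD|ctac|intros; apply pow2_ge_0]. Qed.
Lemma qi_facts i : 0 < qi i /\ Ji i <= qi i /\ (M * N) ^ 2 * Jw i <= qi i.
Proof.
  assert (X := N_pos). assert (A := Ji_ge0 i). assert (B := Jw_ge0 i). assert (0 < ep / N) by pos.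
  assert (0 <= (M * N) ^ 2 * Jw i) by pos. unfold qi. lra.
Qed.
Definition ci (i : nat) : R := / (Ov * N * qi i).
Lemma ci_pos i : 0 < ci i.
Proof.
  destruct (qi_facts i) as [A _]. assert (X := N_pos). assert (Y := Ov_ge1). unfold ci. apply Rinv_0_lt_compat.
  apply Rmult_lt_0_compat; auto. apply Rmult_lt_0_compat; lra.
Qed.
(** The kernels of all windows are superposed with weights, so that one application of the core
    estimate treats them together. [GGb] and [GG1] are its derivative and a primitive in [b]; the
    latter uses [gi = Gi'] and [e2^2 = 1]. *)
Definition GG (b z : R) : R := bs (fun i => ci i * (gi i z * gi i (z - e2 * b / N))) n.
Definition GGb (b z : R) : R := bs (fun i => ci i * (gi i z * (- e2 / N * gi' i (z - e2 * b / N)))) n.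
Definition GG1 (b z : R) : R := bs (fun i => ci i * (gi i z * (- e2 * N * Gi i (z - e2 * b / N)))) n.
Lemma ct_GG : ct2 GG.
Proof. unfold GG, ct2. apply (ct_bs (fun i p => ci i * (gi i (snd p) * gi i (snd p - e2 * fst p / N)))). intro i. ctac. Qed.
Lemma ct_GGb : ct2 GGb.
Proof. unfold GGb, ct2. apply (ct_bs (fun i p => ci i * (gi i (snd p) * (- e2 / N * gi' i (snd p - e2 * fst p / N))))). intro i. ctac. Qed.
Lemma ct_GG1 : ct2 GG1.
Proof. unfold GG1, ct2. apply (ct_bs (fun i p => ci i * (gi i (snd p) * (- e2 * N * Gi i (snd p - e2 * fst p / N))))). intro i. ctac. Qed.
#[local] Hint Resolve ct_GG ct_GGb ct_GG1 : ctdb.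

Lemma bs_d (F F' : nat -> R -> R) (x : R) m : (forall i, is_derive (F i) x (F' i x)) ->
  is_derive (fun x => bs (fun i => F i x) m) x (bs (fun i => F' i x) m).
Proof. intro H. induction m; simpl; [apply D_const|]. apply (D_plus (fun x => bs (fun i => F i x) m) (F m)); auto. Qed.
Lemma sh_d (z b : R) : is_derive (fun b => z - e2 * b / N) b (- e2 / N).
Proof. auto_derive; auto. unfold Rdiv; ring. Qed.
Lemma GG_d b z : is_derive (fun b => GG b z) b (GGb b z).
Proof.
  unfold GG, GGb. apply (bs_d (fun i b => ci i * (gi i z * gi i (z - e2 * b / N))) (fun i b => ci i * (gi i z * (- e2 / N * gi' i (z - e2 * b / N))))).
  intro i. apply (D_scal (fun b => gi i z * gi i (z - e2 * b / N))), (D_scal (fun b => gi i (z - e2 * b / N))).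
  apply (D_comp (gi i) (fun b => z - e2 * b / N)); [apply gi_d|apply sh_d].
Qed.
Lemma GG1_d b z : is_derive (fun b => GG1 b z) b (GG b z).
Proof.
  assert (X := N_pos).
  unfold GG, GG1. apply (bs_d (fun i b => ci i * (gi i z * (- e2 * N * Gi i (z - e2 * b / N)))) (fun i b => ci i * (gi i z * gi i (z - e2 * b / N)))).
  intro i. apply (D_scal (fun b => gi i z * (- e2 * N * Gi i (z - e2 * b / N)))), (D_scal (fun b => - e2 * N * Gi i (z - e2 * b / N))).
  eapply D_eq.
  - apply (D_scal (fun b => Gi i (z - e2 * b / N))). apply (D_comp (Gi i) (fun b => z - e2 * b / N)); [apply Gi_d|apply sh_d].
  - transitivity (e2 ^ 2 * gi i (z - e2 * b / N)); [field; lra|]. rewrite He2. ring.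
Qed.
Lemma bs_zero (F : nat -> R) m : (forall i, (i < m)%nat -> F i = 0) -> bs F m = 0.
Proof. intro H. induction m; simpl; [auto|]. rewrite H, IHm by auto. ring. Qed.
Lemma csup_GG b : csup R0w (GG b).
Proof. intros z Hz. apply bs_zero. intros i Hi. destruct (csup_g i Hi) as [A _]. rewrite (A z) by auto. ring. Qed.
Lemma csup_GG1 b : csup R0w (GG1 b).
Proof. intros z Hz. apply bs_zero. intros i Hi. destruct (csup_g i Hi) as [A _]. rewrite (A z) by auto. ring. Qed.

(** Integration in [b] sweeps an interval adjacent to [z] with Jacobian [N]. *)
Lemma shift_int F z : ct F -> csup R0w F -> (forall x, 0 <= F x) -> RI (fun b => F (z - e2 * b / N)) 0 (Bd L kap) <= N * J F.
Proof.
  intros CF SF PF. assert (X := N_pos). assert (Y := Bd_ge1). assert (Z := DR).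
  assert (E : RI (fun b => - e2 / N * F (z - e2 * b / N)) 0 (Bd L kap) = RI F (z - e2 * 0 / N) (z - e2 * Bd L kap / N)).
  { apply (RI_comp F (fun b => z - e2 * b / N) (fun _ => - e2 / N)); [lra|auto|ctac|]. intros; apply sh_d. }
  rewrite RI_scal in E by ctac. replace (z - e2 * 0 / N) with z in E by (field; lra). assert (B : 0 <= Bd L kap / N) by pos.
  set (I := RI (fun b => F (z - e2 * b / N)) 0 (Bd L kap)) in *. assert (HI : I = N * (- e2 * RI F z (z - e2 * Bd L kap / N))).
  { rewrite <- E. transitivity (e2 ^ 2 * I); [rewrite He2; ring|field; lra]. } rewrite HI. mul_l.
  assert (e2 = 1 \/ e2 = -1) as [-> | ->].
  { assert ((e2 - 1) * (e2 + 1) = 0) by (replace ((e2 - 1) * (e2 + 1)) with (e2 ^ 2 - 1) by ring; lra).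
    apply Rmult_integral in H. destruct H; [left|right]; lra. }
  - rewrite (RI_swap F (z - 1 * Bd L kap / N) z) by auto.
    replace (- (1) * - RI F (z - 1 * Bd L kap / N) z) with (RI F (z - 1 * Bd L kap / N) z) by ring.
    apply (RI_sub_le F R0w); try apply Z; auto. unfold Rdiv in *. rewrite Rmult_1_l. lra.
  - replace (- -1 * RI F z (z - -1 * Bd L kap / N)) with (RI F z (z - -1 * Bd L kap / N)) by ring.
    apply (RI_sub_le F R0w); try apply Z; auto. unfold Rdiv in *. lra.
Qed.

(* [v = gi] gives the norm of [GG], and [v = Gi] that of [GG1]. *)
Lemma phi_gen (v : nat -> R -> R) (kk : R) : (forall i, ct (v i)) -> (forall i, (i < n)%nat -> csup R0w (v i)) ->
  RI (phi D (fun b z => bs (fun i => ci i * (gi i z * (kk * v i (z - e2 * b / N)))) n)) 0 (Bd L kap) <=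
  bs (fun i => kk ^ 2 * / (Ov * N * qi i ^ 2) * (Ji i * J (fun z => v i z ^ 2))) n.
Proof.
  intros Cv Sv. assert (X := N_pos). assert (Y := Bd_ge1). assert (HO := Ov_ge1). assert (H := HDD).
  assert (Cg : forall i, ct (gi i)) by apply ct_gi.
  assert (Ct2 : ct2 (fun b z => bs (fun i => ci i * (gi i z * (kk * v i (z - e2 * b / N)))) n)).
  { apply (ct_bs (fun i p => ci i * (gi i (snd p) * (kk * v i (snd p - e2 * fst p / N))))). intro i. ctac. }
  assert (Ct3 : forall i, ct2 (fun z b => (ci i * kk * gi i z * v i (z - e2 * b / N)) ^ 2)).
  { intro i. ctac. } assert (Ct4 : ct2 (fun b z => bs (fun i => (ci i * kk * gi i z * v i (z - e2 * b / N)) ^ 2) n)).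
  { apply (ct_bs (fun i p => (ci i * kk * gi i (snd p) * v i (snd p - e2 * fst p / N)) ^ 2)). intro i. ctac. }
  letr_with (RI (fun b => J (fun z => Ov * bs (fun i => (ci i * kk * gi i z * v i (z - e2 * b / N)) ^ 2) n)) 0 (Bd L kap)).
  { set (H1 := fun b z => bs (fun i => ci i * (gi i z * (kk * v i (z - e2 * b / N)))) n) in *.
    set (H2 := fun b z => bs (fun i => (ci i * kk * gi i z * v i (z - e2 * b / N)) ^ 2) n) in *.
    change (RI (fun b => J (fun z => H1 b z ^ 2)) 0 (Bd L kap) <= RI (fun b => J (fun z => Ov * H2 b z)) 0 (Bd L kap)).
    ri_le. intros b _. ri_le. intros z _. unfold H1, H2. letr; [apply (bs_cs_ind _ (Aw + 3) (N * z))|].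
    - assert (Z := Aw_pos). lra.
    - intros i Hi. destruct (g_out i z Hi) as [-> _]. ring.
    - fold Ov. right. apply (f_equal (Rmult Ov)). apply bs_ext; intros; ring. }
  set (H2 := fun b z => bs (fun i => (ci i * kk * gi i z * v i (z - e2 * b / N)) ^ 2) n) in *.
  rewrite (fubini (fun b z => Ov * H2 b z)) by (try lra; ctac).
  rewrite (RI_ext _ (fun z => bs (fun i => (Ov * (ci i * kk) ^ 2) * (gi i z ^ 2 * RI (fun b => v i (z - e2 * b / N) ^ 2) 0 (Bd L kap))) n)).
  2:{ intro z. rewrite RI_scal by ctac. unfold H2. rewrite (RI_bs (fun i b => (ci i * kk * gi i z * v i (z - e2 * b / N)) ^ 2)).
      2:{ intro i. ctac. } rewrite <- bs_scal. apply bs_ext. intros i _.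
      rewrite (RI_ext _ (fun b => (ci i * kk * gi i z) ^ 2 * v i (z - e2 * b / N) ^ 2)) by (intro; ring).
      rewrite RI_scal by ctac. ring. }
  rewrite (RI_bs (fun i z => (Ov * (ci i * kk) ^ 2) * (gi i z ^ 2 * RI (fun b => v i (z - e2 * b / N) ^ 2) 0 (Bd L kap)))).
  2:{ intro i. ctac. } apply bs_le. intros i Hi. destruct (qi_facts i) as [Q _]. rewrite RI_scal by ctac.
  assert (E : J (fun z => gi i z ^ 2 * RI (fun b => v i (z - e2 * b / N) ^ 2) 0 (Bd L kap)) <= N * J (fun z => v i z ^ 2) * Ji i).
  { unfold Ji. rewrite <- RI_scal by ctac. ri_le. intros z _. rewrite Rmult_comm.
    mul_r. apply (shift_int (fun z => v i z ^ 2)); [ctac| |intro; apply pow2_ge_0]. apply csup_sq; auto. }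
  letr_with ((Ov * (ci i * kk) ^ 2) * (N * J (fun z => v i z ^ 2) * Ji i)).
  - apply Rmult_le_compat_l; auto. apply Rmult_le_pos; [lra|pos].
  - right. unfold ci. field. lra.
Qed.

Lemma bs_const v m : bs (fun _ => v) m = INR m * v.
Proof. induction m; [simpl; ring|]. change (bs (fun _ => v) (S m)) with (bs (fun _ => v) m + v). rewrite IHm, S_INR. ring. Qed.

Lemma inv_Ov : 0 < / Ov <= 1.
Proof. assert (HO := Ov_ge1). split; [pos|]. rewrite <- Rinv_1. apply Rinv_le_contravar; lra. Qed.

Lemma NG_loc : RI (phi D GG) 0 (Bd L kap) <= 1.
Proof.
  assert (X := N_pos). assert (HO := Ov_ge1). assert (HI := inv_Ov).
  rewrite (RI_ext _ (phi D (fun b z => bs (fun i => ci i * (gi i z * (1 * gi i (z - e2 * b / N)))) n))).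
  2:{ intro b. unfold phi. apply RI_ext; intro z. apply (f_equal (fun x => x ^ 2)). unfold GG. apply bs_ext; intros; ring. }
  letr; [apply (phi_gen gi 1); [apply ct_gi|intros; apply csup_g; auto]|]. letr_with (bs (fun _ => / N) n).
  - apply bs_le. intros i _. destruct (qi_facts i) as [Q [Q1 _]]. assert (J0 := Ji_ge0 i). fold (Ji i).
    assert (P : Ji i * Ji i <= qi i * qi i) by (apply Rmult_le_compat; auto).
    letr_with (1 ^ 2 * / (Ov * N * qi i ^ 2) * (qi i * qi i)).
    + apply Rmult_le_compat_l; auto. rewrite pow1, Rmult_1_l. left. apply Rinv_0_lt_compat. apply Rmult_lt_0_compat; [pos|pos].
    + replace (1 ^ 2 * / (Ov * N * qi i ^ 2) * (qi i * qi i)) with (/ Ov * / N) by (field; lra).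
      rewrite <- (Rmult_1_l (/ N)) at 2. mul_r; lra.
  - rewrite bs_const. right. field. lra.
Qed.
Lemma NG1_loc : RI (phi D GG1) 0 (Bd L kap) <= (/ M) ^ 2.
Proof.
  assert (X := N_pos). assert (HO := Ov_ge1). assert (HI := inv_Ov).
  letr; [apply (phi_gen Gi (- e2 * N)); [apply ct_Gi|intros; apply csup_g; auto]|]. letr_with (bs (fun _ => / N * (/ M) ^ 2) n).
  - apply bs_le. intros i _. destruct (qi_facts i) as [Q [Q1 Q2]]. assert (J0 := Ji_ge0 i). assert (J1 := Jw_ge0 i). fold (Jw i).
    assert (P : Ji i * ((M * N) ^ 2 * Jw i) <= qi i * qi i).
    { apply Rmult_le_compat; auto. apply Rmult_le_pos; [pos|auto]. }
    replace ((- e2 * N) ^ 2 * / (Ov * N * qi i ^ 2) * (Ji i * Jw i)) with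
      (e2 ^ 2 * (/ Ov * / N * / M ^ 2 * / qi i ^ 2 * (Ji i * ((M * N) ^ 2 * Jw i)))) by (field; lra). rewrite He2, Rmult_1_l.
    assert (0 < / N) by pos. assert (0 < / M ^ 2) by pos. assert (0 < / qi i ^ 2) by pos.
    letr_with (/ Ov * / N * / M ^ 2 * / qi i ^ 2 * (qi i * qi i)).
    + apply Rmult_le_compat_l; auto. repeat apply Rmult_le_pos; lra.
    + replace (/ Ov * / N * / M ^ 2 * / qi i ^ 2 * (qi i * qi i)) with (/ Ov * (/ N * (/ M) ^ 2)) by (field; lra).
      rewrite <- (Rmult_1_l (/ N * (/ M) ^ 2)) at 2. apply Rmult_le_compat_r; [|lra]. apply Rmult_le_pos; [lra|pos].
  - rewrite bs_const. right. field. lra.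
Qed.
Lemma NGL_loc b : J (fun z => Rabs (GG b z)) <= 1.
Proof.
  assert (X := N_pos). assert (HO := Ov_ge1). assert (HI := inv_Ov). assert (H := HDD). assert (Z := DR).
  assert (Cg : forall i, ct (gi i)) by apply ct_gi.
  assert (Cs : ct (fun z => bs (fun i => ci i * (/ 2 * gi i z ^ 2 + / 2 * gi i (z + - (e2 * b / N)) ^ 2)) n)).
  { apply (ct_bs (fun i z => ci i * (/ 2 * gi i z ^ 2 + / 2 * gi i (z + - (e2 * b / N)) ^ 2))). intro i. ctac. }
  letr_with (J (fun z => bs (fun i => ci i * (/ 2 * gi i z ^ 2 + / 2 * gi i (z + - (e2 * b / N)) ^ 2)) n)).
  - apply RI_le; [auto|ctac|auto|]. intros z _. unfold GG. letr; [apply bs_abs|]. apply bs_le. intros i _.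
    rewrite Rabs_mult, (Rabs_right (ci i)) by (left; apply ci_pos). apply Rmult_le_compat_l; [left; apply ci_pos|].
    letr; [apply (amgm_t _ _ 1); lra|]. rewrite Rinv_1. unfold Rminus. lra.
  - rewrite (RI_bs (fun i z => ci i * (/ 2 * gi i z ^ 2 + / 2 * gi i (z + - (e2 * b / N)) ^ 2))).
    2:{ intro i. ctac. } letr_with (bs (fun _ => / N) n); [|rewrite bs_const; right; field; lra].
    apply bs_le. intros i Hi. destruct (qi_facts i) as [Q [Q1 _]]. rewrite RI_scal, RI_plus, !RI_scal by ctac. fold (Ji i).
    assert (S2 : J (fun z => gi i (z + - (e2 * b / N)) ^ 2) <= Ji i).
    { rewrite (RI_shift (fun z => gi i z ^ 2)) by ctac. apply (RI_sub_le (fun z => gi i z ^ 2) R0w); [lra|lra|ctac| |intro; apply pow2_ge_0].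
      apply csup_sq, csup_g; auto. } letr_with (ci i * qi i); [apply Rmult_le_compat_l; [left; apply ci_pos|lra]|].
    unfold ci. replace (/ (Ov * N * qi i) * qi i) with (/ Ov * / N) by (field; lra).
    rewrite <- (Rmult_1_l (/ N)) at 2. mul_r; lra.
Qed.

Notation chi := (ramp L (q ^ 4)).
Notation XG f := (XX 1 L D (thp kap (/ INR n) e2) (ramp L (q ^ 4)) f (bep kap) 0 (L - 1) GG).
Lemma q4 : 0 < q ^ 4 <= 1. Proof. apply pow_le1; auto. Qed.

Lemma XG_scal E : 0 < E -> J (fun y => fu y ^ 2) <= E -> Rabs (XG fu) <= K * q ^ 2 * E.
Proof.
  intros HE HJ. assert (Sq := sqrt_lt_R0 E HE). assert (S2 := sqrt_sqrt E ltac:(lra)). assert (Z := DR). assert (G1 := ct_GG).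
  set (f := fun y => / sqrt E * fu y). assert (H : Rabs (XG f) <= K * q ^ 2).
  { apply (Hcore R0w D (/ M) f GG GGb GG1); try apply Z; auto.
    - split; [pos|auto].
    - unfold f; ctac.
    - apply ct_GGb.
    - apply ct_GG1.
    - apply GG_d.
    - apply GG1_d.
    - apply csup_GG.
    - apply csup_GG1.
    - intros y Hy. unfold f. rewrite csup_fu by auto. ring.
    - apply NG_loc.
    - apply NG1_loc.
    - intros; apply NGL_loc.
    - unfold f. rewrite (RI_ext _ (fun y => / E * fu y ^ 2)) by (intro; rewrite Rpow_mult_distr, pow_inv; simpl (sqrt E ^ 2); rewrite Rmult_1_r, S2; auto).
      rewrite RI_scal by ctac. apply Rmult_le_reg_l with E; auto. rewrite <- Rmult_assoc, Rinv_r; lra. }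
  assert (Q : XG fu = E * XG f).
  { assert (P0 := ct_ramp L (q ^ 4) ltac:(apply q4)).
    unfold XX. rewrite <- RI_scal by (unfold f, bep, thp; ctac). apply RI_ext; intro a.
    rewrite <- RI_scal by (unfold f, bep, thp; ctac). apply RI_ext; intro s.
    rewrite (Rmult_comm E), !Rmult_assoc. do 2 apply f_equal. rewrite Rmult_comm, <- RI_scal by (unfold f, bep, thp; ctac).
    apply RI_ext; intro y. unfold f. set (g := GG (bep kap a s) (y + thp kap (/ N) e2 s)).
    transitivity ((sqrt E * sqrt E) * (/ sqrt E * / sqrt E) * (fu y * fu (y - a) * g)); [field; lra|]. rewrite S2 at 1. ring. }
  rewrite Q, Rabs_mult, Rabs_right by lra. rewrite Rmult_comm. mul_r; lra.
Qed.

Definition Bi (i : nat) (x : R) : R := RI (fun s => chi s * fu (x - s) * gi i (x - e2 * / N * pw kap s)) 1 L.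
Lemma ct_Bi i : ct (Bi i).
Proof. assert (P0 := ct_ramp L (q ^ 4) ltac:(apply q4)). unfold Bi. ctac. Qed.
#[local] Hint Resolve ct_Bi : ctdb.
Definition gf (i : nat) (a s y : R) : R :=
  fu y * fu (y - a) * (gi i (y + thp kap (/ N) e2 s) * gi i (y + thp kap (/ N) e2 s - e2 * bep kap a s / N)).
Lemma ct_gf i : ct3 (gf i). Proof. unfold gf, thp, bep. ctac. Qed.
#[local] Hint Resolve ct_gf : ctdb.
(** [RI_square] expresses [Bi^2] through pairs [s], [s + a]; after a translation by [s] the weighted
    sum over the windows is the form of the core estimate. *)
Lemma Bi_sq : bs (fun i => ci i * J (fun x => Bi i x ^ 2)) n = 2 * XG fu.
Proof.
  assert (P0 := ct_ramp L (q ^ 4) ltac:(apply q4)). assert (X := N_pos). assert (Z := DR).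
  transitivity (bs (fun i => ci i * (2 * RI (fun a => RI (fun s => chi s * chi (s + a) * J (gf i a s)) 1 L) 0 (L - 1))) n).
  - apply bs_ext. intros i Hi. apply (f_equal (Rmult (ci i))).
    set (hx := fun x s => chi s * fu (x - s) * gi i (x - e2 * / N * pw kap s)). assert (Ch : ct2 hx) by (unfold hx; ctac).
    rewrite (RI_ext _ (fun x => 2 * RI (fun a => RI (fun s => hx x s * hx x (s + a)) 1 L) 0 (L - 1))).
    2:{ intro x. unfold Bi. apply RI_square; [lra|apply (ct2_row hx); auto|]. intros s Hs. unfold hx. rewrite ramp_r by auto. ring. }
    rewrite RI_scal by ctac. apply (f_equal (Rmult 2)).
    rewrite (fubini3 (fun x a s => hx x s * hx x (s + a))) by (try lra; unfold ct3; ctac).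
    apply RI_ext; intro a. apply RI_ext_le; [lra|]. intros s Hs. unfold hx. rewrite <- RI_scal by ctac.
    set (Fy := fun y => chi s * chi (s + a) * gf i a s y). assert (CFy : ct Fy) by (unfold Fy; ctac).
    rewrite <- (J_shift Fy R0w D (- s)); auto; [|lra| |rewrite Rabs_Ropp, Rabs_right; lra].
    + apply RI_ext; intro x. unfold Fy, gf, thp, bep.
      replace (x + - s + (s - e2 * / N * pw kap s)) with (x - e2 * / N * pw kap s) by ring.
      replace (x - e2 * / N * pw kap s - e2 * (pw kap (s + a) - pw kap s) / N) with (x - e2 * / N * pw kap (s + a)) by (field; lra).
      replace (x + - s - a) with (x - (s + a)) by ring. replace (x + - s) with (x - s) by ring. ring.
    + intros y Hy. unfold Fy, gf. rewrite csup_fu by auto. ring.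
  - unfold XX.
    rewrite (RI_ext (fun a => RI (fun s => chi s * chi (s + a) * J (fun y => fu y * fu (y - a) * GG (bep kap a s) (y + thp kap (/ N) e2 s))) 1 L)
      (fun a => bs (fun i => ci i * RI (fun s => chi s * chi (s + a) * J (gf i a s)) 1 L) n)).
    2:{ intro a. rewrite (RI_ext _ (fun s => bs (fun i => ci i * (chi s * chi (s + a) * J (gf i a s))) n)).
      - rewrite (RI_bs (fun i s => ci i * (chi s * chi (s + a) * J (gf i a s)))).
        + apply bs_ext. intros i _. apply RI_scal. ctac.
        + intro i. ctac.
      - intro s. rewrite (RI_ext _ (fun y => bs (fun i => ci i * gf i a s y) n)).
        + rewrite (RI_bs (fun i y => ci i * gf i a s y)).
          * rewrite <- bs_scal. apply bs_ext. intros i _. rewrite RI_scal by ctac. ring.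
          * intro i. ctac.
        + intro y. unfold GG, gf. rewrite <- bs_scal. apply bs_ext. intros; ring. }
    rewrite (RI_bs (fun i a => ci i * RI (fun s => chi s * chi (s + a) * J (gf i a s)) 1 L)).
    + rewrite <- bs_scal. apply bs_ext. intros i _. rewrite RI_scal by ctac. ring.
    + intro i. ctac.
Qed.

Definition Bt (x : R) : R := RI (fun s => chi s * u (c + x - s) * w (c + x - e2 * / N * pw kap s)) 1 L.
Lemma ct_Bt : ct Bt.
Proof. assert (P0 := ct_ramp L (q ^ 4) ltac:(apply q4)). unfold Bt. ctac. Qed.
#[local] Hint Resolve ct_Bt : ctdb.

Lemma e2_cases : e2 = 1 \/ e2 = -1.
Proof.
  assert ((e2 - 1) * (e2 + 1) = 0) by (replace ((e2 - 1) * (e2 + 1)) with (e2 ^ 2 - 1) by ring; lra).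
  apply Rmult_integral in H. destruct H; [left|right]; lra.
Qed.

(** For [x] in the window every argument of [w] stays where its cut-off is 1 and the derivative of
    the cut-off is 0, and the arguments of [u] stay where [tz L] is 1. *)
Lemma Bt_win i x : (i < n)%nat -> INR i / N <= x <= INR (S i) / N -> Bt x = Bi i x.
Proof.
  intros Hi Hx. assert (X := N_pos). assert (Z := pos_INR i). assert (Y : INR (S i) <= N) by (apply le_INR; lia).
  assert (H1 : INR i <= N * x <= INR i + 1).
  { rewrite S_INR in Hx. destruct Hx as [A B]. apply (Rmult_le_compat_l N) in A; [|lra]. apply (Rmult_le_compat_l N) in B; [|lra].
    replace (N * (INR i / N)) with (INR i) in A by (field; lra). replace (N * ((INR i + 1) / N)) with (INR i + 1) in B by (field; lra). lra. }
  assert (H2 : 0 <= x <= 1).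
  { split.
    - apply Rmult_le_reg_l with N; lra.
    - apply Rmult_le_reg_l with N; [lra|]. rewrite S_INR in Y. lra. } unfold Bt, Bi. apply RI_ext_le; [lra|]. intros s Hs.
  unfold fu. rewrite tz_in by (apply Rabs_le; lra). rewrite Rmult_1_r.
  assert (PB := pw_bound kap s (2 * L) ltac:(lra)). fold (Bd L kap) in PB. assert (P0 := pw_pos kap s).
  assert (E : N * (x - e2 * / N * pw kap s) - INR i = N * x - INR i - e2 * pw kap s) by (field; lra).
  destruct (k1_in Aw (N * (x - e2 * / N * pw kap s) - INR i)) as [K1 K2].
  { rewrite E. unfold Aw. destruct e2_cases as [-> | ->]; lra. }
  unfold gi. rewrite K1, K2. replace (c + (x - s)) with (c + x - s) by ring.
  replace (c + (x - e2 * / N * pw kap s)) with (c + x - e2 * / N * pw kap s) by ring. ring.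
Qed.

Lemma RI_windows F m : ct F -> RI F 0 (INR m / N) = bs (fun i => RI F (INR i / N) (INR (S i) / N)) m.
Proof.
  intro CF. induction m.
  - simpl. unfold Rdiv. rewrite Rmult_0_l. apply RI_point.
  - change (bs (fun i => RI F (INR i / N) (INR (S i) / N)) (S m)) with (bs (fun i => RI F (INR i / N) (INR (S i) / N)) m + RI F (INR m / N) (INR (S m) / N)).
    rewrite <- IHm. symmetry. apply RI_chasles; auto.
Qed.

Lemma Bt_bound E : 0 < E -> J (fun y => fu y ^ 2) <= E ->
  RI (fun x => Rabs (Bt x)) 0 1 <= q / 2 * bs qi n + Ov * K * q * E.
Proof.
  intros HE HJ. assert (X := N_pos). assert (HO := Ov_ge1). assert (Z := DR).
  replace 1 with (INR n / INR n) at 1 by (field; lra). rewrite RI_windows by ctac.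
  letr_with (bs (fun i => q / 2 * qi i + Ov / (2 * q) * (ci i * J (fun x => Bi i x ^ 2))) n).
  - apply bs_le. intros i Hi. destruct (qi_facts i) as [Q _]. assert (L1 : INR i / N <= INR (S i) / N).
    { apply Rmult_le_compat_r; [pos|apply le_INR; lia]. }
    (* With this weight AM-GM gives [q / 2 * qi] plus [Ov / (2 q) * ci * J (Bi^2)]; the factor [q^2]
       of the core estimate then leaves [q] in the second sum as well. *)
    set (t := N * q * qi i). assert (Ht : 0 < t) by (unfold t; repeat apply Rmult_lt_0_compat; lra).
    letr_with (RI (fun x => t / 2 + / 2 * / t * Bi i x ^ 2) (INR i / N) (INR (S i) / N)).
    + ri_le. intros x Hx. rewrite (Bt_win i x Hi Hx). assert (T := amgm_t 1 (Bi i x) t Ht). rewrite Rmult_1_l in T. lra.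
    + rewrite RI_plus, RI_const, RI_scal by ctac. apply Rplus_le_compat.
      * right. rewrite S_INR. unfold t. field. lra.
      * letr_with (/ 2 * / t * J (fun x => Bi i x ^ 2)).
        { mul_l. assert (W1 : 0 <= INR i / N) by (apply Rdiv_le_0_compat; [apply pos_INR|lra]). assert (W2 : INR (S i) / N <= 1).
          { apply Rmult_le_reg_r with N; [lra|]. unfold Rdiv. rewrite Rmult_assoc, Rinv_l by lra. assert (INR (S i) <= N) by (apply le_INR; lia). lra. }
          apply RI_mono; try lra; [ctac|]. intros; apply pow2_ge_0. } right. unfold ci, t. field. lra.
  - rewrite bs_plus, !bs_scal, Bi_sq. apply Rplus_le_compat_l. assert (XG1 := XG_scal E HE HJ). assert (XG2 := Rle_abs (XG fu)).
    letr_with (Ov / (2 * q) * (2 * (K * q ^ 2 * E))).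
    + mul_l; lra.
    + right. field. lra.
Qed.

Lemma sum_overlap (v : nat -> R -> R) F : (forall i, ct (v i)) -> ct F -> (forall x, 0 <= F x) ->
  (forall i z, v i z <= ind (Aw + 3) (N * z - INR i) * F z) -> bs (fun i => J (v i)) n <= Ov * J F.
Proof.
  intros Cv CF PF Hv. rewrite <- RI_bs by auto. rewrite <- RI_scal by auto.
  apply RI_le; [apply HDD|apply ct_bs; auto|ctac|]. intros z _. letr_with (bs (fun i => F z * ind (Aw + 3) (N * z - INR i)) n).
  - apply bs_le. intros i _. rewrite Rmult_comm. apply Hv.
  - rewrite bs_scal, Rmult_comm. mul_r; auto. apply count_near. assert (Y := Aw_pos). lra.
Qed.

Lemma loc_ep : RI (fun x => Rabs (Bt x)) 0 1 <= q * (2 * Ov * K) * (J (fun z => u (c + z) ^ 2) + J (fun z => w (c + z) ^ 2) +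
  (M * N) ^ 2 * J (fun z => W (c + z) ^ 2)) + q * (1 + Ov * K) * ep.
Proof.
  assert (X := N_pos). assert (HO := Ov_ge1). assert (H := HDD).
  set (U2 := J (fun z => u (c + z) ^ 2)). set (w2 := J (fun z => w (c + z) ^ 2)). set (W2 := J (fun z => W (c + z) ^ 2)).
  assert (P1 : 0 <= U2) by (apply RI_ge0; [auto|ctac|intros; apply pow2_ge_0]).
  assert (P2 : 0 <= w2) by (apply RI_ge0; [auto|ctac|intros; apply pow2_ge_0]).
  assert (P3 : 0 <= W2) by (apply RI_ge0; [auto|ctac|intros; apply pow2_ge_0]). assert (F1 : J (fun y => fu y ^ 2) <= U2).
  { ri_le. intros y _. unfold fu. rewrite Rpow_mult_distr. assert (T := tz_01 L y).
    rewrite <- (Rmult_1_r (u (c + y) ^ 2)) at 2. mul_l. rewrite <- (pow1 2). apply pow_incr; auto. }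
  assert (G1 : bs Ji n <= Ov * (2 * w2 + 2 * N ^ 2 * W2)).
  { letr_with (Ov * J (fun z => 2 * w (c + z) ^ 2 + 2 * N ^ 2 * W (c + z) ^ 2)).
    - apply (sum_overlap (fun i z => gi i z ^ 2)); [intro i; assert (A := ct_gi i); ctac|ctac| |].
      + intro x. assert (A := pow2_ge_0 (w (c + x))). assert (B := pow2_ge_0 (W (c + x))). assert (B2 := pow2_ge_0 N).
        assert (0 <= N ^ 2 * W (c + x) ^ 2) by pos. lra.
      + intros i z. assert (G := g_out i z). unfold ind in *. destruct (Rle_dec (Rabs (N * z - INR i)) (Aw + 3)).
        * clear G. unfold gi. set (a := w (c + z)). set (b := W (c + z)). set (k := k1 Aw _). set (k' := k1' Aw _).
          assert (Hk : 0 <= k <= 1) by apply k1_01. assert (Hk' : Rabs k' <= 1) by apply k1'_1.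
          assert (0 <= (a * k - N * (b * k')) ^ 2) by pos. assert (k ^ 2 <= 1) by (rewrite <- (pow1 2); apply pow_incr; auto).
          assert (k' ^ 2 <= 1) by (rewrite <- (pow2_abs k'), <- (pow1 2); apply pow_incr; split; [pos|auto]).
          assert (a ^ 2 * k ^ 2 <= a ^ 2 * 1) by (mul_l; auto). assert ((N * b) ^ 2 * k' ^ 2 <= (N * b) ^ 2 * 1) by (mul_l; auto).
          rewrite Rpow_mult_distr in H4. lra.
        * destruct (G eq_refl) as [-> _]. lra.
    - right. rewrite RI_plus, !RI_scal by ctac. auto. } assert (G2 : bs Jw n <= Ov * W2).
  { apply (sum_overlap (fun i z => Gi i z ^ 2)); [intro i; assert (A := ct_Gi i); ctac|ctac|intro; apply pow2_ge_0|].
    intros i z. assert (G := g_out i z). unfold ind in *. destruct (Rle_dec (Rabs (N * z - INR i)) (Aw + 3)).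
    - clear G. unfold Gi. rewrite Rpow_mult_distr, Rmult_1_l. assert (T := k1_01 Aw (N * z - INR i)).
      rewrite <- (Rmult_1_r (W (c + z) ^ 2)) at 2. mul_l. rewrite <- (pow1 2). apply pow_incr; auto.
    - destruct (G eq_refl) as [_ ->]. lra. } assert (GQ : bs qi n = bs Ji n + (M * N) ^ 2 * bs Jw n + ep).
  { unfold qi. rewrite !bs_plus, bs_scal, bs_const. field. lra. }
  assert (B := Bt_bound (U2 + ep) ltac:(lra) ltac:(lra)). rewrite GQ in B. assert (NN : N ^ 2 <= (M * N) ^ 2).
  { apply pow_incr. split; [lra|]. rewrite <- (Rmult_1_l N) at 1. mul_r; lra. }
  set (Y := (M * N) ^ 2) in *. assert (HY : 0 <= Y) by apply pow2_ge_0.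
  assert (G3 : Y * bs Jw n <= Y * (Ov * W2)) by (mul_l; auto). assert (G4 : N ^ 2 * W2 <= Y * W2) by (mul_r; auto).
  assert (G5 : bs Ji n + Y * bs Jw n + ep <= Ov * (2 * w2 + 3 * (Y * W2)) + ep).
  { assert (Ov * (N ^ 2 * W2) <= Ov * (Y * W2)) by (mul_l; lra). lra. }
  assert (G6 : q / 2 * (bs Ji n + Y * bs Jw n + ep) <= q / 2 * (Ov * (2 * w2 + 3 * (Y * W2)) + ep)) by (mul_l; lra).
  assert (YW : 0 <= Y * W2) by pos. assert (OK : Ov <= Ov * K) by (rewrite <- (Rmult_1_r Ov) at 1; mul_l; lra).
  assert (V1 : q * Ov * (w2 + 2 * (Y * W2)) <= q * (Ov * K) * (w2 + 2 * (Y * W2))).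
  { mul_r. mul_l; lra. } assert (V2 : 0 <= q * Ov * (Y * W2)) by pos. assert (V3 : 0 <= q * (Ov * K) * w2) by pos.
  assert (V4 : 0 <= q * (Ov * K) * U2) by pos. assert (V5 : 0 <= q * ep) by pos. lra.
Qed.
End Loc.
End Localisation.
Import Localisation.

(** * The core estimate in periodic form and in the original variables *)

Module HardLemma.
Implicit Types f g F u W w : R -> R.

Lemma le_eps a b k : (forall ep, 0 < ep -> a <= b + k * ep) -> 0 <= k -> a <= b.
Proof.
  intros H Hk. apply Rnot_lt_le. intro Hl. assert (X := H ((a - b) / (2 * (k + 1))) ltac:(pos)).
  assert (k * ((a - b) / (2 * (k + 1))) <= (a - b) / 2).
  { replace ((a - b) / 2) with ((k + 1) * ((a - b) / (2 * (k + 1)))) by (field; lra). mul_r; lra. } lra.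
Qed.

Lemma per_avg P F a b : 0 < P -> a <= b -> cper P F -> RI (fun c => RI (fun x => F (c + x)) a b) 0 P = (b - a) * RI F 0 P.
Proof.
  intros HP Hab HF. rewrite (fubini (fun c x => F (c + x))) by (try lra; ctac). rewrite <- RI_const. apply RI_ext; intro x.
  apply per_shift; auto.
Qed.

Definition Bf (L r kap sm : R) u w (x : R) : R := RI (fun s => ramp L r s * u (x - s) * w (x - sm * pw kap s)) 1 L.

Lemma cper_Bf P L r kap sm u w : 0 < r -> cper P u -> cper P w -> cper P (Bf L r kap sm u w).
Proof.
  intros Hr [Cu Pu] [Cw Pw]. assert (A := ct_ramp L r Hr). split; [unfold Bf; ctac|].
  intro x. unfold Bf. apply RI_ext; intro s. rewrite <- (Pu (x - s)), <- (Pw (x - sm * pw kap s)).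
  replace (x + P - s) with (x - s + P) by ring. replace (x + P - sm * pw kap s) with (x - sm * pw kap s + P) by ring. auto.
Qed.

(** The local estimate on [[c, c + 1]] is averaged over [c] in a period, which turns every local
    energy into its length times the energy of the period. *)
Lemma hard_ramp kap L : 0 < kap -> kap <> 1 -> 2 <= L -> exists C nu0, 0 <= C /\ 0 < nu0 /\
  forall n e2 q M P u w w' W, (1 <= n)%nat -> / INR n <= nu0 -> e2 ^ 2 = 1 -> 0 < q <= 1 -> 1 <= M -> / M <= q ^ 48 -> 0 < P ->
  cper P u -> cper P w -> ct w' -> cper P W -> (forall x : R, is_derive W x (w x)) -> (forall x : R, is_derive w x (w' x)) ->
  RI (fun x => Rabs (Bf L (q ^ 4) kap (e2 * / INR n) u w x)) 0 P <= C * q * (En P u + En P w + (M * INR n) ^ 2 * En P W).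
Proof.
  intros Hkap Hkap1 HL. destruct (core_pow kap L Hkap Hkap1 HL) as [K [nu0 [HK [Hnu0 Hcore]]]].
  assert (HO := Ov_ge1 kap L HL). destruct (DR kap L K HL HK) as [[HR0 HRD] _].
  exists (2 * Ov kap L * K * (2 * Dw0 kap L K)), nu0. split; [pos|]. split; [lra|].
  intros n e2 q M P u w w' W Hn HnN He2 Hq HM HMq HP Hu Hw Cw' HW DW Dw.
  assert (Cu : ct u) by apply Hu. assert (Cw : ct w) by apply Hw. assert (CW : ct W) by apply HW.
  assert (HN : 0 < / INR n) by (apply Rinv_0_lt_compat; apply lt_0_INR; lia). assert (Q4 := pow_le1 q 4 Hq).
  assert (HB := cper_Bf P L (q ^ 4) kap (e2 * / INR n) u w ltac:(lra) Hu Hw).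
  set (D := Dw0 kap L K) in *. set (Bq := Bf L (q ^ 4) kap (e2 * / INR n) u w) in *.
  assert (HE : forall c, RI (fun x => Rabs (Bq (c + x))) 0 1 <= q * (2 * Ov kap L * K) * (RI (fun z => u (c + z) ^ 2) (- D) D +
    RI (fun z => w (c + z) ^ 2) (- D) D + (M * INR n) ^ 2 * RI (fun z => W (c + z) ^ 2) (- D) D)).
  { intro c. apply le_eps with (q * (1 + Ov kap L * K)).
    - intros ep Hep. apply (loc_ep kap L K n e2 q M c ep u w w' W HL HK Hn He2 Hq HM HMq Hep Cu Cw Cw' CW DW Dw).
      intros R0 D0 eta f Gam Gamb Gam1 H0 H1 H2. apply (Hcore (/ INR n) e2 q R0 D0 eta f Gam Gamb Gam1); auto. lra.
    - assert (0 <= Ov kap L * K) by pos. apply Rmult_le_pos; lra. }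
  assert (A1 : RI (fun c => RI (fun x => Rabs (Bq (c + x))) 0 1) 0 P = RI (fun x => Rabs (Bq x)) 0 P).
  { rewrite (per_avg P (fun x => Rabs (Bq x)) 0 1); [ring|auto|lra|apply cper_abs; auto]. } rewrite <- A1.
  letr; [apply (RI_le _ (fun c => q * (2 * Ov kap L * K) * (RI (fun z => u (c + z) ^ 2) (- D) D +
    RI (fun z => w (c + z) ^ 2) (- D) D + (M * INR n) ^ 2 * RI (fun z => W (c + z) ^ 2) (- D) D))); [lra|ctac|ctac|intros; apply HE]|].
  rewrite RI_scal, !RI_plus, (RI_scal (fun c => RI (fun z => W (c + z) ^ 2) (- D) D)) by ctac.
  rewrite (per_avg P (fun x => u x ^ 2)), (per_avg P (fun x => w x ^ 2)), (per_avg P (fun x => W x ^ 2)) by (auto with cp; lra).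
  right. unfold En. ring.
Qed.

Lemma ramp_err L r : 2 <= L -> 0 < r <= 1 -> RI (fun s => pw (-1) s - ramp L r s) 1 L <= 2 * r /\
  forall s, 1 <= s <= L -> 0 <= pw (-1) s - ramp L r s.
Proof.
  intros HL Hr. assert (A := ct_ramp L r ltac:(lra)). assert (C := ct_step r ltac:(lra)).
  assert (S : forall x, 0 <= step r x <= 1) by (intro; apply step_01; lra).
  assert (Q : forall s, 1 <= s -> 0 <= pw (-1) s - ramp L r s <= (1 - step r (s - 1)) + (1 - step r (L - s))).
  { intros s Hs. unfold ramp. assert (P1 := pw_pos (-1) s). assert (P2 := pw_neg (-1) s ltac:(lra) Hs).
    assert (S1 := S (s - 1)). assert (S2 := S (L - s)). set (a := step r (s - 1)) in *. set (b := step r (L - s)) in *. set (p := pw (-1) s) in *.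
    replace (p - a * b * p) with ((1 - a * b) * p) by ring. assert (0 <= (1 - a) * (1 - b)) by pos.
    assert (a * b <= 1) by (rewrite <- (Rmult_1_l 1); apply Rmult_le_compat; lra).
    split; [pos|]. letr_with ((1 - a * b) * 1); [mul_l; lra|lra]. } split; [|intros; apply Q; lra].
  letr_with (RI (fun s => (1 - step r (s - 1)) + (1 - step r (L - s))) 1 L).
  { ri_le. intros s Hs; apply Q; lra. } rewrite RI_plus by ctac. assert (E1 : RI (fun s => 1 - step r (s - 1)) 1 L <= r).
  { rewrite <- (RI_chasles _ 1 (1 + r) L) by ctac. rewrite (RI_zero _ (1 + r) L); [|lra|intros; rewrite step_r by lra; ring].
    letr_with (RI (fun _ => 1) 1 (1 + r) + 0); [|rewrite RI_const; lra].
    apply Rplus_le_compat_r. ri_le. intros s _. assert (X := S (s - 1)). lra. }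
  assert (E2 : RI (fun s => 1 - step r (L - s)) 1 L <= r).
  { rewrite <- (RI_chasles _ 1 (L - r) L) by ctac. rewrite (RI_zero _ 1 (L - r)); [|lra|intros; rewrite step_r by lra; ring].
    letr_with (0 + RI (fun _ => 1) (L - r) L); [|rewrite RI_const; lra].
    apply Rplus_le_compat_l. ri_le. intros s _. assert (X := S (L - s)). lra. } lra.
Qed.

Lemma RI_amgm_shift P u w (m m' : R -> R) (rho : R -> R) a b : 0 < P -> a <= b -> cper P u -> cper P w -> ct m -> ct m' -> ct rho ->
  (forall s, a <= s <= b -> 0 <= rho s) ->
  RI (fun x => Rabs (RI (fun s => rho s * u (x - m s) * w (x - m' s)) a b)) 0 P <= RI rho a b * (En P u + En P w).
Proof.
  intros HP Hab Hu Hw Cm Cm' Cr Hr. letr_with (RI (fun x => RI (fun s => rho s * (u (x - m s) ^ 2 + w (x - m' s) ^ 2)) a b) 0 P).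
  - ri_le. intros x _. letr; [apply RI_abs; [lra|ctac]|]. ri_le.
    intros s Hs. rewrite Rmult_assoc, Rabs_mult, (Rabs_right (rho s)) by (apply Rle_ge; auto). mul_l; auto.
    letr; [apply (amgm_t _ _ 1); lra|]. rewrite Rinv_1.
    assert (A := pow2_ge_0 (u (x - m s))). assert (B := pow2_ge_0 (w (x - m' s))). lra.
  - rewrite (fubini (fun x s => rho s * (u (x - m s) ^ 2 + w (x - m' s) ^ 2))) by (try lra; ctac).
    right. rewrite Rmult_comm, <- RI_scal by ctac. apply RI_ext; intro s. rewrite RI_scal, RI_plus by ctac.
    assert (E1 := En_shiftm P u (m s) HP Hu). assert (E2 := En_shiftm P w (m' s) HP Hw). unfold En in *. rewrite E1, E2. ring.
Qed.

(** Replacing [1 / s] by [ramp] costs its missing mass, at most [2 q^4 <= 2 q], times the trivial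
    bound. *)
Lemma hard_unit kap L : 0 < kap -> kap <> 1 -> 2 <= L -> exists C nu0, 0 <= C /\ 0 < nu0 /\
  forall n e2 q M P u w w' W, (1 <= n)%nat -> / INR n <= nu0 -> e2 ^ 2 = 1 -> 0 < q <= 1 -> 1 <= M -> / M <= q ^ 48 -> 0 < P ->
  cper P u -> cper P w -> ct w' -> cper P W -> (forall x : R, is_derive W x (w x)) -> (forall x : R, is_derive w x (w' x)) ->
  RI (fun x => Rabs (RI (fun s => pw (-1) s * u (x - s) * w (x - e2 * / INR n * pw kap s)) 1 L)) 0 P <=
  C * q * (En P u + En P w + (M * INR n) ^ 2 * En P W).
Proof.
  intros Hkap Hkap1 HL. destruct (hard_ramp kap L Hkap Hkap1 HL) as [C [nu0 [HC [Hnu0 H]]]].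
  exists (C + 2), nu0. split; [lra|]. split; auto. intros n e2 q M P u w w' W Hn HnN He2 Hq HM HMq HP Hu Hw Cw' HW DW Dw.
  specialize (H n e2 q M P u w w' W Hn HnN He2 Hq HM HMq HP Hu Hw Cw' HW DW Dw).
  assert (Cu : ct u) by apply Hu. assert (Cw : ct w) by apply Hw. assert (CW : ct W) by apply HW.
  assert (Q4 := pow_le1 q 4 Hq). assert (Cr := ct_ramp L (q ^ 4) ltac:(lra)).
  destruct (ramp_err L (q ^ 4) HL ltac:(lra)) as [R1 R2]. set (sm := e2 * / INR n) in *.
  assert (X := RI_amgm_shift P u w (fun s => s) (fun s => sm * pw kap s) (fun s => pw (-1) s - ramp L (q ^ 4) s) 1 L HP ltac:(lra) Hu Hw
    ct_id ltac:(ctac) ltac:(ctac) R2). cbv beta in X.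
  assert (E1 := En_ge0 P u HP Cu). assert (E2 := En_ge0 P w HP Cw). assert (E3 := En_ge0 P W HP CW).
  assert (CB : ct (Bf L (q ^ 4) kap sm u w)) by (apply (cper_Bf P); auto; lra).
  letr_with (RI (fun x => Rabs (Bf L (q ^ 4) kap sm u w x) +
    Rabs (RI (fun s => (pw (-1) s - ramp L (q ^ 4) s) * u (x - s) * w (x - sm * pw kap s)) 1 L)) 0 P).
  - ri_le. intros x _. replace (RI (fun s => pw (-1) s * u (x - s) * w (x - sm * pw kap s)) 1 L) with (Bf L (q ^ 4) kap sm u w x +
      RI (fun s => (pw (-1) s - ramp L (q ^ 4) s) * u (x - s) * w (x - sm * pw kap s)) 1 L); [apply Rabs_triang|].
    unfold Bf. rewrite <- RI_plus by ctac. apply RI_ext; intro; ring.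
  - rewrite RI_plus by ctac.
    assert (q ^ 4 <= q) by (assert (T := pow_le1 q 3 Hq); replace (q ^ 4) with (q * q ^ 3) by ring; rewrite <- (Rmult_1_r q) at 3; mul_l; lra).
    assert (RI (fun s => pw (-1) s - ramp L (q ^ 4) s) 1 L * (En P u + En P w) <= 2 * q * (En P u + En P w)) by (mul_r; lra).
    assert (0 <= q * ((M * INR n) ^ 2 * En P W)) by pos. lra.
Qed.

Lemma RI_scale P mu s F : 0 < P -> 0 < mu -> s ^ 2 = 1 -> cper P F ->
  RI F 0 P = mu * RI (fun z => F (s * mu * z)) 0 (P / mu).
Proof.
  intros HP Hmu Hs HF. assert (CF : ct F) by apply HF. assert (Hd : 0 <= P / mu) by pos.
  assert (E : RI (fun z => s * mu * F (s * mu * z)) 0 (P / mu) = RI F (s * mu * 0) (s * mu * (P / mu))).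
  { apply (RI_comp F (fun z => s * mu * z) (fun _ => s * mu)); [lra|auto|ctac|]. intros; auto_derive; auto; ring. }
  rewrite RI_scal in E by ctac. rewrite Rmult_0_r in E. replace (s * mu * (P / mu)) with (s * P) in E by (field; lra).
  transitivity (s ^ 2 * (mu * RI (fun z => F (s * mu * z)) 0 (P / mu))); [|rewrite Hs; ring].
  transitivity (s * (s * mu * RI (fun z => F (s * mu * z)) 0 (P / mu))); [|ring]. rewrite E.
  destruct (e2_cases s Hs) as [-> | ->].
  - rewrite !Rmult_1_l. auto.
  - replace (-1 * P) with (- P) by ring. rewrite (RI_swap F (- P) 0) by auto.
    rewrite <- (per_int P F (- P)) by auto. replace (- P + P) with 0 by ring. ring.
Qed.
Lemma cper_scale P mu s F : 0 < mu -> s ^ 2 = 1 -> cper P F -> cper (P / mu) (fun z => F (s * mu * z)).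
Proof.
  intros Hmu Hs [C H]. split; [ctac|]. intro z. replace (s * mu * (z + P / mu)) with (s * mu * z + s * P) by (field; lra).
  destruct (e2_cases s Hs) as [-> | ->].
  - rewrite !Rmult_1_l. apply H.
  - rewrite <- (H (-1 * mu * z + -1 * P)). f_equal. ring.
Qed.

(** Rescaling by the larger shift [INR n * nu] and substituting [s = exp (al * v)] reduce to
    [hard_unit] with [kap = be / al] and [L = 2^al]; the condition [al <> be] becomes [kap <> 1],
    i.e. curvature. *)
Theorem hard al be : 0 < al -> 0 < be -> al <> be -> 1 <= al -> exists C nu0, 0 <= C /\ 0 < nu0 /\
  forall n s1 s2 nu q M P u w w' W, (1 <= n)%nat -> / INR n <= nu0 -> s1 ^ 2 = 1 -> s2 ^ 2 = 1 -> 0 < nu ->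
  0 < q <= 1 -> 1 <= M -> / M <= q ^ 48 -> 0 < P ->
  cper P u -> cper P w -> ct w' -> cper P W -> (forall x : R, is_derive W x (w x)) -> (forall x : R, is_derive w x (w' x)) ->
  RI (fun x => Rabs (RI (fun v => u (x - s1 * mexp (INR n * nu) al v) * w (x - s2 * mexp nu be v)) 0 (ln 2))) 0 P <=
  C * q * (En P u + En P w + (M / nu) ^ 2 * En P W).
Proof.
  intros Hal Hbe Hab Hal1. set (kap := be / al). set (L := exp (al * ln 2)).
  assert (Hkap : 0 < kap) by (apply Rdiv_lt_0_compat; auto).
  assert (Hkap1 : kap <> 1) by (unfold kap; intro E; apply Hab; apply (Rmult_eq_compat_r al) in E; field_simplify in E; lra).
  assert (L2 : 0 < ln 2) by (rewrite <- ln_1; apply ln_increasing; lra). assert (HL : 2 <= L).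
  { unfold L. rewrite <- (exp_ln 2) at 1 by lra. apply exp_le. rewrite <- (Rmult_1_l (ln 2)) at 1. mul_r; lra. }
  destruct (hard_unit kap L Hkap Hkap1 HL) as [C [nu0 [HC [Hnu0 H]]]]. exists C, nu0. split; [auto|]. split; auto.
  intros n s1 s2 nu q M P u w w' W Hn HnN Hs1 Hs2 Hnu Hq HM HMq HP Hu Hw Cw' HW DW Dw.
  assert (HN : 0 < INR n) by (apply lt_0_INR; lia).
  set (mu := INR n * nu). assert (Hmu : 0 < mu) by (apply Rmult_lt_0_compat; auto). assert (Hsm : s1 * mu <> 0).
  { intro E. apply Rmult_integral in E. destruct E as [E|E]; [rewrite E in Hs1; lra|lra]. }
  set (Us := fun z => u (s1 * mu * z)). set (ws := fun z => w (s1 * mu * z)). set (Ws := fun z => / (s1 * mu) * W (s1 * mu * z)).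
  set (ws' := fun z => (s1 * mu) * w' (s1 * mu * z)).
  assert (lin : forall z : R, is_derive (fun z => s1 * mu * z) z (s1 * mu)) by (intro; auto_derive; auto; ring).
  assert (H1 := H n (s1 * s2) q M (P / mu) Us ws ws' Ws Hn HnN ltac:(rewrite Rpow_mult_distr, Hs1, Hs2; ring) Hq HM HMq
    ltac:(pos) (cper_scale P mu s1 u Hmu Hs1 Hu) (cper_scale P mu s1 w Hmu Hs1 Hw) ltac:(unfold ws'; ctac)).
  assert (HW1 : cper (P / mu) Ws) by (apply cper_scal; apply (cper_scale P mu s1 W Hmu Hs1 HW)). specialize (H1 HW1).
  assert (D1 : forall x : R, is_derive Ws x (ws x)).
  { intro x. unfold Ws, ws. eapply D_eq; [apply (D_scal (fun z => W (s1 * mu * z))); apply (D_comp W (fun z => s1 * mu * z)); [apply DW|apply lin]|]. rewrite <- Rmult_assoc, Rinv_l by auto; ring. }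
  assert (D2 : forall x : R, is_derive ws x (ws' x)).
  { intro x. unfold ws', ws. apply (D_comp w (fun z => s1 * mu * z)); [apply Dw|apply lin]. } specialize (H1 D1 D2). clear H.
  set (B := fun x => RI (fun v => u (x - s1 * mexp mu al v) * w (x - s2 * mexp nu be v)) 0 (ln 2)). assert (HB : cper P B).
  { split; [unfold B; ctac|]. intro x. unfold B. apply RI_ext; intro v. rewrite <- (proj2 Hu (x - s1 * mexp mu al v)), <- (proj2 Hw (x - s2 * mexp nu be v)).
    replace (x + P - s1 * mexp mu al v) with (x - s1 * mexp mu al v + P) by ring. replace (x + P - s2 * mexp nu be v) with (x - s2 * mexp nu be v + P) by ring. auto. }
  change (RI (fun x => Rabs (B x)) 0 P <= C * q * (En P u + En P w + (M / nu) ^ 2 * En P W)).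
  rewrite (RI_scale P mu s1 (fun x => Rabs (B x))) by (auto; apply cper_abs; auto).
  assert (Eu : En P u = mu * En (P / mu) Us) by (apply (RI_scale P mu s1 (fun x => u x ^ 2)); auto with cp).
  assert (Ew : En P w = mu * En (P / mu) ws) by (apply (RI_scale P mu s1 (fun x => w x ^ 2)); auto with cp).
  assert (EW : En P W = mu ^ 3 * En (P / mu) Ws).
  { transitivity (mu * RI (fun z => W (s1 * mu * z) ^ 2) 0 (P / mu)); [apply (RI_scale P mu s1 (fun x => W x ^ 2)); auto with cp|].
    unfold Ws. rewrite (En_scal (P / mu) (/ (s1 * mu)) (fun z => W (s1 * mu * z))) by ctac. unfold En.
    rewrite pow_inv, Rpow_mult_distr, Hs1. field. lra. } rewrite Eu, Ew, EW.
  replace (C * q * (mu * En (P / mu) Us + mu * En (P / mu) ws + (M / nu) ^ 2 * (mu ^ 3 * En (P / mu) Ws))) with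
    (mu * (C * q * (En (P / mu) Us + En (P / mu) ws + (M * INR n) ^ 2 * En (P / mu) Ws))) by (unfold mu; field; lra).
  mul_l. letr; [|apply H1]. assert (Hd : 0 <= P / mu) by pos.
  assert (C1 : ct Us) by (unfold Us; ctac). assert (C2 : ct ws) by (unfold ws; ctac). ri_le. intros z _.
  replace (B (s1 * mu * z)) with (/ al * RI (fun s => pw (-1) s * Us (z - s) * ws (z - s1 * s2 * / INR n * pw kap s)) 1 L).
  - rewrite Rabs_mult, Rabs_right by pos. rewrite <- (Rmult_1_l (Rabs _)) at 2.
    mul_r. rewrite <- Rinv_1. apply Rinv_le_contravar; lra.
  - set (Hs := fun s => pw (-1) s * Us (z - s) * ws (z - s1 * s2 * / INR n * pw kap s)). assert (CH : ct Hs) by (unfold Hs; ctac).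
    assert (E : RI (fun v => al * exp (al * v) * Hs (exp (al * v))) 0 (ln 2) = RI Hs (exp (al * 0)) (exp (al * ln 2))).
    { apply (RI_comp Hs (fun v => exp (al * v)) (fun v => al * exp (al * v))); [lra|auto|ctac|]. intros; auto_derive; auto; ring. }
    rewrite Rmult_0_r, exp_0 in E. fold L in E. rewrite <- E. rewrite <- RI_scal by ctac. unfold B.
    apply RI_ext_le; [lra|]. intros v Hv.
    assert (HX : 1 <= exp (al * v)) by (rewrite <- exp_0; apply exp_le; apply Rmult_le_pos; lra).
    assert (P1 : pw (-1) (exp (al * v)) * exp (al * v) = 1).
    { rewrite <- (pw_1 (exp (al * v))) at 2 by lra. rewrite <- pw_plus. replace (-1 + 1) with 0 by ring. apply pw_0. }
    assert (P2 : pw kap (exp (al * v)) = exp (be * v)).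
    { unfold pw, lnc. rewrite Rmax_left, ln_exp by lra. f_equal. unfold kap. field. lra. } unfold Hs. rewrite P2. unfold Us, ws.
    replace (s1 * mu * (z - exp (al * v))) with (s1 * mu * z - s1 * mexp mu al v) by (unfold mexp; ring).
    replace (s1 * mu * (z - s1 * s2 * / INR n * exp (be * v))) with (s1 * mu * z - s2 * mexp nu be v).
    2:{ unfold mexp, mu. transitivity (s1 * (INR n * nu) * z - s1 ^ 2 * (s2 * (nu * exp (be * v)))); [rewrite Hs1; ring|field; lra]. }
    set (X1 := u _). set (X2 := w _). transitivity (/ al * al * (pw (-1) (exp (al * v)) * exp (al * v)) * (X1 * X2)); [ring|]. rewrite P1. field. lra.
Qed.
End HardLemma.
Import HardLemma.

(** * Littlewood-Paley pieces of a block and integration by parts *)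

Module Pieces.
Implicit Types f g F G u W w h : R -> R.

Lemma RI_abs_amgm P u (v : R -> R) (t : R) : 0 < P -> 0 < t -> ct u -> ct v ->
  RI (fun x => Rabs (u x * v x)) 0 P <= / 2 * (t * En P u + / t * En P v).
Proof.
  intros HP Ht Cu Cv. unfold En. rewrite <- !RI_scal, <- RI_plus, <- RI_scal by ctac. ri_le. intros x _. apply amgm_t; auto.
Qed.

(** The primitive [W] has size [rho * mu], and integrating by parts in [v] divides by [mu];
    differentiating the coefficient [c] costs [sg]. *)
Lemma parts_bound P mu al s V W u (c c' : R -> R -> R) rho sg E1 E2 : 0 < P -> 0 < mu -> 1 <= al -> s ^ 2 = 1 -> 0 <= V <= 1 ->
  cper P W -> ct u -> (forall x : R, is_derive W x (u x)) -> ct2 c -> ct2 c' ->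
  (forall x v, 0 <= v <= V -> is_derive (c x) v (c' x v)) -> 0 < rho -> 1 <= sg -> 0 <= E1 -> 0 <= E2 ->
  En P W <= (rho * mu) ^ 2 * E1 -> (forall v, 0 <= v <= V -> En P (fun x => c x v) <= E2) ->
  (forall v, 0 <= v <= V -> En P (fun x => c' x v) <= sg ^ 2 * E2) ->
  RI (fun x => Rabs (RI (fun v => c x v * u (x - s * mexp mu al v)) 0 V)) 0 P <= 2 * rho * sg * (E1 + E2).
Proof.
  intros HP Hmu Hal Hs HV HW Cu DW Cc Cc' Dc Hrho Hsg HE1 HE2 BW Bc Bc'. assert (CW : ct W) by apply HW.
  assert (Sabs : Rabs s = 1) by (destruct (e2_cases s Hs) as [-> | ->]; [apply Rabs_right; lra|unfold Rabs; destruct Rcase_abs; lra]).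
  set (Ws := fun x v => W (x - s * mexp mu al v)). assert (CWs : ct2 Ws) by (unfold Ws; ctac).
  assert (EWs : forall v, En P (fun x => Ws x v) <= (rho * mu) ^ 2 * E1).
  { intro v. unfold Ws. rewrite (En_shiftm P W); auto. } assert (Hrm : 0 < rho * mu) by pos.
  assert (A0 : forall v, 0 <= v <= V -> RI (fun x => Rabs (c x v * Ws x v)) 0 P <= / 2 * (rho * mu) * (E1 + E2)).
  { intros v Hv. letr; [apply (RI_abs_amgm P (fun x => c x v) (fun x => Ws x v) (rho * mu)); auto; ctac|]. assert (X := Bc v Hv).
    assert (rho * mu * En P (fun x => c x v) <= rho * mu * E2) by (apply Rmult_le_compat_l; [lra|exact X]).
    assert (/ (rho * mu) * En P (fun x => Ws x v) <= / (rho * mu) * ((rho * mu) ^ 2 * E1)).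
    { apply Rmult_le_compat_l; auto. left; apply Rinv_0_lt_compat; auto. }
    replace (/ (rho * mu) * ((rho * mu) ^ 2 * E1)) with (rho * mu * E1) in H0 by (field; lra). lra. }
  assert (A1 : forall v, 0 <= v <= V -> RI (fun x => Rabs (c' x v * Ws x v)) 0 P <= / 2 * (rho * mu * sg) * (E1 + E2)).
  { intros v Hv. assert (Ht : 0 < rho * mu / sg) by pos.
    letr; [apply (RI_abs_amgm P (fun x => c' x v) (fun x => Ws x v) (rho * mu / sg)); auto; ctac|]. assert (X := Bc' v Hv).
    assert (rho * mu / sg * En P (fun x => c' x v) <= rho * mu / sg * (sg ^ 2 * E2)) by (apply Rmult_le_compat_l; [lra|exact X]).
    assert (/ (rho * mu / sg) * En P (fun x => Ws x v) <= / (rho * mu / sg) * ((rho * mu) ^ 2 * E1)).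
    { apply Rmult_le_compat_l; auto. left; apply Rinv_0_lt_compat; auto. }
    replace (/ (rho * mu / sg) * ((rho * mu) ^ 2 * E1)) with (rho * mu * sg * E1) in H0 by (field; lra).
    replace (rho * mu / sg * (sg ^ 2 * E2)) with (rho * mu * sg * E2) in H by (field; lra). lra. }
  assert (Him : 0 < / (al * mu)) by pos. letr_with (RI (fun x => / (al * mu) * (Rabs (c x V * Ws x V) + Rabs (c x 0 * Ws x 0) +
    RI (fun v => Rabs (c' x v * Ws x v) + al * Rabs (c x v * Ws x v)) 0 V)) 0 P).
  - ri_le. intros x _.
    rewrite (shift_parts W u mu al s V x (c x) (c' x)); try lra; auto; [|apply ct2_row; auto|apply ct2_row; auto].
    rewrite Rabs_mult, Rabs_Ropp. unfold Rdiv. rewrite Rabs_mult, Sabs, Rmult_1_l, (Rabs_right (/ _)) by lra.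
    mul_l. apply Rabs_minus_le; [apply Rabs_minus_le|].
    + fold (Ws x V). replace (c x V * exp (- al * V) * Ws x V) with (exp (- al * V) * (c x V * Ws x V)) by ring.
      rewrite Rabs_mult. destruct (exp_neg_le1 al V ltac:(lra) ltac:(lra)) as [E3 E4]. rewrite Rabs_right by lra.
      rewrite <- (Rmult_1_l (Rabs _)) at 2. mul_r; auto.
    + fold (Ws x 0). lra.
    + letr; [apply RI_abs; [lra|ctac]|]. ri_le. intros v Hv. fold (Ws x v).
      replace ((c' x v - al * c x v) * exp (- al * v) * Ws x v) with (exp (- al * v) * (c' x v * Ws x v - al * (c x v * Ws x v))) by ring.
      rewrite Rabs_mult. destruct (exp_neg_le1 al v ltac:(lra) ltac:(lra)) as [E3 E4]. rewrite (Rabs_right (exp _)) by lra.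
      rewrite <- (Rmult_1_l (_ + _)). apply Rmult_le_compat; [lra|pos|auto|].
      apply Rabs_minus_le; [lra|]. rewrite Rabs_mult, Rabs_right; lra.
  - rewrite RI_scal, !RI_plus by ctac. rewrite (fubini (fun x v => Rabs (c' x v * Ws x v) + al * Rabs (c x v * Ws x v))) by (try lra; ctac).
    assert (X1 := A0 V ltac:(lra)). assert (X2 := A0 0 ltac:(lra)).
    set (Z := rho * mu * (E1 + E2)). assert (HZ : 0 <= Z) by (apply Rmult_le_pos; lra).
    assert (X3 : RI (fun v => RI (fun x => Rabs (c' x v * Ws x v) + al * Rabs (c x v * Ws x v)) 0 P) 0 V <= / 2 * sg * Z + al * (/ 2 * Z)).
    { letr_with (RI (fun _ => / 2 * sg * Z + al * (/ 2 * Z)) 0 V).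
      - ri_le. intros v Hv. rewrite RI_plus, RI_scal by ctac.
        assert (Y1 := A0 v Hv). assert (Y2 := A1 v Hv). apply Rplus_le_compat; [unfold Z; lra|]. mul_l. unfold Z; lra.
      - rewrite RI_const. assert (0 <= / 2 * sg * Z + al * (/ 2 * Z)).
        { assert (0 <= sg * Z) by pos. assert (0 <= al * Z) by pos. lra. } rewrite <- (Rmult_1_l (_ + _)) at 2. mul_r; lra. }
    replace (/ 2 * (rho * mu) * (E1 + E2)) with (/ 2 * Z) in X1, X2 by (unfold Z; ring).
    letr_with (/ (al * mu) * (Z + (/ 2 * sg * Z + al * (/ 2 * Z)))); [mul_l; lra|].
    replace (/ (al * mu) * (Z + (/ 2 * sg * Z + al * (/ 2 * Z)))) with (rho * (E1 + E2) * (/ al * (1 + / 2 * sg) + / 2)) by (unfold Z; field; lra).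
    replace (2 * rho * sg * (E1 + E2)) with (rho * (E1 + E2) * (2 * sg)) by ring. mul_l.
    assert (/ al <= 1) by (rewrite <- Rinv_1; apply Rinv_le_contravar; lra).
    assert (/ al * (1 + / 2 * sg) <= 1 * (1 + / 2 * sg)) by (mul_r; lra). lra.
Qed.

Definition dk P L F (k : nat) : R := En P (ds (dl L k) F).
Lemma dk_ge0 P L F k : 0 < P -> 0 < L -> cper P F -> 0 <= dk P L F k.
Proof. intros HP HL HF. apply En_ge0; auto. ctac. Qed.

(** Index 0 contains the subtraction of the unshifted average, so that the pieces add up to the
    centred factor; index [m >= 1] is the part [m] steps finer than the shift. *)
Definition piece (L al : R) (a : nat) (s : R) F (m : nat) (x v : R) : R :=
  match m with
  | O => pp (dl L a) F (x - s * mexp (dl L a) al v) - pp (dl L a) F x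
  | _ => qq (dl L (a + m)) F (x - s * mexp (dl L a) al v)
  end.
Definition piece' (L al : R) (a : nat) (s : R) F (m : nat) (x v : R) : R :=
  - (s * al * mexp (dl L a) al v) * match m with
  | O => pp' (dl L a) F (x - s * mexp (dl L a) al v)
  | _ => qq' (dl L (a + m)) F (x - s * mexp (dl L a) al v)
  end.
Lemma ct_piece L al a s F m : ct F -> ct2 (piece L al a s F m).
Proof. intro C. unfold piece. destruct m; ctac. Qed.
Lemma ct_piece' L al a s F m : ct F -> ct2 (piece' L al a s F m).
Proof. intro C. unfold piece'. destruct m; ctac. Qed.
#[export] Hint Resolve ct_piece ct_piece' : ctdb.
Lemma shm_d mu al s (x v : R) : is_derive (fun v => x - s * mexp mu al v) v (- (s * al * mexp mu al v)).
Proof. unfold mexp. auto_derive; auto; ring. Qed.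
Lemma piece_d L al a s F m (x v : R) : 0 < L -> ct F -> is_derive (piece L al a s F m x) v (piece' L al a s F m x v).
Proof.
  intros HL C. unfold piece, piece'. destruct m.
  - eapply D_eq; [apply D_minus; [|apply D_const]; apply (D_comp (pp (dl L a) F)); [apply pp_deriv; [apply dl_pos; auto|auto]|apply shm_d]|]. ring.
  - apply (D_comp (qq (dl L (a + S m)) F)); [apply qq_deriv; [apply dl_pos; auto|auto]|apply shm_d].
Qed.
Lemma mexp_b2 L al a v : 0 < L -> 1 <= al -> 0 <= v <= 1 -> mexp (dl L a) al v ^ 2 <= dl L a ^ 2 * exp al ^ 2.
Proof.
  intros HL Hal Hv. assert (D := dl_pos L a HL). rewrite <- Rpow_mult_distr. rewrite <- pow2_abs. apply pow_incr. split; [pos|].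
  apply (mexp_bound _ _ 1); lra.
Qed.
Lemma dl_rat L a m : 0 < L -> dl L a ^ 2 * / dl L (a + m) ^ 2 = (2 ^ m) ^ 2.
Proof. intro HL. rewrite dl_plus. assert (D := dl_pos L a HL). rewrite pow_inv in *. assert (0 < 2 ^ m) by pos. field. lra. Qed.
Lemma pow2_ge1 m : 1 <= 2 ^ m.
Proof. apply pow_R1_Rle; lra. Qed.
Lemma En_piece P L al a s F m v : 0 < P -> 0 < L -> 1 <= al -> s ^ 2 = 1 -> 0 <= v <= 1 -> cper P F ->
  En P (fun x => piece L al a s F m x v) <= exp al ^ 2 * dk P L F (a + m) /\
  En P (fun x => piece' L al a s F m x v) <= (al * exp al * 2 ^ m) ^ 2 * dk P L F (a + m).
Proof.
  intros HP HL Hal Hs Hv HF. assert (CF : ct F) by apply HF. assert (D := dl_pos L a HL). assert (Dm := dl_pos L (a + m) HL).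
  assert (B := mexp_b2 L al a v HL Hal Hv). assert (K := dk_ge0 P L F (a + m) HP HL HF). assert (E1 : 1 <= exp al ^ 2).
  { rewrite <- (pow1 2). apply pow_incr. split; [lra|]. rewrite <- exp_0. apply exp_le; lra. }
  set (y := s * mexp (dl L a) al v). assert (Hy : y ^ 2 <= dl L a ^ 2 * exp al ^ 2) by (unfold y; rewrite Rpow_mult_distr, Hs; lra).
  split.
  - unfold piece. destruct m.
    + fold y. rewrite Nat.add_0_r in *. unfold dk in *.
      letr; [apply (En_diff P (pp (dl L a) F) (pp' (dl L a) F) (- y)); auto with cp; intro; apply pp_deriv; auto|].
      rewrite En_pp' by auto. replace ((- y) ^ 2) with (y ^ 2) by ring.
      letr_with (dl L a ^ 2 * exp al ^ 2 * (/ dl L a ^ 2 * En P (ds (dl L a) F))).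
      * apply Rmult_le_compat_r; auto. apply Rmult_le_pos; auto. left; apply Rinv_0_lt_compat, pow_lt; auto.
      * right. field. lra.
    + fold y. rewrite (En_shiftm P (qq (dl L (a + S m)) F)) by auto with cp.
      letr; [apply En_qq; auto|]. fold (dk P L F (a + S m)). assert (1 * dk P L F (a + S m) <= exp al ^ 2 * dk P L F (a + S m)) by (mul_r; auto). lra.
  - unfold piece'. fold y. assert (Q : forall H, cper P H -> En P H <= / dl L (a + m) ^ 2 * dk P L F (a + m) ->
      En P (fun x => - (s * al * mexp (dl L a) al v) * H (x - y)) <= (al * exp al * 2 ^ m) ^ 2 * dk P L F (a + m)).
    { intros H HH BH. rewrite (En_scal P (- (s * al * mexp (dl L a) al v)) (fun x => H (x - y))) by (assert (CH : ct H) by apply HH; ctac).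
      rewrite (En_shiftm P H) by auto. replace ((- (s * al * mexp (dl L a) al v)) ^ 2) with (al ^ 2 * y ^ 2) by (unfold y; ring).
      assert (HE := En_ge0 P H HP (proj1 HH)).
      letr_with (al ^ 2 * (dl L a ^ 2 * exp al ^ 2) * (/ dl L (a + m) ^ 2 * dk P L F (a + m))).
      - apply Rmult_le_compat; auto; [apply Rmult_le_pos; apply pow2_ge_0|]. mul_l; auto.
      - right. transitivity (al ^ 2 * exp al ^ 2 * (dl L a ^ 2 * / dl L (a + m) ^ 2) * dk P L F (a + m)); [ring|]. rewrite dl_rat by auto. ring. }
    destruct m.
    + apply (Q (pp' (dl L a) F)); auto with cp. rewrite Nat.add_0_r. rewrite En_pp' by auto. unfold dk. lra.
    + apply (Q (qq' (dl L (a + S m)) F)); auto with cp. apply En_qq'; auto.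
Qed.

Lemma qp_piece P L F a m : 0 < P -> 0 < L -> cper P F -> En P (qp (dl L (a + m)) F) <= ((/ 2) ^ m * dl L a) ^ 2 * dk P L F (a + m).
Proof.
  intros HP HL HF. assert (Dm := dl_pos L (a + m) HL). letr; [apply En_qp; auto|].
  rewrite Rmult_comm with (r1 := (/ 2) ^ m), <- dl_plus. fold (dk P L F (a + m)). assert (K := dk_ge0 P L F (a + m) HP HL HF).
  mul_r; auto. assert (0 <= dl L (a + m) ^ 2) by pos. lra.
Qed.

(** The gain is the size of [qp] relative to the shift of [F]; the loss [2^n] is the [v]-derivative
    of the piece of [G], which is [n] steps finer than its own shift. *)
Lemma bilin_parts P L al be a b s1 s2 V F G m n : 0 < P -> 0 < L -> 1 <= al -> 1 <= be -> s1 ^ 2 = 1 -> s2 ^ 2 = 1 -> 0 <= V <= 1 ->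
  cper P F -> cper P G ->
  RI (fun x => Rabs (RI (fun v => piece L be b s2 G n x v * piece L al a s1 F (S m) x v) 0 V)) 0 P <=
  2 * be * exp be ^ 3 * (/ 2) ^ S m * 2 ^ n * (dk P L F (a + S m) + dk P L G (b + n)).
Proof.
  intros HP HL Hal Hbe Hs1 Hs2 HV HF HG. assert (CF : ct F) by apply HF. assert (CG : ct G) by apply HG.
  assert (D1 := dk_ge0 P L F (a + S m) HP HL HF). assert (D2 := dk_ge0 P L G (b + n) HP HL HG).
  assert (E1 : 1 <= exp be) by (rewrite <- exp_0; apply exp_le; lra). assert (T := pow2_ge1 n).
  assert (E2 : 1 <= exp be ^ 2) by (rewrite <- (pow1 2); apply pow_incr; lra).
  assert (E3 : exp be <= exp be * 2 ^ n) by (rewrite <- (Rmult_1_r (exp be)) at 1; mul_l; lra).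
  assert (E4 : 1 <= be * (exp be * 2 ^ n)) by (rewrite <- (Rmult_1_l 1); apply Rmult_le_compat; lra).
  letr; [apply (parts_bound P (dl L a) al s1 V (qp (dl L (a + S m)) F) (qq (dl L (a + S m)) F) (piece L be b s2 G n)
    (piece' L be b s2 G n) ((/ 2) ^ S m) (be * (exp be * 2 ^ n)) (dk P L F (a + S m)) (exp be ^ 2 * dk P L G (b + n))); auto|].
  - apply dl_pos; auto.
  - auto with cp.
  - ctac.
  - intro x. apply qp_deriv; auto. apply dl_pos; auto.
  - apply ct_piece; auto.
  - apply ct_piece'; auto.
  - intros x v _. apply piece_d; auto.
  - apply pow_half_pos.
  - apply Rmult_le_pos; lra.
  - apply qp_piece; auto.
  - intros v Hv. apply (proj1 (En_piece P L be b s2 G n v HP HL Hbe Hs2 ltac:(lra) HG)).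
  - intros v Hv. letr; [apply (proj2 (En_piece P L be b s2 G n v HP HL Hbe Hs2 ltac:(lra) HG))|].
    rewrite <- Rmult_assoc. mul_r; auto. replace (be * (exp be * 2 ^ n)) with (be * exp be * 2 ^ n) by ring.
    rewrite <- (Rmult_1_r ((be * exp be * 2 ^ n) ^ 2)) at 1. mul_l; auto.
  - replace (2 * be * exp be ^ 3 * (/ 2) ^ S m * 2 ^ n * (dk P L F (a + S m) + dk P L G (b + n))) with
      (2 * (/ 2) ^ S m * (be * (exp be * 2 ^ n)) * (exp be ^ 2 * (dk P L F (a + S m) + dk P L G (b + n)))) by ring.
    apply Rmult_le_compat_l.
    + apply Rmult_le_pos; [|lra]. assert (X := pow_half_pos (S m)). lra.
    + assert (1 * dk P L F (a + S m) <= exp be ^ 2 * dk P L F (a + S m)) by (mul_r; auto). lra.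
Qed.

Lemma bilin_00 P L al be a b s1 s2 V F G m n : 0 < P -> 0 < L -> 1 <= al -> 1 <= be -> s1 ^ 2 = 1 -> s2 ^ 2 = 1 -> 0 <= V <= 1 ->
  cper P F -> cper P G ->
  RI (fun x => Rabs (RI (fun v => piece L al a s1 F m x v * piece L be b s2 G n x v) 0 V)) 0 P <=
  (exp al ^ 2 + exp be ^ 2) * (dk P L F (a + m) + dk P L G (b + n)).
Proof.
  intros HP HL Hal Hbe Hs1 Hs2 HV HF HG. assert (CF : ct F) by apply HF. assert (CG : ct G) by apply HG.
  assert (D1 := dk_ge0 P L F (a + m) HP HL HF). assert (D2 := dk_ge0 P L G (b + n) HP HL HG).
  letr_with (RI (fun x => RI (fun v => Rabs (piece L al a s1 F m x v * piece L be b s2 G n x v)) 0 V) 0 P).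
  - ri_le. intros x _. apply RI_abs; [lra|ctac].
  - rewrite (fubini (fun x v => Rabs (piece L al a s1 F m x v * piece L be b s2 G n x v))) by (try lra; ctac).
    assert (A1 := pow2_ge_0 (exp al)). assert (A2 := pow2_ge_0 (exp be)). assert (Z1 : 0 <= exp al ^ 2 * dk P L F (a + m)) by pos.
    assert (Z2 : 0 <= exp be ^ 2 * dk P L G (b + n)) by pos. assert (Z3 : 0 <= exp be ^ 2 * dk P L F (a + m)) by pos.
    assert (Z4 : 0 <= exp al ^ 2 * dk P L G (b + n)) by pos.
    letr_with (RI (fun _ => exp al ^ 2 * dk P L F (a + m) + exp be ^ 2 * dk P L G (b + n)) 0 V).
    + ri_le. intros v Hv.
      letr; [apply (RI_abs_amgm P (fun x => piece L al a s1 F m x v) (fun x => piece L be b s2 G n x v) 1); try lra; ctac|].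
      destruct (En_piece P L al a s1 F m v) as [B1 _]; auto; try lra. destruct (En_piece P L be b s2 G n v) as [B2 _]; auto; try lra.
    + rewrite RI_const. set (Z := exp al ^ 2 * dk P L F (a + m) + exp be ^ 2 * dk P L G (b + n)).
      letr_with (1 * Z); [apply Rmult_le_compat_r; unfold Z; lra|unfold Z; lra].
Qed.
End Pieces.
Import Pieces.

(** * Exponential decay for pairs of pieces *)

Module PieceBound.
Implicit Types f g F G u W w h : R -> R.

(** [2^(-1/144)], where [144 = 3 * 48]: for [q = rg^(3 n)] one has [q^48 = 2^-n], the smallness
    required of the primitive, and [q <= rg^(m + n)] as long as [m <= 2 n]. *)
Definition rg : R := exp (- (ln 2 / 144)).
Lemma ln2_bd : 0 < ln 2 <= 1.
Proof.
  split; [rewrite <- ln_1; apply ln_increasing; lra|].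
  rewrite <- (ln_exp 1). apply ln_le; [lra|]. assert (X := exp_ineq1_le 1). lra.
Qed.
Lemma rg_bd : 0 < rg < 1.
Proof. assert (X := ln2_bd). unfold rg. split; [pos|]. rewrite <- exp_0. apply exp_increasing. lra. Qed.
Lemma exp_nat x n : exp x ^ n = exp (INR n * x).
Proof.
  induction n; [simpl; rewrite Rmult_0_l, exp_0; auto|]. rewrite S_INR. simpl pow. rewrite IHn, <- exp_plus. f_equal; ring.
Qed.
Lemma rg_half n : rg ^ (144 * n) = (/ 2) ^ n.
Proof.
  rewrite pow_mult. f_equal. unfold rg. rewrite exp_nat. replace (INR 144 * - (ln 2 / 144)) with (- ln 2) by (simpl INR; field).
  rewrite exp_Ropp, exp_ln; lra.
Qed.
Lemma rg_mono i j : (i <= j)%nat -> rg ^ j <= rg ^ i.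
Proof.
  intro H. replace j with (i + (j - i))%nat by lia. rewrite pow_add. assert (X := rg_bd).
  rewrite <- (Rmult_1_r (rg ^ i)) at 2. mul_l. rewrite <- (pow1 (j - i)). apply pow_incr; lra.
Qed.

Section Term.
Context (al be : R) (Hal : 1 <= al) (Hbe : 1 <= be) (Hab : al <> be).
Definition TN P L a b s1 s2 F G m n : R :=
  RI (fun x => Rabs (RI (fun v => piece L al a s1 F m x v * piece L be b s2 G n x v) 0 (ln 2))) 0 P.

(** For [m > 2 n] integration by parts gives [2^-(m-n)], below [rg^(m+n)]; for [m = 0 < n] it is
    used with the roles of [F] and [G] exchanged; [1 <= m <= 2 n] is the case of [hard]. The gap
    [N0] makes the ratio [2^-(b-a)] of the shifts at most [nu0]. *)
Lemma term_bound : exists C N0, 0 <= C /\ forall P L a b s1 s2 F G m n, 0 < P -> 0 < L -> s1 ^ 2 = 1 -> s2 ^ 2 = 1 ->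
  cper P F -> cper P G -> (a + N0 <= b)%nat ->
  TN P L a b s1 s2 F G m n <= C * rg ^ (m + n) * (dk P L F (a + m) + dk P L G (b + n)).
Proof.
  destruct (hard al be ltac:(lra) ltac:(lra) Hab Hal) as [C [nu0 [HC [Hnu0 H]]]]. destruct (INR_unbounded (/ nu0)) as [N0 HN0].
  set (C1 := exp al ^ 2 + exp be ^ 2). set (C2 := 2 * be * exp be ^ 3). set (C3 := 2 * al * exp al ^ 3).
  assert (HC1 : 0 <= C1) by (unfold C1; assert (A := pow2_ge_0 (exp al)); assert (B := pow2_ge_0 (exp be)); lra).
  assert (P3 : forall x, 0 <= exp x ^ 3) by (intro; apply pow_le; left; apply exp_pos).
  assert (HC2 : 0 <= C2) by (unfold C2; apply Rmult_le_pos; [lra|auto]).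
  assert (HC3 : 0 <= C3) by (unfold C3; apply Rmult_le_pos; [lra|auto]). exists (C1 + C2 + C3 + 2 * C), N0. split; [lra|].
  intros P L a b s1 s2 F G m n HP HL Hs1 Hs2 HF HG Hb. assert (CG : ct G) by apply HG. assert (X := ln2_bd). assert (HR := rg_bd).
  assert (D1 := dk_ge0 P L F (a + m) HP HL HF). assert (D2 := dk_ge0 P L G (b + n) HP HL HG).
  set (dd := dk P L F (a + m) + dk P L G (b + n)) in *. assert (Hdd : 0 <= dd) by (unfold dd; lra).
  assert (Fin : forall c, 0 <= c <= C1 + C2 + C3 + 2 * C -> TN P L a b s1 s2 F G m n <= c * rg ^ (m + n) * dd ->
    TN P L a b s1 s2 F G m n <= (C1 + C2 + C3 + 2 * C) * rg ^ (m + n) * dd).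
  { intros c Hc Hl. letr; [apply Hl|]. mul_r; auto. mul_r; lra. } destruct m as [|m].
  - destruct n as [|n].
    + apply (Fin C1); [lra|]. simpl (rg ^ (0 + 0)). rewrite Rmult_1_r. apply bilin_00; auto; lra.
    + apply (Fin C3); [lra|]. assert (B := bilin_parts P L be al b a s2 s1 (ln 2) G F n O HP HL Hbe Hal Hs2 Hs1 ltac:(lra) HG HF).
      letr; [apply B|]. fold C3. replace (dk P L G (b + S n) + dk P L F (a + 0)) with dd by (unfold dd; ring).
      mul_r; auto. simpl (2 ^ 0). rewrite Rmult_1_r. mul_l; auto. rewrite <- rg_half. apply rg_mono. lia.
  - destruct (le_lt_dec (S m) (2 * n)) as [Hmn|Hmn].
    + destruct n as [|n]; [lia|]. apply (Fin (2 * C)); [lra|]. set (mm := S m) in *. set (nn := S n) in *.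
      assert (Hq := pow_le1 rg (3 * nn) ltac:(lra)). assert (D := dl_pos L b HL).
      assert (EN : INR (2 ^ (b - a)) = 2 ^ (b - a)) by (rewrite pow_INR; simpl; auto).
      assert (EM : INR (2 ^ (b - a)) * dl L b = dl L a).
      { rewrite EN. replace b with (a + (b - a))%nat at 2 by lia. rewrite dl_plus. assert (0 < 2 ^ (b - a)) by pos.
        rewrite pow_inv. field. lra. } assert (Hn2 : (1 <= 2 ^ (b - a))%nat) by (apply Nat.neq_0_lt_0, Nat.pow_nonzero; lia).
      assert (Hnu : / INR (2 ^ (b - a)) <= nu0).
      { rewrite <- (Rinv_inv nu0). apply Rinv_le_contravar; [pos|].
        letr_with (INR N0); [lra|]. apply le_INR. apply Nat.le_trans with (b - a)%nat; [lia|].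
        apply Nat.lt_le_incl, Nat.pow_gt_lin_r; lia. }
      (* [M = 2^nn] matches the primitive [qp], which is smaller than the shift [dl L b] by [2^-nn]:
         the term [(M / nu)^2 * En P W] is then at most [dk] again. *)
      assert (Hh := H (2 ^ (b - a))%nat s1 s2 (dl L b) (rg ^ (3 * nn)) (2 ^ nn) P (qq (dl L (a + mm)) F) (qq (dl L (b + nn)) G)
        (qq' (dl L (b + nn)) G) (qp (dl L (b + nn)) G) Hn2 Hnu Hs1 Hs2 D Hq (pow2_ge1 nn)).
      assert (HM : / 2 ^ nn <= (rg ^ (3 * nn)) ^ 48).
      { rewrite <- pow_inv, <- rg_half, <- pow_mult. right. f_equal. lia. }
      assert (DD := dl_pos L (b + nn) HL). assert (DA := dl_pos L (a + mm) HL).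
      specialize (Hh HM HP ltac:(auto with cp) ltac:(auto with cp) ltac:(ctac) ltac:(auto with cp)
        (fun x => qp_deriv (dl L (b + nn)) G x DD CG) (fun x => qq_deriv (dl L (b + nn)) G x DD CG)).
      rewrite EM in Hh. unfold TN, piece. change (S m) with mm. change (S n) with nn. letr; [apply Hh|].
      assert (Q1 := En_qq P (dl L (a + mm)) F HP DA HF). assert (Q2 := En_qq P (dl L (b + nn)) G HP DD HG).
      assert (Q3 := qp_piece P L G b nn HP HL HG). fold (dk P L F (a + mm)) in Q1. fold (dk P L G (b + nn)) in Q2.
      assert (Q4 : (2 ^ nn / dl L b) ^ 2 * En P (qp (dl L (b + nn)) G) <= dk P L G (b + nn)).
      { letr_with ((2 ^ nn / dl L b) ^ 2 * (((/ 2) ^ nn * dl L b) ^ 2 * dk P L G (b + nn))).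
        - apply Rmult_le_compat_l; auto. apply pow2_ge_0.
        - right. assert (0 < 2 ^ nn) by pos. rewrite pow_inv. field. lra. }
      replace (2 * C * rg ^ (mm + nn) * dd) with (C * rg ^ (mm + nn) * (2 * dd)) by ring. apply Rmult_le_compat; [pos| | |].
      * assert (U1 := En_ge0 P (qq (dl L (a + mm)) F) HP ltac:(ctac)). assert (U2 := En_ge0 P (qq (dl L (b + nn)) G) HP ltac:(ctac)).
        assert (U3 := En_ge0 P (qp (dl L (b + nn)) G) HP ltac:(ctac)). assert (U4 := pow2_ge_0 (2 ^ nn / dl L b)).
        assert (0 <= (2 ^ nn / dl L b) ^ 2 * En P (qp (dl L (b + nn)) G)) by pos. lra.
      * mul_l; auto. apply rg_mono. lia.
      * unfold dd. lra.
    + apply (Fin C2); [lra|]. assert (B := bilin_parts P L al be a b s1 s2 (ln 2) F G m n HP HL Hal Hbe Hs1 Hs2 ltac:(lra) HF HG).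
      unfold TN. rewrite (RI_ext _ (fun x => Rabs (RI (fun v => piece L be b s2 G n x v * piece L al a s1 F (S m) x v) 0 (ln 2)))).
      2:{ intro x. apply (f_equal Rabs). apply RI_ext; intro; ring. } letr; [apply B|]. fold C2. fold dd. mul_r; auto.
      rewrite Rmult_assoc. mul_l; auto.
      replace (S m) with ((S m - n) + n)%nat at 1 by lia. rewrite pow_add, Rmult_assoc, <- Rpow_mult_distr.
      replace (/ 2 * 2) with 1 by field. rewrite pow1, Rmult_1_r, <- rg_half. apply rg_mono. lia.
Qed.
End Term.

Lemma bs_first (f : nat -> R) n : bs f (S n) = f O + bs (fun i => f (S i)) n.
Proof. induction n; [simpl; ring|]. change (bs f (S (S n))) with (bs f (S n) + f (S n)). rewrite IHn. simpl. ring. Qed.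

Lemma piece_sum L al a s F K x v : (a <= K)%nat ->
  pp (dl L K) F (x - s * mexp (dl L a) al v) - pp (dl L a) F x = bs (fun m => piece L al a s F m x v) (S (K - a)).
Proof.
  intro H. rewrite bs_first. unfold piece at 1.
  rewrite (bs_ext (fun i => piece L al a s F (S i) x v) (fun i => qq (dl L (a + 1 + i)) F (x - s * mexp (dl L a) al v))).
  - rewrite <- pp_diff. replace (a + (K - a))%nat with K by lia. ring.
  - intros i _. unfold piece. replace (a + S i)%nat with (a + 1 + i)%nat by lia. auto.
Qed.

Lemma bs_rg n : bs (fun m => rg ^ m) n <= / (1 - rg).
Proof.
  assert (X := rg_bd). assert (E : bs (fun m => rg ^ m) n = (1 - rg ^ n) / (1 - rg)).
  { induction n; [simpl; field; lra|]. simpl bs. rewrite IHn. simpl. field. lra. }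
  rewrite E. unfold Rdiv. rewrite <- (Rmult_1_l (/ (1 - rg))) at 2. mul_r. assert (0 < rg ^ n) by pos. lra.
Qed.

Lemma dk_sum P L F (a : nat -> nat) m n : 0 < P -> 0 < L -> cper P F -> (forall l, (a l < a (S l))%nat) ->
  bs (fun l => dk P L F (a l + m)) n <= 4 * En P F.
Proof.
  intros HP HL HF Ha. letr; [apply (bs_sub (fun k => dk P L F k) (fun l => (a l + m)%nat))|apply ds_sum; auto].
  - intros; apply dk_ge0; auto.
  - intro j; assert (X := Ha j); lia.
Qed.
End PieceBound.
Import PieceBound.

(** * Summation over the blocks on one side of the scale *)

Module OneSide.
Implicit Types f g F G u W w h : R -> R.

Lemma bs_mult (p q : nat -> R) m n : bs p m * bs q n = bs (fun i => bs (fun j => p i * q j) n) m.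
Proof. rewrite Rmult_comm, <- bs_scal. apply bs_ext; intros i _. rewrite Rmult_comm, <- bs_scal. apply bs_ext; intros; ring. Qed.

Definition cent (L al be : R) (a b K : nat) (s1 s2 : R) F G (x : R) : R :=
  RI (fun v => (pp (dl L K) F (x - s1 * mexp (dl L a) al v) - pp (dl L a) F x) *
    (pp (dl L K) G (x - s2 * mexp (dl L b) be v) - pp (dl L b) G x)) 0 (ln 2).

Lemma ct_cent L al be a b K s1 s2 F G : ct F -> ct G -> ct (cent L al be a b K s1 s2 F G).
Proof. intros CF CG. unfold cent. ctac. Qed.

Lemma cent_bound P L al be a b K s1 s2 F G : 0 < P -> ct F -> ct G -> (a <= K)%nat -> (b <= K)%nat ->
  RI (fun x => Rabs (cent L al be a b K s1 s2 F G x)) 0 P <=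
  bs (fun m => bs (fun n => TN al be P L a b s1 s2 F G m n) (S (K - b))) (S (K - a)).
Proof.
  intros HP CF CG Ha Hb. assert (C1 : forall m, ct2 (piece L al a s1 F m)) by (intro; apply ct_piece; auto).
  assert (C2 : forall n, ct2 (piece L be b s2 G n)) by (intro; apply ct_piece; auto).
  assert (C3 : forall m n, ct2 (fun x v => piece L al a s1 F m x v * piece L be b s2 G n x v)).
  { intros m n. ctac. } set (T := fun m n x => RI (fun v => piece L al a s1 F m x v * piece L be b s2 G n x v) 0 (ln 2)).
  assert (CT : forall m n, ct (T m n)) by (intros m n; assert (Y := C1 m); assert (Z := C2 n); unfold T; ctac).
  assert (CTa : forall m n, ct (fun x => Rabs (T m n x))) by (intros m n; assert (Y := CT m n); ctac).
  assert (E : forall x, cent L al be a b K s1 s2 F G x = bs (fun m => bs (fun n => T m n x) (S (K - b))) (S (K - a))).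
  { intro x. unfold cent.
    rewrite (RI_ext _ (fun v => bs (fun m => bs (fun n => piece L al a s1 F m x v * piece L be b s2 G n x v) (S (K - b))) (S (K - a)))).
    2:{ intro v. rewrite !piece_sum by auto. apply bs_mult. }
    rewrite (RI_bs (fun m v => bs (fun n => piece L al a s1 F m x v * piece L be b s2 G n x v) (S (K - b)))).
    - apply bs_ext; intros m _. rewrite (RI_bs (fun n v => piece L al a s1 F m x v * piece L be b s2 G n x v)); auto.
      intro n. apply (ct2_row _ x (C3 m n)).
    - intro m. apply (ct_bs (fun n v => piece L al a s1 F m x v * piece L be b s2 G n x v)). intro n. apply (ct2_row _ x (C3 m n)). }
  assert (CB : ct (fun x => bs (fun m => bs (fun n => Rabs (T m n x)) (S (K - b))) (S (K - a)))).
  { apply (ct_bs (fun m x => bs (fun n => Rabs (T m n x)) (S (K - b)))). intro m. apply (ct_bs (fun n x => Rabs (T m n x))); auto. }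
  assert (CC := ct_cent L al be a b K s1 s2 F G CF CG).
  letr; [apply (RI_le _ (fun x => bs (fun m => bs (fun n => Rabs (T m n x)) (S (K - b))) (S (K - a)))); [lra|ctac|auto|]|].
  - intros x _. rewrite E. letr; [apply bs_abs|]. apply bs_le; intros m _. apply bs_abs.
  - rewrite (RI_bs (fun m x => bs (fun n => Rabs (T m n x)) (S (K - b)))).
    + apply bs_le; intros m _. rewrite (RI_bs (fun n x => Rabs (T m n x))); [|auto]. apply bs_le; intros n _. apply Rle_refl.
    + intro m. apply (ct_bs (fun n x => Rabs (T m n x))); auto.
Qed.

(** For a fixed pair [(m, j)] of depths the sum over the blocks is a square-function sum, at most
    [4 (En P F + En P G)]; the decay [rg^(m+j)] then makes the sum over all pairs converge,
    uniformly in [K]. *)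
Lemma cent_sum al be : 1 <= al -> 1 <= be -> al <> be -> exists C N0, 0 <= C /\
  forall P L s1 s2 F G (a b : nat -> nat) K n, 0 < P -> 0 < L -> s1 ^ 2 = 1 -> s2 ^ 2 = 1 -> cper P F -> cper P G ->
  (forall l, (a l < a (S l))%nat) -> (forall l, (b l < b (S l))%nat) ->
  (forall l, (l < n)%nat -> (a l + N0 <= b l)%nat /\ (b l <= K)%nat) ->
  bs (fun l => RI (fun x => Rabs (cent L al be (a l) (b l) K s1 s2 F G x)) 0 P) n <= C * (En P F + En P G).
Proof.
  intros Hal Hbe Hab. destruct (term_bound al be Hal Hbe Hab) as [C [N0 [HC H]]].
  assert (HR := rg_bd). set (q := / (1 - rg)). assert (Hq : 0 < q) by (apply Rinv_0_lt_compat; lra).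
  exists (C * q * q * 4), N0. split; [pos|]. intros P L s1 s2 F G a b K n HP HL Hs1 Hs2 HF HG Ha Hb HK.
  assert (CF : ct F) by apply HF. assert (CG : ct G) by apply HG.
  assert (D1 : forall k, 0 <= dk P L F k) by (intro; apply dk_ge0; auto). assert (D2 : forall k, 0 <= dk P L G k) by (intro; apply dk_ge0; auto).
  assert (PR : forall k, 0 <= rg ^ k) by (intro; apply pow_le; lra).
  set (t := fun m j l => C * (rg ^ m * rg ^ j) * (dk P L F (a l + m) + dk P L G (b l + j))).
  assert (Ht : forall m j l, 0 <= t m j l).
  { intros m j l. unfold t. assert (A := D1 (a l + m)%nat). assert (B := D2 (b l + j)%nat). apply Rmult_le_pos; [|lra]. apply Rmult_le_pos; auto. apply Rmult_le_pos; auto. }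
  letr_with (bs (fun l => bs (fun m => bs (fun j => t m j l) (S K)) (S K)) n).
  - apply bs_le; intros l Hl. destruct (HK l Hl) as [K1 K2]. letr; [apply cent_bound; auto; lia|].
    letr_with (bs (fun m => bs (fun j => t m j l) (S K)) (S (K - a l))).
    + apply bs_le; intros m _. letr_with (bs (fun j => t m j l) (S (K - b l))).
      * apply bs_le; intros j _. unfold t. rewrite <- pow_add. apply H; auto.
      * apply bs_mono_n; [lia|auto].
    + apply bs_mono_n; [lia|]. intro m. apply bs_ge0; auto.
  - rewrite bs_swap. letr_with (bs (fun m => bs (fun j => rg ^ m * rg ^ j * (C * (4 * (En P F + En P G)))) (S K)) (S K)).
    + apply bs_le; intros m _. rewrite bs_swap. apply bs_le; intros j _. unfold t. rewrite bs_scal, bs_plus.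
      assert (X1 := dk_sum P L F a m n HP HL HF Ha). assert (X2 := dk_sum P L G b j n HP HL HG Hb).
      replace (rg ^ m * rg ^ j * (C * (4 * (En P F + En P G)))) with (C * (rg ^ m * rg ^ j) * (4 * (En P F + En P G))) by ring.
      apply Rmult_le_compat_l; [|lra]. apply Rmult_le_pos; auto. apply Rmult_le_pos; auto.
    + set (Z := C * (4 * (En P F + En P G))).
      assert (HZ : 0 <= Z). { unfold Z. assert (A := En_ge0 P F HP CF). assert (B := En_ge0 P G HP CG). apply Rmult_le_pos; lra. }
      rewrite (bs_ext _ (fun m => (Z * bs (fun j => rg ^ j) (S K)) * rg ^ m)).
      * rewrite bs_scal. assert (B := bs_rg (S K)). assert (B0 : 0 <= bs (fun j => rg ^ j) (S K)) by (apply bs_ge0; auto). fold q in B.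
        set (S1 := bs (fun j => rg ^ j) (S K)) in *. letr_with (Z * q * q); [|unfold Z; right; ring].
        apply Rmult_le_compat; auto; [pos|]. mul_l; auto.
      * intros m _. transitivity (bs (fun j => (rg ^ m * Z) * rg ^ j) (S K)); [apply bs_ext; intros; ring|]. rewrite (bs_scal (rg ^ m * Z) (fun j => rg ^ j)). ring.
Qed.

(** Positive minus negative [t] in one block; [e1] and [ep] are the signs of the two shifts for
    negative [t], one being -1 and the other [(-1)^d]. *)
Definition blk (L al be : R) (a b K : nat) (e1 ep : R) F G (x : R) : R :=
  RI (fun v => pp (dl L K) F (x - mexp (dl L a) al v) * pp (dl L K) G (x - mexp (dl L b) be v) -
    pp (dl L K) F (x - e1 * mexp (dl L a) al v) * pp (dl L K) G (x - ep * mexp (dl L b) be v)) 0 (ln 2).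
Lemma ct_blk L al be a b K e1 ep F G : ct F -> ct G -> ct (blk L al be a b K e1 ep F G).
Proof. intros CF CG. unfold blk. ctac. Qed.

(** In the difference of the two centred products the term with both averages cancels. A single
    average meets a Hilbert-transform block if the other shift changes sign, and 0 otherwise; this
    is the meaning of [(1 - e1) / 2] and [(1 - ep) / 2]. *)
Lemma blk_split L al be a b K e1 ep F G x : e1 = 1 \/ e1 = -1 -> ep = 1 \/ ep = -1 -> ct F -> ct G ->
  blk L al be a b K e1 ep F G x = cent L al be a b K 1 1 F G x - cent L al be a b K e1 ep F G x +
    ((1 - e1) / 2 * (Ph L al (ln 2) a (pp (dl L K) F) x * pp (dl L b) G x) + (1 - ep) / 2 * (pp (dl L a) F x * Ph L be (ln 2) b (pp (dl L K) G) x)).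
Proof.
  intros He1 Hep CF CG. unfold blk, cent, Ph, sm.
  assert (Cp : ct (pp (dl L K) F)) by ctac. assert (Cq : ct (pp (dl L K) G)) by ctac.
  generalize dependent (pp (dl L K) F). generalize dependent (pp (dl L K) G). intros q Cq p Cp.
  generalize (pp (dl L a) F x) (pp (dl L b) G x). intros p0 q0.
  rewrite (Rmult_comm (RI _ 0 (ln 2)) q0), <- !RI_scal, <- RI_minus, <- !RI_plus by ctac. apply RI_ext; intro v.
  destruct He1 as [-> | ->]; destruct Hep as [-> | ->];
  replace (x - 1 * mexp (dl L a) al v) with (x - mexp (dl L a) al v) by ring;
  replace (x - -1 * mexp (dl L a) al v) with (x + mexp (dl L a) al v) by ring;
  replace (x - 1 * mexp (dl L b) be v) with (x - mexp (dl L b) be v) by ring;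
  replace (x - -1 * mexp (dl L b) be v) with (x + mexp (dl L b) be v) by ring; field.
Qed.

Lemma RI_lin4 (u1 u2 u3 u4 : R -> R) h j k a b : ct u1 -> ct u2 -> ct u3 -> ct u4 -> ct h ->
  RI (fun x => (u1 x - u2 x + (j * u3 x + k * u4 x)) * h x) a b = RI (fun x => u1 x * h x) a b - RI (fun x => u2 x * h x) a b +
  (j * RI (fun x => u3 x * h x) a b + k * RI (fun x => u4 x * h x) a b).
Proof. intros. rewrite <- !RI_scal, <- RI_minus, <- !RI_plus by ctac. apply RI_ext; intro; ring. Qed.

(** The bounded function [h] dualises the [L^1] norm. The centred terms are summed in [L^1] block by
    block, whereas the other two kinds exploit cancellation between blocks and must be paired with
    [h] as whole sums. *)
Theorem side al be (A B : nat) : 1 <= al -> 1 <= be -> al <> be -> (1 <= A)%nat -> (1 <= B)%nat -> exists C N0, 0 <= C /\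
  forall P L e1 ep F G h (a b : nat -> nat) K n, 0 < P -> 0 < L -> e1 = 1 \/ e1 = -1 -> ep = 1 \/ ep = -1 -> cper P F -> cper P G -> cper P h ->
  (forall x, Rabs (h x) <= 1) -> (forall l, a (S l) = (a l + A)%nat) -> (forall l, b (S l) = (b l + B)%nat) ->
  (forall l, (l < n)%nat -> (a l + N0 <= b l)%nat /\ (a (S l) <= b l)%nat /\ (b l <= K)%nat) ->
  Rabs (RI (fun x => h x * bs (fun l => blk L al be (a l) (b l) K e1 ep F G x) n) 0 P) <= C * (En P F + En P G).
Proof.
  intros Hal Hbe Hab HA HB. destruct (cent_sum al be Hal Hbe Hab) as [C [N0 [HC H]]].
  set (C1 := 100000 * CU al * INR B ^ 2). set (C2 := 100000 * CU be * (INR A ^ 2 + INR B)).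
  assert (HC1 : 0 <= C1) by (unfold C1; assert (X := CU_pos al); apply Rmult_le_pos; [lra|pos]). assert (HC2 : 0 <= C2).
  { unfold C2; assert (X := CU_pos be); apply Rmult_le_pos; [lra|]. assert (Y := pow2_ge_0 (INR A)). assert (Z := pos_INR B). lra. }
  exists (2 * C + C1 + C2), N0. split; [lra|]. intros P L e1 ep F G h a b K n HP HL He1 Hep HF HG Hh H1 Ea Eb Hl.
  assert (CF : ct F) by apply HF. assert (CG : ct G) by apply HG. assert (Ch : ct h) by apply Hh. assert (X := ln2_bd).
  assert (Ha := step_mono a A HA Ea). assert (Hb := step_mono b B HB Eb).
  set (c1 := fun l => cent L al be (a l) (b l) K 1 1 F G). set (c2 := fun l => cent L al be (a l) (b l) K e1 ep F G).
  set (p1 := fun l x => Ph L al (ln 2) (a l) (pp (dl L K) F) x * pp (dl L (b l)) G x).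
  set (p2 := fun l x => pp (dl L (a l)) F x * Ph L be (ln 2) (b l) (pp (dl L K) G) x).
  assert (K1 : forall l, ct (c1 l)) by (intro l; exact (ct_cent L al be (a l) (b l) K 1 1 F G CF CG)).
  assert (K2 : forall l, ct (c2 l)) by (intro l; exact (ct_cent L al be (a l) (b l) K e1 ep F G CF CG)).
  assert (K3 : forall l, ct (p1 l)) by (intro l; unfold p1; ctac). assert (K4 : forall l, ct (p2 l)) by (intro l; unfold p2; ctac).
  assert (Hl' : forall l, (l < n)%nat -> (a l + N0 <= b l)%nat /\ (b l <= K)%nat) by (intros l Hln; destruct (Hl l Hln) as [? [? ?]]; auto).
  assert (Hl2 : forall l, (l < n)%nat -> (a (S l) <= b l)%nat) by (intros l Hln; apply Hl; auto).
  assert (Hl3 : forall l, (l < n)%nat -> (a l <= b l)%nat) by (intros l Hln; destruct (Hl l Hln); lia).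
  assert (B1' := H P L 1 1 F G a b K n HP HL ltac:(ring) ltac:(ring) HF HG Ha Hb Hl').
  assert (B2' := H P L e1 ep F G a b K n HP HL ltac:(destruct He1 as [-> | ->]; ring) ltac:(destruct Hep as [-> | ->]; ring) HF HG Ha Hb Hl').
  assert (B3 := para1 P L al (ln 2) F G h a b A B K n HP HL Hal ltac:(lra) HF HG Hh H1 HA HB Ea Eb Hl2).
  assert (B4 := para2 P L be (ln 2) F G h a b A B K n HP HL Hbe ltac:(lra) HF HG Hh H1 HA HB Ea Eb Hl3).
  fold C1 in B3. fold C2 in B4.
  change (fun x => bs (fun l => Ph L al (ln 2) (a l) (pp (dl L K) F) x * pp (dl L (b l)) G x) n * h x) with
    (fun x => bs (fun l => p1 l x) n * h x) in B3.
  change (fun x => bs (fun l => pp (dl L (a l)) F x * Ph L be (ln 2) (b l) (pp (dl L K) G) x) n * h x) with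
    (fun x => bs (fun l => p2 l x) n * h x) in B4.
  assert (SP : forall l x, blk L al be (a l) (b l) K e1 ep F G x = c1 l x - c2 l x + ((1 - e1) / 2 * p1 l x + (1 - ep) / 2 * p2 l x)).
  { intros l x. exact (blk_split L al be (a l) (b l) K e1 ep F G x He1 Hep CF CG). }
  change (bs (fun l => RI (fun x => Rabs (c1 l x)) 0 P) n <= C * (En P F + En P G)) in B1'.
  change (bs (fun l => RI (fun x => Rabs (c2 l x)) 0 P) n <= C * (En P F + En P G)) in B2'. clearbody c1 c2 p1 p2.
  assert (S1 : ct (fun x => bs (fun l => p1 l x) n)) by (apply ct_bs; auto). assert (S2 : ct (fun x => bs (fun l => p2 l x) n)) by (apply ct_bs; auto).
  assert (S3 : ct (fun x => bs (fun l => c1 l x) n)) by (apply ct_bs; auto). assert (S4 : ct (fun x => bs (fun l => c2 l x) n)) by (apply ct_bs; auto).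
  assert (EE : RI (fun x => h x * bs (fun l => blk L al be (a l) (b l) K e1 ep F G x) n) 0 P =
    RI (fun x => bs (fun l => c1 l x) n * h x) 0 P - RI (fun x => bs (fun l => c2 l x) n * h x) 0 P +
    ((1 - e1) / 2 * RI (fun x => bs (fun l => p1 l x) n * h x) 0 P + (1 - ep) / 2 * RI (fun x => bs (fun l => p2 l x) n * h x) 0 P)).
  { rewrite <- (RI_lin4 (fun x => bs (fun l => c1 l x) n) (fun x => bs (fun l => c2 l x) n) (fun x => bs (fun l => p1 l x) n)
      (fun x => bs (fun l => p2 l x) n)) by auto. apply RI_ext; intro x.
    rewrite (bs_ext _ (fun l => c1 l x - c2 l x + ((1 - e1) / 2 * p1 l x + (1 - ep) / 2 * p2 l x))).
    - rewrite !bs_plus, bs_minus, !bs_scal. ring.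
    - intros l _. apply SP. }
  assert (BC : forall c : nat -> R -> R, (forall l, ct (c l)) -> Rabs (RI (fun x => bs (fun l => c l x) n * h x) 0 P) <= bs (fun l => RI (fun x => Rabs (c l x)) 0 P) n).
  { intros c Cc. rewrite (RI_bs_mul (fun l x => c l x)) by auto. letr; [apply bs_abs|]. apply bs_le; intros l _.
     letr; [apply RI_abs; [lra|ctac]|]. ri_le. intros x _.
    rewrite Rabs_mult. rewrite <- (Rmult_1_r (Rabs (c l x))) at 2. mul_l; auto. }
  assert (B1 := BC c1 K1). assert (B2 := BC c2 K2).
  rewrite EE. assert (Hk : Rabs ((1 - ep) / 2) <= 1) by (destruct Hep as [-> | ->]; apply Rabs_le; lra).
  assert (Hk1 : Rabs ((1 - e1) / 2) <= 1) by (destruct He1 as [-> | ->]; apply Rabs_le; lra).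
  letr; [apply Rabs_plus_le; [apply Rabs_minus_le; [letr; [apply B1|apply B1']|letr; [apply B2|apply B2']]|
    apply Rabs_plus_le; [apply Rabs_mult_le; [apply Hk1|apply B3]|apply Rabs_mult_le; [apply Hk|apply B4]]]|]. lra.
Qed.
End OneSide.
Import OneSide.

(** * The truncated operator on periodic functions *)

Module PeriodicBound.
Implicit Types f g F G u W w h : R -> R.

Definition lip (l : R) F : Prop := forall x y, Rabs (F x - F y) <= l * Rabs (x - y).
Definition bnd (M : R) F : Prop := forall x, Rabs (F x) <= M.

Lemma av_near d F x c e : 0 < d -> ct F -> (forall y, 0 <= y <= d -> Rabs (F (x - y) - c) <= e) -> Rabs (av d F x - c) <= e.
Proof.
  intros Hd C H. assert (Hi : 0 < / d) by pos. replace (av d F x - c) with (/ d * RI (fun y => F (x - y) - c) 0 d).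
  - rewrite Rabs_mult, Rabs_right by lra. letr_with (/ d * ((d - 0) * e)); [|right; field; lra].
    mul_l. apply RI_bound; [lra|ctac|auto].
  - unfold av. rewrite RI_minus, RI_const by ctac. field. lra.
Qed.
Lemma avs_near d F x c e : 0 < d -> ct F -> (forall y, 0 <= y <= d -> Rabs (F (x + y) - c) <= e) -> Rabs (avs d F x - c) <= e.
Proof.
  intros Hd C H. assert (Hi : 0 < / d) by pos. replace (avs d F x - c) with (/ d * RI (fun y => F (x + y) - c) 0 d).
  - rewrite Rabs_mult, Rabs_right by lra. letr_with (/ d * ((d - 0) * e)); [|right; field; lra].
    mul_l. apply RI_bound; [lra|ctac|auto].
  - unfold avs. rewrite RI_minus, RI_const by ctac. field. lra.
Qed.
Lemma pp_near d F l x : 0 < d -> 0 <= l -> ct F -> lip l F -> Rabs (pp d F x - F x) <= l * d.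
Proof.
  intros Hd Hl C H. apply av_near; auto; [ctac|]. intros y Hy. apply avs_near; auto. intros z Hz.
  letr; [apply H|]. mul_l; auto. apply Rabs_le; lra.
Qed.
Lemma pp_bnd d F M : 0 < d -> ct F -> bnd M F -> bnd M (pp d F).
Proof.
  intros Hd C H x. rewrite <- (Rminus_0_r (pp d F x)). apply av_near; auto; [ctac|]. intros y Hy. apply avs_near; auto. intros z Hz.
  rewrite Rminus_0_r. apply H.
Qed.

Definition blki (L al be : R) (a b : nat) (e1 ep : R) F G (x : R) : R :=
  RI (fun v => F (x - mexp (dl L a) al v) * G (x - mexp (dl L b) be v) -
    F (x - e1 * mexp (dl L a) al v) * G (x - ep * mexp (dl L b) be v)) 0 (ln 2).
Lemma ct_blki L al be a b e1 ep F G : ct F -> ct G -> ct (blki L al be a b e1 ep F G).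
Proof. intros CF CG. unfold blki. ctac. Qed.

Lemma prod_near (p q p' q' M e : R) : Rabs p' <= M -> Rabs q <= M -> Rabs (p - p') <= e -> Rabs (q - q') <= e ->
  Rabs (p * q - p' * q') <= 2 * M * e.
Proof.
  intros H1 H2 H3 H4. replace (p * q - p' * q') with ((p - p') * q + p' * (q - q')) by ring.
  letr; [apply Rabs_plus_le; [apply Rabs_mult_le; [apply H3|apply H2]|apply Rabs_mult_le; [apply H1|apply H4]]|]. lra.
Qed.

Lemma blk_blki L al be a b K e1 ep F G M l x : 0 < L -> 0 <= l -> ct F -> ct G -> lip l F -> lip l G -> bnd M F -> bnd M G ->
  Rabs (blk L al be a b K e1 ep F G x - blki L al be a b e1 ep F G x) <= 4 * M * l * dl L K.
Proof.
  intros HL Hl CF CG LF LG BF BG. assert (D := dl_pos L K HL). assert (X := ln2_bd).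
  assert (HM : 0 <= M) by (letr; [apply Rabs_pos|apply (BF 0)]). assert (HZ : 0 <= 2 * M * (l * dl L K)) by pos.
  unfold blk, blki. rewrite <- RI_minus by ctac. letr; [apply (RI_bound _ _ _ (4 * M * l * dl L K)); [lra|ctac|]|].
  - intros v _. assert (Q : forall y z, Rabs (pp (dl L K) F y * pp (dl L K) G z - F y * G z) <= 2 * M * (l * dl L K)).
    { intros y z. apply prod_near; [apply BF|apply pp_bnd; auto|apply pp_near; auto|apply pp_near; auto]. }
    set (y1 := x - mexp (dl L a) al v). set (z1 := x - mexp (dl L b) be v).
    set (y2 := x - e1 * mexp (dl L a) al v). set (z2 := x - ep * mexp (dl L b) be v).
    assert (Q1 := Q y1 z1). assert (Q2 := Q y2 z2).
    replace (pp (dl L K) F y1 * pp (dl L K) G z1 - pp (dl L K) F y2 * pp (dl L K) G z2 - (F y1 * G z1 - F y2 * G z2)) with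
      ((pp (dl L K) F y1 * pp (dl L K) G z1 - F y1 * G z1) - (pp (dl L K) F y2 * pp (dl L K) G z2 - F y2 * G z2)) by ring.
    letr; [apply Rabs_minus_le; [apply Q1|apply Q2]|]. lra.
  - rewrite Rminus_0_r. rewrite <- (Rmult_1_l (4 * M * l * dl L K)) at 2. mul_r; lra.
Qed.

Lemma dl_small L e : 0 < L -> 0 < e -> exists K0, forall K, (K0 <= K)%nat -> dl L K <= e.
Proof.
  intros HL He. destruct (INR_unbounded (L / e)) as [K0 HK]. exists K0. intros K HKK. unfold dl. assert (0 < 2 ^ K) by pos.
  assert (H1 : L / e <= 2 ^ K).
  { letr_with (INR K); [apply Rlt_le, Rlt_le_trans with (INR K0); [auto|apply le_INR; auto]|].
    replace (2 ^ K) with (INR (2 ^ K)) by (rewrite pow_INR; simpl; auto). apply le_INR. apply Nat.lt_le_incl, Nat.pow_gt_lin_r; lia. }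
  apply Rmult_le_reg_r with (2 ^ K); auto. unfold Rdiv at 1. rewrite Rmult_assoc, Rinv_l, Rmult_1_r by lra.
  apply (Rmult_le_compat_r e) in H1; [|lra]. unfold Rdiv in H1. rewrite Rmult_assoc, Rinv_l in H1 by lra. lra.
Qed.

(** Removes the regularisation [pp (dl L K)]: it converges uniformly for Lipschitz data, and the
    constant of [side] does not depend on [K]. *)
Lemma side_inf al be (A B : nat) : 1 <= al -> 1 <= be -> al <> be -> (1 <= A)%nat -> (1 <= B)%nat -> exists C N0, 0 <= C /\
  forall P L e1 ep F G h M l (a b : nat -> nat) n, 0 < P -> 0 < L -> e1 = 1 \/ e1 = -1 -> ep = 1 \/ ep = -1 ->
  cper P F -> cper P G -> cper P h -> 0 <= l -> lip l F -> lip l G -> bnd M F -> bnd M G ->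
  (forall x, Rabs (h x) <= 1) -> (forall l, a (S l) = (a l + A)%nat) -> (forall l, b (S l) = (b l + B)%nat) ->
  (forall l, (l < n)%nat -> (a l + N0 <= b l)%nat /\ (a (S l) <= b l)%nat) ->
  Rabs (RI (fun x => h x * bs (fun l => blki L al be (a l) (b l) e1 ep F G x) n) 0 P) <= C * (En P F + En P G).
Proof.
  intros Hal Hbe Hab HA HB. destruct (side al be A B Hal Hbe Hab HA HB) as [C [N0 [HC H]]]. exists C, N0. split; auto.
  intros P L e1 ep F G h M l a b n HP HL He1 Hep HF HG Hh Hl LF LG BF BG H1 Ea Eb Hab2.
  assert (CF : ct F) by apply HF. assert (CG : ct G) by apply HG. assert (HM : 0 <= M) by (letr; [apply Rabs_pos|apply (BF 0)]).
  assert (HZ : 0 <= P * (INR n * (4 * M * l))).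
  { apply Rmult_le_pos; [lra|]. apply Rmult_le_pos; [apply pos_INR|]. repeat apply Rmult_le_pos; lra. }
  apply le_eps with (P * (INR n * (4 * M * l))); auto. intros e He.
  destruct (dl_small L e HL He) as [K0 HK0]. set (K := (K0 + b n)%nat). assert (HK := HK0 K ltac:(unfold K; lia)).
  assert (Hmon : forall i, (i <= n)%nat -> (b i <= b n)%nat).
  { assert (Hk : forall i k, (b i <= b (i + k))%nat).
    { intros i k. induction k; [rewrite Nat.add_0_r; auto|]. rewrite Nat.add_succ_r, Eb. lia. }
    intros i Hi. replace n with (i + (n - i))%nat by lia. apply Hk. }
  assert (Hab3 : forall i, (i < n)%nat -> (a i + N0 <= b i)%nat /\ (a (S i) <= b i)%nat /\ (b i <= K)%nat).
  { intros i Hi. destruct (Hab2 i Hi) as [Z1 Z2]. assert (X := Hmon i (Nat.lt_le_incl _ _ Hi)). unfold K. lia. }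
  assert (Main := H P L e1 ep F G h a b K n HP HL He1 Hep HF HG Hh H1 Ea Eb Hab3).
  set (b1 := fun i => blk L al be (a i) (b i) K e1 ep F G) in *. set (b2 := fun i => blki L al be (a i) (b i) e1 ep F G).
  assert (C1 : forall i, ct (b1 i)) by (intro i; exact (ct_blk L al be (a i) (b i) K e1 ep F G CF CG)).
  assert (C2 : forall i, ct (b2 i)) by (intro i; exact (ct_blki L al be (a i) (b i) e1 ep F G CF CG)).
  assert (Df : forall i x, Rabs (b2 i x - b1 i x) <= 4 * M * l * e).
  { intros i x. rewrite Rabs_minus_sym. letr; [exact (blk_blki L al be (a i) (b i) K e1 ep F G M l x HL Hl CF CG LF LG BF BG)|].
    apply Rmult_le_compat_l; auto. repeat apply Rmult_le_pos; lra. }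
  change (Rabs (RI (fun x => h x * bs (fun i => b1 i x) n) 0 P) <= C * (En P F + En P G)) in Main.
  change (Rabs (RI (fun x => h x * bs (fun i => b2 i x) n) 0 P) <= C * (En P F + En P G) + P * (INR n * (4 * M * l)) * e).
  clearbody b1 b2.
  assert (S1 : ct (fun x => bs (fun i => b1 i x) n)) by (apply ct_bs; auto). assert (S2 : ct (fun x => bs (fun i => b2 i x) n)) by (apply ct_bs; auto).
  replace (RI (fun x => h x * bs (fun i => b2 i x) n) 0 P) with (RI (fun x => h x * bs (fun i => b1 i x) n) 0 P +
    RI (fun x => h x * bs (fun i => b2 i x) n - h x * bs (fun i => b1 i x) n) 0 P).
  2:{ rewrite RI_minus by ctac. ring. } apply Rabs_plus_le; auto.
  letr; [apply (RI_bound _ _ _ (1 * (INR n * (4 * M * l * e)))); [lra|ctac|]|right; ring].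
  intros x _. rewrite <- Rmult_minus_distr_l, <- bs_minus. apply Rabs_mult_le; auto.
  letr; [apply bs_abs|]. rewrite <- bs_const. apply bs_le; intros; apply Df.
Qed.

Section Periodic.
Context (d : nat) (Hd : (2 <= d)%nat).
Definition eps_d : R := (-1) ^ d.
Lemma eps_pm : eps_d = 1 \/ eps_d = -1.
Proof. apply (e2_cases eps_d). unfold eps_d. rewrite <- pow_mult, Nat.mul_comm, pow_mult. replace ((-1) ^ 2) with 1 by ring. apply pow1. Qed.
(** The integrand in logarithmic variables: [exp t] and [- exp t] replace the original variable, and
    the kernel becomes Lebesgue measure, with a minus sign on the negative half-line. *)
Definition Psi F G (x t : R) : R := F (x - exp t) * G (x - exp (INR d * t)) - F (x + exp t) * G (x - eps_d * exp (INR d * t)).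
Lemma ct_Psi F G : ct F -> ct G -> ct2 (Psi F G).
Proof. intros. unfold Psi. ctac. Qed.
#[local] Hint Resolve ct_Psi : ctdb.
Lemma dINR : 2 <= INR d.
Proof. change 2 with (INR 2). apply le_INR; auto. Qed.

Lemma exp_ln2 n : exp (INR n * ln 2) = 2 ^ n.
Proof. rewrite <- exp_nat, exp_ln; lra. Qed.
Lemma exp_mexp L n (t : R) al v : exp t = dl L n -> exp (t + al * v) = mexp (dl L n) al v.
Proof. intro H. unfold mexp. rewrite exp_plus, H. auto. Qed.

Lemma small_blocks F G j0 n x : ct F -> ct G ->
  RI (Psi F G x) (- INR (j0 + n) * ln 2) (- INR j0 * ln 2) =
  bs (fun l => blki 1 1 (INR d) (j0 + 1 + l) (d * (j0 + 1 + l)) (-1) eps_d F G x) n.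
Proof.
  intros CF CG. assert (C := ct_Psi F G CF CG). assert (Cx := ct2_row _ x C). induction n.
  - rewrite Nat.add_0_r. apply RI_point.
  - rewrite <- (RI_chasles _ _ (- INR (j0 + n) * ln 2)) by auto. rewrite IHn. simpl bs. rewrite Rplus_comm. f_equal.
    set (a := (j0 + 1 + n)%nat).
    replace (- INR (j0 + S n) * ln 2) with (0 + - INR a * ln 2) by (unfold a; replace (j0 + S n)%nat with (j0 + 1 + n)%nat by lia; ring).
    replace (- INR (j0 + n) * ln 2) with (ln 2 + - INR a * ln 2) by (unfold a; rewrite !plus_INR; simpl; ring).
    rewrite <- RI_shift by auto. unfold blki. apply RI_ext; intro v. unfold Psi.
    assert (E : forall m, exp (- INR m * ln 2) = dl 1 m).
    { intro m. replace (- INR m * ln 2) with (- (INR m * ln 2)) by ring. rewrite exp_Ropp, exp_ln2. unfold dl. field. apply pow_nonzero; lra. }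
    replace (v + - INR a * ln 2) with (- INR a * ln 2 + 1 * v) by ring. rewrite (exp_mexp 1 a) by auto.
    replace (INR d * (- INR a * ln 2 + 1 * v)) with (- INR (d * a) * ln 2 + INR d * v) by (rewrite mult_INR; ring).
    rewrite (exp_mexp 1 (d * a)) by auto. replace (x - -1 * mexp (dl 1 a) 1 v) with (x + mexp (dl 1 a) 1 v) by ring. auto.
Qed.

(** For large [t] the shift of [G] is the longer one, so the factors are exchanged. Blocks are
    counted from the largest [t] downwards: with [i = j0 + n - 1 - l] the two scales are
    [dl L (d * l) = 2^(d i)] and [dl L ((d - 1) * (j0 + n - 1) + l) = 2^i]. *)
Lemma large_blocks F G j0 n x : ct F -> ct G ->
  RI (Psi F G x) (INR j0 * ln 2) (INR (j0 + n) * ln 2) =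
  bs (fun l => blki (2 ^ (d * (j0 + n - 1))) (INR d) 1 (d * l) ((d - 1) * (j0 + n - 1) + l) eps_d (-1) G F x) n.
Proof.
  intros CF CG. assert (C := ct_Psi F G CF CG). assert (Cx := ct2_row _ x C). set (L := 2 ^ (d * (j0 + n - 1))).
  enough (Q : forall m, (m <= n)%nat -> RI (Psi F G x) (INR (j0 + n - m) * ln 2) (INR (j0 + n) * ln 2) =
    bs (fun l => blki L (INR d) 1 (d * l) ((d - 1) * (j0 + n - 1) + l) eps_d (-1) G F x) m).
  { rewrite <- Q by lia. replace (j0 + n - n)%nat with j0 by lia. auto. } induction m; intro Hm.
  - rewrite Nat.sub_0_r. apply RI_point.
  - rewrite <- (RI_chasles _ _ (INR (j0 + n - m) * ln 2)) by auto. rewrite IHm by lia. simpl bs. rewrite Rplus_comm. f_equal.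
    set (i := (j0 + n - S m)%nat). replace (INR i * ln 2) with (0 + INR i * ln 2) by ring.
    replace (INR (j0 + n - m) * ln 2) with (ln 2 + INR i * ln 2).
    2:{ replace (j0 + n - m)%nat with (S i) by (unfold i; lia). rewrite S_INR. ring. }
    rewrite <- RI_shift by auto. unfold blki. apply RI_ext; intro v. unfold Psi.
    assert (E1 : exp (INR i * ln 2) = dl L ((d - 1) * (j0 + n - 1) + m)).
    { rewrite exp_ln2. unfold L, dl. assert (0 < 2 ^ ((d - 1) * (j0 + n - 1) + m)) by pos.
      apply Rmult_eq_reg_r with (2 ^ ((d - 1) * (j0 + n - 1) + m)); [|lra]. unfold Rdiv. rewrite Rmult_assoc, Rinv_l, Rmult_1_r by lra.
      rewrite <- pow_add. f_equal. unfold i. destruct d as [|d']; [lia|]. simpl Nat.sub at 2. rewrite Nat.sub_0_r. nia. }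
    assert (E2 : exp (INR (d * i) * ln 2) = dl L (d * m)).
    { rewrite exp_ln2. unfold L, dl. assert (0 < 2 ^ (d * m)) by pos.
      apply Rmult_eq_reg_r with (2 ^ (d * m)); [|lra]. unfold Rdiv. rewrite Rmult_assoc, Rinv_l, Rmult_1_r by lra.
      rewrite <- pow_add. f_equal. unfold i. nia. }
    replace (v + INR i * ln 2) with (INR i * ln 2 + 1 * v) by ring. rewrite (exp_mexp L _ _ _ _ E1).
    replace (INR d * (INR i * ln 2 + 1 * v)) with (INR (d * i) * ln 2 + INR d * v) by (rewrite mult_INR; ring).
    rewrite (exp_mexp L _ _ _ _ E2).
    replace (x - -1 * mexp (dl L ((d - 1) * (j0 + n - 1) + m)) 1 v) with (x + mexp (dl L ((d - 1) * (j0 + n - 1) + m)) 1 v) by ring. ring.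
Qed.

Definition BJ F G (J : nat) (x : R) : R := RI (Psi F G x) (- INR J * ln 2) (INR J * ln 2).
Lemma ct_BJ F G J : ct F -> ct G -> ct (BJ F G J).
Proof. intros CF CG. unfold BJ. ctac. Qed.
Lemma cper_BJ P F G J : cper P F -> cper P G -> cper P (BJ F G J).
Proof.
  intros [CF PF] [CG PG]. split; [apply ct_BJ; auto|]. intro x. unfold BJ. apply RI_ext; intro t. unfold Psi.
  rewrite <- (PF (x - exp t)), <- (PF (x + exp t)), <- (PG (x - exp (INR d * t))), <- (PG (x - eps_d * exp (INR d * t))).
  f_equal; f_equal; f_equal; ring.
Qed.

Lemma middle P F G h T : 0 < P -> 0 <= T -> cper P F -> cper P G -> ct h -> (forall x, Rabs (h x) <= 1) ->
  Rabs (RI (fun x => h x * RI (Psi F G x) (- T) T) 0 P) <= 4 * T * (En P F + En P G).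
Proof.
  intros HP HT HF HG Ch H1. assert (CF : ct F) by apply HF. assert (CG : ct G) by apply HG.
  set (u1 := fun x => RI (fun t => 1 * F (x - exp t) * G (x - exp (INR d * t))) (- T) T).
  set (u2 := fun x => RI (fun t => 1 * F (x - - exp t) * G (x - eps_d * exp (INR d * t))) (- T) T).
  assert (C1 : ct u1) by (unfold u1; ctac). assert (C2 : ct u2) by (unfold u2; ctac).
  assert (B1 := RI_amgm_shift P F G (fun t => exp t) (fun t => exp (INR d * t)) (fun _ => 1) (- T) T HP ltac:(lra) HF HG
    ltac:(ctac) ltac:(ctac) ltac:(ctac) ltac:(intros; lra)).
  assert (B2 := RI_amgm_shift P F G (fun t => - exp t) (fun t => eps_d * exp (INR d * t)) (fun _ => 1) (- T) T HP ltac:(lra) HF HG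
    ltac:(ctac) ltac:(ctac) ltac:(ctac) ltac:(intros; lra)).
  cbv beta in B1, B2. fold u1 in B1. fold u2 in B2. rewrite RI_const in B1, B2. letr; [apply RI_abs; [lra|ctac]|].
  letr_with (RI (fun x => Rabs (u1 x) + Rabs (u2 x)) 0 P).
  - ri_le. intros x _. replace (RI (Psi F G x) (- T) T) with (u1 x - u2 x).
    + rewrite <- (Rmult_1_l (Rabs (u1 x) + Rabs (u2 x))). apply Rabs_mult_le; auto. apply Rabs_minus_le; lra.
    + unfold u1, u2. rewrite <- RI_minus by ctac. apply RI_ext; intro t. unfold Psi.
      replace (x - - exp t) with (x + exp t) by ring. ring.
  - rewrite RI_plus by ctac. change (RI (fun x => Rabs (u1 x)) 0 P <= (T - - T) * 1 * (En P F + En P G)) in B1.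
    change (RI (fun x => Rabs (u2 x)) 0 P <= (T - - T) * 1 * (En P F + En P G)) in B2. lra.
Qed.

(** Outside the range between [2^-j0] and [2^j0] the two scales are far enough apart for [side_inf];
    that range itself has bounded logarithmic length and needs no cancellation. *)
Lemma per_h : exists C j0, 0 <= C /\ forall P F G h M l J, 0 < P -> cper P F -> cper P G -> cper P h -> 0 <= l -> lip l F -> lip l G ->
  bnd M F -> bnd M G -> (forall x, Rabs (h x) <= 1) -> (j0 <= J)%nat ->
  Rabs (RI (fun x => h x * BJ F G J x) 0 P) <= C * (En P F + En P G).
Proof.
  assert (D := dINR).
  destruct (side_inf 1 (INR d) 1 d ltac:(lra) ltac:(lra) ltac:(lra) ltac:(lia) ltac:(lia)) as [C1 [N1 [HC1 S1]]].
  destruct (side_inf (INR d) 1 d 1 ltac:(lra) ltac:(lra) ltac:(lra) ltac:(lia) ltac:(lia)) as [C2 [N2 [HC2 S2]]].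
  (* As [d >= 2], the gap between the two indices is at least [j0] on both sides, so [N1] and [N2]
     are covered; the 2 secures [a (S l) <= b l] for large [t]. *)
  set (j0 := (N1 + N2 + 2)%nat). exists (C1 + C2 + 4 * (INR j0 * ln 2)), j0.
  assert (X := ln2_bd). assert (HT : 0 <= INR j0 * ln 2) by (apply Rmult_le_pos; [apply pos_INR|lra]).
  split; [lra|]. intros P F G h M l J HP HF HG Hh Hl LF LG BF BG H1 HJ.
  assert (CF : ct F) by apply HF. assert (CG : ct G) by apply HG. assert (Ch : ct h) by apply Hh. assert (C := ct_Psi F G CF CG).
  set (n := (J - j0)%nat). set (a1 := fun l => (j0 + 1 + l)%nat). set (b1 := fun l => (d * (j0 + 1 + l))%nat).
  assert (A1 : forall l, a1 (S l) = (a1 l + 1)%nat) by (intro; unfold a1; lia).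
  assert (A2 : forall l, b1 (S l) = (b1 l + d)%nat) by (intro; unfold b1; ring).
  assert (A3 : forall i, (i < n)%nat -> (a1 i + N1 <= b1 i)%nat /\ (a1 (S i) <= b1 i)%nat).
  { intros i _. unfold a1, b1. assert (Y : (2 * (j0 + 1 + i) <= d * (j0 + 1 + i))%nat) by (apply Nat.mul_le_mono_r; auto). unfold j0 in *. lia. }
  assert (B1 := S1 P 1 (-1) eps_d F G h M l a1 b1 n HP Rlt_0_1 (or_intror eq_refl) eps_pm HF HG Hh Hl LF LG BF BG H1 A1 A2 A3).
  set (a2 := fun l => (d * l)%nat). set (b2 := fun l => ((d - 1) * (j0 + n - 1) + l)%nat).
  assert (A4 : forall l, a2 (S l) = (a2 l + d)%nat) by (intro; unfold a2; ring).
  assert (A5 : forall l, b2 (S l) = (b2 l + 1)%nat) by (intro; unfold b2; lia).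
  assert (Q : forall i, (i < n)%nat -> (a2 i + N2 <= b2 i)%nat /\ (a2 (S i) <= b2 i)%nat).
  { intros i Hi. unfold a2, b2. set (D1 := (d - 1)%nat). assert (HD1 : d = (D1 + 1)%nat) by (unfold D1; lia). rewrite HD1.
    assert (X1 : (D1 * (j0 + i) <= D1 * (j0 + n - 1))%nat) by (apply Nat.mul_le_mono_l; lia).
    assert (X2 : (1 * j0 <= D1 * j0)%nat) by (apply Nat.mul_le_mono_r; lia).
    rewrite Nat.mul_add_distr_l in X1. rewrite !Nat.mul_add_distr_r, !Nat.mul_1_l, Nat.mul_succ_r.
     unfold j0 in X2 |- *. fold j0. lia. } assert (B2 := S2 P (2 ^ (d * (j0 + n - 1))) eps_d (-1) G F h M l a2 b2 n HP
    ltac:(pos) eps_pm (or_intror eq_refl) HG HF Hh Hl LG LF BG BF H1 A4 A5 Q).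
  assert (B3 := middle P F G h (INR j0 * ln 2) HP HT HF HG Ch H1).
  set (U1 := fun x => RI (Psi F G x) (- INR (j0 + n) * ln 2) (- INR j0 * ln 2)).
  set (U2 := fun x => RI (Psi F G x) (INR j0 * ln 2) (INR (j0 + n) * ln 2)).
  set (U3 := fun x => RI (Psi F G x) (- (INR j0 * ln 2)) (INR j0 * ln 2)).
  assert (V1 : ct U1) by (unfold U1; ctac). assert (V2 : ct U2) by (unfold U2; ctac). assert (V3 : ct U3) by (unfold U3; ctac).
  rewrite (RI_ext _ (fun x => h x * U1 x)) in B1 by (intro x; unfold U1; rewrite small_blocks by auto; auto).
  rewrite (RI_ext _ (fun x => h x * U2 x)) in B2 by (intro x; unfold U2; rewrite large_blocks by auto; auto).
  change (Rabs (RI (fun x => h x * U3 x) 0 P) <= 4 * (INR j0 * ln 2) * (En P F + En P G)) in B3.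
  assert (E : forall x, BJ F G J x = U1 x + U3 x + U2 x).
  { intro x. assert (Cx := ct2_row _ x C). unfold BJ, U1, U2, U3. replace (j0 + n)%nat with J by (unfold n; lia).
    replace (- (INR j0 * ln 2)) with (- INR j0 * ln 2) by ring. rewrite !RI_chasles by auto. auto. }
  rewrite (RI_ext _ (fun x => h x * U1 x + h x * U3 x + h x * U2 x)) by (intro x; rewrite E; ring).
  clearbody U1 U2 U3. rewrite !RI_plus by ctac.
  letr; [apply Rabs_plus_le; [apply Rabs_plus_le; [apply B1|apply B3]|apply B2]|]. lra.
Qed.

Lemma per_bound : exists C j0, 0 <= C /\ forall P F G M l J, 0 < P -> cper P F -> cper P G -> 0 <= l -> lip l F -> lip l G ->
  bnd M F -> bnd M G -> (j0 <= J)%nat -> RI (fun x => Rabs (BJ F G J x)) 0 P <= C * (En P F + En P G).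
Proof.
  destruct per_h as [C [j0 [HC H]]]. exists C, j0. split; auto. intros P F G M l J HP HF HG Hl LF LG BF BG HJ.
  assert (HB := cper_BJ P F G J HF HG). set (B := BJ F G J) in *. assert (CB : ct B) by apply HB.
  apply le_eps with P; [|lra]. intros e He.
  assert (Den : forall x, 0 < Rabs (B x) + e) by (intro x; assert (X := Rabs_pos (B x)); lra).
  (* A continuous substitute for the sign of [B], losing at most [e] pointwise:
     [h * B >= |B| - e]. *)
  set (h := fun x => B x / (Rabs (B x) + e)).
  assert (Ch : ct h) by (unfold h; apply ct_div; [auto|ctac|intro x; assert (X := Den x); lra]).
  assert (Hh : cper P h) by (split; auto; intro x; unfold h; rewrite (proj2 HB x); auto). assert (H1 : forall x, Rabs (h x) <= 1).
  { intro x. unfold h, Rdiv. assert (X := Den x). rewrite Rabs_mult, (Rabs_right (/ _)) by pos.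
    apply Rmult_le_reg_r with (Rabs (B x) + e); auto. rewrite Rmult_assoc, Rinv_l by lra. lra. }
  assert (Main := H P F G h M l J HP HF HG Hh Hl LF LG BF BG H1 HJ). fold B in Main.
  assert (Lo : RI (fun x => Rabs (B x) - e) 0 P <= RI (fun x => h x * B x) 0 P).
  { ri_le. intros x _. unfold h. assert (X := Den x).
    replace (B x / (Rabs (B x) + e) * B x) with (Rabs (B x) ^ 2 / (Rabs (B x) + e)) by (rewrite pow2_abs; field; lra).
    apply Rmult_le_reg_r with (Rabs (B x) + e); auto. unfold Rdiv. rewrite (Rmult_assoc (Rabs (B x) ^ 2)), Rinv_l by lra.
    assert (0 <= e ^ 2) by pos. lra. } rewrite RI_minus, RI_const in Lo by ctac. apply Rabs_le_between in Main. lra.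
Qed.
End Periodic.
End PeriodicBound.
Import PeriodicBound.

(** * From periodic functions to functions on the line *)

Module LocalBound.
Implicit Types f g F G u W w h : R -> R.

(** The distance to the nearest half-integer. As a minimum over integers ([tri_le]) it is visibly
    Lipschitz and 1-periodic. *)
Definition tri (x : R) : R := Rabs (x - IZR (Int_part x) - / 2).
Lemma tri_le x k : tri x <= Rabs (x - IZR k - / 2).
Proof.
  unfold tri. destruct (base_Int_part x) as [H1 H2]. set (m := Int_part x) in *.
  assert (Hu : Rabs (x - IZR m - / 2) <= / 2) by (apply Rabs_le; lra). destruct (Z.lt_trichotomy k m) as [H|[H|H]].
  - assert (IZR k + 1 <= IZR m) by (rewrite <- plus_IZR; apply IZR_le; lia). assert (X := Rle_abs (x - IZR k - / 2)). lra.
  - rewrite H. lra.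
  - assert (IZR m + 1 <= IZR k) by (rewrite <- plus_IZR; apply IZR_le; lia). assert (X := Rle_abs (- (x - IZR k - / 2))). rewrite Rabs_Ropp in X. lra.
Qed.
Lemma tri_lip1 x y : tri x <= tri y + Rabs (x - y).
Proof.
  letr; [apply (tri_le x (Int_part y))|]. unfold tri.
  replace (x - IZR (Int_part y) - / 2) with ((y - IZR (Int_part y) - / 2) + (x - y)) by ring. apply Rabs_triang.
Qed.
Lemma tri_per x : tri (x + 1) = tri x.
Proof.
  apply Rle_antisym.
  - letr; [apply (tri_le (x + 1) (Int_part x + 1))|]. rewrite plus_IZR. unfold tri. right. f_equal. ring.
  - letr; [apply (tri_le x (Int_part (x + 1) - 1))|]. rewrite minus_IZR. unfold tri. right. f_equal. ring.
Qed.
Lemma tri_val x : 0 <= x <= 1 -> tri x = Rabs (x - / 2).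
Proof.
  intro H. apply Rle_antisym; [letr; [apply (tri_le x 0)|right; f_equal; ring]|].
  unfold tri. destruct (base_Int_part x) as [H1 H2]. set (m := Int_part x) in *. assert (m = 0 \/ m = 1)%Z as [-> | ->].
  { assert (IZR m < 2) by lra. assert (-1 < IZR m) by lra. apply lt_IZR in H0. apply lt_IZR in H3. lia. }
  - right. f_equal. ring.
  - assert (E : x = 1) by lra. rewrite E. replace (1 - 1 - / 2) with (- (1 - / 2)) by field. rewrite Rabs_Ropp. lra.
Qed.

(* The identity on [-P/4, P/4], so that [f o wave] periodises [f] without any cut-off. *)
Definition wave (P x : R) : R := P * (/ 4 - tri (x / P + / 4)).
Lemma wave_lip P : 0 < P -> lip 1 (wave P).
Proof.
  intros HP x y. unfold wave. set (a := x / P + / 4). set (b := y / P + / 4).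
  replace (P * (/ 4 - tri a) - P * (/ 4 - tri b)) with (P * (tri b - tri a)) by ring. rewrite Rabs_mult, Rabs_right by lra.
  assert (A := tri_lip1 a b). assert (B := tri_lip1 b a). rewrite (Rabs_minus_sym b a) in B.
  letr_with (P * Rabs (a - b)); [apply Rmult_le_compat_l; [lra|apply Rabs_le; lra]|].
  right. rewrite <- (Rabs_right P) at 1 by lra. rewrite <- Rabs_mult, Rmult_1_l. f_equal. unfold a, b. field. lra.
Qed.
Lemma wave_per P x : 0 < P -> wave P (x + P) = wave P x.
Proof. intro HP. unfold wave. replace ((x + P) / P + / 4) with (x / P + / 4 + 1) by (field; lra). rewrite tri_per. auto. Qed.
Lemma div_range P x a b : 0 < P -> a * P <= x <= b * P -> a <= x / P <= b.
Proof. intros HP H. split; apply Rmult_le_reg_r with P; auto; unfold Rdiv; rewrite Rmult_assoc, Rinv_l; lra. Qed.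
Lemma wave_id P x : 0 < P -> - (P / 4) <= x <= P / 4 -> wave P x = x.
Proof.
  intros HP H. assert (R1 := div_range P x (- / 4) (/ 4) HP ltac:(lra)). unfold wave. rewrite tri_val by lra. rewrite Rabs_left1 by lra. field. lra.
Qed.
Lemma wave_refl P x : 0 < P -> P / 4 <= x <= P / 4 + P / 2 -> wave P x = P / 2 - x.
Proof.
  intros HP H. assert (R1 := div_range P x (/ 4) (3 / 4) HP ltac:(lra)). unfold wave. rewrite tri_val by lra. rewrite Rabs_right by lra. field. lra.
Qed.

Lemma lip_ct l F : 0 <= l -> lip l F -> ct F.
Proof.
  intros Hl H x. apply continuity_pt_filterlim. intros e He. exists (e / (l + 1)). split; [apply Rdiv_lt_0_compat; lra|].
  intros y [_ Hy]. unfold dist in *. simpl in *. unfold Rdist in *. eapply Rle_lt_trans; [apply H|].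
  apply Rle_lt_trans with (l * (e / (l + 1))); [mul_l; lra|].
  apply Rlt_le_trans with ((l + 1) * (e / (l + 1))); [|right; field; lra]. apply Rmult_lt_compat_r; [pos|lra].
Qed.

(** During a period the wave traverses [[-P/4, P/4]] once upwards and once downwards, at unit
    speed. *)
Lemma En_wave P f : 0 < P -> ct f -> En P (fun x => f (wave P x)) = 2 * RI (fun x => f x ^ 2) (- (P / 4)) (P / 4).
Proof.
  intros HP C. assert (Cw : ct (wave P)) by (apply (lip_ct 1); [lra|apply wave_lip; auto]). unfold En.
  rewrite <- (per_int P (fun x => f (wave P x) ^ 2) (- (P / 4))); auto.
  2:{ split; [ctac|]. intro x. rewrite wave_per by auto. auto. } rewrite <- (RI_chasles _ (- (P / 4)) (P / 4)) by ctac.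
  rewrite (RI_ext_le (fun x => f (wave P x) ^ 2) (fun x => f x ^ 2) (- (P / 4)) (P / 4)); [|lra|intros x Hx; rewrite wave_id; auto].
  rewrite (RI_ext_le (fun x => f (wave P x) ^ 2) (fun x => f (P / 2 - x) ^ 2) (P / 4) (- (P / 4) + P)); [|lra|intros x Hx; rewrite wave_refl by lra; auto].
  rewrite (RI_refl (fun x => f x ^ 2) (P / 2) (P / 4) (- (P / 4) + P)) by (try lra; ctac).
  replace (P / 2 - (- (P / 4) + P)) with (- (P / 4)) by field. replace (P / 2 - P / 4) with (P / 4) by field. ring.
Qed.

Section Local.
Context (d : nat) (Hd : (2 <= d)%nat).

(** For [|x| <= N] the truncated operator reads [f] and [g] only within distance
    [N + exp T + exp (INR d * T)] of the origin. With [P] four times this, [wave P] is the identity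
    there, and the periodic bound does not depend on [P]. *)
Lemma local_bound : exists C j0, 0 <= C /\ forall f g M l J N Af Ag, 0 <= l -> lip l f -> lip l g -> bnd M f -> bnd M g -> (j0 <= J)%nat -> 0 <= N ->
  (forall T, 0 <= T -> RI (fun x => f x ^ 2) (- T) T <= Af) -> (forall T, 0 <= T -> RI (fun x => g x ^ 2) (- T) T <= Ag) ->
  RI (fun x => Rabs (BJ d f g J x)) (- N) N <= C * (Af + Ag).
Proof.
  destruct (per_bound d Hd) as [C [j0 [HC H]]]. exists (2 * C), j0. split; [lra|].
  intros f g M l J N Af Ag Hl Lf Lg Bf Bg HJ HN Hf Hg.
  assert (Cf := lip_ct l f Hl Lf). assert (Cg := lip_ct l g Hl Lg). assert (D := dINR d Hd).
  assert (X := ln2_bd). set (T := INR J * ln 2). assert (HT : 0 <= T) by (apply Rmult_le_pos; [apply pos_INR|lra]).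
  set (Q := N + exp T + exp (INR d * T)). assert (E1 := exp_pos T). assert (E2 := exp_pos (INR d * T)).
  set (P := 4 * Q). assert (HQ : 0 < Q) by (unfold Q; lra). assert (HP : 0 < P) by (unfold P; lra).
  assert (Cw : ct (wave P)) by (apply (lip_ct 1); [lra|apply wave_lip; auto]).
  set (F := fun x => f (wave P x)). set (G := fun x => g (wave P x)).
  assert (L : forall k, lip l k -> lip l (fun x => k (wave P x))).
  { intros k Hk x y. letr; [apply Hk|]. mul_l; auto. rewrite <- (Rmult_1_l (Rabs (x - y))). apply wave_lip; auto. }
  assert (Cp : forall k, ct k -> cper P (fun x => k (wave P x))).
  { intros k Ck. split; [ctac|]. intro x. rewrite wave_per by auto. auto. }
  assert (Main := H P F G M l J HP (Cp f Cf) (Cp g Cg) Hl (L f Lf) (L g Lg) (fun x => Bf _) (fun x => Bg _) HJ).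
  assert (CF : ct F) by apply (Cp f Cf). assert (CG : ct G) by apply (Cp g Cg). assert (CB := ct_BJ d F G J CF CG).
  assert (Eq : forall x, - N <= x <= N -> BJ d f g J x = BJ d F G J x).
  { intros x Hx. unfold BJ. apply RI_ext_le; [unfold T in HT; lra|]. intros t Ht.
    assert (T1 : 0 < exp t <= exp T) by (split; [pos|apply exp_le; unfold T; lra]).
    assert (T2 : 0 < exp (INR d * t) <= exp (INR d * T)).
    { split; [pos|]. apply exp_le. apply Rmult_le_compat_l; [lra|unfold T; lra]. }
    unfold Psi, F, G. rewrite !wave_id; auto; try (unfold P, Q; lra). destruct (eps_pm d) as [-> | ->]; unfold P, Q; lra. }
  rewrite (RI_ext_le _ (fun x => Rabs (BJ d F G J x))); [|lra|intros x Hx; rewrite Eq; auto].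
  letr_with (RI (fun x => Rabs (BJ d F G J x)) (- (P / 2)) (- (P / 2) + P)).
  - apply RI_mono; try (unfold P, Q; lra); [ctac|intros; apply Rabs_pos].
  - rewrite per_int; auto; [|apply cper_abs, cper_BJ; [apply (Cp f Cf)|apply (Cp g Cg)]].
    letr; [apply Main|]. unfold F, G. rewrite !En_wave by auto.
    assert (A1 := Hf (P / 4) ltac:(lra)). assert (A2 := Hg (P / 4) ltac:(lra)).
    replace (2 * C * (Af + Ag)) with (C * (2 * Af + 2 * Ag)) by ring. mul_l; auto. lra.
Qed.
End Local.
End LocalBound.
Import LocalBound.

(** * Existence of the principal value and passage to the limit *)

Module PrincipalValue.
Implicit Types f g F G u W w h : R -> R.

Lemma RInt_def F a b : ex_RInt F a b -> is_RInt F a b (RInt F a b).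
Proof. intro H. exists (ex_RInt_Reals_0 F a b H). symmetry. apply RInt_Reals. Qed.
Lemma RInt_uniq F a b v : is_RInt F a b v -> v = RInt F a b.
Proof. intros [pr <-]. symmetry. apply RInt_Reals. Qed.

Lemma pv_unique F l1 l2 : pv_int F l1 -> pv_int F l2 -> l1 = l2.
Proof.
  intros H1 H2. assert (Q : forall e, 0 < e -> Rabs (l1 - l2) <= 0 + 2 * e).
  { intros e He. destruct (H1 e He) as [d1 [P1 Q1]]. destruct (H2 e He) as [d2 [P2 Q2]].
    assert (Hm : 0 < Rmin d1 d2) by (apply Rmin_glb_lt; auto). assert (M1 := Rmin_l d1 d2). assert (M2 := Rmin_r d1 d2).
    destruct (Q1 (Rmin d1 d2 / 2) ltac:(lra)) as [v1 [v2 [A1 [A2 A3]]]]. destruct (Q2 (Rmin d1 d2 / 2) ltac:(lra)) as [w1 [w2 [B1 [B2 B3]]]].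
    rewrite (RInt_uniq _ _ _ _ A1), (RInt_uniq _ _ _ _ A2) in A3. rewrite (RInt_uniq _ _ _ _ B1), (RInt_uniq _ _ _ _ B2) in B3.
    apply Rabs_lt_between in A3. apply Rabs_lt_between in B3. apply Rabs_le. lra. } assert (X := le_eps _ _ _ Q ltac:(lra)).
  destruct (Req_dec (l1 - l2) 0) as [E|E]; [lra|]. apply Rabs_pos_lt in E. lra.
Qed.

Section PV.
Context (d : nat) (Hd : (2 <= d)%nat) (Nm : R -> R -> R) (M l : R) (CN : ct2 Nm) (HM : 0 <= M) (Hl : 0 <= l)
  (LN : forall y z y' z', Rabs (Nm y z - Nm y' z') <= l * (Rabs (y - y') + Rabs (z - z')))
  (BN : forall y z, Rabs (Nm y z) <= M) (DN : forall y z, Rabs (y * Nm y z) <= M).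

(** [Nm y z] stands for a sum of products [f y * g z], since the real and the imaginary part are
    each a sum of two products. [LN] gives convergence near 0 and [DN], decay in the first variable,
    convergence at infinity. *)
Definition Ps (x t : R) : R := Nm (x - exp t) (x - exp (INR d * t)) - Nm (x + exp t) (x - eps_d d * exp (INR d * t)).
Lemma ct_Ps : ct2 Ps. Proof. unfold Ps. ctac. Qed.
#[local] Hint Resolve ct_Ps : ctdb.
Definition HT (T x : R) : R := RI (Ps x) (- T) T.
Lemma ct_HT T : ct (HT T). Proof. assert (A := ct_Ps). unfold HT. ctac. Qed.
Definition KN (N : R) : R := 4 * l + 4 * M * (N + 1).
Lemma KN_pos N : 0 <= N -> 0 <= KN N.
Proof. intro H. unfold KN. assert (0 <= M * (N + 1)) by (apply Rmult_le_pos; lra). lra. Qed.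

Lemma Nm_far N y z e : 0 <= N -> 1 <= e -> e - N <= Rabs y -> Rabs (Nm y z) <= 2 * M * (N + 1) * / e.
Proof.
  intros HN He Hy. apply Rmult_le_reg_r with e; [lra|]. rewrite (Rmult_assoc _ (/ e)), Rinv_l, Rmult_1_r by lra.
  assert (B := BN y z). assert (D := DN y z). assert (P := Rabs_pos (Nm y z)). rewrite Rabs_mult in D.
  destruct (Rle_dec (2 * N) e) as [H|H].
  - assert (e / 2 <= Rabs y) by lra. assert (e / 2 * Rabs (Nm y z) <= M).
    { letr; [apply Rmult_le_compat_r; [auto|apply H0]|auto]. } assert (0 <= M * N) by (apply Rmult_le_pos; auto). lra.
  - letr_with (M * (2 * N)); [apply Rmult_le_compat; lra|]. lra.
Qed.

Lemma Ps_small x t N : 0 <= N -> t <= 0 -> Rabs (Ps x t) <= KN N * exp t.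
Proof.
  intros HN Ht. unfold Ps. letr; [apply LN|]. assert (D := dINR d Hd). assert (P2 := exp_pos (INR d * t)).
  assert (E : exp (INR d * t) <= exp t).
  { apply exp_le. assert (0 <= (INR d - 1) * - t) by (apply Rmult_le_pos; lra). lra. }
  assert (A1 : Rabs (x - exp t - (x + exp t)) <= 2 * exp t) by (apply Rabs_le; lra).
  assert (A2 : Rabs (x - exp (INR d * t) - (x - eps_d d * exp (INR d * t))) <= 2 * exp t).
  { destruct (eps_pm d) as [-> | ->]; apply Rabs_le; lra. } letr_with (l * (4 * exp t)); [mul_l; lra|].
  unfold KN. assert (0 <= M * (N + 1)) by (apply Rmult_le_pos; lra). assert (0 <= M * (N + 1) * exp t) by (apply Rmult_le_pos; lra). lra.
Qed.
Lemma Ps_large x t N : Rabs x <= N -> 0 <= t -> Rabs (Ps x t) <= KN N * exp (- t).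
Proof.
  intros Hx Ht. assert (HN : 0 <= N) by (assert (X := Rabs_pos x); lra). assert (E : 1 <= exp t) by (rewrite <- exp_0; apply exp_le; auto).
  assert (P := exp_pos (- t)). apply Rabs_le_between in Hx.
  unfold Ps. letr; [apply Rabs_minus_le; apply (Nm_far N _ _ (exp t)); auto|].
  - assert (X := Rle_abs (- (x - exp t))). rewrite Rabs_Ropp in X. lra.
  - assert (X := Rle_abs (x + exp t)). lra.
  - rewrite <- exp_Ropp. unfold KN. assert (0 <= l * exp (- t)) by (apply Rmult_le_pos; lra). lra.
Qed.

Lemma RI_exp a b : a <= b -> RI exp a b = exp b - exp a.
Proof. intro H. apply (RI_ftc exp exp); [auto|intro u; apply continuous_exp|]. intros x _. apply is_derive_exp. Qed.

(** [Ps] decays exponentially in [|t|] on both ends, uniformly for [|x| <= N]; this gives pointwise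
    limits as well as continuity of the limit. *)
Lemma HT_diff N T T' x : Rabs x <= N -> 0 <= T <= T' -> Rabs (HT T' x - HT T x) <= 2 * KN N * exp (- T).
Proof.
  intros Hx HTT. assert (A := ct_Ps). assert (Ax := ct2_row _ x A). assert (HN : 0 <= N) by (assert (X := Rabs_pos x); lra).
  assert (HK := KN_pos N HN). assert (E : HT T' x - HT T x = RI (Ps x) (- T') (- T) + RI (Ps x) T T').
  { unfold HT. rewrite <- (RI_chasles (Ps x) (- T') (- T) T'), <- (RI_chasles (Ps x) (- T) T T') by auto. ring. }
  rewrite E. replace (2 * KN N * exp (- T)) with (KN N * exp (- T) + KN N * exp (- T)) by ring. apply Rabs_plus_le.
  - letr; [apply RI_abs; [lra|auto]|]. letr_with (RI (fun t => KN N * exp t) (- T') (- T)).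
    + ri_le. intros t Ht. apply Ps_small; auto; lra.
    + rewrite (RI_scal exp), RI_exp by (try lra; intro; apply continuous_exp). mul_l; auto. assert (P := exp_pos (- T')). lra.
  - letr; [apply RI_abs; [lra|auto]|]. letr_with (RI (fun t => KN N * exp (0 - t)) T T').
    + ri_le. intros t Ht. rewrite Rminus_0_l. apply Ps_large; auto; lra.
    + rewrite RI_scal by ctac. rewrite (RI_refl exp 0 T T') by (try lra; intro; apply continuous_exp). rewrite RI_exp by lra. rewrite !Rminus_0_l.
      mul_l; auto. assert (P := exp_pos (- T')). lra.
Qed.

Lemma exp_small e : 0 < e -> exists n, forall T, INR n <= T -> exp (- T) <= e.
Proof.
  intro He. destruct (INR_unbounded (/ e)) as [n Hn]. exists n. intros T HTn. rewrite exp_Ropp.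
  assert (X := exp_ineq1_le T). rewrite <- (Rinv_inv e). apply Rinv_le_contravar; [apply Rinv_0_lt_compat; auto|lra].
Qed.

Lemma HT_cauchy x : Cauchy_crit (fun n => HT (INR n) x).
Proof.
  intros e He. set (N := Rabs x). assert (HK := KN_pos N (Rabs_pos x)).
  destruct (exp_small (e / (4 * KN N + 1))) as [n0 Hn0]; [apply Rdiv_lt_0_compat; lra|].
  exists n0. assert (B : forall n, (n0 <= n)%nat -> Rabs (HT (INR n) x - HT (INR n0) x) < e / 2).
  { intros n Hn. eapply Rle_lt_trans; [apply (HT_diff N); [unfold N; lra|split; [apply pos_INR|apply le_INR; auto]]|].
    assert (X := Hn0 (INR n0) ltac:(lra)). apply (Rmult_le_compat_l (2 * KN N)) in X; [|lra].
    eapply Rle_lt_trans; [apply X|]. apply Rmult_lt_reg_r with (4 * KN N + 1); [lra|].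
    replace (2 * KN N * (e / (4 * KN N + 1)) * (4 * KN N + 1)) with (2 * KN N * e) by (field; lra). lra. }
  intros n m Hn Hm. unfold Rdist. assert (B1 := B n Hn). assert (B2 := B m Hm).
  apply Rabs_lt_between in B1. apply Rabs_lt_between in B2. apply Rabs_def1; lra.
Qed.

(** The limit along integer truncations; [Hl_bound] extends the convergence to all truncations, with
    a rate. *)
Definition Hl_ (x : R) : R := proj1_sig (Rcomplete.R_complete _ (HT_cauchy x)).
Lemma Hl_bound N T x : Rabs x <= N -> 0 <= T -> Rabs (Hl_ x - HT T x) <= 2 * KN N * exp (- T).
Proof.
  intros Hx HT0. unfold Hl_. destruct (Rcomplete.R_complete _ (HT_cauchy x)) as [y Hy]. simpl.
  apply le_eps with 1; [|lra]. intros e He. destruct (Hy e He) as [n0 Hn0].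
  destruct (INR_unbounded T) as [n1 Hn1]. set (n := (n0 + n1)%nat). assert (X := Hn0 n ltac:(unfold n; lia)). unfold Rdist in X.
  assert (Y : INR n1 <= INR n) by (apply le_INR; unfold n; lia). assert (Z := HT_diff N T (INR n) x Hx ltac:(lra)).
  apply Rabs_lt_between in X. apply Rabs_le_between in Z. apply Rabs_le. lra.
Qed.

Lemma ct_Hl : ct Hl_.
Proof.
  intro x0. apply continuity_pt_filterlim. intros e He. set (N := Rabs x0 + 1).
  assert (HN : 0 <= N) by (unfold N; assert (X := Rabs_pos x0); lra). assert (HK := KN_pos N HN).
  destruct (exp_small (e / (6 * KN N + 1))) as [n Hn]; [apply Rdiv_lt_0_compat; lra|].
  assert (Hs : 2 * KN N * exp (- INR n) < e / 3).
  { assert (X := Hn (INR n) ltac:(lra)). apply (Rmult_le_compat_l (2 * KN N)) in X; [|lra].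
    eapply Rle_lt_trans; [apply X|]. apply Rmult_lt_reg_r with (6 * KN N + 1); [lra|].
    replace (2 * KN N * (e / (6 * KN N + 1)) * (6 * KN N + 1)) with (2 * KN N * e) by (field; lra). lra. }
  assert (C := ct_HT (INR n) x0). apply continuity_pt_filterlim in C. destruct (C (e / 3) ltac:(lra)) as [a [Ha Ca]].
  exists (Rmin a 1). split; [apply Rmin_glb_lt; lra|]. intros x [Dx Hx]. assert (R1 := Rmin_l a 1). assert (R2 := Rmin_r a 1).
  unfold dist in *. simpl in *. unfold Rdist in *.
  assert (Hx2 : Rabs (x - x0) < a) by lra. assert (Y := Ca x (conj Dx Hx2)). unfold dist in Y; simpl in Y; unfold Rdist in Y.
  assert (X0 : Rabs x0 <= N) by (unfold N; lra). assert (X1 : Rabs x <= N).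
  { unfold N. replace x with (x0 + (x - x0)) by ring. letr; [apply Rabs_triang|]. lra. }
  assert (B0 := Hl_bound N (INR n) x0 X0 (pos_INR n)). assert (B1 := Hl_bound N (INR n) x X1 (pos_INR n)).
  apply Rabs_lt_between in Y. apply Rabs_le_between in B0. apply Rabs_le_between in B1. apply Rabs_def1; lra.
Qed.
#[local] Hint Resolve ct_Hl : ctdb.

Definition Fpv (x t : R) : R := Nm (x - t) (x - t ^ d) / t.
Lemma Fpv_cont x (t : R) : t <> 0 -> continuous (Fpv x) t.
Proof.
  intro Ht. unfold Fpv, Rdiv. apply (continuous_mult (fun t => Nm (x - t) (x - t ^ d)) Rinv).
  - assert (C : ct (fun t => Nm (x - t) (x - t ^ d))) by ctac. apply C.
  - apply continuous_Rinv; auto.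
Qed.
Lemma exp_dpow t : exp t ^ d = exp (INR d * t).
Proof. apply exp_nat. Qed.

Lemma Fpv_right x T : 0 <= T -> ex_RInt (Fpv x) (exp (- T)) (exp T) /\
  RInt (Fpv x) (exp (- T)) (exp T) = RI (fun t => Nm (x - exp t) (x - exp (INR d * t))) (- T) T.
Proof.
  intro HT0. split.
  - apply (ex_RInt_continuous (V := R_CompleteNormedModule)). intros z Hz. apply Fpv_cont. rewrite Rmin_left in Hz by (apply exp_le; lra).
    assert (X := exp_pos (- T)). lra.
  - rewrite <- (RInt_comp (V := R_CompleteNormedModule) (Fpv x) exp exp (- T) T).
    + unfold RI. apply RInt_ext. intros t _. unfold scal; simpl; unfold mult; simpl. unfold Fpv. rewrite exp_dpow.
      assert (X := exp_pos t). field. lra.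
    + intros t _. apply Fpv_cont. assert (X := exp_pos t). lra.
    + intros t _. split; [apply is_derive_exp|apply continuous_exp].
Qed.
Lemma Fpv_left x T : 0 <= T -> ex_RInt (Fpv x) (- exp T) (- exp (- T)) /\
  RInt (Fpv x) (- exp T) (- exp (- T)) = - RI (fun t => Nm (x + exp t) (x - eps_d d * exp (INR d * t))) (- T) T.
Proof.
  intro HT0. split.
  - apply (ex_RInt_continuous (V := R_CompleteNormedModule)). intros z Hz. apply Fpv_cont.
    assert (Y : exp (- T) <= exp T) by (apply exp_le; lra). rewrite Rmax_right in Hz by lra. assert (X := exp_pos (- T)). lra.
  - rewrite <- (RInt_comp (V := R_CompleteNormedModule) (Fpv x) (fun t => - exp t) (fun t => - exp t) T (- T)).
    + rewrite <- RI_swap by ctac. unfold RI. apply RInt_ext. intros t _. unfold scal; simpl; unfold mult; simpl. unfold Fpv.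
      replace ((- exp t) ^ d) with (eps_d d * exp (INR d * t)).
      2:{ unfold eps_d. rewrite <- exp_dpow, <- Rpow_mult_distr. f_equal. ring. }
      replace (x - - exp t) with (x + exp t) by ring. assert (X := exp_pos t). field. lra.
    + intros t _. apply Fpv_cont. assert (X := exp_pos t). lra.
    + intros t _. split; [apply D_opp, is_derive_exp|]. assert (C : ct (fun t => - exp t)) by ctac. apply C.
Qed.

(** The truncation [e <= |t| <= / e] is the interval [[-T, T]] in logarithmic variables, with
    [T = - ln e]; keeping [e] below 1 ensures [T >= 0]. *)
Lemma pv_Hl x : pv_int (Fpv x) (Hl_ x).
Proof.
  intros eps He. set (N := Rabs x). assert (HK := KN_pos N (Rabs_pos x)).
  exists (Rmin 1 (eps / (2 * KN N + 1))). assert (Z : 0 < eps / (2 * KN N + 1)) by (apply Rdiv_lt_0_compat; lra).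
  split; [apply Rmin_glb_lt; lra|]. intros e Hee. assert (R1 := Rmin_l 1 (eps / (2 * KN N + 1))). assert (R2 := Rmin_r 1 (eps / (2 * KN N + 1))).
  set (T := - ln e). assert (ET : exp (- T) = e) by (unfold T; rewrite Ropp_involutive; apply exp_ln; lra).
  assert (ET' : exp T = / e) by (rewrite <- ET, exp_Ropp, Rinv_inv; auto).
  assert (HT0 : 0 <= T) by (assert (X : ln e <= ln 1) by (apply ln_le; lra); rewrite ln_1 in X; unfold T; lra).
  destruct (Fpv_right x T HT0) as [A1 A2]. destruct (Fpv_left x T HT0) as [B1 B2]. rewrite ET, ET' in *.
  exists (RInt (Fpv x) (- / e) (- e)), (RInt (Fpv x) e (/ e)). split; [apply RInt_def; auto|]. split; [apply RInt_def; auto|].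
  assert (E : RInt (Fpv x) (- / e) (- e) + RInt (Fpv x) e (/ e) = HT T x).
  { unfold HT, Ps. rewrite RI_minus by ctac. rewrite A2, B2. ring. } rewrite E.
  assert (X := Hl_bound N T x ltac:(unfold N; lra) HT0). rewrite ET in X. rewrite Rabs_minus_sym. eapply Rle_lt_trans; [apply X|].
  apply Rle_lt_trans with (2 * KN N * (eps / (2 * KN N + 1))); [mul_l; lra|]. apply Rmult_lt_reg_r with (2 * KN N + 1); [lra|].
  replace (2 * KN N * (eps / (2 * KN N + 1)) * (2 * KN N + 1)) with (2 * KN N * eps) by (field; lra). lra.
Qed.

Lemma Hl_int N B j0 : 0 <= N -> (forall J, (j0 <= J)%nat -> RI (fun x => Rabs (HT (INR J * ln 2) x)) (- N) N <= B) ->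
  RI (fun x => Rabs (Hl_ x)) (- N) N <= B.
Proof.
  intros HN HB. assert (HK := KN_pos N HN). assert (C := ct_Hl). assert (L2 := ln2_bd).
  apply le_eps with (2 * N * (2 * KN N)); [|apply Rmult_le_pos; lra]. intros e He.
  destruct (exp_small e He) as [n Hn]. destruct (INR_unbounded (INR n / ln 2)) as [m Hm].
  set (J := (j0 + m)%nat). assert (HJ := HB J ltac:(unfold J; lia)). set (T := INR J * ln 2) in *. assert (HTn : INR n <= T).
  { assert (INR m <= INR J) by (apply le_INR; unfold J; lia). letr_with (INR n / ln 2 * ln 2); [right; field; lra|].
    unfold T. mul_r; lra. } assert (HT0 : 0 <= T) by (assert (X := pos_INR n); lra). assert (C' := ct_HT T).
  letr_with (RI (fun x => Rabs (HT T x) + 2 * KN N * e) (- N) N).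
  - ri_le. intros x Hx. assert (X := Hl_bound N T x ltac:(apply Rabs_le; lra) HT0).
    assert (Y := Hn T HTn). apply (Rmult_le_compat_l (2 * KN N)) in Y; [|lra].
    replace (Hl_ x) with (HT T x + (Hl_ x - HT T x)) by ring. letr; [apply Rabs_triang|]. lra.
  - rewrite RI_plus, RI_const by ctac. lra.
Qed.
End PV.
End PrincipalValue.
Import PrincipalValue.

(** * Schwartz functions, complex values and the product bound *)

Implicit Types f g F G u W w h : R -> R.

(** What the proof uses of a Schwartz function; the constants [M] and [l] do not enter the final
    bound. *)
Definition nice (M l : R) f : Prop := bnd M f /\ (forall x, Rabs (x * f x) <= M) /\ lip l f.
Lemma nice_mono M l M' l' f : M <= M' -> l <= l' -> nice M l f -> nice M' l' f.
Proof.
  intros HM Hl [A [B C]]. split; [|split].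
  - intro x. assert (X := A x). lra.
  - intro x. assert (X := B x). lra.
  - intros x y. letr; [apply C|]. mul_r; auto.
Qed.
Lemma nice_scal M l k f : Rabs k <= 1 -> nice M l f -> nice M l (fun x => k * f x).
Proof.
  intros Hk [A [B C]]. assert (Q : forall z Z, Rabs z <= Z -> Rabs (k * z) <= Z).
  { intros z Z H. rewrite <- (Rmult_1_l Z). apply Rabs_mult_le; auto. } split; [|split].
  - intro x. apply Q, A.
  - intro x. replace (x * (k * f x)) with (k * (x * f x)) by ring. apply Q, B.
  - intros x y. rewrite <- Rmult_minus_distr_l. apply Q, C.
Qed.

Lemma schwartz_nice f : schwartz_real f -> exists M l, 0 <= M /\ 0 <= l /\ nice M l f.
Proof.
  intros [D [D0 [DD DB]]]. destruct (DB 0%nat 0%nat) as [M0 B0]. destruct (DB 1%nat 0%nat) as [M1 B1]. destruct (DB 0%nat 1%nat) as [l Bl].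
  rewrite D0 in *. assert (B0' : bnd M0 f) by (intro x; assert (X := B0 x); rewrite pow_O, Rmult_1_l in X; auto).
  assert (P0 : 0 <= M0) by (letr; [apply Rabs_pos|apply (B0' 0)]). assert (P1 : 0 <= M1) by (letr; [apply Rabs_pos|apply (B1 0)]).
  assert (Pl : 0 <= l) by (letr; [apply Rabs_pos|apply (Bl 0)]). exists (M0 + M1), l. split; [lra|]. split; auto. split; [|split].
  - intro x. assert (X := B0' x). lra.
  - intro x. assert (X := B1 x). rewrite pow_1 in X. lra.
  - intros x y. assert (DF : forall z : R, is_derive f z (D 1%nat z)) by (intro z; apply is_derive_Reals; rewrite <- D0; apply DD).
    destruct (MVT_gen f y x (D 1%nat)) as [c [_ Hc]].
    + intros; apply DF.
    + intros z _. apply continuity_pt_filterlim. apply (ex_derive_continuous f z). eexists; apply DF.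
    + rewrite Hc. apply Rabs_mult_le; [|lra]. assert (X := Bl c). rewrite pow_O, Rmult_1_l in X. auto.
Qed.

(** The optimal value is [t = sqrt b / sqrt a]; if [a] vanishes [t] is sent to infinity, if [b]
    does, to 0. *)
Lemma scale_opt v K a b : 0 <= K -> 0 <= a -> 0 <= b -> (forall t, 0 < t -> v <= K * (t * a + b / t)) -> v <= 2 * K * sqrt a * sqrt b.
Proof.
  intros HK Ha Hb H. destruct (Req_dec a 0) as [Ea|Ea]; [|destruct (Req_dec b 0) as [Eb|Eb]].
  - subst a. rewrite sqrt_0, Rmult_0_r, Rmult_0_l. apply le_eps with (K * b); [|pos].
    intros e He. assert (X := H (/ e) ltac:(pos)). unfold Rdiv in X. rewrite Rinv_inv in X. lra.
  - subst b. rewrite sqrt_0, Rmult_0_r. apply le_eps with (K * a); [|pos].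
    intros e He. assert (X := H e He). unfold Rdiv in X. lra.
  - assert (Sa : 0 < sqrt a) by (apply sqrt_lt_R0; lra). assert (Sb : 0 < sqrt b) by (apply sqrt_lt_R0; lra).
    assert (X := H (sqrt b / sqrt a) ltac:(pos)). rewrite <- (sqrt_sqrt a Ha) in X at 2. rewrite <- (sqrt_sqrt b Hb) in X at 2.
    replace (sqrt b / sqrt a * (sqrt a * sqrt a) + sqrt b * sqrt b / (sqrt b / sqrt a)) with (2 * sqrt a * sqrt b) in X by (field; lra). lra.
Qed.

Section Final.
Context (d : nat) (Hd : (2 <= d)%nat).

(** Each product is unchanged when [f] and [g] are replaced by [k f] and [g / k]; with [k = sqrt t]
    the additive bound becomes the family [t a + b / t], from which [scale_opt] recovers a
    product. *)
Lemma form_exists : exists C, 0 <= C /\ forall f1 g1 f2 g2 M l a b, 0 <= M -> 0 <= l -> nice M l f1 -> nice M l g1 -> nice M l f2 -> nice M l g2 ->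
  (forall T, 0 <= T -> RI (fun x => f1 x ^ 2) (- T) T <= a) -> (forall T, 0 <= T -> RI (fun x => g1 x ^ 2) (- T) T <= b) ->
  (forall T, 0 <= T -> RI (fun x => f2 x ^ 2) (- T) T <= a) -> (forall T, 0 <= T -> RI (fun x => g2 x ^ 2) (- T) T <= b) ->
  exists H, ct H /\ (forall x, pv_int (fun t => (f1 (x - t) * g1 (x - t ^ d) + f2 (x - t) * g2 (x - t ^ d)) / t) (H x)) /\
  forall N t, 0 <= N -> 0 < t -> RI (fun x => Rabs (H x)) (- N) N <= C * (t * a + b / t).
Proof.
  destruct (local_bound d Hd) as [C [j0 [HC LB]]]. exists (2 * C). split; [lra|].
  intros f1 g1 f2 g2 M l a b HM Hl N1 N2 N3 N4 A1 B1 A2 B2.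
  assert (Cf1 := lip_ct l f1 Hl (proj2 (proj2 N1))). assert (Cg1 := lip_ct l g1 Hl (proj2 (proj2 N2))).
  assert (Cf2 := lip_ct l f2 Hl (proj2 (proj2 N3))). assert (Cg2 := lip_ct l g2 Hl (proj2 (proj2 N4))).
  set (Nm := fun y z => f1 y * g1 z + f2 y * g2 z). assert (CN : ct2 Nm) by (unfold Nm; ctac).
  assert (MM : 0 <= M * M) by pos. assert (ML : 0 <= M * l) by pos.
  assert (L1 : forall f g, nice M l f -> nice M l g -> forall y z y' z', Rabs (f y * g z - f y' * g z') <= M * l * (Rabs (y - y') + Rabs (z - z'))).
  { intros f g [Bf [_ Lf]] [Bg [_ Lg]] y z y' z'. replace (f y * g z - f y' * g z') with ((f y - f y') * g z + f y' * (g z - g z')) by ring.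
    letr; [apply Rabs_plus_le; [apply Rabs_mult_le; [apply Lf|apply Bg]|apply Rabs_mult_le; [apply Bf|apply Lg]]|]. right; ring. }
  assert (LN : forall y z y' z', Rabs (Nm y z - Nm y' z') <= 2 * M * l * (Rabs (y - y') + Rabs (z - z'))).
  { intros y z y' z'. unfold Nm. replace (f1 y * g1 z + f2 y * g2 z - (f1 y' * g1 z' + f2 y' * g2 z')) with
      ((f1 y * g1 z - f1 y' * g1 z') + (f2 y * g2 z - f2 y' * g2 z')) by ring.
    letr; [apply Rabs_plus_le; [apply (L1 f1 g1); auto|apply (L1 f2 g2); auto]|]. right; ring. }
  assert (BN : forall y z, Rabs (Nm y z) <= 2 * (M * M)).
  { intros y z. unfold Nm. letr; [apply Rabs_plus_le; apply Rabs_mult_le; [apply N1|apply N2|apply N3|apply N4]|]. right; ring. }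
  assert (DN : forall y z, Rabs (y * Nm y z) <= 2 * (M * M)).
  { intros y z. unfold Nm. replace (y * (f1 y * g1 z + f2 y * g2 z)) with ((y * f1 y) * g1 z + (y * f2 y) * g2 z) by ring.
    letr; [apply Rabs_plus_le; apply Rabs_mult_le; [apply N1|apply N2|apply N3|apply N4]|]. right; ring. }
  assert (H0 : 0 <= 2 * (M * M)) by lra. assert (H1 : 0 <= 2 * M * l) by lra.
  exists (Hl_ d Hd Nm (2 * (M * M)) (2 * M * l) CN H0 H1 LN BN DN). split; [apply ct_Hl|]. split.
  - intro x. exact (pv_Hl d Hd Nm (2 * (M * M)) (2 * M * l) CN H0 H1 LN BN DN x).
  - intros N t HN Ht. apply Hl_int with j0; auto. intros J HJ.
    set (k := sqrt t). assert (Hk : 0 < k) by (apply sqrt_lt_R0; auto). assert (Kt : k ^ 2 = t) by (unfold k; rewrite <- Rsqr_pow2; apply Rsqr_sqrt; lra).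
    assert (P1 : forall f g, nice M l f -> nice M l g -> ct f -> ct g -> (forall T, 0 <= T -> RI (fun x => f x ^ 2) (- T) T <= a) ->
      (forall T, 0 <= T -> RI (fun x => g x ^ 2) (- T) T <= b) -> RI (fun x => Rabs (BJ d f g J x)) (- N) N <= C * (t * a + b / t)).
    { intros f g [Bf [_ Lf]] [Bg [_ Lg]] Cf Cg Af Bgg. assert (Hik : 0 < / k) by pos.
      assert (X := LB (fun x => k * f x) (fun x => / k * g x) ((k + / k) * M) ((k + / k) * l) J N (t * a) (b / t) ltac:(pos)).
      assert (Sc : forall c z K : R, 0 < c <= k + / k -> Rabs z <= K -> 0 <= K -> Rabs (c * z) <= (k + / k) * K).
      { intros c z K Hc Hh HK. apply Rabs_mult_le; auto. rewrite Rabs_right; lra. }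
      assert (E : forall x, BJ d f g J x = BJ d (fun x => k * f x) (fun x => / k * g x) J x).
      { intro x. unfold BJ. apply RI_ext; intro s. unfold Psi. field. lra. }
      rewrite (RI_ext _ (fun x => Rabs (BJ d (fun x => k * f x) (fun x => / k * g x) J x))) by (intro; rewrite E; auto).
      apply X; auto.
      - intros x y. rewrite <- Rmult_minus_distr_l, (Rmult_assoc (k + / k)). apply Sc; [lra|apply Lf|]. apply Rmult_le_pos; [auto|pos].
      - intros x y. rewrite <- Rmult_minus_distr_l, (Rmult_assoc (k + / k)). apply Sc; [lra|apply Lg|]. apply Rmult_le_pos; [auto|pos].
      - intro x. apply Sc; [lra|apply Bf|auto].
      - intro x. apply Sc; [lra|apply Bg|auto].
      - intros T HT0. rewrite (RI_ext _ (fun x => t * f x ^ 2)) by (intro; rewrite Rpow_mult_distr, Kt; auto). rewrite RI_scal by ctac.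
        apply Rmult_le_compat_l; [lra|auto].
      - intros T HT0. rewrite (RI_ext _ (fun x => / t * g x ^ 2)) by (intro; rewrite Rpow_mult_distr, pow_inv, Kt; auto). rewrite RI_scal by ctac.
        unfold Rdiv. rewrite (Rmult_comm b). mul_l; auto. }
    assert (Q1 := P1 f1 g1 N1 N2 Cf1 Cg1 A1 B1). assert (Q2 := P1 f2 g2 N3 N4 Cf2 Cg2 A2 B2).
    assert (CB1 := ct_BJ d f1 g1 J Cf1 Cg1). assert (CB2 := ct_BJ d f2 g2 J Cf2 Cg2). assert (CH := ct_HT d Nm CN (INR J * ln 2)).
    letr_with (RI (fun x => Rabs (BJ d f1 g1 J x) + Rabs (BJ d f2 g2 J x)) (- N) N).
    + ri_le. intros x _. replace (HT d Nm (INR J * ln 2) x) with (BJ d f1 g1 J x + BJ d f2 g2 J x); [apply Rabs_triang|].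
      assert (C1 := ct2_row _ x (ct_Psi d f1 g1 Cf1 Cg1)). assert (C2 := ct2_row _ x (ct_Psi d f2 g2 Cf2 Cg2)).
      unfold HT, BJ. replace (- (INR J * ln 2)) with (- INR J * ln 2) by ring. rewrite <- RI_plus by auto. apply RI_ext; intro s.
      unfold Ps, Psi, Nm. ring.
    + rewrite RI_plus by ctac. lra.
Qed.
End Final.

Lemma L2_part fr fi nf : ct fr -> ct fi -> L2sq fr fi nf -> 0 <= nf /\
  forall T, 0 <= T -> RI (fun x => fr x ^ 2) (- T) T <= nf /\ RI (fun x => fi x ^ 2) (- T) T <= nf.
Proof.
  intros Cr Ci H. assert (Q : forall T, 0 <= T -> RI (fun x => fr x ^ 2 + fi x ^ 2) (- T) T <= nf).
  { intros T HT0. apply le_eps with 1; [|lra]. intros e He. destruct (H e He) as [N0 HN0].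
    destruct (HN0 (Rmax N0 T) (Rmax_l _ _)) as [v [Hv Bv]]. rewrite (RInt_uniq _ _ _ _ Hv) in Bv.
    assert (M := Rmax_r N0 T). set (N := Rmax N0 T) in *. change (Rabs (RI (fun x => fr x ^ 2 + fi x ^ 2) (- N) N - nf) < e) in Bv.
    apply Rabs_lt_between in Bv.
    assert (X : RI (fun x => fr x ^ 2 + fi x ^ 2) (- T) T <= RI (fun x => fr x ^ 2 + fi x ^ 2) (- N) N).
    { apply RI_mono; try lra; [ctac|]. intros x _. assert (A := pow2_ge_0 (fr x)). assert (B := pow2_ge_0 (fi x)). lra. } lra. }
  assert (P : forall T, 0 <= T -> 0 <= RI (fun x => fr x ^ 2) (- T) T /\ 0 <= RI (fun x => fi x ^ 2) (- T) T).
  { intros T HT0. split; (apply RI_ge0; [lra|ctac|intros; apply pow2_ge_0]). } split.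
  - destruct (P 0 ltac:(lra)) as [X Y]. assert (Z := Q 0 ltac:(lra)). rewrite RI_plus in Z by ctac. lra.
  - intros T HT0. destruct (P T HT0) as [X Y]. assert (Z := Q T HT0). rewrite RI_plus in Z by ctac. lra.
Qed.

Theorem theorem1 (d : nat) (hd : (2 <= d)%nat) :
  exists C : R,
    forall fr fi gr gi : R -> R,
      schwartz fr fi -> schwartz gr gi ->
      forall nf ng : R, L2sq fr fi nf -> L2sq gr gi ng ->
        (* H_Gamma(f,g)(x) is well defined for every x *)
        (exists hr hi : R -> R, is_H_Gamma d fr fi gr gi hr hi) /\
        (* ||H_Gamma(f,g)||_{L^1} <= C ||f||_{L^2} ||g||_{L^2} *)
        (forall hr hi : R -> R, is_H_Gamma d fr fi gr gi hr hi ->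
           forall N : R, exists v,
             is_RInt (fun x => sqrt (hr x ^ 2 + hi x ^ 2)) (- N) N v /\
             v <= C * sqrt nf * sqrt ng).
Proof.
  destruct (form_exists d hd) as [C [HC Form]]. exists (4 * C). intros fr fi gr gi [Sfr Sfi] [Sgr Sgi] nf ng Hf Hg.
  destruct (schwartz_nice fr Sfr) as [M1 [l1 [PM1 [Pl1 Nfr]]]]. destruct (schwartz_nice fi Sfi) as [M2 [l2 [PM2 [Pl2 Nfi]]]].
  destruct (schwartz_nice gr Sgr) as [M3 [l3 [PM3 [Pl3 Ngr]]]]. destruct (schwartz_nice gi Sgi) as [M4 [l4 [PM4 [Pl4 Ngi]]]].
  set (M := M1 + M2 + M3 + M4). set (l := l1 + l2 + l3 + l4).
  assert (HM : 0 <= M) by (unfold M; lra). assert (Hl : 0 <= l) by (unfold l; lra).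
  apply (nice_mono M1 l1 M l) in Nfr; [|unfold M; lra|unfold l; lra]. apply (nice_mono M2 l2 M l) in Nfi; [|unfold M; lra|unfold l; lra].
  apply (nice_mono M3 l3 M l) in Ngr; [|unfold M; lra|unfold l; lra]. apply (nice_mono M4 l4 M l) in Ngi; [|unfold M; lra|unfold l; lra].
  assert (Cfr := lip_ct l fr Hl (proj2 (proj2 Nfr))). assert (Cfi := lip_ct l fi Hl (proj2 (proj2 Nfi))).
  assert (Cgr := lip_ct l gr Hl (proj2 (proj2 Ngr))). assert (Cgi := lip_ct l gi Hl (proj2 (proj2 Ngi))).
  destruct (L2_part fr fi nf Cfr Cfi Hf) as [Pnf Af]. destruct (L2_part gr gi ng Cgr Cgi Hg) as [Png Ag].
  (* The sign in the real part is absorbed into [fi], so that it too is a sum of two products. *)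
  assert (Nmi : nice M l (fun x => -1 * fi x)) by (apply nice_scal; auto; apply Rabs_le; lra).
  assert (Ami : forall T, 0 <= T -> RI (fun x => (-1 * fi x) ^ 2) (- T) T <= nf).
  { intros T HT0. rewrite (RI_ext _ (fun x => fi x ^ 2)) by (intro; ring). apply Af; auto. }
  destruct (Form fr gr (fun x => -1 * fi x) gi M l nf ng HM Hl Nfr Ngr Nmi Ngi (fun T H => proj1 (Af T H)) (fun T H => proj1 (Ag T H))
    Ami (fun T H => proj2 (Ag T H))) as [Hr [Cr [Pr Br]]].
  destruct (Form fr gi fi gr M l nf ng HM Hl Nfr Ngi Nfi Ngr (fun T H => proj1 (Af T H)) (fun T H => proj2 (Ag T H))
    (fun T H => proj2 (Af T H)) (fun T H => proj1 (Ag T H))) as [Hi [Ci [Pi_ Bi_]]].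
  assert (PR : forall x, pv_int (integrand_re d fr fi gr gi x) (Hr x)).
  { intro x. replace (integrand_re d fr fi gr gi x) with
      (fun t => (fr (x - t) * gr (x - t ^ d) + -1 * fi (x - t) * gi (x - t ^ d)) / t); [apply Pr|].
    apply functional_extensionality. intro t. unfold integrand_re. apply (f_equal (fun z => z / t)). ring. }
  assert (PI_ : forall x, pv_int (integrand_im d fr fi gr gi x) (Hi x)) by (intro x; apply Pi_). split.
  { exists Hr, Hi. intro x. split; auto. }
  intros hr hi HG N. assert (Er : forall x, hr x = Hr x) by (intro x; apply (pv_unique _ _ _ (proj1 (HG x)) (PR x))).
  assert (Ei : forall x, hi x = Hi x) by (intro x; apply (pv_unique _ _ _ (proj2 (HG x)) (PI_ x))).
  set (S := fun x => sqrt (Hr x ^ 2 + Hi x ^ 2)). assert (CS : ct S) by (unfold S; apply ct_sqrt; ctac).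
  exists (RI S (- N) N). split.
  - replace (fun x => sqrt (hr x ^ 2 + hi x ^ 2)) with S; [apply RInt_def, ct_ex; auto|].
    apply functional_extensionality. intro x. unfold S. rewrite Er, Ei. auto.
  - assert (Pos : 0 <= 4 * C * sqrt nf * sqrt ng) by (repeat apply Rmult_le_pos; try lra; apply sqrt_pos).
    destruct (Rle_dec 0 N) as [HN|HN].
    (* One factor 2 comes from bounding the modulus by the sum of the absolute real and imaginary
       parts, the other from [scale_opt]. *)
    + replace (4 * C * sqrt nf * sqrt ng) with (2 * (2 * C) * sqrt nf * sqrt ng) by ring.
      apply scale_opt; [lra|auto|auto|]. intros t Ht. letr_with (RI (fun x => Rabs (Hr x) + Rabs (Hi x)) (- N) N).
      * apply RI_le; [lra|auto|ctac|]. intros x _. unfold S. assert (A := Rabs_pos (Hr x)). assert (B := Rabs_pos (Hi x)).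
        rewrite <- (sqrt_pow2 (Rabs (Hr x) + Rabs (Hi x))) by lra. apply sqrt_le_1_alt.
        rewrite <- (pow2_abs (Hr x)), <- (pow2_abs (Hi x)). assert (0 <= Rabs (Hr x) * Rabs (Hi x)) by pos. lra.
      * rewrite RI_plus by ctac. assert (X := Br N t HN Ht). assert (Y := Bi_ N t HN Ht). lra.
    (* For [N < 0] the oriented integral is minus the integral of a nonnegative function. *)
    + rewrite RI_swap by auto. assert (0 <= RI S N (- N)); [|lra]. apply RI_ge0; [lra|auto|]. intros; apply sqrt_pos.
Qed.
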